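(* Let $d\ge 5$ and let $F(\mathbf z)=\tfrac12 A\mathbf z\cdot\mathbf z$ be a non-degenerate quadratic form on $\mathbb R^d$ with integer coefficients. Then for any $0<\varepsilon\le 1$ there exist positive constants $K_1(d,\varepsilon)$, $K_2(d,\varepsilon)$, $K_3(d,\varepsilon)$ with $K_2(d,\varepsilon)\le K_3(d,\varepsilon)$ such that if $w\in\mathcal C^{K_1,K_2}(\mathbb R^d)\cap\mathcal C^{0,K_3}(\mathbb R^d)$, $L\ge 1$, and a real number $m$ satisfies $L^2m\in\mathbb Z$, then $$\bigl|N_L(w;A,m)-\sigma_\infty(w;A,m)\,\sigma(A,L^2m)\,L^{d-2}\bigr|\le C\,L^{d/2+\varepsilon}\bigl(\|w\|_{K_1,K_2}+\|w\|_{0,K_3}\bigr),$$ where the constant $C$ depends only on $d,\varepsilon,m$ and $A$. The constant $\sigma(A,L^2m)$ is bounded uniformly in $L$ and $m$. In particular, if $\varepsilon=1/2$ one can take $K_1=2d(d^2+d-1)$, $K_2=4(d+1)^2+3d+1$ and $K_3=K_1+3d+4$.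
   Context: $A$ is a non-degenerate symmetric $d\times d$ matrix with integer entries and even diagonal entries; $F(\mathbf z)=\tfrac12A\mathbf z\cdot\mathbf z$, $F^t=F-t$, $\Sigma_t=\{\mathbf z\in\mathbb R^d:F(\mathbf z)=t\}$ for $t\in\mathbb R$. For $L\ge1$, $\mathbb Z^d_L=L^{-1}\mathbb Z^d$, and $N_L(w;A,m)=\sum_{\mathbf z\in\Sigma_m\cap\mathbb Z^d_L}w(\mathbf z)$. Norms: $\langle\mathbf x\rangle=\max\{1,|\mathbf x|\}$ with $|\cdot|$ Euclidean; for $n_1\in\mathbb N\cup\{0\}$, $n_2\in\mathbb R$, $\|f\|_{n_1,n_2}=\sup_{\mathbf z\in\mathbb R^d}\max_{|\alpha|_1\le n_1}|\partial^\alpha f(\mathbf z)|\langle\mathbf z\rangle^{n_2}$, where $|\alpha|_1=\sum\alpha_j$; $\mathcal C^{n_1,n_2}(\mathbb R^d)$ is the space of $C^{n_1}$-smooth functions $f:\mathbb R^d\to\mathbb R$ with $\|f\|_{n_1,n_2}<\infty$. Singular integral: $\sigma_\infty(w;A,t)=\int_{\Sigma_t}w(\mathbf z)\,\mu^{\Sigma_t}(d\mathbf z)$, where $\mu^{\Sigma_t}(d\mathbf z)=|A\mathbf z|^{-1}dz|_{\Sigma_t}$ and $dz|_{\Sigma_t}$ is the volume element on $\Sigma_t$ (on $\Sigma_0\setminus\{0\}$ if $t=0$) induced by the Euclidean structure of $\mathbb R^d$. Singular series: $e_q(x)=e^{2\pi i x/q}$; for $q\in\mathbb N$, $\mathbf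 c\in\mathbb Z^d$, $t\in\mathbb Z$, $S_q(\mathbf c;A,t)=\sum^*_{a\,(\mathrm{mod}\,q)}\sum_{\mathbf b\,(\mathrm{mod}\,q)}e_q(aF^t(\mathbf b)+\mathbf c\cdot\mathbf b)$, where $\sum^*$ is over residues $a$ coprime to $q$, $\mathbf b$ ranges over $(\mathbb Z/q)^d$, and $S_1\equiv1$. For a prime $p$, $\sigma_p(A,t)=\sum_{l=0}^\infty p^{-dl}S_{p^l}(\mathbf 0;A,t)$, and $\sigma(A,t)=\prod_p\sigma_p(A,t)$ (product over all primes, understood as the limit of the partial products over $p\le n$). *)

(* Defs.v *)
From HB Require Import structures.
From mathcomp Require Import all_boot all_order all_algebra.
From mathcomp Require Import complex.
From mathcomp Require Import all_classical all_reals all_analysis.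

Set Implicit Arguments.
Unset Strict Implicit.
Unset Printing Implicit Defensive.

Import Order.TTheory GRing.Theory Num.Theory.
Import numFieldNormedType.Exports.

Local Open Scope classical_set_scope.
Local Open Scope ring_scope.

(* Lebesgue measure on R^n, with R^n seen as n.-tuple R so that the product
   sigma-algebra of the library applies; built by iterating the binary product
   measure. *)
Section lebesgue_tuple.
Context {R : realType}.

Lemma sigma_finite_dirac_nil :
  sigma_finite [set: 0.-tuple R] (\d_([tuple] : 0.-tuple R) : _ -> \bar R).
Proof.
exists (fun=> setT); first by rewrite bigcup_const//; exists 0%N.
by move=> _; split=> //; rewrite diracT ltry.
Qed.

Definition lebesgue_nil : set (0.-tuple R) -> \bar R := \d_([tuple] : 0.-tuple R).
HB.instance Definition _ := Measure.on lebesgue_nil.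
HB.instance Definition _ :=
  Measure_isSigmaFinite.Build _ _ _ lebesgue_nil sigma_finite_dirac_nil.

Section cons.
Variables (n : nat) (mu : {sigma_finite_measure set (n.-tuple R) -> \bar R}).

Definition tcons (p : measurableTypeR R * n.-tuple R) : n.+1.-tuple R :=
  [the n.+1.-tuple R of p.1 :: p.2].

Lemma measurable_tcons : measurable_fun [set: _] tcons.
Proof.
apply: (@measurable_cons _ _ _ (measurableTypeR R)).
- exact: measurable_fst.
- exact: measurable_snd.
Qed.

Definition lebesgue_cons : set (n.+1.-tuple R) -> \bar R :=
  pushforward (lebesgue_measure \x mu)%E tcons.

Let lebesgue_cons0 : lebesgue_cons set0 = 0%E.
Proof. by rewrite /lebesgue_cons /pushforward preimage_set0 measure0. Qed.

Let lebesgue_cons_ge0 A : (0 <= lebesgue_cons A)%E.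
Proof. exact: (measure_ge0 (lebesgue_measure \x mu)%E). Qed.

Let lebesgue_cons_sigma_additive : semi_sigma_additive lebesgue_cons.
Proof.
exact: (@measure_semi_sigma_additive _ _ _
  (measure_function_pushforward__canonical__measure_function_Measure
    (lebesgue_measure \x mu)%E measurable_tcons)).
Qed.

HB.instance Definition _ := isMeasure.Build _ _ _ lebesgue_cons
  lebesgue_cons0 lebesgue_cons_ge0 lebesgue_cons_sigma_additive.

Lemma sigma_finite_lebesgue_cons : sigma_finite setT lebesgue_cons.
Proof.
have /sigma_finiteP[F [TF ndF Foo]] := sigma_finiteT (@lebesgue_measure R).
have /sigma_finiteP[G [TG ndG Goo]] := sigma_finiteT mu.
pose u (t : n.+1.-tuple R) : measurableTypeR R * n.-tuple R :=
  (thead t, [tuple of behead t]).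
have mu_ : measurable_fun [set: _] u.
  apply/measurable_fun_pairP; split.
  - exact: (@measurable_tnth _ (measurableTypeR R)).
  - exact: (@measurable_behead _ (measurableTypeR R)).
exists (fun i => u @^-1` (F i `*` G i)).
  apply/esym; rewrite -subTset => t _.
  have [i _ Fi] : (\bigcup_i F i) (thead t) by rewrite -TF.
  have [j _ Gj] : (\bigcup_i G i) [tuple of behead t] by rewrite -TG.
  exists (maxn i j) => //; split.
  - by move: Fi; exact/subsetPset/ndF/leq_maxl.
  - by move: Gj; exact/subsetPset/ndG/leq_maxr.
move=> i; have [mF Fi] := Foo i; have [mG Gi] := Goo i; split.
  by rewrite -[X in measurable X]setTI; apply: mu_ => //; exact: measurableX.
rewrite /lebesgue_cons /pushforward.
have -> : tcons @^-1` (u @^-1` (F i `*` G i)) = F i `*` G i.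
  rewrite -comp_preimage (_ : u \o tcons = id)//.
  by apply/funext => -[x t]; congr pair; exact: val_inj.
by rewrite product_measure1E// lte_mul_pinfty// ge0_fin_numE.
Qed.

HB.instance Definition _ := Measure_isSigmaFinite.Build _ _ _ lebesgue_cons
  sigma_finite_lebesgue_cons.

End cons.

Fixpoint lebesgue_tuple n : {sigma_finite_measure set (n.-tuple R) -> \bar R} :=
  if n is m.+1 then lebesgue_cons (lebesgue_tuple m) else lebesgue_nil.

End lebesgue_tuple.

Section euclidean.
Context {R : realType} {d : nat}.
Implicit Types (u v z : 'rV[R]_d) (f : 'rV[R]_d -> R).

Definition dotv u v : R := \sum_(i < d) u 0 i * v 0 i.

(* The library norm on 'rV[R]_d is the sup norm; this is the Euclidean one. *)
Definition enorm z : R := Num.sqrt (dotv z z).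

Definition jbracket z : R := Num.max 1 (enorm z).

Definition partial (i : 'I_d) f : 'rV[R]_d -> R :=
  fun z => 'D_(delta_mx 0 i) f z.

Definition mpartial (alpha : {ffun 'I_d -> nat}) f : 'rV[R]_d -> R :=
  foldr (fun i g => iter (alpha i) (partial i) g) f (enum 'I_d).

Fixpoint Csmooth (n : nat) f : Prop :=
  continuous f /\
  if n is k.+1 then
    forall i : 'I_d,
      (forall z, derivable f z (delta_mx 0 i)) /\ Csmooth k (partial i f)
  else True.

Definition wnorm (n1 : nat) (n2 : R) f : \bar R :=
  ereal_sup [set y | exists z (alpha : {ffun 'I_d -> nat}),
    (\sum_i alpha i <= n1)%N /\
    y = (`|mpartial alpha f z| * jbracket z `^ n2)%:E].

Definition Cspace (n1 : nat) (n2 : R) f : Prop :=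
  Csmooth n1 f /\ (wnorm n1 n2 f < +oo)%E.

End euclidean.

Definition even_form (d : nat) (A : 'M[int]_d) : Prop :=
  [/\ A^T = A, forall i, (2 %| A i i)%Z & \det A != 0].

Section quadric.
Context {R : realType} {d : nat}.
Variable A : 'M[int]_d.
Implicit Types (z : 'rV[R]_d) (t : R).

(* The row vector of coordinates of A z. *)
Definition mxact z : 'rV[R]_d := z *m (map_mx intr A)^T.

Definition qform z : R := 2^-1 * dotv (mxact z) z.

Definition quadric t : set 'rV[R]_d := [set z | qform z = t].

Definition lattice (L : R) : set 'rV[R]_d :=
  [set L^-1 *: map_mx intr k | k in [set: 'rV[int]_d]].

(* The absolutely convergent sum of a signed function is the difference of the
   sums of its positive and negative parts, esum being meant for nonnegative
   functions. *)
Definition lattice_count (L : R) (w : 'rV[R]_d -> R) (m : R) : R :=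
  fine (\esum_(z in quadric m `&` lattice L) (EFin \o w)^\+ z)%E -
  fine (\esum_(z in quadric m `&` lattice L) (EFin \o w)^\- z)%E.

Definition lattice_summable (L : R) (w : 'rV[R]_d -> R) (m : R) : Prop :=
  summable (quadric m `&` lattice L) (EFin \o w).

(* Volume element of the smooth hypersurface quadric t minus the origin.
   Since (A z)_i is the derivative of qform in the i-th variable, and qform is
   a polynomial of degree at most 2 in this variable, each of the open subsets
   {z in quadric t | (A z)_i > 0} and {z in quadric t | (A z)_i < 0} is the
   graph of a smooth function expressing z_i through the other coordinates.
   As det A <> 0, these 2 d graphs cover quadric t minus the origin.  In each
   of them the volume element induced by the Euclidean structure is
   sqrt (det g) dx, with g the Gram matrix of the parametrization, and points
   lying in several graphs are attributed to the least possible index i. *)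

Definition insert_coord (i : 'I_d) (u : R) (x : 'rV[R]_d.-1) : 'rV[R]_d :=
  \row_j oapp (fun k => x 0 k) u (unlift i j).

Definition graph_part t (i : 'I_d) (s : bool) : set 'rV[R]_d :=
  [set z | quadric t z /\ 0 < (-1) ^+ s * mxact z 0 i].

Definition graph_dom t (i : 'I_d) (s : bool) : set 'rV[R]_d.-1 :=
  [set x | exists u, graph_part t i s (insert_coord i u x)].

Definition graph_map t (i : 'I_d) (s : bool) (x : 'rV[R]_d.-1) : 'rV[R]_d :=
  insert_coord i (xget 0 [set u | graph_part t i s (insert_coord i u x)]) x.

Definition vol_density (f : 'rV[R]_d.-1 -> 'rV[R]_d) (x : 'rV[R]_d.-1) : R :=
  Num.sqrt (\det (jacobian f x *m (jacobian f x)^T)).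

Definition graph_piece t (i : 'I_d) (s : bool) : set 'rV[R]_d.-1 :=
  graph_dom t i s `&`
  [set x | forall j : 'I_d, (j < i)%N -> mxact (graph_map t i s x) 0 j = 0].

Definition row_of_tuple n (x : n.-tuple R) : 'rV[R]_n := \row_j tnth x j.

Definition piece_dom t i s : set (d.-1.-tuple R) :=
  row_of_tuple (n := d.-1) @^-1` graph_piece t i s.

Definition piece_integrand t i s (f : 'rV[R]_d -> R) (x : d.-1.-tuple R) :
    \bar R :=
  let y := row_of_tuple x in
  (f (graph_map t i s y) * vol_density (graph_map t i s) y)%:E.

Definition surface_integral t (f : 'rV[R]_d -> R) : \bar R :=
  (\sum_(i < d) \sum_(s : bool)
     \int[lebesgue_tuple d.-1]_(x in piece_dom t i s)
       piece_integrand t i s f x)%E.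

Definition surface_integrable t (f : 'rV[R]_d -> R) : Prop :=
  forall i s,
    (lebesgue_tuple d.-1).-integrable (piece_dom t i s)
      (piece_integrand t i s f).

Definition sing_weight (w : 'rV[R]_d -> R) z : R := w z / enorm (mxact z).

Definition sing_integral (w : 'rV[R]_d -> R) t : R :=
  fine (surface_integral t (sing_weight w)).

End quadric.

Section singular_series.
Variables (R : realType) (d : nat).
Implicit Types (A : 'M[int]_d) (t : int) (q p : nat).

Definition eq_char q (x : R) : R[i] :=
  Complex (cos (2 * pi * x / q%:R)) (sin (2 * pi * x / q%:R)).

Definition residue_vec q (b : {ffun 'I_d -> 'I_q}) : 'rV[R]_d :=
  \row_i (b i : nat)%:R.

Definition gauss_sum q (c : 'rV[int]_d) A t : R[i] :=
  \sum_(a < q | coprime a q) \sum_(b : {ffun 'I_d -> 'I_q})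
    eq_char q (a%:R * (qform A (residue_vec b) - t%:~R)
               + dotv (map_mx intr c) (residue_vec b)).

Definition sigma_p_terms A t p : nat -> R[i]^o :=
  fun l => ((p ^ (d * l))%:R)^-1 * gauss_sum (p ^ l) 0 A t.

Definition sigma_p A t p : R[i]^o := limn (series (sigma_p_terms A t p)).

Definition sigma_prod A t : nat -> R[i]^o :=
  fun n => \prod_(p < n.+1 | prime p) sigma_p A t p.

Definition sing_series A t : R[i]^o := limn (sigma_prod A t).

Definition sing_series_cvg A t : Prop :=
  (forall p, prime p -> cvgn (series (sigma_p_terms A t p))) /\
  cvgn (sigma_prod A t).

End singular_series.

(* The singular series is real but defined as a complex number, hence the
   complex modulus in the estimate. *)
Definition counting_asymptotics (R : realType) (d : nat) (eps : R)
    (K1 : nat) (K2 K3 : R) : Prop :=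
  forall A : 'M[int]_d, even_form A -> forall m : R,
  exists C : R, forall (L : R) (t : int) (w : 'rV[R]_d -> R),
    1 <= L -> L ^+ 2 * m = t%:~R -> Cspace K1 K2 w -> Cspace 0 K3 w ->
    [/\ lattice_summable A L w m,
        surface_integrable A m (sing_weight A w) &
        ComplexField.Normc.normc
          (real_complex R (lattice_count A L w m)
           - real_complex R (sing_integral A w m) * sing_series R A t
             * real_complex R (L ^+ (d - 2)))
        <= C * L `^ (d%:R / 2 + eps)
             * (fine (wnorm K1 K2 w) + fine (wnorm 0 K3 w))].

(* Main.v *)
Require Import Defs.
From HB Require Import structures.
From mathcomp Require Import all_boot all_order all_algebra.
From mathcomp Require Import fingroup perm complex.
From mathcomp Require Import all_classical all_reals all_analysis.
From mathcomp Require Import measurable_realfun.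
From mathcomp Require Import ring lra zify.

Set Implicit Arguments.
Unset Strict Implicit.
Unset Printing Implicit Defensive.

Import Order.TTheory GRing.Theory Num.Theory.
Import numFieldNormedType.Exports.

Local Open Scope classical_set_scope.
Local Open Scope ring_scope.

(** Circle method for the quadratic form F, without any Kloosterman refinement.
The sum over the lattice points of the quadric is the integral over one period of
Theta(al) = sum_z w(z/L) cos(2 pi al (F(z) - t)).  Squaring Theta and summing twice by
parts in each coordinate (Weyl differencing) bounds it by L^(d/2) times the (d/2)-th power
of a spacing sum.  With P = L^(2 eps/d), this gives O((L P)^(d/2)) off the arcs
|al - a/q| < 1/(3 q L P), q <= L/P, while on these arcs Theta is compared with a Gauss sum
times the oscillatory integral Ic(lam) = int w cos(2 pi lam (F - m)) by comparing a
smooth sum over a residue class with an integral.  The same inequality on (Z/q)^d and in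
the limit L -> oo bounds the Gauss sums by q^(d/2) and Ic by (1 + |lam|)^(-2), so that the main term is
sigma * L^(d-2) * Jc with Jc = int Ic.

It remains to identify Jc with the surface integral.  Jc is the limit of
int w pk_eta(F - m), pk_eta being the Poisson kernel.  Let l = (A y)_i be the derivative
of F in the i-th coordinate.  For the weight w l^2/(k^2 + l^2) an integration by parts in this
coordinate gives the integral over the i-th charts of the quadric.  The remaining weight
w k^2/(k^2 + l^2) is a superposition of linear phases; as these do not affect the
Weyl bound for Ic, its contribution tends to 0 with k, uniformly in eta.  The same
argument shows that the pieces of the i-th charts with i > 0 are null sets. *)

(** * Real-valued integrals and lattice sums *)

(** The loss [P] is what is paid for averaging trivially over the numerators a. On the arcs the
    error is L^d (2/P)^(K+1), so [K + 1] differences suffice once P^(2(K+1)) >= L^d, that is K + 1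
    >= d^2/(4 eps); this fixes the smoothness. With Q = L/P, the arcs cut the series at Q and the
    rescaled integral at L^2/(3qLP) = Q/(3q). Both truncations cost O(Q^(-(d-4)/2)), and L^(d-2)
    Q^(-(d-4)/2) = L^(d/2) P^((d-4)/2) is below (L P)^(d/2). Exponential sums are kept real: a free
    phase [th] in the cosine yields the sine at th = - pi/2. Integrals over R^d are limits of
    lattice sums, so that invariance under shifts and permutations, and the Weyl bound, pass from
    sums to integrals. The density 1/|l| of a chart blows up where l = 0. The factor l^2/(k^2 + l^2)
    turns it into a smooth function of l and makes the integration by parts legitimate on the whole
    space, including the cone m = 0; what it removes is controlled by the decay of [Ic] alone, with
    no geometry of the quadric near l = 0. *)

HB.instance Definition _ := isPointed.Build int 0.
(** With the discrete sigma-algebra every function of an integer vector is measurable: lattice sums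
    are integrals for the counting measure, open to Fubini and dominated convergence. *)
HB.instance Definition _ (d : nat) := @isMeasurable.Build default_measure_display
  'rV[int]_d discrete_measurable discrete_measurable0
  discrete_measurableC discrete_measurableU.

Section real_integral.
Context d (T : measurableType d) (R : realType).
Variable mu : {measure set T -> \bar R}.
Implicit Types f g : T -> R.

Definition L1 f := mu.-integrable setT (EFin \o f).

Lemma L1_measurable f : L1 f -> measurable_fun setT f.
Proof. by move=> /measurable_int/measurable_EFinP. Qed.

Lemma L1_dom f g : measurable_fun setT f -> L1 g ->
  (forall x, `|f x| <= g x) -> L1 f.
Proof.
move=> mf ig fg; apply: (le_integrable measurableT _ _ ig).
  exact/measurable_EFinP.
by move=> x _ /=; rewrite lee_fin (le_trans (fg x))// ler_norm.
Qed.

Lemma L1_fin f : L1 f -> (\int[mu]_x (f x)%:E)%E \is a fin_num.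
Proof. by move=> /(integrable_fin_num measurableT). Qed.

Lemma L1_fineK f : L1 f -> (\int[mu]_x f x)%:E = (\int[mu]_x (f x)%:E)%E.
Proof. by move=> /L1_fin ?; rewrite /Rintegral fineK. Qed.

Lemma rint_le f g : L1 f -> L1 g -> (forall x, f x <= g x) ->
  \int[mu]_x f x <= \int[mu]_x g x.
Proof. by move=> ? ? fg; apply: le_Rintegral => // x _; exact: fg. Qed.

Lemma rint_norm f g : measurable_fun setT f -> L1 g ->
  (forall x, `|f x| <= g x) -> `|\int[mu]_x f x| <= \int[mu]_x g x.
Proof.
move=> mf ig fg; have i_f := L1_dom mf ig fg.
apply: (le_trans (le_normr_Rintegral measurableT i_f)).
apply: rint_le => //; apply: (L1_dom _ ig) => [|x]; last by rewrite normr_id.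
exact: measurableT_comp.
Qed.

Lemma L1D f g : L1 f -> L1 g -> L1 (fun x => f x + g x).
Proof. by move=> i_f i_g; apply: (integrableD measurableT i_f i_g). Qed.

Lemma L1B f g : L1 f -> L1 g -> L1 (fun x => f x - g x).
Proof. by move=> i_f i_g; apply: (integrableB measurableT i_f i_g). Qed.

Lemma L1Z (c : R) f : L1 f -> L1 (fun x => c * f x).
Proof. by move=> i_f; apply: (integrableZl measurableT c i_f). Qed.

Lemma L10 : L1 (fun=> 0).
Proof. exact: integrable0. Qed.

Lemma L1_sum (I : Type) (s : seq I) (P : pred I) (f : I -> T -> R) :
  (forall i, L1 (f i)) -> L1 (fun x => \sum_(i <- s | P i) f i x).
Proof.
move=> h; elim: s => [|a s ih].
  by under eq_fun do rewrite big_nil; exact: L10.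
under eq_fun do rewrite big_cons.
by case: (P a) => //; apply: L1D.
Qed.

Lemma rintD f g : L1 f -> L1 g ->
  \int[mu]_x (f x + g x) = \int[mu]_x f x + \int[mu]_x g x.
Proof. exact: RintegralD. Qed.

Lemma rintB f g : L1 f -> L1 g ->
  \int[mu]_x (f x - g x) = \int[mu]_x f x - \int[mu]_x g x.
Proof. exact: RintegralB. Qed.

Lemma rintZ c f : L1 f -> \int[mu]_x (c * f x) = c * \int[mu]_x f x.
Proof. by move=> h; apply: RintegralZl. Qed.

Lemma rint0 : \int[mu]_x (0 : R) = 0.
Proof. by rewrite /Rintegral integral0. Qed.

Lemma rint_sum (I : Type) (s : seq I) (P : pred I) (f : I -> T -> R) :
  (forall i, L1 (f i)) ->
  \int[mu]_x (\sum_(i <- s | P i) f i x) = \sum_(i <- s | P i) \int[mu]_x f i x.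
Proof.
move=> h; elim: s => [|a s ih].
  rewrite big_nil; under eq_Rintegral do rewrite big_nil; exact: rint0.
rewrite big_cons; under eq_Rintegral do rewrite big_cons.
by case: (P a) => //; rewrite rintD ?ih//; apply: L1_sum.
Qed.

Lemma eq_rint f g : f =1 g -> \int[mu]_x f x = \int[mu]_x g x.
Proof. by move=> fg; apply: eq_Rintegral. Qed.

Lemma rint_ge0 f : (forall x, 0 <= f x) -> 0 <= \int[mu]_x f x.
Proof. by move=> h; apply: Rintegral_ge0. Qed.

Lemma rint_cvg (f_ : nat -> T -> R) f g :
  (forall n, measurable_fun setT (f_ n)) -> measurable_fun setT f ->
  (\forall x \ae mu, f_ ^~ x @ \oo --> f x) -> L1 g ->
  (forall n x, `|f_ n x| <= g x) ->
  L1 f /\ (fun n => \int[mu]_x f_ n x) @ \oo --> \int[mu]_x f x.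
Proof.
move=> mf_ mf cf ig fg.
have mE (h : T -> R) : measurable_fun setT h -> measurable_fun setT (EFin \o h).
  by move=> ?; exact/measurable_EFinP.
have [|||i_f _ +] := @dominated_convergence _ _ _ mu setT measurableT
  (fun n => EFin \o f_ n) (EFin \o f) (EFin \o g) (fun n => mE _ (mf_ n))
  (mE _ mf).
- apply: filterS cf => x cx _ /=.
  by apply: cvg_EFin => //; near=> n.
- by [].
- by apply: aeW => x n _; rewrite /= lee_fin.
move=> h; split=> //.
move: h; rewrite -[X in _ --> X](L1_fineK i_f); exact: fine_cvg.
Unshelve. all: by end_near. Qed.

Lemma L1_norm f : L1 f -> L1 (fun x => `|f x|).
Proof. by move=> i_f; apply: (integrable_norm i_f). Qed.

End real_integral.

Section fubini_dom.
Context d1 d2 (T1 : measurableType d1) (T2 : measurableType d2) (R : realType).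
Variable m1 : {sigma_finite_measure set T1 -> \bar R}.
Variable m2 : {sigma_finite_measure set T2 -> \bar R}.
Variables (f : T1 * T2 -> R) (g : T1 -> R) (h : T2 -> R).
Hypothesis mf : measurable_fun setT f.
Hypothesis ig : L1 m1 g.
Hypothesis ih : L1 m2 h.
Hypothesis fgh : forall x y, `|f (x, y)| <= g x * h y.

Lemma fub_sec1 x : L1 m2 (fun y => f (x, y)).
Proof.
apply: (@L1_dom _ _ _ _ _ (fun y => g x * h y)) => [||y]; last exact: fgh.
  exact: measurableT_comp.
exact: L1Z.
Qed.

Lemma fub_sec2 y : L1 m1 (fun x => f (x, y)).
Proof.
apply: (@L1_dom _ _ _ _ _ (fun x => h y * g x)) => [||x]; last first.
- by rewrite mulrC; exact: fgh.
- exact: L1Z.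
- exact: measurableT_comp.
Qed.

(** By Tonelli: the separated majorant g(x) h(y) bounds the iterated integral of |f| by the product
    of the integrals of |g| and |h|. *)
Lemma fub_prod : L1 (m1 \x m2)%E f.
Proof.
have mEf : measurable_fun setT (EFin \o f) by exact/measurable_EFinP.
apply/(integrable12ltyP m1 m2) => //.
have i_1 : m1.-integrable setT (fun x => (\int[m2]_y `|h y|)%:E * `|(g x)%:E|)%E.
  apply: integrableZl => //; exact: (integrable_abse ig).
have ih' : m2.-integrable setT (EFin \o (fun y => `|h y|)) by exact: L1_norm.
have : (\int[m1]_x ((\int[m2]_y `|h y|)%:E * `|(g x)%:E|) < +oo)%E.
  have /integrableP[_] := i_1; apply: le_lt_trans.
  apply: ge0_le_integral => //.
  - move=> x _; apply: mule_ge0 => //; rewrite lee_fin; exact: rint_ge0.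
  - exact: (measurable_int m1 i_1).
  - by apply: measurableT_comp => //; exact: (measurable_int m1 i_1).
  - by move=> x _; exact: lee_abs.
apply: le_lt_trans; apply: ge0_le_integral => //.
- by move=> x _; exact: integral_ge0.
- apply: (@measurable_fun_fubini_tonelli_F _ _ _ _ _ m2 (abse \o (EFin \o f))).
    exact: measurableT_comp.
  by move=> z; exact: abse_ge0.
- exact: (measurable_int m1 i_1).
move=> x _.
apply: (@le_trans _ _ (\int[m2]_y (`|g x|%:E * (`|h y|)%:E))%E).
  apply: ge0_le_integral => //.
  - apply/measurable_EFinP; apply: measurableT_comp => //.
    exact: measurableT_comp.
  - apply/measurable_EFinP; apply: measurable_funM => //.
    apply: measurableT_comp => //; exact: (L1_measurable ih).
  - by move=> y _; rewrite /= lee_fin (le_trans (fgh _ _))// -normrM ler_norm.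
by rewrite integralZl// -L1_fineK// muleC.
Qed.

Let EF := EFin \o f.

Lemma fub_int x : (\int[m2]_y f (x, y))%:E = (\int[m2]_y EF (x, y))%E.
Proof. by rewrite L1_fineK//; exact: fub_sec1. Qed.

Lemma fub_int2 y : (\int[m1]_x f (x, y))%:E = (\int[m1]_x EF (x, y))%E.
Proof. by rewrite L1_fineK//; exact: fub_sec2. Qed.

Lemma fub_L1 : L1 m1 (fun x => \int[m2]_y f (x, y)).
Proof.
rewrite /L1 (_ : _ \o _ = fubini_F m2 EF).
  exact: (integrable_fubini_F fub_prod).
by apply/funext => x /=; rewrite fub_int.
Qed.

Lemma fubini_dom1 :
  \int[m1]_x \int[m2]_y f (x, y) = \int[(m1 \x m2)%E]_z f z.
Proof.
have h0 := integral12_prod_meas1 fub_prod.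
rewrite /Rintegral; congr fine; rewrite -[RHS]h0; apply: eq_integral => x _.
exact: fub_int.
Qed.

Lemma fubini_dom :
  \int[m1]_x \int[m2]_y f (x, y) = \int[m2]_y \int[m1]_x f (x, y).
Proof.
rewrite fubini_dom1; have h0 := integral21_prod_meas1 fub_prod.
rewrite /Rintegral; congr fine; rewrite -[LHS]h0; apply: eq_integral => x _.
exact/esym/fub_int2.
Qed.

End fubini_dom.

Section fubini_dom_swap.
Context d1 d2 (T1 : measurableType d1) (T2 : measurableType d2) (R : realType).
Variable m1 : {sigma_finite_measure set T1 -> \bar R}.
Variable m2 : {sigma_finite_measure set T2 -> \bar R}.

Lemma fub_L12 (f : T1 * T2 -> R) (g : T1 -> R) (h : T2 -> R) :
  measurable_fun setT f -> L1 m1 g -> L1 m2 h ->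
  (forall x y, `|f (x, y)| <= g x * h y) ->
  L1 m2 (fun y => \int[m1]_x f (x, y)).
Proof.
move=> mf ig ih fgh.
apply: (@fub_L1 _ _ _ _ _ m2 m1 (fun p => f (p.2, p.1)) h g) => //.
  apply: measurableT_comp => //.
  by apply: measurable_fun_pair; [exact: measurable_snd|exact: measurable_fst].
by move=> x y; rewrite mulrC; exact: fgh.
Qed.

End fubini_dom_swap.

Section lattice_sum.
Context (R : realType) (d : nat).
Local Notation V := 'rV[int]_d.
Local Notation cnt := (@counting V R).

Lemma measurable_lat d' (T : measurableType d') (f : V -> T) :
  measurable_fun setT f.
Proof. by []. Qed.

(** The fibres of [pickle] cut the countable lattice into cells with at most one point; summing over
    them turns an integral into a series. *)
Let lat_set1 (n : nat) : [set k : V | pickle k = n] = set0 \/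
  exists k : V, [set k : V | pickle k = n] = [set k].
Proof.
have [[k kn]|h] := pselect (exists k : V, pickle k = n).
  right; exists k; apply/seteqP; split => x /=; last by move=> ->.
  by rewrite -kn => /(pcan_inj pickleK).
by left; apply/seteqP; split => x //= xn; case: h; exists x.
Qed.

Lemma sigma_finite_counting_lat : sigma_finite [set: V] cnt.
Proof.
exists (fun n => [set k : V | pickle k = n]).
  by apply/seteqP; split => // x _; exists (pickle x).
move=> n; split => //; rewrite /counting/= asboolT ?ltry//.
by have [->|[k ->]] := lat_set1 n; [exact: finite_set0|exact: finite_set1].
Qed.

Lemma ge0_integral_lat (f : V -> \bar R) : (forall k, 0 <= f k)%E ->
  (\int[cnt]_k f k = \esum_(k in setT) f k)%E.
Proof.
move=> f0; pose F n := [set k : V | pickle k = n].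
have FT : \bigcup_n F n = setT.
  by apply/seteqP; split => // x _; exists (pickle x).
have tF : trivIset setT F.
  apply/trivIsetP => i j _ _ ij; rewrite -subset0 => x [xi xj].
  by case/eqP: ij; exact: (etrans (esym xi) xj).
rewrite -[in LHS]FT ge0_integral_bigcup// -[in RHS]FT esum_bigcupT//.
rewrite nneseries_esum; last by move=> n _; apply: integral_ge0.
have -> : [set x : nat | true] = setT by apply/seteqP.
apply: eq_esum => n _; rewrite /F.
have [->|[k ->]] := lat_set1 n; first by rewrite integral_set0 esum_set0.
rewrite esum_set1// (eq_integral (cst (f k))); last by move=> x; rewrite inE => ->.
rewrite integral_cst//= /counting/= asboolT; last exact: finite_set1.
by rewrite fset_set1 finmap.cardfs1 mule1.
Qed.

Lemma lat_L1_summable (f : V -> R) : L1 cnt f <-> summable setT (EFin \o f).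
Proof.
rewrite /summable -ge0_integral_lat//; split => [/integrableP[]//|h].
by apply/integrableP.
Qed.

(** The right-hand side has the shape in which [lattice_count] is defined. *)
Lemma lat_sumE (D : set V) (f : V -> R) : L1 cnt f ->
  (forall k, ~ D k -> f k = 0) ->
  \int[cnt]_k f k = fine (\esum_(k in D) (EFin \o f)^\+ k)%E
                    - fine (\esum_(k in D) (EFin \o f)^\- k)%E.
Proof.
move=> i_f Df; rewrite /Rintegral integralE.
have E (g : V -> \bar R) : (forall k, 0 <= g k)%E -> (forall k, ~ D k -> g k = 0%E) ->
    (\int[cnt]_k g k = \esum_(k in D) g k)%E.
  move=> g0 gD; rewrite ge0_integral_lat// (esum_mkcond D).
  apply: eq_esum => k _; case: ifPn => // /negP kD; rewrite gD//.
  by move=> Dk; apply: kD; rewrite inE.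
rewrite -!E//.
- rewrite fineB//; first exact: (integrable_pos_fin_num measurableT i_f).
  exact: (integrable_neg_fin_num measurableT i_f).
- by move=> k /Df fk; rewrite funenegE/= fk oppr0 maxxx.
- by move=> k /Df fk; rewrite funeposE/= fk maxxx.
Qed.

Lemma lat_integral_inj (e : V -> V) (f : V -> \bar R) : injective e ->
  (forall k, (forall x, k <> e x) -> f k = 0)%E -> (forall k, 0 <= f k)%E ->
  (\int[cnt]_k f k = \int[cnt]_k f (e k))%E.
Proof.
move=> ie f0 fge0; rewrite !ge0_integral_lat//.
rewrite -(@esum_image _ _ _ setT e f); last by move=> x y _ _; exact: ie.
rewrite [RHS]esum_mkcond; apply: eq_esum => k _; case: ifPn => // /negP ke.
by apply: f0 => x kx; apply: ke; rewrite inE; exists x.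
Qed.

(** Serves for translations, residue classes, permutations of coordinates and the injective matrix
    of the form. *)
Lemma lat_rint_inj (e : V -> V) (f : V -> R) : injective e ->
  (forall k, (forall x, k <> e x) -> f k = 0) ->
  \int[cnt]_k f k = \int[cnt]_k f (e k).
Proof.
move=> ie f0; rewrite /Rintegral integralE [in RHS]integralE.
have fp k : (EFin \o (f \o e))^\+%E k = (EFin \o f)^\+%E (e k) by rewrite !funeposE.
have fn k : (EFin \o (f \o e))^\-%E k = (EFin \o f)^\-%E (e k) by rewrite !funenegE.
congr (fine (_ - _)%E).
  rewrite (eq_integral _ _ (fun k _ => fp k)) (lat_integral_inj ie)// => k /f0 fk.
  by rewrite funeposE/= fk maxxx.
rewrite (eq_integral _ _ (fun k _ => fn k)) (lat_integral_inj ie)// => k /f0 fk.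
by rewrite funenegE/= fk oppr0 maxxx.
Qed.

Lemma lat_shift (h : V) (f : V -> R) :
  \int[cnt]_k f (k + h) = \int[cnt]_k f k.
Proof.
apply/esym/(@lat_rint_inj (fun k => k + h)) => [|k kh]; first exact: addIr.
by case: (kh (k - h)); rewrite subrK.
Qed.

Lemma lat_L1_inj (e : V -> V) (f : V -> R) : injective e -> L1 cnt f ->
  L1 cnt (f \o e).
Proof.
move=> ie /lat_L1_summable h; apply/lat_L1_summable; apply: le_lt_trans h.
rewrite -(@esum_image _ _ _ setT e (fun k => `|(f k)%:E|)%E); last first.
  by move=> x y _ _; exact: ie.
rewrite esum_mkcond; apply: le_esum => k _; case: ifPn => // _.
Qed.

(** A finite set of lattice points lies in a box [-X, X]^d, and over a box the sum of a product of
    functions of single coordinates is the product of the sums. The spacing sum in d variables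
    becomes one-dimensional in this way. *)
Lemma esum_lat_prod (phi : 'I_d -> int -> R) (B : 'I_d -> R) :
  (forall i k, 0 <= phi i k) ->
  (forall i (X : nat), \sum_(j < X.*2.+1) phi i (j%:Z - X%:Z) <= B i) ->
  (\esum_(k in [set: V]) (\prod_i phi i (k 0 i))%:E <= (\prod_i B i)%:E)%E.
Proof.
move=> phi0 hB; apply: ub_ereal_sup => _ [F [finF _] <-].
have /finite_seqP[s Fs] := finF.
pose X := \max_(k <- s) \max_(i < d) `|k 0%R i|%N.
have XP k i : F k -> (`|k 0%R i| <= X)%N.
  move=> Fk; have ks : k \in s by move: Fk; rewrite Fs.
  apply: leq_trans (leq_bigmax_seq k ks isT).
  rewrite /=; apply: (@leq_bigmax _ (fun i0 : 'I_d => absz (k 0%R i0)) i).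
pose r (f : {ffun 'I_d -> 'I_(X.*2.+1)}) : V := \row_i ((f i)%:Z - X%:Z).
have ir : injective r.
  move=> f g /rowP fg; apply/ffunP => i; apply: val_inj => /=.
  by have := fg i; rewrite !mxE => /addIr [].
have a0 (k : V) : (0 <= (\prod_i phi i (k 0 i))%:E)%E.
  by rewrite lee_fin; apply: prodr_ge0.
apply: (@le_trans _ _ (\esum_(k in [set r f | f in setT]) (\prod_i phi i (k 0 i))%:E)%E).
  apply: ereal_sup_ubound; exists F => //; split => // k Fk.
  exists [ffun i => inord (absz (k 0 i + X%:Z))] => //; apply/rowP => i.
  have := XP _ i Fk; rewrite mxE ffunE; move: (k 0 i) => z hz; rewrite inordK; lia.
rewrite esum_image; last by move=> x y _ _; exact: ir.
rewrite esum_fset; [|exact: finite_finset|by move=> *; exact: a0].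
rewrite (fsbigE (index_enum {ffun 'I_d -> 'I_(X.*2.+1)})); last 3 first.
- exact: index_enum_uniq.
- by [].
- by move=> f _; rewrite mem_index_enum.
rewrite (eq_bigl xpredT); last by move=> f; exact: mem_set.
rewrite sumEFin lee_fin.
have E f : \prod_i phi i (r f 0 i) = \prod_i phi i ((f i)%:Z - X%:Z).
  by apply: eq_bigr => i _; rewrite mxE.
rewrite (eq_bigr _ (fun f _ => E f)).
rewrite -(bigA_distr_bigA (fun i (j : 'I_(X.*2.+1)) => phi i (j%:Z - X%:Z))).
apply: ler_prod => i _; rewrite hB andbT; exact: sumr_ge0.
Qed.

Lemma lat_L1_prod (phi : 'I_d -> int -> R) (B : 'I_d -> R) :
  (forall i k, 0 <= phi i k) ->
  (forall i (X : nat), \sum_(j < X.*2.+1) phi i (j%:Z - X%:Z) <= B i) ->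
  L1 cnt (fun k => \prod_i phi i (k 0 i)) /\
  \int[cnt]_k \prod_i phi i (k 0 i) <= \prod_i B i.
Proof.
move=> phi0 hB; have h := esum_lat_prod phi0 hB.
have p0 (k : V) : 0 <= \prod_i phi i (k 0 i) by apply: prodr_ge0.
have i1 : L1 cnt (fun k => \prod_i phi i (k 0 i)).
  apply/lat_L1_summable; apply: le_lt_trans (ltry (\prod_i B i)).
  by apply: le_trans h; apply: le_esum => k _; rewrite /= ger0_norm.
split=> //; by rewrite -lee_fin L1_fineK// ge0_integral_lat.
Qed.
End lattice_sum.

(** * Weights and phases *)

Section calculus.
Context {R : realType}.
Implicit Types (f g : R -> R) (J : set R).

Lemma is_derive_fun f g (x df dg : R) : f =1 g -> df = dg ->
  is_derive x (1:R) f df -> is_derive x (1:R) g dg.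
Proof. by move=> /funext -> ->. Qed.

(** Unfolded, the j-th derivative is at most B X^j on [J] for j <= K. Geometric growth is stable
    under products, the rates adding up, so that no binomial sums have to be carried along. *)
Fixpoint dbd (K : nat) J (B X : R) f : Prop :=
  (forall u, J u -> `|f u| <= B) /\
  if K is k.+1 then exists f' : R -> R,
    (forall u : R, is_derive u (1:R) f (f' u)) /\ dbd k J (B * X) X f'
  else True.

Lemma dbd_bound K J B X f : dbd K J B X f -> forall u, J u -> `|f u| <= B.
Proof. by case: K => [|K] []. Qed.

Lemma dbd_pred K J B X f : dbd K.+1 J B X f -> dbd K J B X f.
Proof.
elim: K B f => [|K IH] B f; first by case=> fB _; split.
case=> fB [f' [df hf']]; split=> //; exists f'; split=> //.
exact: IH.
Qed.

Lemma dbd_mono K J B X B' X' f : 0 <= B -> 0 <= X -> B <= B' -> X <= X' ->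
  dbd K J B X f -> dbd K J B' X' f.
Proof.
move=> + X0 + XX'; elim: K B B' f => [|K IH] B B' f B0 BB'.
  by case=> fB _; split=> // u /fB h; exact: le_trans BB'.
case=> fB [f' [df hf']]; split=> [u /fB h|]; first exact: le_trans BB'.
exists f'; split=> //; apply: IH hf'; first exact: mulr_ge0.
by apply: ler_pM.
Qed.

Lemma dbdD K J B1 B2 X f g : dbd K J B1 X f -> dbd K J B2 X g ->
  dbd K J (B1 + B2) X (fun u => f u + g u).
Proof.
elim: K B1 B2 f g => [|K IH] B1 B2 f g [fB hf] [gB hg].
  by split=> // u Ju; rewrite (le_trans (ler_normD _ _))// lerD ?fB ?gB.
split=> [u Ju|].
  by rewrite (le_trans (ler_normD _ _))// lerD ?fB ?gB.
case: hf hg => f' [df hf] [g' [dg hg]].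
exists (fun u => f' u + g' u); split=> [u|]; last by rewrite mulrDl; exact: IH.
exact: is_deriveD.
Qed.

(** The powers of X1 + X2 absorb the binomial sum of the Leibniz rule. *)
Lemma dbdM K J B1 B2 X1 X2 f g : 0 <= B1 -> 0 <= B2 -> 0 <= X1 -> 0 <= X2 ->
  dbd K J B1 X1 f -> dbd K J B2 X2 g ->
  dbd K J (B1 * B2) (X1 + X2) (fun u => f u * g u).
Proof.
move=> + + X10 X20; elim: K B1 B2 f g => [|K IH] B1 B2 f g B10 B20 hf hg.
  split=> // u Ju; rewrite normrM ler_pM//; [exact: (dbd_bound hf)|exact: (dbd_bound hg)].
split=> [u Ju|].
  rewrite normrM ler_pM//; [exact: (dbd_bound hf)|exact: (dbd_bound hg)].
have hf0 := dbd_pred hf; have hg0 := dbd_pred hg.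
case: hf => fB [f' [df hf]]; case: hg => gB [g' [dg hg]].
exists (fun u => f' u * g u + f u * g' u); split=> [u|].
  apply: is_derive_fun (is_deriveM (df u) (dg u)) => //.
  by rewrite /GRing.scale/=; ring.
have -> : B1 * B2 * (X1 + X2) = B1 * X1 * B2 + B1 * (B2 * X2) by ring.
by apply: dbdD; apply: IH => //; exact: mulr_ge0.
Qed.

Lemma is_derive_affine f (f' a b u : R) : is_derive (a * u + b) (1:R) f f' ->
  is_derive u (1:R) (fun v => f (a * v + b)) (a * f').
Proof.
move=> df.
have da : is_derive u (1:R) (fun v => a * v + b) a.
  apply: is_derive_fun (is_deriveD (is_deriveZ a (is_derive_id u 1)) (is_derive_cst b u 1)) => //.
  by rewrite /GRing.scale/=; ring.
by apply: is_derive_fun (@is_derive1_comp _ f (fun v => a * v + b) u _ _ df da); rewrite // mulrC.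
Qed.

Lemma dbd_cst K J B X c : `|c| <= B -> 0 <= X -> dbd K J B X (fun=> c).
Proof.
move=> cB X0; elim: K B c cB => [|K IH] B c cB; first by split.
split=> //; exists (fun=> 0); split=> [u|]; first exact: is_derive_cst.
by apply: IH; rewrite normr0 mulr_ge0// (le_trans _ cB).
Qed.

Lemma dbd_lin K J Y p q : 0 <= Y -> `|p| <= Y ^+ 2 ->
  (forall u, J u -> `|p * u + q| <= Y) -> dbd K J Y Y (fun u => p * u + q).
Proof.
move=> Y0 pY h; case: K => [|K]; first by split.
split=> //; exists (fun=> p); split; last by apply: dbd_cst => //; rewrite -expr2.
move=> u; apply: is_derive_fun (is_derive_affine (f := id) (b := q) (a := p) _) => //.
by rewrite mulr1.
Qed.

Lemma is_derive_quadratic (p q r u : R) :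
  is_derive u (1:R) (fun v : R => p * v ^+ 2 + q * v + r) (2 * p * u + q).
Proof.
have h1 := is_deriveZ p (is_deriveX 1 (is_derive_id u (1:R))).
have h2 := is_deriveZ q (is_derive_id u (1:R)).
apply: is_derive_fun (is_deriveD (is_deriveD (is_deriveZ p (is_deriveX 2 (is_derive_id u (1:R)))) h2) (is_derive_cst r u 1)) => //.
by rewrite /GRing.scale/= expr1; ring.
Qed.

(** The derivative is again a cosine, with [r] increased by pi/2, times the slope of the phase. The
    slope has bound and rate [Y], so every derivative adds [Y] to the rate. *)
Lemma dbd_cos K J Y p q r : 0 <= Y -> `|2 * p| <= Y ^+ 2 ->
  (forall u, J u -> `|2 * p * u + q| <= Y) ->
  dbd K J 1 (K%:R * Y) (fun u => cos (p * u ^+ 2 + q * u + r)).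
Proof.
move=> Y0 pY hY.
have cb x : `|cos x| <= 1 :> R by rewrite ler_norml cos_geN1 cos_le1.
elim: K r => [|K IH] r; first by split.
split=> //; exists (fun u => cos (p * u ^+ 2 + q * u + (r + pi / 2)) * (2 * p * u + q)).
split=> [u|].
  apply: is_derive_fun (@is_derive1_comp _ (@cos R) (fun v => p * v ^+ 2 + q * v + r) u _ _ (is_derive_cos _) (is_derive_quadratic p q r u)) => //.
  by rewrite addrA cosDpihalf.
have KY0 : 0 <= K%:R * Y by rewrite mulr_ge0.
apply: (@dbd_mono _ _ (1 * Y) (K%:R * Y + Y)); rewrite ?mul1r ?addr_ge0//.
- by rewrite -natr1 mulrDl mul1r lerDr.
- by rewrite -natr1 mulrDl mul1r.
- rewrite -[X in dbd _ _ X]mul1r; apply: dbdM => //.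
  exact: dbd_lin.
Qed.

Definition Dh (h : R) f : R -> R := fun u => f (u + h) - f u.

Lemma mvt_norm f f' a h B : 0 <= h -> (forall u : R, is_derive u (1:R) f (f' u)) ->
  (forall u, a <= u <= a + h -> `|f' u| <= B) -> `|f (a + h) - f a| <= B * h.
Proof.
move=> h0 df fB; have aah : a <= a + h by rewrite lerDl.
have [|c] := MVT_segment aah (fun u _ => df u).
  apply: continuous_subspaceT => u; apply: differentiable_continuous.
  by apply/derivable1_diffP; exact: ex_derive.
rewrite in_itv/= => /fB cB ->; rewrite addrAC subrr add0r normrM (ger0_norm h0).
by rewrite ler_wpM2r.
Qed.

Lemma dbd_Dh K p q B X h f : 0 <= h -> dbd K.+1 `[p, q] B X f ->
  dbd K `[p, q - h] (B * X * h) X (Dh h f).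
Proof.
move=> h0; elim: K B f => [|K IH] B f [fB [f' [df hf']]].
  split=> // u; rewrite /= in_itv/= => /andP[pu uq].
  apply: (mvt_norm h0 df) => v /andP[uv vu]; apply: hf'.1.
  by rewrite /= in_itv/=; apply/andP; split; lra.
split=> [u|].
  rewrite /= in_itv/= => /andP[pu uq].
  apply: (mvt_norm h0 df) => v /andP[uv vu]; apply: hf'.1.
  by rewrite /= in_itv/=; apply/andP; split; lra.
exists (Dh h f'); split=> [u|]; last by rewrite [B * X * h * X]mulrAC; exact: IH.
apply: is_deriveB => //; rewrite -[f' _]mul1r.
apply: is_derive_fun (is_derive_affine (f := f) (a := 1) (b := h) _) => //.
  by move=> v; rewrite mul1r.
by rewrite !mul1r.
Qed.

(** By the mean value theorem each difference costs one derivative, gains X h and shortens the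
    interval by h. *)
Lemma dbd_iter_Dh K p q B X h f u : 0 <= h -> dbd K `[p, q] B X f ->
  p <= u -> u + K%:R * h <= q -> `|iter K (Dh h) f u| <= B * (X * h) ^+ K.
Proof.
move=> h0 + pu; elim: K q B f => [|K IH] q B f hf uq.
  rewrite expr0 mulr1; apply: (dbd_bound hf).
  by rewrite /= in_itv/= pu/=; move: uq; rewrite mul0r addr0.
rewrite iterSr exprS !mulrA; apply: (IH (q - h)); first exact: dbd_Dh.
by move: uq; rewrite -natr1 mulrDl; lra.
Qed.

(** The derivative of the arctangent, and the universal majorant of the proof: its sums telescope,
    and its product over the coordinates dominates (1 + |y|^2)^(-d). *)
Definition rho (x : R) : R := (1 + x ^+ 2)^-1.

Lemma rho_gt0 x : 0 < rho x.
Proof. by rewrite invr_gt0 ltr_wpDr// sqr_ge0. Qed.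

Lemma rho_ge0 x : 0 <= rho x. Proof. exact/ltW/rho_gt0. Qed.

Lemma rho_le1 x : rho x <= 1.
Proof. by rewrite invf_le1 ?lerDl ?sqr_ge0// ltr_wpDr// sqr_ge0. Qed.

(** Mean value theorem: 1 + c^2 <= 3 (1 + x^2) for c within distance 1 of x. *)
Lemma rho_atan (x s : R) : 0 <= s <= 1 -> s * rho x <= 3 * (atan (x + s) - atan x).
Proof.
move=> /andP[s0 s1]; have xs : x <= x + s by rewrite lerDl.
have [|c] := MVT_segment xs (fun u _ => is_derive1_atan u).
  by apply: continuous_subspaceT => u; exact: continuous_atan.
rewrite in_itv/= => /andP[xc cx] ->; rewrite addrAC subrr add0r.
rewrite mulrA [leRHS]mulrC ler_wpM2l// /rho.
have p1 : 0 < 1 + x ^+ 2 by rewrite ltr_wpDr// sqr_ge0.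
have p2 : 0 < 1 + c ^+ 2 by rewrite ltr_wpDr// sqr_ge0.
rewrite -div1r ler_pdivrMr// mulrAC ler_pdivlMr// mul1r.
have : (c - x) ^+ 2 <= 1 by rewrite expr_le1//; lra.
have := sqr_ge0 (c - 2 * x); nra.
Qed.

(** The increments of the arctangent telescope to less than pi < 4; with the factor 3 of [rho_atan]
    this is the 12. *)
Lemma sum_rho (s u : R) (n : nat) (a : int) : 0 < s <= 1 ->
  \sum_(j < n) rho (s * ((j%:Z + a)%:~R + u)) <= 12 / s.
Proof.
move=> /andP[s0 s1]; rewrite ler_pdivlMr// mulr_suml.
pose g (j : nat) := atan (s * ((j%:Z + a)%:~R + u)).
have : \sum_(j < n) rho (s * ((j%:Z + a)%:~R + u)) * s <=
    \sum_(j < n) 3 * (g j.+1 - g j).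
  apply: ler_sum => j _; rewrite mulrC; apply: (le_trans (rho_atan _ _)).
    by rewrite (ltW s0) s1.
  rewrite ler_wpM2l// lerB// /g le_eqVlt; apply/orP; left; apply/eqP; congr atan.
  by rewrite -addn1 PoszD -addrA (addrC 1) addrA !rmorphD/=; ring.
move/le_trans; apply; rewrite -mulr_sumr -(big_mkord xpredT (fun j => g j.+1 - g j)).
rewrite telescope_sumr//.
have := atan_ltpi2 (s * ((n%:Z + a)%:~R + u)).
have := atan_gtNpi2 (s * ((0%:Z + a)%:~R + u)).
have := @pihalf_lt2 R; rewrite -/(g n) -/(g 0%N); lra.
Qed.

End calculus.

Section weights.
Context {R : realType} {d : nat}.
Local Notation E := 'rV[R]_d.
Local Notation V := 'rV[int]_d.
Implicit Types (y z h : E) (i : 'I_d).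

(** A polynomial substitute for the square of [jbracket]; hence [M] powers of it stand for a decay
    exponent 2 M. *)
Definition S y : R := 1 + dotv y y.
Definition unitv i : E := delta_mx 0 i.
Definition toR (k : V) : E := map_mx intr k.

Lemma dotv_ge0 y : 0 <= dotv y y.
Proof. by apply: sumr_ge0 => i _; rewrite -expr2 sqr_ge0. Qed.

Lemma S_ge1 y : 1 <= S y. Proof. by rewrite lerDl dotv_ge0. Qed.
Lemma S_gt0 y : 0 < S y. Proof. exact: lt_le_trans (S_ge1 y). Qed.
Lemma Sinv_ge0 y : 0 <= (S y)^-1. Proof. by rewrite invr_ge0 ltW// S_gt0. Qed.
Lemma Sinv_gt0 y : 0 < (S y)^-1. Proof. by rewrite invr_gt0 S_gt0. Qed.
Lemma Sinv_le1 y : (S y)^-1 <= 1. Proof. by rewrite invf_le1 ?S_gt0// S_ge1. Qed.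

Lemma SinvX_le M1 M2 y : (M2 <= M1)%N -> (S y)^-1 ^+ M1 <= (S y)^-1 ^+ M2.
Proof. by move=> ?; apply: ler_wiXn2l; rewrite ?Sinv_ge0 ?Sinv_le1. Qed.

Lemma coord_sqr_le i y : y 0 i ^+ 2 <= dotv y y.
Proof.
rewrite /dotv (bigD1 i)//= -expr2 lerDl; apply: sumr_ge0 => j _.
by rewrite -expr2 sqr_ge0.
Qed.

Lemma coord_le_S i y : `|y 0 i| <= S y.
Proof.
have := coord_sqr_le i y; rewrite /S -(real_normK (num_real (y 0 i))).
by have := sqr_ge0 (`|y 0 i| - 1); rewrite expr2; nra.
Qed.

Lemma S_shift y h : S y <= 2 * S (y + h) * S h.
Proof.
have : dotv y y <= 2 * dotv (y + h) (y + h) + 2 * dotv h h.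
  rewrite !mulr_sumr -big_split/=; apply: ler_sum => i _; rewrite !mxE.
  by have := sqr_ge0 (y 0 i + 2 * h 0 i); nra.
by rewrite /S; have := dotv_ge0 (y + h); have := dotv_ge0 h; nra.
Qed.

Lemma Sinv_shift y h : (S (y + h))^-1 <= 2 * S h * (S y)^-1.
Proof.
rewrite ler_pdivlMr ?S_gt0// mulrC ler_pdivrMr ?S_gt0//.
by apply: le_trans (S_shift y h) _; rewrite mulrAC.
Qed.

(** Peetre's inequality, from h = (y + h) - y. Decay at both end points y and y + h is traded for
    decay in the shift h, which makes correlations of a weight with its translates summable over
    h. *)
Lemma S_peetre y h : S h <= 2 * S (y + h) * S y.
Proof.
have : dotv h h <= 2 * dotv (y + h) (y + h) + 2 * dotv y y.
  rewrite !mulr_sumr -big_split/=; apply: ler_sum => i _; rewrite !mxE.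
  by have := sqr_ge0 (h 0 i + 2 * y 0 i); nra.
by rewrite /S; have := dotv_ge0 (y + h); have := dotv_ge0 y; nra.
Qed.

Lemma dotv_unitv u i : dotv (u *: unitv i) (u *: unitv i) = u ^+ 2.
Proof.
rewrite /dotv (bigD1 i)//= big1 ?addr0 => [|j ji].
  by rewrite !mxE !eqxx mulr1 expr2.
by rewrite !mxE (negbTE ji) mulr0 mul0r.
Qed.

Lemma prod_S y : (S y)^-1 ^+ d <= \prod_i rho (y 0 i).
Proof.
rewrite -[X in _ ^+ X]card_ord -prodr_const; apply: ler_prod => i _.
rewrite Sinv_ge0/= lef_pV2 ?posrE ?S_gt0//; first by rewrite lerD2l coord_sqr_le.
by rewrite ltr_wpDr// sqr_ge0.
Qed.

Local Notation cnt := (@counting V R).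

Lemma lat_rho (s : R) (b : E) : 0 < s <= 1 ->
  L1 cnt (fun k => \prod_i rho ((b + s *: toR k) 0 i)) /\
  \int[cnt]_k \prod_i rho ((b + s *: toR k) 0 i) <= (12 / s) ^+ d.
Proof.
move=> s01; have s0 : s != 0 by case/andP: s01 => /lt0r_neq0.
pose phi i (k : int) := rho (s * (k%:~R + b 0 i / s)).
have h0 i k : 0 <= phi i k by exact: rho_ge0.
have h1 i X : \sum_(j < X.*2.+1) phi i (j%:Z - X%:Z) <= 12 / s.
  exact: (@sum_rho _ s (b 0 i / s) _ (- X%:Z)).
have [L I] := lat_L1_prod h0 h1.
have E0 : (fun k : V => \prod_i rho ((b + s *: toR k) 0 i)) =
    (fun k : V => \prod_i phi i (k 0 i)).
  apply/funext => k; apply: eq_bigr => i _; rewrite /phi !mxE.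
  by congr rho; field.
by rewrite E0; split=> //; rewrite (le_trans I)// prodr_const card_ord.
Qed.

Lemma lat_S (s : R) (b : E) : 0 < s <= 1 ->
  L1 cnt (fun k => (S (b + s *: toR k))^-1 ^+ d) /\
  \int[cnt]_k (S (b + s *: toR k))^-1 ^+ d <= (12 / s) ^+ d.
Proof.
move=> s01; have [L I] := lat_rho b s01.
have h k : `|(S (b + s *: toR k))^-1 ^+ d| <= \prod_i rho ((b + s *: toR k) 0 i).
  by rewrite ger0_norm ?exprn_ge0 ?Sinv_ge0// prod_S.
have L' : L1 cnt (fun k => (S (b + s *: toR k))^-1 ^+ d) by apply: L1_dom L h.
split=> //; apply: le_trans I; apply: rint_le => // k; exact: prod_S.
Qed.

(** Only unmixed derivatives are recorded, because every difference operator below acts in a single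
    coordinate. *)
Definition wt (K M : nat) (N : R) (w : E -> R) :=
  continuous w /\ exists g : 'I_d -> nat -> E -> R,
   [/\ forall i, g i 0%N = w,
       forall i k z, (k < K)%N -> is_derive z (unitv i) (g i k) (g i k.+1 z) &
       forall i k z, (k <= K)%N -> `|g i k z| <= N * (S z)^-1 ^+ M].

Lemma is_derive_line (f : E -> R) z v (u a : R) :
  is_derive (z + u *: v) v f a -> is_derive u (1 : R) (fun u => f (z + u *: v)) a.
Proof.
move=> [df va].
have EQ : (fun h : R => h^-1 *: (((fun u => f (z + u *: v)) \o shift u) (h *: 1) -
      f (z + u *: v))) =
    (fun h : R => h^-1 *: ((f \o shift (z + u *: v)) (h *: v) - f (z + u *: v))).
  apply/funext => h /=; congr (_ *: (f _ - _)).
  by rewrite [h%:A](mulr1 h) scalerDl addrCA.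
apply: DeriveDef; first by move: df; rewrite /derivable EQ.
by move: va; rewrite /derive EQ.
Qed.

Lemma wt_bound K M N w z : wt K M N w -> (0 < d)%N ->
  `|w z| <= N * (S z)^-1 ^+ M.
Proof.
move=> [_ [g [g0 _ gB]]] d0; have := gB (Ordinal d0) 0%N z isT.
by rewrite g0.
Qed.

(** Within distance r of z the function [S] changes by at most the factor 2 (1 + r^2), so the decay
    at z serves for the whole segment. *)
Lemma wt_line K M N w i z r : 0 <= r -> 0 <= N -> wt K M N w ->
  dbd K `[-r, r] (N * (2 * (1 + r ^+ 2)) ^+ M * (S z)^-1 ^+ M) 1
    (fun u => w (z + u *: unitv i)).
Proof.
move=> r0 N0 [_ [g [g0 gd gB]]].
have Sb u : `[-r, r]%classic u ->
    (S (z + u *: unitv i))^-1 ^+ M <= (2 * (1 + r ^+ 2)) ^+ M * (S z)^-1 ^+ M.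
  rewrite /= in_itv/= => /andP[ru ur]; rewrite -exprMn.
  have h1 := Sinv_shift z (u *: unitv i).
  apply: lerXn2r; rewrite ?nnegrE ?Sinv_ge0//.
    by rewrite !mulr_ge0 ?Sinv_ge0// addr_ge0// sqr_ge0.
  apply: (le_trans h1); rewrite ler_wpM2r ?Sinv_ge0// ler_wpM2l//.
  by rewrite /S dotv_unitv lerD2l -[X in X <= _]real_normK ?num_real//
     lerXn2r ?nnegrE// ler_norml ru.
have hB j u : (j <= K)%N -> `[-r, r]%classic u ->
    `|g i j (z + u *: unitv i)| <= N * (2 * (1 + r ^+ 2)) ^+ M * (S z)^-1 ^+ M.
  by move=> jK /Sb h; rewrite (le_trans (gB _ _ _ jK))// -mulrA ler_wpM2l.
rewrite -(g0 i); suff : forall k j, (j + k = K)%N ->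
  dbd k `[-r, r] (N * (2 * (1 + r ^+ 2)) ^+ M * (S z)^-1 ^+ M) 1
    (fun u => g i j (z + u *: unitv i)) by apply.
elim=> [|k IH] j jk.
  by split=> // u ru; apply: hB => //; rewrite -jk leq_addr.
split=> [u ru|]; first by apply: hB => //; rewrite -jk leq_addr.
exists (fun u => g i j.+1 (z + u *: unitv i)); split=> [u|]; last first.
  by rewrite mulr1; apply: IH; rewrite addSnnS.
by apply: is_derive_line; apply: gd; rewrite -jk -addSnnS leq_addr.
Qed.

Lemma mpartial_pure i k (f : E -> R) :
  mpartial [ffun j => if j == i then k else 0%N] f = iter k (partial i) f.
Proof.
rewrite /mpartial; set a := finfun _.
have Hs : forall s : seq 'I_d, uniq s ->
   foldr (fun j g => iter (a j) (partial j) g) f s =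
   if i \in s then iter k (partial i) f else f.
  elim=> [//|j s IH] /= /andP[js us]; rewrite IH// in_cons /a ffunE.
  by case: (eqVneq j i) js => [->|ji] js //=; rewrite (negbTE js).
by rewrite Hs ?enum_uniq// mem_enum.
Qed.

Lemma sum_pure i k : (\sum_j [ffun j => if j == i then k else 0%N] j = k)%N.
Proof.
rewrite (bigD1 i)//= big1 ?addn0 ?ffunE ?eqxx// => j ji.
by rewrite ffunE (negbTE ji).
Qed.

Lemma S_jbracket z : S z <= 2 * jbracket z ^+ 2.
Proof.
have e0 : enorm z ^+ 2 = dotv z z by rewrite sqr_sqrtr// dotv_ge0.
rewrite /S -e0 /jbracket; have : 0 <= enorm z by exact: sqrtr_ge0.
by rewrite /Num.max; case: ltP => h h0; nra.
Qed.

Lemma jbracket_ge1 z : 1 <= jbracket z.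
Proof. by rewrite /jbracket le_max lexx. Qed.

Lemma wnorm_ge0 K1 K2 (w : E -> R) : (0 <= wnorm K1 K2 w)%E.
Proof.
apply: (@le_trans _ _ (`|mpartial [ffun=> 0%N] w 0| * jbracket (0 : E) `^ K2)%:E).
  by rewrite lee_fin mulr_ge0// powR_ge0.
apply: ereal_sup_ubound; exists 0, [ffun=> 0%N]; split=> //.
by rewrite big1// => i _; rewrite ffunE.
Qed.

(** The comparison S <= 2 [jbracket]^2 accounts both for the factor 2^M and for the exponent 2 M. *)
Lemma Cspace_wt K1 K2 K M (w : E -> R) : Cspace K1 K2 w -> (K <= K1)%N ->
  (2 * M)%:R <= K2 -> wt K M (2 ^+ M * fine (wnorm K1 K2 w)) w.
Proof.
move=> [sm wfin] KK1 MK2; split; first by case: K1 sm {wfin KK1} => [|K1] [].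
have nE : (fine (wnorm K1 K2 w))%:E = wnorm K1 K2 w.
  by rewrite fineK// ge0_fin_numE// wnorm_ge0.
exists (fun i k => iter k (partial i) w); split=> //.
- have H : forall k n (f : E -> R) i, Csmooth (k + n) f -> Csmooth n (iter k (partial i) f).
    elim=> [//|k IH] n f i /= [_ h]; rewrite -iterS iterSr; apply: IH.
    by case: (h i).
  move=> i k z kK; have := H k (K1 - k)%N w i; rewrite subnKC; last lia.
  move=> /(_ sm); case E1 : (K1 - k)%N => [|n]; first by lia.
  by move=> [_ /(_ i)[dr _]]; apply: DeriveDef => //; exact: dr.
move=> i k z kK.
have : (`|iter k (partial i) w z| * jbracket z `^ K2 <= fine (wnorm K1 K2 w)).
  rewrite -lee_fin nE; apply: ereal_sup_ubound.
  exists z, [ffun j => if j == i then k else 0%N]; split; last by rewrite mpartial_pure.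
  by rewrite sum_pure (leq_trans kK).
have j1 := jbracket_ge1 z; have j0 : 0 < jbracket z by exact: lt_le_trans j1.
have h1 : jbracket z ^+ (2 * M) <= jbracket z `^ K2.
  by rewrite -powR_mulrn ?(ltW j0)//; apply: (ler_powR j1).
have h2 : (S z) ^+ M <= 2 ^+ M * jbracket z ^+ (2 * M).
  rewrite exprM -exprMn; apply: lerXn2r; rewrite ?nnegrE ?S_jbracket// ?(ltW (S_gt0 z))//.
  by rewrite mulr_ge0// sqr_ge0.
move=> h3; rewrite exprVn ler_pdivlMr ?exprn_gt0 ?S_gt0//.
apply: (@le_trans _ _ (`|iter k (partial i) w z| * (2 ^+ M * jbracket z ^+ (2 * M)))).
  by rewrite ler_wpM2l.
rewrite mulrCA ler_wpM2l ?exprn_ge0//; apply: le_trans h3.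
by rewrite ler_wpM2l.
Qed.

End weights.

Section continuity.
Context {R : realType} {T : topologicalType}.
Implicit Types f g : T -> R.

Lemma ctD f g : continuous f -> continuous g -> continuous (fun x => f x + g x).
Proof. by move=> cf cg x; apply: (cvgD (cf x) (cg x)). Qed.

Lemma ctB f g : continuous f -> continuous g -> continuous (fun x => f x - g x).
Proof. by move=> cf cg x; apply: (cvgB (cf x) (cg x)). Qed.

Lemma ctM f g : continuous f -> continuous g -> continuous (fun x => f x * g x).
Proof. by move=> cf cg x; apply: (cvgM (cf x) (cg x)). Qed.

Lemma ctC (c : R) : continuous (fun _ : T => c).
Proof. by move=> x; exact: cvg_cst. Qed.

Lemma ctX f n : continuous f -> continuous (fun x => f x ^+ n).
Proof.
move=> cf; elim: n => [|n IH]; first exact: ctC.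
by rewrite (_ : (fun x => _) = (fun x => f x * f x ^+ n)); [exact: ctM|apply/funext => x; rewrite exprS].
Qed.

Lemma ctV f : (forall x, f x != 0) -> continuous f -> continuous (fun x => (f x)^-1).
Proof. by move=> f0 cf x; apply: (cvgV (f0 x) (cf x)). Qed.

Lemma ct_comp (g : R -> R) f : continuous g -> continuous f -> continuous (fun x => g (f x)).
Proof. by move=> cg cf x; apply: continuous_comp; [exact: cf|exact: cg]. Qed.

Lemma ct_sum (I : Type) (r : seq I) (f : I -> T -> R) :
  (forall i, continuous (f i)) -> continuous (fun x => \sum_(i <- r) f i x).
Proof.
move=> h; elim: r => [|i r IH].
  by under eq_fun do rewrite big_nil; exact: ctC.
by under eq_fun do rewrite big_cons; exact: ctD.
Qed.

End continuity.

Section quadratic_form.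
Context {R : realType} {d : nat}.
Variable A : 'M[int]_d.
Local Notation E := 'rV[R]_d.
Local Notation V := 'rV[int]_d.
Implicit Types (x y z h : E) (i : 'I_d).

Lemma dotvC x y : dotv x y = dotv y x.
Proof. by apply: eq_bigr => i _; rewrite mulrC. Qed.

Lemma dotvDl x y z : dotv (x + y) z = dotv x z + dotv y z.
Proof. by rewrite -big_split/=; apply: eq_bigr => i _; rewrite mxE mulrDl. Qed.

Lemma dotvDr x y z : dotv z (x + y) = dotv z x + dotv z y.
Proof. by rewrite dotvC dotvDl !(dotvC _ z). Qed.

Lemma dotvZl (c : R) x y : dotv (c *: x) y = c * dotv x y.
Proof. by rewrite mulr_sumr; apply: eq_bigr => i _; rewrite mxE mulrA. Qed.

Lemma dotvZr (c : R) x y : dotv y (c *: x) = c * dotv y x.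
Proof. by rewrite dotvC dotvZl dotvC. Qed.

Lemma dotv_unit x i : dotv x (unitv i) = x 0 i.
Proof.
rewrite /dotv (bigD1 i)//= big1 ?addr0 => [|j ji].
  by rewrite !mxE !eqxx mulr1.
by rewrite !mxE (negbTE ji) mulr0.
Qed.

Lemma mxactE x i : mxact A x 0 i = \sum_j (A i j)%:~R * x 0 j.
Proof. by rewrite !mxE; apply: eq_bigr => j _; rewrite !mxE mulrC. Qed.

Lemma mxactD x y : mxact A (x + y) = mxact A x + mxact A y.
Proof. exact: mulmxDl. Qed.

Lemma mxactZ (c : R) x : mxact A (c *: x) = c *: mxact A x.
Proof. by rewrite /mxact scalemxAl. Qed.

Lemma mxact_unit i j : mxact A (unitv i : E) 0 j = (A j i)%:~R.
Proof.
rewrite mxactE (bigD1 i)//= big1 ?addr0 => [|k ki].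
  by rewrite !mxE !eqxx mulr1.
by rewrite !mxE (negbTE ki) mulr0.
Qed.

Hypothesis symA : A^T = A.

Let Aij i j : A i j = A j i.
Proof. by rewrite -[in LHS]symA mxE. Qed.

Lemma mxact_sym x y : dotv (mxact A x) y = dotv x (mxact A y).
Proof.
transitivity (\sum_i \sum_j (A i j)%:~R * x 0 j * y 0 i).
  by apply: eq_bigr => i _; rewrite mxactE mulr_suml.
rewrite exchange_big/=; apply: eq_bigr => j _; rewrite mxactE mulr_sumr.
by apply: eq_bigr => i _; rewrite Aij; ring.
Qed.

Lemma qformD y h : qform A (y + h) = qform A y + dotv (mxact A h) y + qform A h.
Proof.
rewrite /qform mxactD dotvDl !dotvDr (mxact_sym y h) (dotvC y (mxact A h)).
by field.
Qed.

Lemma qformZ (c : R) h : qform A (c *: h) = c ^+ 2 * qform A h.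
Proof. by rewrite /qform mxactZ dotvZl dotvZr; ring. Qed.

Lemma qform_line y i u :
  qform A (y + u *: unitv i) = (A i i)%:~R / 2 * u ^+ 2 + mxact A y 0 i * u + qform A y.
Proof.
rewrite qformD qformZ mxact_sym dotvZl dotvC dotv_unit.
by rewrite {2}/qform dotv_unit mxact_unit; field.
Qed.

Definition CA : R := \sum_i \sum_j `|(A i j)%:~R|.

Lemma CA_ge0 : 0 <= CA.
Proof. by apply: sumr_ge0 => i _; apply: sumr_ge0 => j _. Qed.

Lemma A_le_CA i j : `|(A i j)%:~R| <= CA.
Proof.
rewrite /CA (bigD1 i)//= (bigD1 j)//= -addrA lerDl addr_ge0//.
  exact: sumr_ge0.
by apply: sumr_ge0 => k _; apply: sumr_ge0.
Qed.

Lemma mxact_bound z i : `|mxact A z 0 i| <= CA * S z.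
Proof.
rewrite mxactE (le_trans (ler_norm_sum _ _ _))//.
apply: (@le_trans _ _ (\sum_j `|(A i j)%:~R| * S z)).
  by apply: ler_sum => j _; rewrite normrM ler_wpM2l// coord_le_S.
rewrite -mulr_suml ler_wpM2r ?(ltW (S_gt0 _))// /CA [leRHS](bigD1 i)//= lerDl.
by apply: sumr_ge0 => k _; apply: sumr_ge0.
Qed.

Lemma mxact_continuous i : continuous (fun z : E => mxact A z 0 i).
Proof.
rewrite (_ : (fun z : E => _) = (fun z => \sum_j (A i j)%:~R * z 0 j)).
  by apply: ct_sum => j; apply: ctM; [exact: ctC|exact: coord_continuous].
by apply/funext => x; rewrite mxactE.
Qed.

Lemma dotv_continuous : continuous (fun z : E => dotv z z).
Proof. by apply: ct_sum => j; apply: ctM; exact: coord_continuous. Qed.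

Lemma S_continuous : continuous (@S R d).
Proof. by apply: ctD; [exact: ctC|exact: dotv_continuous]. Qed.

Lemma qform_continuous : continuous (fun z : E => qform A z).
Proof.
apply: ctM; first exact: ctC.
by apply: ct_sum => j; apply: ctM; [exact: mxact_continuous|exact: coord_continuous].
Qed.

Hypothesis evenA : forall i, (2 %| A i i)%Z.

(** The integral polynomial behind [qform]: the even diagonal makes the divisions by 2 exact. *)
Definition qZ (k : V) : int :=
  \sum_(i < d) (A i i %/ 2)%Z * k 0 i ^+ 2 +
  \sum_(i < d) \sum_(j < d | (i < j)%N) A i j * k 0 i * k 0 j.

Lemma qformZE (k : V) : qform A (toR k) = (qZ k)%:~R :> R.
Proof.
have h : 2 * qform A (toR k) = \sum_i \sum_j ((A i j * k 0 i * k 0 j)%:~R : R).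
  rewrite /qform mulrA mulfV ?mul1r//; apply: eq_bigr => i _.
  rewrite mxactE mulr_suml; apply: eq_bigr => j _.
  by rewrite !mxE !intrM; ring.
have {h} : 2 * qform A (toR k) = (2 * qZ k)%:~R :> R.
  rewrite h -(eq_bigr _ (fun i _ => rmorph_sum _ _ _ _)) -rmorph_sum/=; congr _%:~R.
  pose a i j := A i j * k 0 i * k 0 j.
  have split3 i : \sum_j a i j = a i i + \sum_(j < d | (i < j)%N) a i j +
      \sum_(j < d | (j < i)%N) a i j.
    rewrite (bigD1 i)//= -addrA; congr (_ + _).
    rewrite (bigID (fun j : 'I_d => (i < j)%N))/=; congr (_ + _); apply: eq_bigl => j.
      by rewrite andb_idl// => ij; rewrite -val_eqE/= gtn_eqF.
    by rewrite -val_eqE/=; lia.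
  rewrite (eq_bigr _ (fun i _ => split3 i)) !big_split/=.
  have -> : \sum_(i < d) \sum_(j < d | (j < i)%N) a i j = \sum_(i < d) \sum_(j < d | (i < j)%N) a i j.
    rewrite (exchange_big_dep xpredT)//=; apply: eq_bigr => i _; apply: eq_bigr => j _.
    by rewrite /a Aij; ring.
  rewrite /qZ -addrA mulrDr mulr_sumr; congr (_ + _); last by rewrite /a; ring.
  by apply: eq_bigr => i _; rewrite /a -{1}(divzK (evenA i)); ring.
rewrite intrM => h; have n2 : (2 : R) != 0 by [].
exact: (mulfI n2 h).
Qed.

Definition actZ (k : V) : V := k *m A^T.

Lemma mxact_toR (k : V) : mxact A (toR k) = toR (actZ k) :> E.
Proof. by rewrite /mxact /toR /actZ map_mxM map_trmx. Qed.

Definition dotZ (k l : V) : int := \sum_i k 0 i * l 0 i.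

Lemma dotv_toR (k l : V) : dotv (toR k) (toR l) = (dotZ k l)%:~R :> R.
Proof.
by rewrite rmorph_sum; apply: eq_bigr => i _; rewrite !mxE rmorphM.
Qed.

Lemma toRD (k l : V) : toR (k + l) = toR k + toR l :> E.
Proof. by rewrite /toR map_mxD. Qed.

Lemma toRZ (c : int) (k : V) : toR (c *: k) = c%:~R *: toR k :> E.
Proof. by rewrite /toR map_mxZ. Qed.

Lemma qZD (k l : V) : qZ (k + l) = qZ k + dotZ (actZ l) k + qZ l.
Proof.
apply: (@intr_inj R); rewrite -qformZE toRD qformD !qformZE mxact_toR dotv_toR.
by rewrite !rmorphD.
Qed.

Lemma qZZ c (k : V) : qZ (c *: k) = c ^+ 2 * qZ k.
Proof.
apply: (@intr_inj R); rewrite -qformZE toRZ qformZ qformZE rmorphM/=.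
by rewrite rmorphXn.
Qed.

Lemma qZ_mod (q : int) (b k : V) : exists n : int, qZ (b + q *: k) = qZ b + q * n.
Proof.
exists (dotZ (actZ k) b + q * qZ k); rewrite qZD qZZ.
have -> : dotZ (actZ (q *: k)) b = q * dotZ (actZ k) b.
  rewrite /actZ -scalemxAl /dotZ mulr_sumr; apply: eq_bigr => i _.
  by rewrite mxE mulrA.
by ring.
Qed.

End quadratic_form.

Section phase.
Context {R : realType} {d : nat}.
Local Notation E := 'rV[R]_d.
Implicit Types (y z : E) (i : 'I_d) (f : E -> R).

Definition Dv i (h : R) f : E -> R := fun y => f (y + h *: unitv i) - f y.

Lemma iter_Dv K i h f y u :
  iter K (Dv i h) f (y + u *: unitv i) =
  iter K (Dh h) (fun u => f (y + u *: unitv i)) u.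
Proof.
elim: K u => [//|K IH] u; rewrite !iterS /Dv /Dh -!IH.
by rewrite -addrA -scalerDl.
Qed.

Lemma iter_Dv0 K i h f y :
  iter K (Dv i h) f y = iter K (Dh h) (fun u => f (y + u *: unitv i)) 0.
Proof. by rewrite -iter_Dv scale0r addr0. Qed.

Variable A : 'M[int]_d.
Hypothesis symA : A^T = A.

(** The phase [th] replaces complex values: 0 and - pi/2 give the real and imaginary parts of the
    oscillating weight, and the phases of Gauss sums enter through it as well. *)
Definition phi (w : E -> R) (lam m th : R) : E -> R :=
  fun y => w y * cos (2 * pi * lam * (qform A y - m) + th).

Lemma phi_continuous w lam m th : continuous w -> continuous (phi w lam m th).
Proof.
move=> cw; apply: ctM => //.
apply: (@ct_comp _ _ (@cos R)); first exact: continuous_cos.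
apply: ctD; last exact: ctC.
apply: ctM; first exact: ctC.
by apply: ctB; [exact: qform_continuous|exact: ctC].
Qed.

Lemma norm_cos (x : R) : `|cos x| <= 1.
Proof. by rewrite ler_norml cos_geN1 cos_le1. Qed.

Lemma phi_le w lam m th y : `|phi w lam m th y| <= `|w y|.
Proof. by rewrite normrM ler_piMr// norm_cos. Qed.

(** Since A y grows linearly, a derivative of the phase is of size (1 + |lam|) S(y). The K
    derivatives consume K powers of [S]: the weight decays with exponent [K + M] and [M] is left. *)
Lemma phi_line K M : exists2 C : R, 0 <= C &
  forall N w, 0 <= N -> wt K (K + M) N w -> forall lam m th i y h,
  0 <= h -> K%:R * h <= 1 ->
  `|iter K (Dv i h) (phi w lam m th) y| <=
     C * N * ((1 + `|lam|) * h) ^+ K * (S y)^-1 ^+ M.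
Proof.
pose c : R := 2 * pi * (1 + CA A) * 2.
have CA0 : 0 <= CA A :> R by exact: CA_ge0.
have pi0 := @pi_ge2 R.
have c1 : 2 <= c by rewrite /c; nra.
pose X0 : R := 1 + K%:R * c.
have X00 : 0 <= X0 by rewrite addr_ge0// mulr_ge0//; lra.
exists (4 ^+ (K + M) * X0 ^+ K).
  by rewrite mulr_ge0 ?exprn_ge0.
move=> N w N0 hw lam m th i y h h0 Kh; rewrite iter_Dv0.
have Sy := S_ge1 y; have S0 := S_gt0 y.
have l0 : 0 <= `|lam| by [].
(* [Y] bounds the slope of the phase on the unit segment: one half for the slope at y, one half for
   its variation. As Y >= 1, the second derivative is below Y^2, as [dbd_cos] requires. *)
pose Y := c * (1 + `|lam|) * S y.
have Y1 : 1 <= Y.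
  rewrite /Y -[X in X <= _]mulr1 ler_pM// -[X in X <= _]mulr1 ler_pM//; lra.
have hw1 := wt_line i y ler01 N0 hw.
have lA : 2 * pi * `|lam| * CA A <= Y / 2.
  rewrite /Y /c; have : `|lam| * CA A <= (1 + CA A) * (1 + `|lam|) * S y.
    apply: (@le_trans _ _ ((1 + CA A) * (1 + `|lam|))); first nra.
    by rewrite ler_peMr// mulr_ge0; lra.
  by move=> hh; nra.
have hc : dbd K `[-1, 1] 1 (K%:R * Y)
    (fun u => cos (2 * pi * lam * ((A i i)%:~R / 2) * u ^+ 2 +
       2 * pi * lam * mxact A y 0 i * u + (2 * pi * lam * (qform A y - m) + th))).
  have lAi : `|2 * pi * lam * (A i i)%:~R| <= Y / 2.
    apply: le_trans lA; rewrite !normrM (ger0_norm (x := 2))// (ger0_norm (pi_ge0 R)).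
    by rewrite ler_wpM2l ?A_le_CA// !mulr_ge0// pi_ge0.
  have EA : 2 * (2 * pi * lam * ((A i i)%:~R / 2)) = 2 * pi * lam * (A i i)%:~R by field.
  apply: dbd_cos; first lra.
    by rewrite EA; apply: (le_trans lAi); rewrite expr2; nra.
  move=> u; rewrite /= in_itv/= => /andP[u1 u2]; rewrite EA.
  apply: (le_trans (ler_normD _ _)).
  have h1 : `|2 * pi * lam * (A i i)%:~R * u| <= Y / 2.
    rewrite normrM; apply: le_trans lAi; rewrite ler_piMr// ler_norml; lra.
  have h2 : `|2 * pi * lam * mxact A y 0 i| <= Y / 2.
    rewrite !normrM (ger0_norm (x := 2))// (ger0_norm (pi_ge0 R)).
    apply: (@le_trans _ _ (2 * pi * `|lam| * (CA A * S y))).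
      by rewrite ler_wpM2l ?mxact_bound// !mulr_ge0// pi_ge0.
    rewrite /Y /c mulrA; have : `|lam| * CA A <= (1 + CA A) * (1 + `|lam|) by nra.
    move=> hh.
    have -> : 2 * pi * (1 + CA A) * 2 * (1 + `|lam|) * S y / 2 =
      2 * pi * ((1 + CA A) * (1 + `|lam|)) * S y by field.
    rewrite ler_wpM2r ?(ltW S0)// -mulrA ler_wpM2l// mulr_ge0//; exact: pi_ge0.
  by lra.
have hp : dbd K `[-1, 1] (N * 4 ^+ (K + M) * (S y)^-1 ^+ (K + M)) (1 + K%:R * Y)
    (fun u => phi w lam m th (y + u *: unitv i)).
  have -> : (fun u => phi w lam m th (y + u *: unitv i)) =
     (fun u => w (y + u *: unitv i) * cos (2 * pi * lam * ((A i i)%:~R / 2) * u ^+ 2 +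
       2 * pi * lam * mxact A y 0 i * u + (2 * pi * lam * (qform A y - m) + th))).
    by apply/funext => u; rewrite /phi qform_line//; congr (_ * cos _); ring.
  rewrite -[X in dbd _ _ X]mulr1; apply: dbdM => //.
  - by rewrite !mulr_ge0// exprn_ge0// Sinv_ge0.
  - by rewrite mulr_ge0//; lra.
  - by move: hw1; rewrite expr1n (_ : 2 * (1 + 1) = 4)//; ring.
have := dbd_iter_Dh (u := 0) h0 hp _ _; rewrite oppr_le0 ler01 add0r => /(_ isT Kh).
move/le_trans; apply.
have XY : 1 + K%:R * Y <= X0 * ((1 + `|lam|) * S y).
  have P1 : 1 <= (1 + `|lam|) * S y by nra.
  have -> : K%:R * Y = K%:R * c * ((1 + `|lam|) * S y) by rewrite /Y; ring.
  by rewrite /X0 [leRHS]mulrDl mul1r lerD2r.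
have key : (S y)^-1 ^+ K * ((1 + K%:R * Y) * h) ^+ K <= X0 ^+ K * ((1 + `|lam|) * h) ^+ K.
  rewrite -!exprMn; apply: lerXn2r; rewrite ?nnegrE.
  - rewrite !mulr_ge0 ?Sinv_ge0// addr_ge0// mulr_ge0//; lra.
  - by rewrite !mulr_ge0//; lra.
  rewrite [leLHS]mulrA [leRHS]mulrA ler_wpM2r// mulrC ler_pdivrMr//.
  by apply: (le_trans XY); rewrite mulrA.
rewrite [(S y)^-1 ^+ (K + M)]exprD; set T := (S y)^-1 in key *.
have T0 : 0 <= T by exact: Sinv_ge0.
have -> : N * 4 ^+ (K + M) * (T ^+ K * T ^+ M) * ((1 + K%:R * Y) * h) ^+ K =
  N * 4 ^+ (K + M) * T ^+ M * (T ^+ K * ((1 + K%:R * Y) * h) ^+ K) by ring.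
have -> : 4 ^+ (K + M) * X0 ^+ K * N * ((1 + `|lam|) * h) ^+ K * T ^+ M =
  N * 4 ^+ (K + M) * T ^+ M * (X0 ^+ K * ((1 + `|lam|) * h) ^+ K) by ring.
by rewrite ler_wpM2l// !mulr_ge0 ?exprn_ge0.
Qed.

End phase.

(** * Riemann sums and residue classes *)

Section fibers.
Context d (T : measurableType d) (R : realType) (n : nat).
Local Notation V := 'rV[int]_n.
Local Notation cnt := (@counting V R).
Variables (mu : {measure set T -> \bar R}) (kap : T -> V) (c : R).
Hypothesis mkap : measurable_fun setT kap.
Hypothesis muk : forall k, mu (kap @^-1` [set k]) = c%:E.

(** Used with Lebesgue measure and the cells of a grid of mesh s, where c = s^d: an integral of a
    step function is a Riemann sum. *)
Lemma fiber_ge0_integral (f : V -> \bar R) : (forall k, 0 <= f k)%E ->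
  (\int[mu]_x f (kap x) = c%:E * \int[cnt]_k f k)%E.
Proof.
move=> f0; pose F (j : nat) := [set x : T | pickle (kap x) = j].
have mF j : measurable (F j).
  by rewrite -[X in measurable X]setTI; apply: (mkap measurableT (Y := [set k | pickle k = j])).
have FT : \bigcup_j F j = setT.
  by apply/seteqP; split => // x _; exists (pickle (kap x)).
have tF : trivIset setT F.
  apply/trivIsetP => i j _ _ ij; rewrite -subset0 => x [xi xj].
  by case/eqP: ij; exact: (etrans (esym xi) xj).
have mf : measurable_fun setT (fun x => f (kap x)).
  by apply: measurableT_comp => //; exact: measurable_lat.
rewrite -[in LHS]FT ge0_integral_bigcup//; last by rewrite FT.
pose G (j : nat) := [set k : V | pickle k = j].
have GT : \bigcup_j G j = setT.
  by apply/seteqP; split => // x _; exists (pickle x).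
have tG : trivIset setT G.
  apply/trivIsetP => i j _ _ ij; rewrite -subset0 => x [xi xj].
  by case/eqP: ij; exact: (etrans (esym xi) xj).
rewrite ge0_integral_lat// -[in RHS]GT esum_bigcupT//.
have -> : (\esum_(i in setT) \esum_(j in G i) f j =
    \sum_(0 <= i <oo) \esum_(j in G i) f j)%E.
  rewrite nneseries_esum; last by move=> j _; apply: esum_ge0.
  by congr esum; apply/seteqP.
rewrite -nneseriesZl//; last by move=> j *; apply: esum_ge0.
apply: eq_eseriesr => j _; rewrite /F /G.
case E : (unpickle j : option V) => [k|]; last first.
  have -> : [set x | pickle (kap x) = j] = set0.
    by apply/seteqP; split => // x /= kj; move: E; rewrite -kj pickleK.
  have -> : [set k : V | pickle k = j] = set0.
    by apply/seteqP; split => // x /= kj; move: E; rewrite -kj pickleK.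
  by rewrite integral_set0 esum_set0 mule0.
have [kj|kj] := eqVneq (pickle k) j; last first.
  have nE (x : V) : pickle x <> j.
    by move=> xj; move: E kj; rewrite -xj pickleK => -[->]; rewrite eqxx.
  have -> : [set x | pickle (kap x) = j] = set0 by apply/seteqP; split => // x /= /nE.
  have -> : [set k : V | pickle k = j] = set0 by apply/seteqP; split => // x /= /nE.
  by rewrite integral_set0 esum_set0 mule0.
have -> : [set k : V | pickle k = j] = [set k].
  by apply/seteqP; split => x /=; [rewrite -kj => /(pcan_inj pickleK)|move=> ->].
have -> : [set x | pickle (kap x) = j] = kap @^-1` [set k].
  by apply/seteqP; split => x /=; [rewrite -kj => /(pcan_inj pickleK)|move=> ->].
rewrite esum_set1// (eq_integral (cst (f k))); last first.
  by move=> x; rewrite inE /= => ->.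
rewrite integral_cst ?muk 1?muleC// -[X in measurable X]setTI.
exact: (mkap measurableT (Y := [set k])).
Qed.

Lemma fiber_rint (f : V -> R) :
  \int[mu]_x f (kap x) = c * \int[cnt]_k f k \/ ~ L1 cnt f.
Proof.
have [i_f|] := pselect (L1 cnt f); last by right.
left; rewrite /Rintegral integralE [in RHS]integralE.
have fp x : (EFin \o (f \o kap))^\+%E x = (EFin \o f)^\+%E (kap x) by rewrite !funeposE.
have fn x : (EFin \o (f \o kap))^\-%E x = (EFin \o f)^\-%E (kap x) by rewrite !funenegE.
rewrite (eq_integral _ _ (fun k _ => fp k)) (eq_integral _ _ (fun k _ => fn k)).
rewrite !fiber_ge0_integral// -muleBr//; last first.
  apply: fin_num_adde_defr.
  exact: (integrable_pos_fin_num measurableT i_f).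
rewrite fineM// fin_numB.
by rewrite (integrable_neg_fin_num measurableT i_f) (integrable_pos_fin_num measurableT i_f).
Qed.

End fibers.

Section lebesgue_tuple.
Context {R : realType}.
Local Notation leb := (@lebesgue_measure R).
Local Notation lt n := (@lebesgue_tuple R n).

Lemma lt_cons_rint n (f : n.+1.-tuple R -> R) (g : R -> R) (h : n.-tuple R -> R) :
  measurable_fun setT f -> L1 leb g -> L1 (lt n) h ->
  (forall u x, `|f (tcons (u, x))| <= g u * h x) ->
  L1 (lt n.+1) f /\
  \int[lt n.+1]_x f x = \int[leb]_u \int[lt n]_x f (tcons (u, x)).
Proof.
move=> mf ig ih fgh.
have mft : measurable_fun setT (f \o @tcons R n).
  by apply: measurableT_comp => //; exact: measurable_tcons.
have P := fub_prod mft ig ih fgh.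
have mEf : measurable_fun setT (EFin \o f) by exact/measurable_EFinP.
split.
  exact: (@integrable_pushforward _ _ _ _ _ _ (@measurable_tcons R n)
    (leb \x lt n)%E setT (EFin \o f) mEf P measurableT).
rewrite (fubini_dom1 mft ig ih fgh) /Rintegral; congr fine.
transitivity (\int[pushforward (leb \x lt n) (@tcons R n)]_x (f x)%:E)%E; first by [].
by rewrite (integral_pushforward (@measurable_tcons R n))// preimage_setT.
Qed.

Lemma lt_prod n (f : 'I_n -> R -> R) : (forall i u, 0 <= f i u) ->
  (forall i, L1 leb (f i)) ->
  L1 (lt n) (fun x => \prod_i f i (tnth x i)) /\
  \int[lt n]_x \prod_i f i (tnth x i) = \prod_i \int[leb]_u f i u.
Proof.
elim: n f => [|n IH] f f0 i_f.
  have E0 : (fun x : 0.-tuple R => \prod_(i < 0) f i (tnth x i)) = cst 1.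
    by apply/funext => x; rewrite big_ord0.
  have E1 : (\int[lt 0]_x (1%:E) = 1%:E)%E.
    rewrite integral_cst// mul1e; exact: diracT.
  rewrite big_ord0 E0; split.
    apply/integrableP; split; first exact/measurable_EFinP.
    rewrite [X in (X < _)%E](_ : _ = \int[lt 0]_x 1%:E)%E; first by rewrite E1 ltry.
    by apply: eq_integral => x _; rewrite /= normr1.
  by rewrite /Rintegral E1.
have mpr m (f' : 'I_m -> R -> R) : (forall i, L1 leb (f' i)) ->
    measurable_fun setT (fun x : m.-tuple R => \prod_i f' i (tnth x i)).
  move=> h; apply: measurable_prod => i _.
  apply: measurableT_comp; last exact: measurable_tnth.
  exact: (L1_measurable (h i)).
have [L I] := IH (fun i => f (lift ord0 i)) (fun i => f0 _) (fun i => i_f _).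
have E u x : \prod_i f i (tnth (tcons (u, x)) i) =
    f ord0 u * \prod_i f (lift ord0 i) (tnth x i).
  rewrite big_ord_recl tnth0; congr (_ * _); apply: eq_bigr => i _.
  by rewrite tnthS.
have [|L' ->] := @lt_cons_rint n (fun x => \prod_i f i (tnth x i)) _ _ (mpr _ f i_f) (i_f ord0) L.
  move=> u x; rewrite E ger0_norm// mulr_ge0//; exact: prodr_ge0.
split=> //; rewrite big_ord_recl -I -RintegralZr//.
by apply: eq_rint => u; rewrite -rintZ//; apply: eq_rint => x; rewrite E.
exact: i_f.
Qed.

Lemma L1_rho : L1 leb (@rho R).
Proof.
have mr : measurable_fun setT (@rho R).
  by apply: continuous_measurable_fun; exact: continuous_oneDsqrV.
apply/integrableP; split; first exact/measurable_EFinP.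
rewrite [X in (X < _)%E](_ : _ = \int[leb]_x (rho x)%:E)%E; last first.
  by apply: eq_integral => x _; rewrite /= ger0_norm// rho_ge0.
rewrite ge0_symfun_integralT//.
- rewrite -set_itvcy [X in (_ * X)%E](_ : _ = (pi / 2)%:E); last exact: integral0y_oneDsqr.
  by rewrite -EFinM ltry.
- by move=> x; exact: rho_ge0.
- exact: continuous_oneDsqrV.
- by move=> x; rewrite /rho /= sqrrN.
Qed.

End lebesgue_tuple.

Section riemann_sum.
Context {R : realType} {d : nat}.
Local Notation E := 'rV[R]_d.
Local Notation V := 'rV[int]_d.
Local Notation leb := (@lebesgue_measure R).
Local Notation lt := (@lebesgue_tuple R d).
Local Notation cnt := (@counting V R).
Local Notation row := (@row_of_tuple R d).

Definition cell (b : E) (s : R) (x : d.-tuple R) : V :=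
  \row_i Num.floor ((tnth x i - b 0 i) / s).

Section cell.
Variables (b : E) (s : R).
Hypothesis s0 : 0 < s.

Let cell_pre (k : V) : cell b s @^-1` [set k] =
  [set x | forall i, tnth x i \in `[b 0 i + s * (k 0 i)%:~R, b 0 i + s * (k 0 i + 1)%:~R[ ].
Proof.
have H (x : d.-tuple R) i (k0 : int) : (Num.floor ((tnth x i - b 0 i) / s) == k0) =
    (tnth x i \in `[b 0 i + s * k0%:~R, b 0 i + s * (k0 + 1)%:~R[).
  rewrite floor_eq in_itv/= ler_pdivlMr// ltr_pdivrMr// lerBrDl ltrBlDl.
  by rewrite ![_ * s]mulrC.
apply/seteqP; split => x /=.
  by move=> <- i; rewrite !mxE -H.
by move=> h; apply/rowP => i; rewrite mxE; apply/eqP; rewrite H.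
Qed.

Lemma measurable_cell : measurable_fun setT (cell b s).
Proof.
have m1 (k : V) : measurable (cell b s @^-1` [set k]).
  rewrite cell_pre.
  rewrite (_ : [set x | _] = \bigcap_(i in [set: 'I_d]) ((fun x => tnth x i) @^-1`
      `[b 0 i + s * (k 0 i)%:~R, b 0 i + s * (k 0 i + 1)%:~R[%classic)).
    apply: fin_bigcap_measurable => // i _; rewrite -[X in measurable X]setTI.
    exact: (@measurable_tnth _ (measurableTypeR R) d i).
  by apply/seteqP; split => x /= h i; [move=> _; exact: h|exact: (h i)].
move=> _ Y _; rewrite setTI.
have -> : cell b s @^-1` Y = \bigcup_j
    (if unpickle j is Some k then if k \in Y then cell b s @^-1` [set k] else set0 else set0).
  apply/seteqP; split => [x Yx|x [j _]].
    exists (pickle (cell b s x)) => //; rewrite pickleK.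
    by rewrite mem_set.
  by case: (unpickle j) => // k; case: ifPn => //; rewrite inE => Yk /= ->.
apply: bigcup_measurable => j _; case: (unpickle j) => // k.
by case: ifPn.
Qed.

Lemma cell_measure (k : V) : lt (cell b s @^-1` [set k]) = (s ^+ d)%:E.
Proof.
pose J i : set R := `[b 0 i + s * (k 0 i)%:~R, b 0 i + s * (k 0 i + 1)%:~R[%classic.
have mJ i : measurable (J i) by exact: measurable_itv.
have lJ i : leb (J i) = s%:E.
  rewrite /J lebesgue_measure_itv/= lte_fin ltrD2l ltr_pM2l// ltr_int ltrDl ltr01.
  by rewrite -EFinD; congr EFin; rewrite rmorphD/=; ring.
have iI i : (\int[leb]_u (\1_(J i) u)%:E = s%:E)%E.
  rewrite integral_indic; [|exact: measurableT|exact: measurable_itv].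
  by rewrite setIT; exact: lJ.
have iJ i : L1 leb (\1_(J i) : R -> R) by exact: integrable_indic_itv.
have rJ i : \int[leb]_u (\1_(J i) u : R) = s by rewrite /Rintegral iI.
have [L] := lt_prod (fun i u => (ltac:(by rewrite indicE) : 0 <= (\1_(J i) u : R))) iJ.
under [X in _ = X]eq_bigr do rewrite rJ.
rewrite prodr_const card_ord => <-.
rewrite L1_fineK//.
have mc : measurable (cell b s @^-1` [set k]).
  by rewrite -[X in measurable X]setTI; exact: (measurable_cell measurableT (Y := [set k])).
rewrite -[LHS]mul1e -[LHS]integral_cst// integral_mkcond.
apply: eq_integral => x _; rewrite patchE; case: ifPn.
  rewrite inE cell_pre /= => h; rewrite big1// => i _.
  by rewrite indicE mem_set//; exact: h.
rewrite notin_setE cell_pre /= => /existsNP[i /negP xi].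
rewrite (bigD1 i)//= indicE memNset ?mul0r//.
by move=> h; move/negP: xi; apply; exact: h.
Qed.

Lemma cell_close (x : d.-tuple R) i :
  0 <= (row x) 0 i - (b + s *: toR (cell b s x)) 0 i < s.
Proof.
rewrite !mxE; have := floor_itv ((tnth x i - b 0 i) / s).
rewrite ler_pdivlMr// ltr_pdivrMr// rmorphD/= => /andP[h1 h2].
by apply/andP; split; lra.
Qed.

End cell.

Lemma L1_prod_rho : L1 lt (fun x => \prod_i rho ((row x) 0 i)).
Proof.
have [L _] := lt_prod (fun (_ : 'I_d) => @rho_ge0 R) (fun=> L1_rho).
rewrite (_ : (fun x => _) = (fun x => \prod_(i < d) rho (tnth x i)))//.
by apply/funext => x; apply: eq_bigr => i _; rewrite mxE.
Qed.

Lemma cvg_row (y : nat -> E) (x : E) (s : nat -> R) :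
  (forall n i, `|x 0 i - y n 0 i| <= s n) -> s @ \oo --> 0 -> y @ \oo --> x.
Proof.
move=> h s0; apply/cvg_ballP => e e0.
have /cvgrPdist_lt/(_ e e0) := s0; apply: filterS => n; rewrite sub0r normrN => sn.
split=> // i j; rewrite (ord1 i) /ball/=; apply: le_lt_trans (h n j) _.
exact: le_lt_trans (ler_norm _) sn.
Qed.

Variable f : E -> R.
Hypothesis cf : continuous f.

Lemma cell_cvg (b : E) (s : nat -> R) (x : d.-tuple R) : (forall n, 0 < s n) ->
  s @ \oo --> 0 ->
  f (b + s n *: toR (cell b (s n) x)) @[n --> \oo] --> f (row x).
Proof.
move=> s0 cs; apply: (@cvg_comp _ _ _ (fun n => b + s n *: toR (cell b (s n) x)) f).
  2: exact: cf.
apply: (cvg_row (s := s)) => // n i.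
have /andP[h1 h2] := cell_close b (s0 n) x i; rewrite ger0_norm//; exact: ltW.
Qed.

(** A continuous function is the pointwise limit of its values at the corners of finer and finer
    grid cells, and these step functions are measurable for the product sigma-algebra on tuples. *)
Lemma measurable_row : measurable_fun setT (fun x => f (row x)).
Proof.
apply: (@measurable_fun_cvg _ _ _ setT
  (fun n x => f (0 + n.+1%:R^-1 *: toR (cell 0 (n.+1%:R^-1) x)))).
  move=> n; apply: (@measurableT_comp _ _ _ _ _ _
    (fun k : V => f (0 + n.+1%:R^-1 *: toR k))); first exact: measurable_lat.
  by apply: measurable_cell; rewrite invr_gt0.
move=> x _; apply: cell_cvg => [n|]; first by rewrite invr_gt0.
exact: cvg_harmonic.
Qed.

Variable C : R.
Hypothesis fC : forall y, `|f y| <= C * (S y)^-1 ^+ d.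

Lemma L1_row : L1 lt (fun x => f (row x)).
Proof.
apply: (@L1_dom _ _ _ _ _ (fun x => `|C| * \prod_i rho ((row x) 0 i))).
- exact: measurable_row.
- exact/L1Z/L1_prod_rho.
- move=> x; apply: (le_trans (fC _)); apply: (@le_trans _ _ (`|C| * (S (row x))^-1 ^+ d)).
    by rewrite ler_wpM2r ?exprn_ge0 ?Sinv_ge0// ler_norm.
  by rewrite ler_wpM2l// prod_S.
Qed.

(** Dominated convergence for the step functions on cells. The limit does not depend on the offset
    [b], and this is the source of translation invariance later on. *)
Lemma riemann_cvg (b : E) (s : nat -> R) : (forall n, 0 < s n <= 1) ->
  s @ \oo --> 0 ->
  (s n ^+ d * \int[cnt]_k f (b + s n *: toR k)) @[n --> \oo] -->
  \int[lt]_x f (row x).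
Proof.
move=> s01 cs; have s0 n : 0 < s n by case/andP: (s01 n).
have E0 n : s n ^+ d * \int[cnt]_k f (b + s n *: toR k) =
    \int[lt]_x f (b + s n *: toR (cell b (s n) x)).
  have [->//|/(_ _)[]] := fiber_rint (measurable_cell b (s0 n))
    (cell_measure b (s0 n)) (fun k => f (b + s n *: toR k)).
  have [L _] := lat_S b (s01 n).
  apply: (L1_dom _ (L1Z C L)) => // k; exact: fC.
under eq_fun do rewrite E0.
apply: (rint_cvg (g := fun x => `|C| * (2 * (1 + d%:R)) ^+ d * \prod_i rho ((row x) 0 i)) _ _ _ _ _).2.
- move=> n; apply: (@measurableT_comp _ _ _ _ _ _
    (fun k : V => f (b + s n *: toR k))); first exact: measurable_lat.
  exact: measurable_cell.
- exact: measurable_row.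
- by apply: aeW => x; exact: cell_cvg.
- exact/L1Z/L1_prod_rho.
move=> n x; apply: (le_trans (fC _)).
set y := b + _; set z := row x.
(* A point and its grid corner differ by less than s <= 1 in each coordinate, so [S] of the
   difference is at most 1 + d. *)
have h1 : (S y)^-1 <= 2 * (1 + d%:R) * (S z)^-1.
  rewrite -[y](subrK z) addrC; apply: le_trans (Sinv_shift z (y - z)) _.
  rewrite ler_wpM2r ?Sinv_ge0// ler_wpM2l// lerD2l.
  apply: (@le_trans _ _ (\sum_(i < d) 1)); last by rewrite sumr_const card_ord.
  apply: ler_sum => i _; have /andP[] := cell_close b (s0 n) x i.
  rewrite -/y -/z; have /andP[_ s1] := s01 n; rewrite !mxE => h1 h2.
  by rewrite -expr2 -sqrrN expr_le1//; lra.
apply: (@le_trans _ _ (`|C| * (S y)^-1 ^+ d)).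
  by rewrite ler_wpM2r ?exprn_ge0 ?Sinv_ge0// ler_norm.
rewrite -mulrA ler_wpM2l//; apply: (@le_trans _ _ ((2 * (1 + d%:R) * (S z)^-1) ^+ d)).
  by apply: lerXn2r; rewrite ?nnegrE ?Sinv_ge0// mulr_ge0 ?Sinv_ge0// mulr_ge0// addr_ge0.
by rewrite exprMn ler_wpM2l ?prod_S// exprn_ge0// mulr_ge0// addr_ge0.
Qed.

End riemann_sum.

(** * Smooth lattice sums against integrals, by differences of high order *)

Section periodic_difference.
Context {R : realType}.
Implicit Types g : nat -> R.

Definition Dn g : nat -> R := fun j => g j.+1 - g j.

(** The first differences sum to 0 over a period, so each of them is at most their oscillation.
    Induction descends from the top difference, with one factor n for each order. *)
Lemma periodic_osc (n K : nat) (B : R) g : (0 < n)%N ->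
  (forall j, g (j + n)%N = g j) ->
  (forall j, `|iter K.+1 Dn g j| <= B) ->
  forall i j, (i <= j <= n)%N -> `|g j - g i| <= n%:R ^+ K.+1 * B.
Proof.
move=> n0; elim: K g => [|K IH] g pg hB i j /andP[ij jn].
  have tel : g j - g i = \sum_(i <= k < j) Dn g k by rewrite telescope_sumr.
  rewrite tel (le_trans (ler_norm_sum _ _ _))//.
  apply: (@le_trans _ _ (\sum_(i <= k < j) B)); first by apply: ler_sum => k _; exact: hB.
  rewrite sumr_const_nat expr1 -[leLHS]mulr_natl ler_wpM2r//.
    exact: le_trans (hB 0%N).
  by rewrite ler_nat; lia.
have pD j0 : Dn g (j0 + n)%N = Dn g j0 by rewrite /Dn -addSn !pg.
have hD j0 : `|iter K.+1 Dn (Dn g) j0| <= B by rewrite -iterSr.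
have B0 : 0 <= B by exact: le_trans (hB 0%N).
pose B' := n%:R ^+ K.+1 * B.
have osc k l : (k <= n)%N -> (l <= n)%N -> `|Dn g k - Dn g l| <= B'.
  move=> kn ln; have [kl|/ltnW lk] := leqP k l.
    by rewrite distrC; apply: (IH _ pD hD); rewrite kl.
  by apply: (IH _ pD hD); rewrite lk.
have Db k : (k < n)%N -> `|Dn g k| <= B'.
  move=> kn; have n0R : 0 < n%:R :> R by rewrite ltr0n.
  have : \sum_(0 <= l < n) (Dn g k - Dn g l) = n%:R * Dn g k.
    rewrite sumrB telescope_sumr// sumr_const_nat subn0 mulr_natl.
    by rewrite -[X in g X - _]add0n pg subrr subr0.
  move=> E; rewrite -(ler_pM2l n0R) -[X in X * `|_|](ger0_norm (ltW n0R)) -normrM -E.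
  apply: (le_trans (ler_norm_sum _ _ _)); rewrite !big_mkord.
  apply: (@le_trans _ _ (\sum_(l < n) B')); last by rewrite sumr_const card_ord mulr_natl.
  by apply: ler_sum => l _; apply: osc; exact: ltnW.
have tel : g j - g i = \sum_(i <= k < j) Dn g k by rewrite telescope_sumr.
rewrite tel (le_trans (ler_norm_sum _ _ _))//.
apply: (@le_trans _ _ (\sum_(i <= k < j) B')).
  by rewrite !big_nat; apply: ler_sum => k /andP[_ kj]; apply: Db; lia.
rewrite sumr_const_nat exprS -mulrA -[leLHS]mulr_natl ler_wpM2r//.
  by rewrite mulr_ge0// exprn_ge0.
by rewrite ler_nat; lia.
Qed.

Context d (T : measurableType d) (mu : {measure set T -> \bar R}).

Lemma rint_iter_Dn (psi : nat -> T -> R) K j : (forall j, L1 mu (psi j)) ->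
  L1 mu (fun x => iter K Dn (psi^~ x) j) /\
  iter K Dn (fun j => \int[mu]_x psi j x) j = \int[mu]_x iter K Dn (psi^~ x) j.
Proof.
move=> L; elim: K j => [|K IH] j; first by split=> //; exact: L.
have [La Ea] := IH j.+1; have [Lb Eb] := IH j.
by split; [exact: L1B|rewrite iterS /Dn Ea Eb -rintB].
Qed.

End periodic_difference.

Section sum_vs_integral.
Context {R : realType} {d : nat}.
Local Notation E := 'rV[R]_d.
Local Notation V := 'rV[int]_d.
Local Notation lt := (@lebesgue_tuple R d).
Local Notation cnt := (@counting V R).
Local Notation row := (@row_of_tuple R d).

Definition resv n (f : {ffun 'I_d -> 'I_n}) : V := \row_i (f i)%:Z.

Lemma lat_residue (n : nat) (H : V -> R) : (0 < n)%N -> L1 cnt H ->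
  \int[cnt]_z H z =
  \sum_(f : {ffun 'I_d -> 'I_n}) \int[cnt]_k H (resv f + n%:Z *: k).
Proof.
case: n => // n _ LH.
pose res (z : V) : {ffun 'I_d -> 'I_n.+1} := [ffun i => inord (absz (modz (z 0 i) n.+1%:Z))].
have resP (z : V) i : (res z i)%:Z = modz (z 0 i) n.+1%:Z.
  by rewrite ffunE inordK; lia.
pose Hf (f : {ffun 'I_d -> 'I_n.+1}) (z : V) := (res z == f)%:R * H z.
have LHf f : L1 cnt (Hf f).
  apply: (L1_dom _ (L1_norm LH)); first exact: measurable_lat.
  by move=> z; rewrite /Hf; case: (_ == _); rewrite ?mul1r ?mul0r ?normr0.
transitivity (\int[cnt]_z \sum_f Hf f z).
  apply: eq_rint => z; rewrite (bigD1 (res z))//= big1 ?addr0 => [|f fz].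
    by rewrite /Hf eqxx mul1r.
  by rewrite /Hf eq_sym (negbTE fz) mul0r.
rewrite rint_sum//; apply: eq_bigr => f _.
rewrite (@lat_rint_inj _ _ (fun k => resv f + n.+1%:Z *: k)).
- apply: eq_rint => k; rewrite /Hf (_ : res _ = f) ?eqxx ?mul1r//.
  apply/ffunP => i; apply: val_inj; apply/eqP; rewrite -eqz_nat resP !mxE.
  by rewrite addrC mulrC modzMDl modz_small// ltz_nat ltn_ord.
- move=> k l /addrI /rowP kl; apply/rowP => i; have := kl i; rewrite !mxE.
  by move/mulfI; apply.
move=> z zE; rewrite /Hf; case: eqVneq => [zf|_]; last by rewrite mul0r.
case: (zE (\row_i divz (z 0 i) n.+1%:Z)); apply/rowP => i; rewrite !mxE -zf resP.
by rewrite addrC mulrC -divz_eq.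
Qed.

Variable f : E -> R.
Hypothesis cf : continuous f.
Variable C : R.
Hypothesis fC : forall y, `|f y| <= C * (S y)^-1 ^+ d.

Lemma L1_lat_f (b : E) (s : R) : 0 < s <= 1 -> L1 cnt (fun k => f (b + s *: toR k)).
Proof.
move=> s01; have [L _] := lat_S b s01; apply: (L1_dom _ (L1Z C L)) => // k; exact: fC.
Qed.

Variables (K : nat) (D : R).
Hypothesis D0 : 0 <= D.
Hypothesis fD : forall i y h, 0 <= h -> K.+1%:R * h <= 1 ->
  `|iter K.+1 (Dv i h) f y| <= D * h ^+ K.+1 * (S y)^-1 ^+ d.

Lemma iter_Dn_Dv k (i : 'I_d) (h : R) (y : E) j :
  iter k Dn (fun j => f (y + (j%:R * h) *: unitv i)) j =
  iter k (Dv i h) f (y + (j%:R * h) *: unitv i).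
Proof.
elim: k j => [//|k IH] j; rewrite iterS {1}/Dn !IH iterS.
transitivity (iter k (Dv i h) f (y + (j%:R * h) *: unitv i + h *: unitv i) -
  iter k (Dv i h) f (y + (j%:R * h) *: unitv i)); last by [].
by rewrite -natr1 mulrDl mul1r scalerDl addrA.
Qed.

(** The normalized sum on the mesh s/n is the mean of n^d translates of the sum on the mesh s. In
    each coordinate a translate is periodic with n steps of length s/n, so [periodic_osc] shows that
    it is nearly constant. This takes the place of Poisson summation. *)
Lemma lattice_refine (b : E) (s : R) (n : nat) : (0 < n)%N -> (K < n)%N -> 0 < s <= 1 ->
  `|\int[cnt]_k f (b + s *: toR k) -
    n%:R^-1 ^+ d * \int[cnt]_z f (b + (s / n%:R) *: toR z)| <=
  d%:R * (D * s ^+ K.+1 * (12 / s) ^+ d).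
Proof.
move=> n0 Kn s01; have /andP[s0 s1] := s01.
have n0R : 0 < n%:R :> R by rewrite ltr0n.
have nn0 : n%:R != 0 :> R by rewrite gt_eqF.
pose h := s / n%:R; pose B := D * s ^+ K.+1 * (12 / s) ^+ d.
have h0 : 0 < h by rewrite divr_gt0.
have n1R : 1 <= n%:R :> R by rewrite ler1n.
have h1 : h <= 1 by rewrite ler_pdivrMr// mul1r (le_trans s1).
have B0 : 0 <= B by rewrite !mulr_ge0 ?exprn_ge0// ?(ltW s0)// divr_ge0// ltW.
pose G (v : V) := \int[cnt]_k f (b + h *: toR v + s *: toR k).
have osc1 (v : V) i (j : nat) : (j <= n)%N -> `|G (v + j%:Z *: delta_mx 0 i) - G v| <= B.
  move=> jn; pose g (j : nat) := G (v + j%:Z *: delta_mx 0 i).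
  pose psi (j : nat) (k : V) := f (b + h *: toR v + s *: toR k + (j%:R * h) *: unitv i).
  have gE j0 : g j0 = \int[cnt]_k psi j0 k.
    apply: eq_rint => k; congr f; rewrite toRD scalerDr addrA -!addrA; congr (_ + (_ + _)).
    rewrite addrC; congr (_ + _); rewrite toRZ scalerA mulrC; congr (_ *: _).
    exact: map_delta_mx.
  have gN : g =1 fun j0 => \int[cnt]_k psi j0 k by [].
  have Lpsi j0 : L1 cnt (psi j0).
    rewrite (_ : psi j0 = fun k => f (b + h *: toR v + (j0%:R * h) *: unitv i + s *: toR k)).
      exact: L1_lat_f.
    by apply/funext => k; rewrite /psi addrAC.
  have pg j0 : g (j0 + n)%N = g j0.
    rewrite /g /G; rewrite -[RHS](lat_shift (delta_mx 0 i)); apply: eq_rint => k; congr f.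
    rewrite PoszD scalerDl !toRD !scalerDr -!addrA; congr (_ + (_ + (_ + _))).
    rewrite addrC; congr (_ + _); rewrite toRZ scalerA; congr (_ *: _).
    by rewrite /h mulrVK// unitfE.
  (* The power of 1/n comes from the step h = s/n and cancels the n^(K+1) lost in [periodic_osc]. *)
  have hB j0 : `|iter K.+1 Dn g j0| <= n%:R^-1 ^+ K.+1 * B.
    have -> : g = (fun j0 => \int[cnt]_k psi j0 k) by apply/funext.
    have [L ->] := rint_iter_Dn K.+1 j0 Lpsi.
    pose y k : E := b + h *: toR v + (j0%:R * h) *: unitv i + s *: toR k.
    have [LS IS] := lat_S (b + h *: toR v + (j0%:R * h) *: unitv i) s01.
    apply: (@le_trans _ _ (\int[cnt]_k (D * h ^+ K.+1 * (S (y k))^-1 ^+ d))).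
      apply: rint_norm => //; first exact: L1Z.
      move=> k; rewrite (iter_Dn_Dv K.+1 i h (b + h *: toR v + s *: toR k) j0) addrAC.
      apply: fD; first exact: ltW.
      rewrite /h mulrA ler_pdivrMr// mul1r.
      apply: (@le_trans _ _ K.+1%:R); last by rewrite ler_nat.
      by rewrite ler_piMr.
    rewrite rintZ//; apply: (@le_trans _ _ (D * h ^+ K.+1 * (12 / s) ^+ d)).
      by rewrite ler_wpM2l// mulr_ge0// exprn_ge0// ltW.
    rewrite /B /h [(_ / _) ^+ K.+1]exprMn le_eqVlt; apply/orP; left; apply/eqP; ring.
  have := periodic_osc n0 pg hB (i := 0) (j := j); rewrite leq0n jn => /(_ isT).
  rewrite mulrA -exprMn mulfV// expr1n mul1r /g.
  by rewrite (_ : v + 0%:Z *: _ = v)// scale0r addr0.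
(* The residue vector is reached from 0 by changing one coordinate at a time, hence the factor d. *)
have oscd (u : {ffun 'I_d -> 'I_n}) : `|G (resv u) - G 0| <= d%:R * B.
  pose part (s0 : seq 'I_d) : V := \sum_(i <- s0) (u i)%:Z *: delta_mx 0 i.
  have H s' : `|G (part s') - G 0| <= (size s')%:R * B.
    elim: s' => [|i s' IH]; first by rewrite /part big_nil subrr normr0 mul0r.
    rewrite /part big_cons [(u i)%:Z *: _ + _]addrC -/(part s') /= -natr1 mulrDl mul1r.
    have := osc1 (part s') i (u i) (ltnW (ltn_ord _)) => h2.
    rewrite [leRHS]addrC -(subrKA (G (part s'))).
    by apply: (le_trans (ler_normD _ _)); exact: lerD.
  have := H (enum 'I_d); rewrite size_enum_ord (_ : part _ = resv u)//.
  rewrite /part big_enum/=; apply/rowP => i; rewrite summxE (bigD1 i)//= big1 ?addr0.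
    by rewrite !mxE !eqxx mulr1.
  by move=> j ji; rewrite !mxE [i == j]eq_sym (negbTE ji) mulr0.
have G0 : G 0 = \int[cnt]_k f (b + s *: toR k).
  apply: eq_rint => k; congr f; congr (_ + _).
  by rewrite (_ : toR 0 = 0) ?scaler0 ?addr0//; apply/rowP => i; rewrite !mxE.
have GS : \int[cnt]_z f (b + h *: toR z) =
    \sum_(u : {ffun 'I_d -> 'I_n}) G (resv u).
  have h01 : 0 < h <= 1 by rewrite h0.
  rewrite (lat_residue n0 (L1_lat_f b h01)).
  apply: eq_bigr => u _; apply: eq_rint => k; congr f.
  rewrite toRD scalerDr addrA; congr (_ + _); rewrite toRZ scalerA; congr (_ *: _).
  by rewrite /h mulrVK// unitfE.
rewrite -G0 GS.
have nd (c : R) : n%:R^-1 ^+ d * \sum_(u : {ffun 'I_d -> 'I_n}) c = c.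
  rewrite sumr_const card_ffun !card_ord -[X in _ * X]mulr_natr natrX mulrCA -exprMn mulVf//.
  by rewrite expr1n mulr1.
have -> : G 0 - n%:R^-1 ^+ d * \sum_(u : {ffun 'I_d -> 'I_n}) G (resv u) =
   n%:R^-1 ^+ d * \sum_(u : {ffun 'I_d -> 'I_n}) (G 0 - G (resv u)).
  by rewrite sumrB mulrBr nd.
rewrite normrM ger0_norm ?exprn_ge0 ?invr_ge0//.
apply: (@le_trans _ _ (n%:R^-1 ^+ d * \sum_(u : {ffun 'I_d -> 'I_n}) (d%:R * B))).
  rewrite ler_wpM2l ?exprn_ge0 ?invr_ge0// (le_trans (ler_norm_sum _ _ _))//.
  by apply: ler_sum => u _; rewrite distrC.
by rewrite nd.
Qed.

(** The bound of [lattice_refine] does not depend on the refinement, and the refined sums tend to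
    the integral. *)
Lemma sum_vs_integral (b : E) (s : R) : 0 < s <= 1 ->
  `|s ^+ d * \int[cnt]_k f (b + s *: toR k) - \int[lt]_x f (row x)| <=
  d%:R * 12 ^+ d * D * s ^+ K.+1.
Proof.
move=> s01; have /andP[s0 s1] := s01.
(* The refinement starts at K + 1, as [lattice_refine] asks for more than K subdivisions. *)
pose sn (n : nat) := s / (n + K).+1%:R.
have sn01 n : 0 < sn n <= 1.
  rewrite divr_gt0//= ler_pdivrMr// mul1r (le_trans s1)//.
  by rewrite ler1n.
have csn : sn @ \oo --> 0.
  rewrite -(mulr0 s); apply: cvgM; first exact: cvg_cst.
  have := @cvg_harmonic R; rewrite -(cvg_shiftn K); apply: cvg_trans.
  by apply: near_eq_cvg; near=> n.
have := riemann_cvg cf fC b sn01 csn.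
set I := \int[lt]_x _ => cI.
have : (fun n => `|s ^+ d * \int[cnt]_k f (b + s *: toR k) -
   sn n ^+ d * \int[cnt]_k f (b + sn n *: toR k)|) @ \oo -->
   `|s ^+ d * \int[cnt]_k f (b + s *: toR k) - I|.
  by apply: cvg_norm; apply: cvgB; [exact: cvg_cst|exact: cI].
move=> cN; rewrite -(cvg_lim _ cN)//; apply: limr_le; first by apply/cvg_ex; eexists; exact: cN.
near=> n; have := @lattice_refine b s (n + K).+1 isT _ s01.
move=> /(_ ltac:(lia)) h.
have -> : s ^+ d * \int[cnt]_k f (b + s *: toR k) -
   sn n ^+ d * \int[cnt]_k f (b + sn n *: toR k) =
   s ^+ d * (\int[cnt]_k f (b + s *: toR k) - (n + K).+1%:R^-1 ^+ d *
   \int[cnt]_k f (b + sn n *: toR k)).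
  by rewrite mulrBr mulrA -exprMn.
rewrite normrM ger0_norm ?exprn_ge0 ?(ltW s0)//.
apply: (le_trans (ler_wpM2l (exprn_ge0 d (ltW s0)) h)).
rewrite le_eqVlt; apply/orP; left; apply/eqP.
rewrite exprMn exprVn; field.
by rewrite expf_neq0// gt_eqF.
Unshelve. all: by end_near. Qed.

End sum_vs_integral.

(** * Weyl differencing *)

Section exponential_spacing.
Context {R : realType}.
Implicit Types (x y al : R).

(* [sn2 x] is [4 sin(pi x)^2]. *)
Definition sn2 x : R := 2 - 2 * cos (2 * pi * x).

(** The gain of one double summation by parts at scale L, or 1 when there is none; of the order of
    1/(1 + L^2 ||x||^2), with ||x|| the distance to the nearest integer. *)
Definition bw (L x : R) : R := (Num.max 1 (L ^+ 2 * sn2 x))^-1.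

Lemma sn2_ge0 x : 0 <= sn2 x.
Proof. by rewrite /sn2; have := cos_le1 (2 * pi * x); lra. Qed.

Lemma bw_gt0 L x : 0 < bw L x.
Proof. by rewrite invr_gt0 lt_max ltr01. Qed.

Lemma bw_ge0 L x : 0 <= bw L x. Proof. exact/ltW/bw_gt0. Qed.

Lemma cosD2pin x (n : nat) : cos (x + 2 * pi * n%:R) = cos x.
Proof.
elim: n => [|n IH]; first by rewrite mulr0 addr0.
by rewrite -[RHS]IH -[RHS]cosD2pi; congr cos; rewrite -natr1; ring.
Qed.

Lemma cosD2piz x (n : int) : cos (x + 2 * pi * n%:~R) = cos x.
Proof.
case: n => n; first by rewrite -[RHS](cosD2pin x n).
rewrite NegzE -[LHS](cosD2pin _ n.+1); congr cos.
by rewrite mulrNz; ring.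
Qed.

Lemma sinD2piz x (n : int) : sin (x + 2 * pi * n%:~R) = sin x.
Proof.
rewrite -[LHS]cosBpihalf -[RHS]cosBpihalf -[RHS](cosD2piz _ n); congr cos; ring.
Qed.

Lemma sn2_int x (n : int) : sn2 (x - n%:~R) = sn2 x.
Proof.
rewrite /sn2 -[in RHS](cosD2piz _ (- n)); congr (_ - _ * cos _).
by rewrite mulrNz; ring.
Qed.

Lemma sin_ge_half (u : R) : 0 <= u <= pi / 4 -> u / 2 <= sin u.
Proof.
move=> /andP[u0 u4]; have pi0 := @pi_gt0 R.
have [|c] := MVT_segment u0 (fun u _ => is_derive_sin u).
  by apply: continuous_subspaceT => ?; exact: continuous_sin.
rewrite in_itv/= => /andP[c0 cu]; rewrite sin0 !subr0 => ->.
have hc2 : 0 <= cos (c + c) by apply: cos_ge0_pihalf; apply/andP; split; lra.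
have hc : 0 <= cos c by apply: cos_ge0_pihalf; apply/andP; split; lra.
have := cos_le1 c; move: hc2; rewrite cosD -!expr2 sin2cos2 => h1 h2.
by rewrite mulrC ler_wpM2r//; nra.
Qed.

Lemma sn2_ge (y : R) : `|y| <= 1 / 2 -> y ^+ 2 <= sn2 y.
Proof.
wlog y0 : y / 0 <= y => [H|].
  case: (lerP 0 y) => [/H//|y0 yh]; have := H (- y); rewrite normrN sqrrN => h.
  have -> : sn2 y = sn2 (- y) by rewrite /sn2 mulrN cosN.
  by apply: h => //; lra.
rewrite ger0_norm// => yh; have pi2 := @pi_ge2 R.
have E0 : sn2 y = 4 * (sin (pi * y)) ^+ 2.
  rewrite /sn2 (_ : 2 * pi * y = pi * y + pi * y); last ring.
  by rewrite cosD -!expr2 sin2cos2; ring.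
pose u := pi * y / 2.
have E1 : sin (pi * y) = 2 * sin u * cos u.
  by rewrite {1}(_ : pi * y = u + u) /u ?sinD; field.
have u0 : 0 <= u by rewrite /u; nra.
have u4 : u <= pi / 4 by rewrite /u; nra.
have su : u / 2 <= sin u by apply: sin_ge_half; rewrite u0.
have pi0 := @pi_gt0 R.
have hc2 : 0 <= cos (u + u) by apply: cos_ge0_pihalf; apply/andP; split; lra.
have hc : 0 <= cos u by apply: cos_ge0_pihalf; apply/andP; split; lra.
have cu : 1 / 2 <= cos u.
  by have := cos_le1 u; move: hc2; rewrite cosD -!expr2 sin2cos2 => h1 h2; nra.
have h1 : y / 2 <= sin (pi * y).
  rewrite E1; apply: (@le_trans _ _ (2 * (u / 2) * (1 / 2))); last first.
    by rewrite ler_pM// ?mulr_ge0 ?ler_wpM2l//; lra.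
  rewrite /u; nra.
rewrite E0; have : 0 <= y / 2 by lra.
by move=> h2; nra.
Qed.

Lemma rho_shift (x h : R) : rho x <= 2 * (1 + h ^+ 2) * rho (x + h).
Proof.
rewrite /rho ler_pdivlMr ?ltr_wpDr ?sqr_ge0// mulrC ler_pdivrMr ?ltr_wpDr ?sqr_ge0//.
by have := sqr_ge0 (x + 2 * h - x - h - x); nra.
Qed.

Lemma bw_rho (L y : R) : `|y| <= 1 / 2 -> bw L y <= 2 * rho (L * y).
Proof.
move=> yh; rewrite /bw /rho -[2]invrK -invfM lef_pV2 ?posrE; last 2 first.
- by rewrite lt_max ltr01.
- by rewrite mulr_gt0 ?invr_gt0// ltr_wpDr// sqr_ge0.
have : L ^+ 2 * y ^+ 2 <= L ^+ 2 * sn2 y by rewrite ler_wpM2l ?sqr_ge0// sn2_ge.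
by rewrite exprMn /Num.max; case: ltP => h h'; lra.
Qed.

Lemma sum_inj_le (H X : nat) (n : 'I_H -> int) (f : int -> R) : injective n ->
  (forall j, (`|n j| <= X)%N) -> (forall k, 0 <= f k) ->
  \sum_(j < H) f (n j) <= \sum_(j < X.*2.+1) f (j%:Z + - X%:Z).
Proof.
move=> injn nX f0; pose g (j : 'I_H) : 'I_(X.*2.+1) := inord (absz (n j + X%:Z)).
have gE j : (g j)%:Z + - X%:Z = n j by rewrite inordK; have := nX j; lia.
have ig : injective g by move=> i j /(congr1 (fun k => (val k)%:Z + - X%:Z)); rewrite !gE => /injn.
rewrite (eq_bigr (fun j => f ((g j)%:Z + - X%:Z))); last by move=> j _; rewrite gE.
rewrite -(big_imset (fun k : 'I__ => f (k%:Z + - X%:Z)))/=; last by move=> i j _ _; exact: ig.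
by rewrite [leRHS](bigID (fun k => k \in [set g j | j in 'I_H]%SET))/= lerDl sumr_ge0.
Qed.

(** The points of a window are [Del]-separated modulo 1, so after reduction to [-1/2, 1/2] they lie
    in distinct intervals of length [Del]. Moving each to the end of its interval costs a factor 8,
    and the 12 of [sum_rho] gives 96. *)
Lemma window_sum (L al Del : R) (H : nat) (k0 : int) : 0 < L -> 0 < Del -> L * Del <= 1 ->
  (forall (n : nat) (m : int), (0 < n < H)%N -> Del <= `|al * n%:R - m%:~R|) ->
  \sum_(j < H) bw L (al * (k0 + j%:Z)%:~R) <= 96 / (L * Del).
Proof.
move=> L0 D0 LD sp.
pose x (j : nat) := al * (k0 + j%:Z)%:~R.
pose y (j : nat) := x j - (Num.floor (x j + 1 / 2))%:~R.
have yh j : `|y j| <= 1 / 2.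
  have /andP[] := floor_itv (x j + 1 / 2); rewrite rmorphD/= => h1 h2.
  by rewrite ler_norml /y; apply/andP; split; lra.
pose n (j : 'I_H) : int := Num.floor (y j / Del).
have nb (j : 'I_H) : Del * (n j)%:~R <= y j /\ y j < Del * (n j)%:~R + Del.
  have /andP[] := floor_itv (y j / Del); rewrite ler_pdivlMr// ltr_pdivrMr// rmorphD/= -/(n j).
  by move=> h1 h2; split; lra.
have injn : injective n.
  have key (i j : 'I_H) : n i = n j -> (i < j)%N -> False.
    move=> nij ij; have [a1 a2] := nb i; have [b1 b2] := nb j.
    have := sp (j - i)%N (Num.floor (x j + 1 / 2) - Num.floor (x i + 1 / 2)).
    have -> : (0 < j - i < H)%N by have := ltn_ord j; lia.
    move=> /(_ isT); apply/negP; rewrite -ltNge.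
    have -> : al * (j - i)%:R - (Num.floor (x j + 1 / 2) - Num.floor (x i + 1 / 2))%:~R =
       y j - y i.
      rewrite /y /x natrB ?(ltnW ij)// !rmorphB !rmorphD/=; ring.
    by rewrite nij in a1 a2; rewrite ltr_norml; apply/andP; split; lra.
  move=> i j nij; case: (ltngtP (i : nat) j) => [ij|ji|/val_inj//].
    by case: (key _ _ nij ij).
  by case: (key _ _ (esym nij) ji).
pose X := \max_(j < H) absz (n j).
have nX j : (`|n j| <= X)%N by exact: (@leq_bigmax _ (fun j0 => absz (n j0)) j).
have step (j : 'I_H) : bw L (x j) <= 8 * rho (L * Del * ((n j)%:~R + 0)).
  have -> : bw L (x j) = bw L (y j) by rewrite /bw /y sn2_int.
  apply: (le_trans (bw_rho L (yh j))).
  have [a1 a2] := nb j.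
  pose h := L * Del * ((n j)%:~R + 0) - L * y j.
  have -> : L * Del * ((n j)%:~R + 0) = L * y j + h by rewrite /h; ring.
  have hh : h ^+ 2 <= 1.
    by rewrite -sqrrN expr_le1// /h; nra.
  have := rho_shift (L * y j) h; have := rho_ge0 (L * y j + h).
  by nra.
apply: (@le_trans _ _ (\sum_(j < H) 8 * rho (L * Del * ((n j)%:~R + 0)))).
  by apply: ler_sum => j _; exact: step.
rewrite -mulr_sumr; have -> : 96 / (L * Del) = 8 * (12 / (L * Del)) by field; rewrite !gt_eqF.
rewrite ler_wpM2l//.
apply: (le_trans (sum_inj_le (f := fun k => rho (L * Del * (k%:~R + 0))) injn nX _)).
  by move=> k; exact: rho_ge0.
by apply: sum_rho; rewrite LD andbT mulr_gt0.
Qed.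

(** The spacing sum is bounded through its symmetric partial sums, which is the form that
    [lat_L1_prod] takes as input. *)
Definition Tsum_le (L al B : R) := forall X : nat,
  \sum_(j < X.*2.+1) (rho ((j%:Z - X%:Z)%:~R / L) * bw L (al * (j%:Z - X%:Z)%:~R)) <= B.

Definition CT : R := 4 * 96 * 12.

Lemma CT_ge0 : 0 <= CT. Proof. by rewrite !mulr_ge0. Qed.

(** The range is cut into windows of length H <= L, on which [rho] of k/L varies by a factor of at
    most 4. The windows contribute 12 L/H by [sum_rho], and each of them 96/(L [Del]); hence
    [CT]. *)
Lemma Tsum_spacing (L al Del : R) (H : nat) : (0 < H)%N -> H%:R <= L -> 0 < Del ->
  L * Del <= 1 ->
  (forall (n : nat) (m : int), (0 < n < H)%N -> Del <= `|al * n%:R - m%:~R|) ->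
  Tsum_le L al (CT * (L / H%:R) / (L * Del)).
Proof.
move=> H0 HL D0 LD sp X; have H0R : 0 < H%:R :> R by rewrite ltr0n.
have L0 : 0 < L by exact: lt_le_trans HL.
pose F (j : nat) := rho ((j%:Z - X%:Z)%:~R / L) * bw L (al * (j%:Z - X%:Z)%:~R).
have F0 j : 0 <= F j by rewrite mulr_ge0 ?rho_ge0 ?bw_ge0.
pose P := X.*2.+1.
(* Extending the range to P H terms makes it a whole number of windows; the terms are
   nonnegative. *)
have : \sum_(j < P) F j <= \sum_(j < P * H) F j.
  have PH : (P <= P * H)%N by rewrite leq_pmulr.
  rewrite -(big_mkord xpredT F) -[leRHS](big_mkord xpredT F).
  by rewrite [leRHS](big_cat_nat (n := P))//= lerDl sumr_ge0.
move/le_trans; apply.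
have split P' : \sum_(j < P' * H) F j = \sum_(p < P') \sum_(r < H) F (p * H + r)%N.
  elim: P' => [|P' IH]; first by rewrite mul0n !big_ord0.
  rewrite big_ord_recr/= -IH mulSn addnC big_split_ord/=; congr (_ + _).
rewrite split.
have blk (p : 'I_P) : \sum_(r < H) F (p * H + r)%N <=
    4 * (96 / (L * Del)) * rho (H%:R / L * ((p%:Z + 0)%:~R + - (X%:R / H%:R))).
  set rp := rho _.
  have rb (r : 'I_H) : F (p * H + r)%N <= 4 * rp * bw L (al * ((p * H)%:Z - X%:Z + r%:Z)%:~R).
    rewrite /F; have -> : ((p * H + r)%N%:Z - X%:Z) = (p * H)%:Z - X%:Z + r%:Z by lia.
    rewrite ler_wpM2r ?bw_ge0// /rp.
    pose x : R := ((p * H)%:Z - X%:Z + r%:Z)%:~R / L; pose h := - (r%:R / L).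
    rewrite -/x; have -> : H%:R / L * ((p%:Z + 0)%:~R + - (X%:R / H%:R)) = x + h.
      rewrite /x /h addr0 !rmorphD/= rmorphN/= -!pmulrn natrM; field.
      by rewrite !gt_eqF.
    have h1 : h ^+ 2 <= 1.
      rewrite /h sqrrN expr_le1 ?divr_ge0 ?(ltW L0)// ler_pdivrMr// mul1r.
      by apply: le_trans HL; rewrite ler_nat ltnW.
    by have := rho_shift x h; have := rho_ge0 (x + h); nra.
  apply: (@le_trans _ _ (4 * rp * \sum_(r < H) bw L (al * ((p * H)%:Z - X%:Z + r%:Z)%:~R))).
    by rewrite mulr_sumr; apply: ler_sum => r _; exact: rb.
  rewrite [leRHS]mulrAC ler_wpM2l ?mulr_ge0 ?rho_ge0//.
  exact: window_sum.
apply: (le_trans (ler_sum _ (fun p _ => blk p))).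
rewrite -mulr_sumr.
have -> : CT * (L / H%:R) / (L * Del) = 4 * (96 / (L * Del)) * (12 / (H%:R / L)).
  by rewrite /CT; field; rewrite !gt_eqF.
rewrite ler_wpM2l//.
  by rewrite !mulr_ge0// invr_ge0 mulr_ge0// ltW.
by apply: sum_rho; rewrite divr_gt0//= ler_pdivrMr// mul1r.
Qed.

Lemma Tsum_mono L al B B' : Tsum_le L al B -> B <= B' -> Tsum_le L al B'.
Proof. by move=> h BB X; exact: le_trans (h X) BB. Qed.

End exponential_spacing.

(** * Rational approximation and the resulting spacings *)

Section dirichlet.
Context {R : realType}.

(** Box principle with [N] boxes, 2 L <= N <= 3 L. Dividing out the gcd makes the fraction reduced
    and only improves the approximation. *)
Lemma dirichlet (al L : R) : 1 <= L -> exists (q : nat) (a : int),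
  [/\ (0 < q)%N, q%:R <= 3 * L, coprimez a q & `|q%:R * al - a%:~R| <= 1 / (2 * L)].
Proof.
move=> L1; have L0 : 0 < L by lra.
pose N := (absz (Num.floor (2 * L))).+1.
have [NL LN] : N%:R <= 3 * L /\ 2 * L <= N%:R.
  have c0 : 0 <= Num.floor (2 * L) by rewrite floor_ge_int; lra.
  have NE : N%:R = (Num.floor (2 * L))%:~R + 1 :> R.
    by rewrite /N -natr1 -[in RHS](gez0_abs c0).
  rewrite NE; have := floor_itv (2 * L); rewrite rmorphD/= => /andP[h1 h2].
  by split; lra.
have N0 : (0 < N)%N by rewrite -(ltr_nat R); lra.
have N0R : 0 < N%:R :> R by rewrite ltr0n.
pose fr (i : nat) := i%:R * al - (Num.floor (i%:R * al))%:~R.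
have fr01 i : 0 <= fr i < 1.
  have /andP[] := floor_itv (i%:R * al); rewrite rmorphD/= => h1 h2.
  by rewrite /fr; apply/andP; split; lra.
pose box (i : 'I_N.+1) : 'I_N := inord (absz (Num.floor (N%:R * fr i))).
suff [i [j [ij bij]]] : exists i j : 'I_N.+1, (i < j)%N /\ Num.floor (N%:R * fr i) = Num.floor (N%:R * fr j).
  pose q0 := (j - i)%N; pose a0 := Num.floor (j%:R * al) - Num.floor (i%:R * al).
  have q00 : (0 < q0)%N by rewrite subn_gt0.
  have q0a : `|q0%:R * al - a0%:~R| <= 1 / N%:R.
    have -> : q0%:R * al - a0%:~R = fr j - fr i.
      by rewrite /q0 /a0 /fr natrB ?(ltnW ij)// rmorphB/=; ring.
    have /andP[a1 a2] := floor_itv (N%:R * fr i); have /andP[b1 b2] := floor_itv (N%:R * fr j).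
    rewrite bij !rmorphD/= in a1 a2; rewrite !rmorphD/= in b2.
    rewrite ler_pdivlMr// mulrC -[X in X * `|_|](ger0_norm (ltW N0R)) -normrM mulrBr.
    by rewrite ler_norml; apply/andP; split; lra.
  have g0 : (0 < gcdn (absz a0) q0)%N by rewrite gcdn_gt0 q00 orbT.
  pose g := gcdn (absz a0) q0.
  have gq : (g %| q0)%N by exact: dvdn_gcdr.
  have ga : (g%:Z %| a0)%Z by rewrite dvdzE/= dvdn_gcdl.
  exists (q0 %/ g)%N, (a0 %/ g%:Z)%Z; split.
  - by rewrite divn_gt0// dvdn_leq.
  - apply: le_trans NL; rewrite ler_nat (leq_trans (leq_div _ _))//.
    by rewrite /q0; have := ltn_ord j; lia.
  - rewrite /coprimez /gcdz/=; apply/eqP; congr Posz.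
    have hb : absz a0 = (absz (a0 %/ g%:Z)%Z * g)%N by rewrite -{1}(divzK ga) abszM.
    have hc : q0 = (q0 %/ g * g)%N by rewrite divnK.
    apply/eqP; rewrite -(eqn_pmul2r g0) mul1n muln_gcdl -/g -hb -hc; exact/eqP.
  have gR : 1 <= g%:R :> R by rewrite ler1n.
  have gR0 : g%:R != 0 :> R by rewrite gt_eqF//; lra.
  have E : q0%:R * al - a0%:~R = g%:R * ((q0 %/ g)%N%:R * al - (a0 %/ g%:Z)%Z%:~R).
    rewrite -{1}(divnK gq) -{1}(divzK ga) natrM rmorphM/= -pmulrn; ring.
  apply: (@le_trans _ _ `|q0%:R * al - a0%:~R|).
    by rewrite E normrM ger0_norm// ler_peMl.
  by apply: (le_trans q0a); rewrite !div1r lef_pV2 ?posrE ?mulr_gt0.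
have boxE (i : 'I_N.+1) : (box i)%:Z = Num.floor (N%:R * fr i).
  have /andP[f0 f1] := fr01 i.
  have b0 : 0 <= Num.floor (N%:R * fr i) by rewrite floor_ge_int mulr_ge0.
  have b1 : Num.floor (N%:R * fr i) < N%:Z.
    by rewrite floor_lt_int -[ltRHS]mulr1 -pmulrn ltr_pM2l.
  by rewrite /box inordK; lia.
have [/injectiveP inj|/injectivePn[i [j ij bij]]] := boolP (injectiveb box).
  by have := leq_card box inj; rewrite !card_ord ltnn.
have bij' : Num.floor (N%:R * fr i) = Num.floor (N%:R * fr j) by rewrite -!boxE bij.
by case: (ltngtP i j) ij => [?|?|/val_inj ->]; [exists i, j|exists j, i|rewrite eqxx].
Qed.

Section approx.
Variables (al L : R) (q : nat) (a : int).

(** As q does not divide n, n a / q is at least 1/q away from the integers. Replacing a/q by al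
    moves it by at most half of that, and 1/(2q) >= 1/(6L). *)
Lemma spacing_ndvd (n : nat) (m : int) : 1 <= L -> (0 < q)%N -> q%:R <= 3 * L -> coprimez a q ->
  `|q%:R * al - a%:~R| <= 1 / (2 * L) ->
  n%:R <= L -> ~~ (q %| n)%N ->
  1 / (6 * L) <= `|al * n%:R - m%:~R|.
Proof.
move=> L1 q0 qL aq hal; have L0 : 0 < L := lt_le_trans ltr01 L1.
have q0R : 0 < q%:R :> R by rewrite ltr0n.
move=> nL nq.
have num : 1 <= `|(n%:Z * a - m * q%:Z)%:~R : R|.
  rewrite -intr_norm -[1]/(1%:~R) ler_int -gtz0_ge1 normr_gt0.
  apply: contra nq => /eqP/subr0_eq h.
  have : (q%:Z %| n%:Z * a)%Z by rewrite h dvdz_mull.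
  by rewrite Gauss_dvdzl 1?coprimez_sym// dvdzE.
have E : q%:R * (al * n%:R - m%:~R) = n%:R * (q%:R * al - a%:~R) + (n%:Z * a - m * q%:Z)%:~R.
  by rewrite rmorphB !rmorphM/= -!pmulrn; ring.
have h1 : 1 / 2 <= q%:R * `|al * n%:R - m%:~R|.
  rewrite -[X in X * `|_|](ger0_norm (ltW q0R)) -normrM E.
  have : `|n%:R * (q%:R * al - a%:~R)| <= 1 / 2.
    rewrite normrM ger0_norm//; apply: (le_trans (ler_pM _ _ nL hal)) => //.
    by rewrite le_eqVlt; apply/orP; left; apply/eqP; field; rewrite gt_eqF.
  move=> h2; have := ler_normB (n%:R * (q%:R * al - a%:~R) + (n%:Z * a - m * q%:Z)%:~R) (n%:R * (q%:R * al - a%:~R)).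
  by rewrite addrAC subrr add0r => h3; lra.
rewrite ler_pdivrMr ?mulr_gt0//.
have := ler_wpM2r (normr_ge0 (al * n%:R - m%:~R)) qL; move: h1; set x := `|_| => h1 h2.
have : 1 / 2 <= 3 * L * x := le_trans h1 h2; rewrite ler_pdivrMr// => h3; lra.
Qed.

(** In a window of length q no difference is a multiple of q, so the spacing is 1/(6L). When q
    exceeds the integral part of L, windows of that length are used instead, and L/q >= 1/3 restores
    the shape of the bound. *)
Lemma Tsum_q : 1 <= L -> (0 < q)%N -> q%:R <= 3 * L -> coprimez a q ->
  `|q%:R * al - a%:~R| <= 1 / (2 * L) ->
  Tsum_le L al (50 * CT * (L / q%:R)).
Proof.
move=> L1 q0 qL aq hal; have L0 : 0 < L := lt_le_trans ltr01 L1.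
have q0R : 0 < q%:R :> R by rewrite ltr0n.
have D0 : 0 < 1 / (6 * L) by rewrite divr_gt0// mulr_gt0.
have LD : L * (1 / (6 * L)) = 1 / 6 by field; rewrite gt_eqF.
have fl0 : 0 <= Num.floor L by rewrite floor_ge_int ltW.
pose l := absz (Num.floor L).
have lE : l%:R = (Num.floor L)%:~R :> R by rewrite -[X in X%:~R]gez0_abs.
have [lL Ll] : l%:R <= L /\ L < l%:R + 1.
  by have /andP[] := floor_itv L; rewrite rmorphD/= -lE.
have l0 : (0 < l)%N by rewrite -(ltr_nat R); lra.
have [ql|lq] := leqP q l.
  have qL' : q%:R <= L by apply: le_trans lL; rewrite ler_nat.
  apply: (Tsum_mono (Tsum_spacing q0 qL' D0 _ _)); first by rewrite LD; lra.
    move=> n m /andP[n0 nq]; apply: spacing_ndvd => //.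
      by apply: le_trans qL'; rewrite ler_nat ltnW.
    by rewrite gtnNdvd.
  have h0 : 0 <= CT * (L / q%:R) by rewrite mulr_ge0 ?CT_ge0// divr_ge0// ltW.
  by rewrite LD -[50 * CT * _]mulrA; move: h0; set x := CT * (L / q%:R) => h0; lra.
apply: (Tsum_mono (Tsum_spacing l0 lL D0 _ _)); first by rewrite LD; lra.
  move=> n m /andP[n0 nl]; apply: spacing_ndvd => //.
    by apply: le_trans lL; rewrite ler_nat ltnW.
  by rewrite gtnNdvd// (ltn_trans nl).
have l0R : 1 <= l%:R :> R by rewrite ler1n.
have h1 : L / l%:R <= 2 by rewrite ler_pdivrMr; lra.
have h2 : 1 / 3 <= L / q%:R by rewrite ler_pdivlMr//; lra.
have := ler_wpM2l (@CT_ge0 R) h1; have := ler_wpM2l (@CT_ge0 R) h2.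
rewrite LD -[50 * CT * _]mulrA; set x := CT * (L / q%:R); set y := CT * (L / l%:R); have := @CT_ge0 R; lra.
Qed.

(** Here the windows have about L elements, and differences n = j q occur; these are separated
    because n al lies at distance j |q al - a| <= 1/2 from the integer j a. All spacings are at
    least |q al - a|/3. *)
Lemma Tsum_beta : 1 <= L -> (0 < q)%N -> q%:R <= 3 * L -> coprimez a q ->
  `|q%:R * al - a%:~R| <= 1 / (2 * L) ->
  `|q%:R * al - a%:~R| != 0 ->
  Tsum_le L al (6 * CT / (L * `|q%:R * al - a%:~R|)).
Proof.
move=> L1 q0 qL aq hal; have L0 : 0 < L := lt_le_trans ltr01 L1.
have q0R : 0 < q%:R :> R by rewrite ltr0n.
move: hal; set be : R := `|_| => hal be0; have be0' : 0 < be by rewrite lt_def be0/= normr_ge0.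
have D0 : 0 < be / 3 by rewrite divr_gt0.
have beL : be * L <= 1 / 2 by move: hal; rewrite ler_pdivlMr ?mulr_gt0//; lra.
have LD : L * (be / 3) <= 1 by nra.
have fl0 : 0 <= Num.floor L by rewrite floor_ge_int ltW.
pose l := absz (Num.floor L).
have lE : l%:R = (Num.floor L)%:~R :> R by rewrite -[X in X%:~R]gez0_abs.
have [lL Ll] : l%:R <= L /\ L < l%:R + 1.
  by have /andP[] := floor_itv L; rewrite rmorphD/= -lE.
have l0 : (0 < l)%N by rewrite -(ltr_nat R); lra.
have l0R : 1 <= l%:R :> R by rewrite ler1n.
apply: (Tsum_mono (Tsum_spacing l0 lL D0 LD _)).
  move=> n m /andP[n0 nl].
  have nL : n%:R <= L by apply: le_trans lL; rewrite ler_nat ltnW.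
  have [qn|nq] := boolP (q %| n)%N; last first.
    apply: le_trans (spacing_ndvd m L1 q0 qL aq hal nL nq); rewrite ler_pdivlMr ?mulr_gt0//; nra.
  pose j := (n %/ q)%N; have nE : n = (j * q)%N by rewrite divnK.
  have j0 : (0 < j)%N by rewrite divn_gt0// dvdn_leq.
  have j1 : 1 <= j%:R :> R by rewrite ler1n.
  have E : al * n%:R - m%:~R = j%:R * (q%:R * al - a%:~R) + (j%:Z * a - m)%:~R.
    by rewrite nE natrM rmorphB rmorphM/= -pmulrn; ring.
  have jL : j%:R <= L.
    by apply: le_trans nL; rewrite ler_nat nE leq_pmulr.
  have jb : j%:R * be <= 1 / 2 by nra.
  have jbe : `|j%:R * (q%:R * al - a%:~R)| = j%:R * be by rewrite normrM ger0_norm.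
  rewrite E; have [->|k0] := eqVneq (j%:Z * a - m) 0.
    by rewrite addr0 jbe; nra.
  have num : 1 <= `|(j%:Z * a - m)%:~R : R|.
    by rewrite -intr_norm -[1]/(1%:~R) ler_int -gtz0_ge1 normr_gt0.
  have := ler_normB (j%:R * (q%:R * al - a%:~R) + (j%:Z * a - m)%:~R) (j%:R * (q%:R * al - a%:~R)).
  rewrite addrAC subrr add0r jbe => h3; nra.
have h1 : L / l%:R <= 2 by rewrite ler_pdivrMr; lra.
have -> : 6 * CT / (L * be) = CT * 2 / (L * (be / 3)).
  by field; rewrite !gt_eqF.
apply: ler_wpM2r; last exact: (ler_wpM2l (@CT_ge0 R) h1).
by rewrite invr_ge0 mulr_ge0 ?(ltW L0) ?(ltW D0).
Qed.

End approx.
End dirichlet.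

Lemma dotv0l {R : realType} {d : nat} (x : 'rV[R]_d) : dotv 0 x = 0.
Proof. by rewrite -(scale0r 0) dotvZl mul0r. Qed.

Lemma dotvl_continuous {R : realType} {d : nat} (x : 'rV[R]_d) : continuous (dotv x).
Proof. by apply: ct_sum => i; apply: ctM; [exact: ctC|exact: coord_continuous]. Qed.

Section lattice_more.
Context (R : realType) (d : nat).
Local Notation V := 'rV[int]_d.
Local Notation cnt := (@counting V R).

(* The named copy carries the sigma-finite structure that Fubini requires. *)
Definition lat_count : set V -> \bar R := cnt.
HB.instance Definition _ := Measure.on lat_count.
HB.instance Definition _ := Measure_isSigmaFinite.Build _ _ _ lat_count
  (@sigma_finite_counting_lat R d).

Lemma measurable_lat2 d' (T : measurableType d') (f : V * V -> T) :
  measurable_fun setT f.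
Proof.
move=> _ Y _; rewrite setTI.
have -> : f @^-1` Y = \bigcup_j (if unpickle j is Some p then
    (if p \in f @^-1` Y then [set p.1] `*` [set p.2] else set0) else set0).
  apply/seteqP; split => [[k l] Yx|[k l] [j _]].
    by exists (pickle (k, l)) => //; rewrite pickleK mem_set.
  case: (unpickle j) => // -[k' l']; case: ifPn => //; rewrite inE => h [/= -> ->].
  exact: h.
apply: bigcup_measurable => j _; case: (unpickle j) => // p.
by case: ifPn => // _; apply: measurableX.
Qed.

Lemma lat_le_inj (e : V -> V) (F : V -> R) : injective e -> (forall k, 0 <= F k) ->
  L1 cnt F -> \int[cnt]_k F (e k) <= \int[cnt]_k F k.
Proof.
move=> ie F0 LF; pose G k := if `[< exists x, k = e x >] then F k else 0.
have <- : \int[cnt]_k G k = \int[cnt]_k F (e k).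
  rewrite (lat_rint_inj ie) => [|k h].
    by apply: eq_rint => k; rewrite /G asboolT//; exists k.
  by rewrite /G asboolF// => -[x kx]; exact: (h x).
have GF k : `|G k| <= F k by rewrite /G; case: ifP; rewrite ?normr0// ger0_norm.
have LG : L1 cnt G by apply: (L1_dom _ LF).
by apply: rint_le => // k; exact: le_trans (ler_norm _) (GF k).
Qed.

Lemma L1_shift (h : V) (f : V -> R) : L1 cnt f -> L1 cnt (fun k => f (k + h)).
Proof. by apply: (lat_L1_inj (e := fun k => k + h)); exact: addIr. Qed.

Lemma L1_mulcos (f xi : V -> R) : L1 cnt f -> L1 cnt (fun k => f k * cos (xi k)).
Proof.
move=> Lf; apply: (L1_dom _ (L1_norm Lf)); first exact: measurable_lat.
by move=> k; rewrite normrM ler_piMr// norm_cos.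
Qed.

Definition D2 (e : V) (W : V -> R) : V -> R := fun k => W (k + e) + W (k - e) - 2 * W k.

Lemma L1_D2 e W : L1 cnt W -> L1 cnt (D2 e W).
Proof.
by move=> LW; apply: L1B; [apply: L1D; exact: L1_shift|exact: L1Z].
Qed.

(** The difference is moved onto the cosine, where cos(xi - tau) + cos(xi + tau) = 2 cos tau cos xi.
    The symmetric second difference makes the sines cancel, so the sum reproduces itself. *)
Lemma second_diff (e : V) (W xi : V -> R) (tau : R) : L1 cnt W ->
  (forall k, xi (k + e) = xi k + tau) ->
  \int[cnt]_k (D2 e W k * cos (xi k)) =
  - (2 - 2 * cos tau) * \int[cnt]_k (W k * cos (xi k)).
Proof.
move=> LW hxi; have hxi' k : xi (k - e) = xi k - tau.
  by have := hxi (k - e); rewrite subrK => ->; rewrite addrK.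
have -> : \int[cnt]_k (D2 e W k * cos (xi k)) =
    \int[cnt]_k (W (k + e) * cos (xi k)) + \int[cnt]_k (W (k - e) * cos (xi k))
    - 2 * \int[cnt]_k (W k * cos (xi k)).
  rewrite -rintZ ?L1_mulcos// -rintD -?rintB.
  - by apply: eq_rint => k; rewrite /D2; ring.
  - by apply: L1D; apply: L1_mulcos; exact: L1_shift.
  - exact/L1Z/L1_mulcos.
  - by apply: L1_mulcos; exact: L1_shift.
  - by apply: L1_mulcos; exact: L1_shift.
have -> : \int[cnt]_k (W (k + e) * cos (xi k)) = \int[cnt]_k (W k * cos (xi k - tau)).
  rewrite -(lat_shift (- e)); apply: eq_rint => k.
  by rewrite subrK hxi'.
have -> : \int[cnt]_k (W (k - e) * cos (xi k)) = \int[cnt]_k (W k * cos (xi k + tau)).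
  by rewrite -(lat_shift e); apply: eq_rint => k; rewrite addrK hxi.
have Ls k : `|W k * sin (xi k) | <= `|W k|.
  by rewrite normrM ler_piMr// ler_norml sin_geN1 sin_le1.
have L1c : L1 cnt (fun k => W k * cos (xi k)) by exact: L1_mulcos.
rewrite -rintD; [|exact: L1_mulcos|exact: L1_mulcos].
have -> : \int[cnt]_k (W k * cos (xi k - tau) + W k * cos (xi k + tau)) =
   \int[cnt]_k (2 * cos tau * (W k * cos (xi k))).
  by apply: eq_rint => k; rewrite cosB cosD; ring.
by rewrite rintZ//; ring.
Qed.

Lemma iter_second_diff (e : V) (W xi : V -> R) (tau : R) r : L1 cnt W ->
  (forall k, xi (k + e) = xi k + tau) ->
  L1 cnt (iter r (D2 e) W) /\
  \int[cnt]_k (iter r (D2 e) W k * cos (xi k)) =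
  (- (2 - 2 * cos tau)) ^+ r * \int[cnt]_k (W k * cos (xi k)).
Proof.
move=> LW hxi; elim: r => [|r [LI IH]]; first by rewrite expr0 mul1r.
rewrite iterS; split; first exact: L1_D2.
by rewrite (second_diff LI hxi) IH exprS mulrA.
Qed.

End lattice_more.

Section weyl.
Context {R : realType} {d : nat}.
Variable A : 'M[int]_d.
Hypothesis symA : A^T = A.
Hypothesis detA : \det A != 0.
Hypothesis d0 : (0 < d)%N.
Local Notation E := 'rV[R]_d.
Local Notation V := 'rV[int]_d.
Local Notation cnt := (@counting V R).
Implicit Types (y z eta : E) (i : 'I_d).

(** The adjugate brings A k back to det A times k. Sums over A h may then be extended to the whole
    lattice, where the majorant factors. *)
Lemma actZ_inj : injective (actZ A).
Proof.
move=> k l; rewrite /actZ => kl.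
have h (v : V) : v *m A^T *m \adj A^T = \det A *: v.
  by rewrite -mulmxA mul_mx_adj det_tr mul_mx_scalar.
have := congr1 (mulmx^~ (\adj A^T)) kl; rewrite !h => /rowP e.
by apply/rowP => i; have := e i; rewrite !mxE => /(mulfI detA).
Qed.

Lemma enorm_sqr y : enorm y ^+ 2 = dotv y y.
Proof. by rewrite sqr_sqrtr// dotv_ge0. Qed.

Lemma coord_le_enorm y i : `|y 0 i| <= enorm y.
Proof.
rewrite -(@ler_pXn2r _ 2) ?nnegrE ?sqrtr_ge0// enorm_sqr real_normK ?num_real//.
exact: coord_sqr_le.
Qed.

Lemma mxact_enorm z i : `|mxact A z 0 i| <= CA A * enorm z.
Proof.
rewrite mxactE (le_trans (ler_norm_sum _ _ _))//.
apply: (@le_trans _ _ (\sum_j `|(A i j)%:~R| * enorm z)).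
  by apply: ler_sum => j _; rewrite normrM ler_wpM2l// coord_le_enorm.
rewrite -mulr_suml ler_wpM2r ?sqrtr_ge0// /CA [leRHS](bigD1 i)//= lerDl.
by apply: sumr_ge0 => k _; apply: sumr_ge0.
Qed.

Definition cS : R := 1 + d%:R * CA A ^+ 2.

Lemma cS_ge1 : 1 <= cS.
Proof. by rewrite lerDl mulr_ge0// sqr_ge0. Qed.

Lemma S_mxact y : S (mxact A y) <= cS * S y.
Proof.
have h : dotv (mxact A y) (mxact A y) <= d%:R * CA A ^+ 2 * dotv y y.
  rewrite -mulrA mulr_natl -[X in _ *+ X]card_ord -sumr_const; apply: ler_sum => i _.
  rewrite -expr2 -real_normK ?num_real// -enorm_sqr -exprMn.
  by apply: lerXn2r; rewrite ?nnegrE ?mulr_ge0 ?sqrtr_ge0 ?CA_ge0// mxact_enorm.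
have : 0 <= d%:R * CA A ^+ 2 :> R by rewrite mulr_ge0// sqr_ge0.
by have := dotv_ge0 y; rewrite /S /cS; nra.
Qed.

Lemma Sinv_mxact y : (S y)^-1 <= cS * (S (mxact A y))^-1.
Proof.
rewrite ler_pdivlMr ?S_gt0// mulrC ler_pdivrMr ?S_gt0//; exact: S_mxact.
Qed.

Lemma peetre_pow y eta : (S y)^-1 ^+ (2 * d) * (S (y + eta))^-1 ^+ (2 * d) <=
  2 ^+ d * (S eta)^-1 ^+ d * (S y)^-1 ^+ d.
Proof.
have p1 : (S y)^-1 * (S (y + eta))^-1 <= 2 * (S eta)^-1.
  rewrite -invfM -[2]invrK -invfM lef_pV2 ?posrE ?mulr_gt0 ?invr_gt0 ?S_gt0//.
  rewrite ler_pdivrMl// mulrCA; have := S_peetre y eta.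
  by move/le_trans; apply; rewrite le_eqVlt; apply/orP; left; apply/eqP; ring.
have E1 : (S y)^-1 ^+ (2 * d) * (S (y + eta))^-1 ^+ (2 * d) =
   ((S y)^-1 * (S (y + eta))^-1) ^+ d * (S (y + eta))^-1 ^+ d * (S y)^-1 ^+ d.
  by rewrite mul2n -addnn !exprD exprMn; ring.
rewrite E1 ler_wpM2r ?exprn_ge0 ?Sinv_ge0//.
apply: (@le_trans _ _ (((S y)^-1 * (S (y + eta))^-1) ^+ d)).
  by rewrite ler_piMr ?exprn_ge0 ?mulr_ge0 ?Sinv_ge0// exprn_ile1 ?Sinv_ge0 ?Sinv_le1.
rewrite -exprMn; apply: lerXn2r; rewrite ?nnegrE ?mulr_ge0 ?Sinv_ge0//.
Qed.

Lemma iter_D2_Dv (f : E -> R) i (s : R) r (k : V) :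
  iter r (D2 (delta_mx 0 i)) (fun k => f (s *: toR k)) k =
  iter (2 * r) (Dv i s) f (s *: toR k + (- (r%:R * s)) *: unitv i).
Proof.
have tE : toR (delta_mx 0 i : V) = unitv i :> E by exact: map_delta_mx.
elim: r k => [|r IH] k; first by rewrite mul0r oppr0 scale0r addr0.
rewrite iterS /D2 !IH mulnS !iterS -/(2 * r)%N; set g := iter (2 * r) _ f.
rewrite /Dv toRD toRD tE (_ : toR (- delta_mx 0 i : V) = - unitv i :> E); last first.
  by rewrite -tE /toR map_mxN.
rewrite !scalerDr scalerN -natr1.
have -> : s *: toR k + s *: unitv i + (- (r%:R * s)) *: unitv i =
   s *: toR k + (- ((r%:R + 1) * s)) *: unitv i + s *: unitv i + s *: unitv i.
  by rewrite -!addrA -!scalerDl; congr (_ + _ *: _); ring.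
have -> : s *: toR k - s *: unitv i + (- (r%:R * s)) *: unitv i =
   s *: toR k + (- ((r%:R + 1) * s)) *: unitv i.
  by rewrite -!addrA -scaleNr -!scalerDl; congr (_ + _ *: _); ring.
have -> : s *: toR k + (- (r%:R * s)) *: unitv i =
   s *: toR k + (- ((r%:R + 1) * s)) *: unitv i + s *: unitv i.
  by rewrite -!addrA -!scalerDl; congr (_ + _ *: _); ring.
by rewrite -?natr1; ring.
Qed.

(** Two factors from [wt_line] on a segment of half-length d, one for each copy of the weight;
    2^(2d) from the rate 1 + 1 of their product; 2^d from [peetre_pow]. *)
Definition cW : R := (2 * (1 + d%:R ^+ 2)) ^+ (2 * d) * (2 * (1 + d%:R ^+ 2)) ^+ (2 * d) * 2 ^+ (2 * d) * 2 ^+ d.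

Lemma cW_ge1 : 1 <= cW.
Proof.
have h : 1 <= 2 * (1 + d%:R ^+ 2) :> R by have := sqr_ge0 (d%:R : R); lra.
by rewrite /cW; do ?[exact: h|apply: mulr_ege1|apply: exprn_ege1]; rewrite ?ler1n.
Qed.

Section correlation.
Variables (N : R) (w : E -> R) (L : R).
Hypothesis N0 : 0 <= N.
Hypothesis hw : wt (2 * d) (2 * d) N w.
Hypothesis L1' : 1 <= L.

Let L0 : 0 < L. Proof. exact: lt_le_trans L1'. Qed.
Let s01 : 0 < L^-1 <= 1. Proof. by rewrite invr_gt0 L0 invf_le1. Qed.

Lemma corr_bound (h : V) y : `|w y * w (y + L^-1 *: toR h)| <=
  cW * N ^+ 2 * (S (L^-1 *: toR h))^-1 ^+ d * (S y)^-1 ^+ d.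
Proof.
have b1 := wt_bound y hw d0; have b2 := wt_bound (y + L^-1 *: toR h) hw d0.
rewrite normrM; apply: (le_trans (ler_pM _ _ b1 b2)) => //.
rewrite mulrACA -expr2; have pp := peetre_pow y (L^-1 *: toR h).
apply: (le_trans (ler_wpM2l (sqr_ge0 N) pp)).
have -> : cW * N ^+ 2 * (S (L^-1 *: toR h))^-1 ^+ d * (S y)^-1 ^+ d =
  cW / 2 ^+ d * (N ^+ 2 * (2 ^+ d * (S (L^-1 *: toR h))^-1 ^+ d * (S y)^-1 ^+ d)).
  by field; rewrite expf_neq0.
have X0 : 0 <= N ^+ 2 * (2 ^+ d * (S (L^-1 *: toR h))^-1 ^+ d * (S y)^-1 ^+ d).
  by rewrite mulr_ge0 ?sqr_ge0// !mulr_ge0 ?exprn_ge0 ?Sinv_ge0.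
apply: (ler_peMl X0); rewrite /cW mulfK ?expf_neq0//.
have hh : 1 <= 2 * (1 + d%:R ^+ 2) :> R by have := sqr_ge0 (d%:R : R); lra.
by do ?[exact: hh|apply: mulr_ege1|apply: exprn_ege1]; rewrite ?ler1n.
Qed.

Lemma corr_diff (h k : V) i :
  `|iter d (D2 (delta_mx 0 i)) (fun k => w (L^-1 *: toR k) * w (L^-1 *: toR k + L^-1 *: toR h)) k| <=
  cW * N ^+ 2 * L^-1 ^+ (2 * d) * (S (L^-1 *: toR h))^-1 ^+ d * (S (L^-1 *: toR k))^-1 ^+ d.
Proof.
set eta := L^-1 *: toR h; set y := L^-1 *: toR k.
have Li0 : 0 <= L^-1 by rewrite invr_ge0 ltW.
have Li1 : L^-1 <= 1 by case/andP: s01.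
rewrite (iter_D2_Dv (fun y => w y * w (y + eta)) i L^-1 d k) -/y iter_Dv.
have dd0 : 0 <= d%:R :> R by [].
have h1 := wt_line i y dd0 N0 hw; have h2 := wt_line i (y + eta) dd0 N0 hw.
set B1 := N * _ * _ in h1; set B2 := N * _ * _ in h2.
have cc : 0 <= 2 * (1 + d%:R ^+ 2) :> R by rewrite mulr_ge0// addr_ge0// sqr_ge0.
have B10 : 0 <= B1 by rewrite !mulr_ge0 ?exprn_ge0 ?Sinv_ge0.
have B20 : 0 <= B2 by rewrite !mulr_ge0 ?exprn_ge0 ?Sinv_ge0.
have h3 : dbd (2 * d) `[- d%:R, d%:R] (B1 * B2) (1 + 1)
    (fun u => w (y + u *: unitv i) * w (y + u *: unitv i + eta)).
  apply: dbdM => //; rewrite (_ : (fun u => w _) = (fun u => w (y + eta + u *: unitv i)))//.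
  by apply/funext => u; rewrite addrAC.
have := dbd_iter_Dh (u := - (d%:R * L^-1)) Li0 h3 _ _.
have dL : d%:R * L^-1 <= d%:R by rewrite ler_piMr.
move=> /(_ ltac:(by rewrite lerN2)) /(_ ltac:(by rewrite natrM; lra)).
move/le_trans; apply.
have -> : B1 * B2 * ((1 + 1) * L^-1) ^+ (2 * d) =
  ((2 * (1 + d%:R ^+ 2)) ^+ (2 * d) * (2 * (1 + d%:R ^+ 2)) ^+ (2 * d) * 2 ^+ (2 * d)) *
  (N ^+ 2 * L^-1 ^+ (2 * d)) * ((S y)^-1 ^+ (2 * d) * (S (y + eta))^-1 ^+ (2 * d)).
  rewrite /B1 /B2 (_ : 1 + 1 = 2 :> R)// [(2 / L) ^+ _]exprMn.
  by move: (_ ^+ (2 * d)) (2 ^+ (2 * d)) (L^-1 ^+ (2 * d)) ((S y)^-1 ^+ (2 * d)) => a b c e; ring.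
have -> : cW * N ^+ 2 * L^-1 ^+ (2 * d) * (S eta)^-1 ^+ d * (S y)^-1 ^+ d =
  ((2 * (1 + d%:R ^+ 2)) ^+ (2 * d) * (2 * (1 + d%:R ^+ 2)) ^+ (2 * d) * 2 ^+ (2 * d)) *
  (N ^+ 2 * L^-1 ^+ (2 * d)) * (2 ^+ d * (S eta)^-1 ^+ d * (S y)^-1 ^+ d).
  by rewrite /cW; ring.
rewrite ler_wpM2l ?peetre_pow//.
by rewrite !mulr_ge0 ?exprn_ge0.
Qed.

(** For fixed h the phase is linear in k with slopes al (A h)_i. Besides the trivial bound there is,
    for each i, the bound after d double summations by parts. [S_mxact] turns the decay in h into
    decay in A h. *)
Lemma corr_integral (h : V) (al phi0 : R) :
  `|\int[cnt]_k (w (L^-1 *: toR k) * w (L^-1 *: toR k + L^-1 *: toR h) *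
      cos (2 * pi * al * dotv (mxact A (toR h)) (toR k) + phi0))| <=
  12 ^+ d * cW * cS ^+ d * N ^+ 2 * L ^+ d *
   \prod_i (rho ((actZ A h 0 i)%:~R / L) * bw L (al * (actZ A h 0 i)%:~R)).
Proof.
set I := \int[cnt]_k _; set eta := L^-1 *: toR h.
pose W (k : V) := w (L^-1 *: toR k) * w (L^-1 *: toR k + eta).
pose xi (k : V) : R := 2 * pi * al * dotv (mxact A (toR h)) (toR k) + phi0.
have [LS IS] := lat_S (0 : E) s01; rewrite invrK in IS.
have LS' : L1 cnt (fun k : V => (S (L^-1 *: toR k))^-1 ^+ d).
  by move: LS; under eq_fun do rewrite add0r.
have IS' : \int[cnt]_k (S (L^-1 *: toR k))^-1 ^+ d <= (12 * L) ^+ d.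
  by move: IS; under eq_Rintegral do rewrite add0r.
have LW : L1 cnt W.
  apply: (L1_dom _ (L1Z (cW * N ^+ 2 * (S eta)^-1 ^+ d) LS')) => // k.
  exact: corr_bound.
pose X := 12 ^+ d * cW * N ^+ 2 * L ^+ d * (S eta)^-1 ^+ d.
have cW0 : 0 <= cW by exact: le_trans cW_ge1.
have X0 : 0 <= X.
  by rewrite !mulr_ge0 ?exprn_ge0 ?Sinv_ge0 ?sqr_ge0// ltW.
have IX : `|I| <= X.
  apply: (@le_trans _ _ (\int[cnt]_k (cW * N ^+ 2 * (S eta)^-1 ^+ d * (S (L^-1 *: toR k))^-1 ^+ d))).
    apply: rint_norm => //; first exact: L1Z.
    move=> k; rewrite normrM; apply: le_trans (corr_bound h (L^-1 *: toR k)).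
    by rewrite ler_piMr// norm_cos.
  rewrite rintZ//; apply: (le_trans (ler_wpM2l _ IS')).
    by rewrite !mulr_ge0 ?exprn_ge0 ?Sinv_ge0 ?sqr_ge0.
  by rewrite /X exprMn le_eqVlt; apply/orP; left; apply/eqP; ring.
have tE i : toR (delta_mx 0 i : V) = unitv i :> E by exact: map_delta_mx.
have mE i : mxact A (toR h) 0 i = (actZ A h 0 i)%:~R :> R.
  by rewrite mxact_toR mxE.
have IXi i : `|I| <= X * bw L (al * (actZ A h 0 i)%:~R) ^+ d.
  pose tau : R := 2 * pi * (al * (actZ A h 0 i)%:~R).
  have hxi k : xi (k + delta_mx 0 i) = xi k + tau.
    by rewrite /xi toRD dotvDr tE dotv_unit mE /tau; ring.
  have [LD ED] := iter_second_diff d LW hxi.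
  have sE : 2 - 2 * cos tau = sn2 (al * (actZ A h 0 i)%:~R) by [].
  have key : sn2 (al * (actZ A h 0 i)%:~R) ^+ d * `|I| <= L^-1 ^+ (2 * d) * X.
    rewrite -[X in X * _ <= _]ger0_norm ?exprn_ge0 ?sn2_ge0// -normrM.
    rewrite -(normrMsign d) mulrA -exprMn mulN1r -sE -ED.
    apply: (@le_trans _ _ (\int[cnt]_k (cW * N ^+ 2 * L^-1 ^+ (2 * d) * (S eta)^-1 ^+ d * (S (L^-1 *: toR k))^-1 ^+ d))).
      apply: rint_norm => //; first exact: L1Z.
      move=> k; rewrite normrM; apply: le_trans (corr_diff h k i).
      by rewrite ler_piMr// norm_cos.
    rewrite rintZ//; apply: (le_trans (ler_wpM2l _ IS')).
      by rewrite !mulr_ge0 ?exprn_ge0 ?Sinv_ge0 ?sqr_ge0// invr_ge0 ltW.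
    by rewrite /X exprMn le_eqVlt; apply/orP; left; apply/eqP; ring.
  rewrite /bw exprVn ler_pdivlMr ?exprn_gt0 ?lt_max ?ltr01// mulrC.
  rewrite /Num.max; case: ifP => _; last by rewrite expr1n mul1r.
  rewrite exprMn -exprM -mulrA; apply: (le_trans (ler_wpM2l (exprn_ge0 (2 * d) (ltW L0)) key)).
  by rewrite mulrA -exprMn mulfV ?gt_eqF// expr1n mul1r.
have IP : `|I| <= X * \prod_i bw L (al * (actZ A h 0 i)%:~R).
  (* Only one coordinate can be exploited at a time; the d-th power of the smallest factor is below
     the product of all of them. *)
  pose i0 := [arg min_(i < Ordinal d0) bw L (al * (actZ A h 0 i)%:~R)]%O.
  apply: (le_trans (IXi i0)); rewrite ler_wpM2l//.
  rewrite -[X in _ ^+ X]card_ord -prodr_const; apply: ler_prod => i _.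
  rewrite bw_ge0/= /i0; case: arg_minP => // j _; exact.
apply: (le_trans IP).
rewrite big_split/= [X in _ <= X]mulrA.
rewrite ler_wpM2r//; first by apply: prodr_ge0 => i _; exact: bw_ge0.
have etaE : mxact A eta = \row_i ((actZ A h 0 i)%:~R / L).
  apply/rowP => i; by rewrite /eta mxactZ mxE mE [RHS]mxE mulrC.
have hS : (S eta)^-1 ^+ d <= cS ^+ d * \prod_i rho ((actZ A h 0 i)%:~R / L).
  apply: (@le_trans _ _ (cS ^+ d * (S (mxact A eta))^-1 ^+ d)).
    rewrite -exprMn; apply: lerXn2r; rewrite ?nnegrE ?Sinv_ge0 ?Sinv_mxact//.
    by rewrite mulr_ge0 ?Sinv_ge0// (le_trans _ cS_ge1).
  rewrite ler_wpM2l ?exprn_ge0 ?(le_trans _ cS_ge1)//; apply: (le_trans (prod_S _)).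
  by rewrite etaE le_eqVlt; apply/orP; left; apply/eqP; apply: eq_bigr => i _; rewrite mxE.
have -> : 12 ^+ d * cW * cS ^+ d * N ^+ 2 * L ^+ d * \prod_i rho ((actZ A h 0 i)%:~R / L) =
   12 ^+ d * cW * N ^+ 2 * L ^+ d * (cS ^+ d * \prod_i rho ((actZ A h 0 i)%:~R / L)) by ring.
by rewrite ler_wpM2l// !mulr_ge0 ?exprn_ge0 ?sqr_ge0// ltW.
Qed.

End correlation.

Definition theta_lin (w : E -> R) (L al t : R) (xi : E) (th : R) : R :=
  \int[cnt]_k (w (L^-1 *: toR k) *
    cos (2 * pi * al * (qform A (toR k) - t) + dotv xi (toR k) + th)).

Definition theta (w : E -> R) (L al t th : R) : R :=
  \int[cnt]_k (w (L^-1 *: toR k) * cos (2 * pi * al * (qform A (toR k) - t) + th)).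

Lemma wt_lat_L1 K M (N : R) (w : E -> R) (L : R) (b : E) : 0 <= N -> wt K M N w -> (d <= M)%N -> 1 <= L ->
  L1 cnt (fun k => w (b + L^-1 *: toR k)).
Proof.
move=> N0 hw dM L1'; have s01 : 0 < L^-1 <= 1.
  by rewrite invr_gt0 (lt_le_trans ltr01 L1') invf_le1 ?(lt_le_trans ltr01 L1').
have [LS _] := lat_S b s01.
apply: (L1_dom _ (L1Z N LS)) => // k; apply: (le_trans (wt_bound _ hw d0)).
by rewrite ler_wpM2l// SinvX_le.
Qed.

Definition cweyl : R := 12 ^+ d * cW * cS ^+ d.

(** Weyl differencing. A linear phase xi . k contributes only xi . h to the difference, a constant
    in k, so the bound is uniform in [xi]; this uniformity is what later allows the weight [chi]. *)
Lemma weyl_lin (N : R) (w : E -> R) (L al t : R) (xi : E) (th B : R) :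
  0 <= N -> wt (2 * d) (2 * d) N w -> 1 <= L ->
  Tsum_le L al B -> theta_lin w L al t xi th ^+ 2 <= cweyl * N ^+ 2 * L ^+ d * B ^+ d.
Proof.
move=> N0 hw L1' hB; have s01 : 0 < L^-1 <= 1.
  by rewrite invr_gt0 (lt_le_trans ltr01 L1') invf_le1 ?(lt_le_trans ltr01 L1').
have L0 : 0 < L := lt_le_trans ltr01 L1'.
pose a (k : V) := w (L^-1 *: toR k).
pose psi (k : V) : R := 2 * pi * al * (qform A (toR k) - t) + dotv xi (toR k) + th.
have La : L1 cnt a.
  have dd : (d <= 2 * d)%N by rewrite leq_pmull.
  have := wt_lat_L1 0 N0 hw dd L1'; by under eq_fun do rewrite add0r.
have Lc : L1 cnt (fun k => a k * cos (psi k)) by exact: L1_mulcos.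
have Ls : L1 cnt (fun k => a k * sin (psi k)).
  by under eq_fun do rewrite -cosBpihalf; exact: L1_mulcos.
set T := theta_lin _ _ _ _ _ _; pose Ts := \int[cnt]_k (a k * sin (psi k)).
have TE : T = \int[cnt]_k (a k * cos (psi k)) by [].
pose G (p : V * V) := a p.1 * a (p.2 + p.1) * cos (psi (p.2 + p.1) - psi p.1).
(* The squared modulus of the exponential sum with real part [T] and imaginary part [Ts], written as
   a sum over pairs (k, k + h). *)
have E1 : \int[cnt]_k \int[cnt]_h G (k, h) = T ^+ 2 + Ts ^+ 2.
  transitivity (\int[cnt]_k (T * (a k * cos (psi k)) + Ts * (a k * sin (psi k)))).
    apply: eq_rint => k; rewrite /G/=.
    rewrite (lat_shift k (fun l => a k * a l * cos (psi l - psi k))).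
    transitivity (\int[cnt]_l (a k * cos (psi k) * (a l * cos (psi l)) +
        a k * sin (psi k) * (a l * sin (psi l)))).
      by apply: eq_rint => l; rewrite cosB; ring.
    rewrite rintD; [|exact: L1Z|exact: L1Z].
    by rewrite !rintZ// -TE -/Ts; ring.
  rewrite rintD; [|exact: L1Z|exact: L1Z].
  by rewrite !rintZ// -TE -/Ts !expr2.
have [LS _] := lat_S (0 : E) s01.
have LS' : L1 cnt (fun k : V => (S (L^-1 *: toR k))^-1 ^+ d).
  by move: LS; under eq_fun do rewrite add0r.
have GE k h : G (k, h) = w (L^-1 *: toR k) * w (L^-1 *: toR k + L^-1 *: toR h) *
   cos (2 * pi * al * dotv (mxact A (toR h)) (toR k) +
     (2 * pi * al * qform A (toR h) + dotv xi (toR h))).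
  rewrite /G/= /a [h + k]addrC toRD scalerDr; congr (_ * cos _).
  by rewrite /psi toRD qformD// dotvDr; ring.
have Gdom k h : `|G (k, h)| <= cW * N ^+ 2 * (S (L^-1 *: toR k))^-1 ^+ d * (S (L^-1 *: toR h))^-1 ^+ d.
  rewrite GE normrM [leRHS]mulrAC; apply: le_trans (corr_bound L hw h (L^-1 *: toR k)).
  by rewrite ler_piMr// norm_cos.
have mG : measurable_fun setT G by exact: measurable_lat2.
have LGk : L1 cnt (fun k : V => cW * N ^+ 2 * (S (L^-1 *: toR k))^-1 ^+ d) by exact: L1Z.
have LG := @fub_L12 _ _ V V R (@lat_count R d) (@lat_count R d) G _ _ mG LGk LS' Gdom.
have TT : T ^+ 2 <= \int[cnt]_h \int[cnt]_k G (k, h).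
  by rewrite -(@fubini_dom _ _ V V R (@lat_count R d) (@lat_count R d) G _ _ mG LGk LS' Gdom) E1 lerDl sqr_ge0.
apply: (le_trans TT).
pose P (k : V) : R := \prod_i (rho ((k 0 i)%:~R / L) * bw L (al * (k 0 i)%:~R)).
have [LP IP] : L1 cnt P /\ \int[cnt]_k P k <= \prod_(i < d) B.
  apply: (@lat_L1_prod R d (fun _ k => rho (k%:~R / L) * bw L (al * k%:~R)) (fun=> B)).
    by move=> i k; rewrite mulr_ge0 ?rho_ge0 ?bw_ge0.
  by move=> i X; exact: hB.
have P0 k : 0 <= P k by apply: prodr_ge0 => i _; rewrite mulr_ge0 ?rho_ge0 ?bw_ge0.
rewrite prodr_const card_ord in IP.
have c0 : 0 <= cweyl * N ^+ 2 * L ^+ d.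
  rewrite !mulr_ge0 ?exprn_ge0 ?(le_trans ler01 cW_ge1) ?(le_trans ler01 cS_ge1)//; exact: ltW.
have LPA : L1 cnt (fun h => P (actZ A h)) by exact: (lat_L1_inj actZ_inj LP).
apply: (@le_trans _ _ (\int[cnt]_h (cweyl * N ^+ 2 * L ^+ d * P (actZ A h)))).
  apply: rint_le => //; first exact: L1Z.
  move=> h; apply: (le_trans (ler_norm _)).
  rewrite (eq_rint _ (fun k => GE k h)); exact: corr_integral.
rewrite rintZ// ler_wpM2l//.
exact: (le_trans (lat_le_inj actZ_inj P0 LP)).
Qed.

Lemma weyl (N : R) (w : E -> R) (L al t th B : R) : 0 <= N -> wt (2 * d) (2 * d) N w -> 1 <= L ->
  Tsum_le L al B -> theta w L al t th ^+ 2 <= cweyl * N ^+ 2 * L ^+ d * B ^+ d.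
Proof.
move=> N0 hw L1' hB; have <- : theta_lin w L al t 0 th = theta w L al t th.
  by apply: eq_rint => k; rewrite dotv0l addr0.
exact: weyl_lin hB.
Qed.

End weyl.

(** * Oscillatory integrals *)

Section lebesgue_line.
Context {R : realType}.
Local Notation leb := (@lebesgue_measure R).

Section affine.
Variables (c b : R).
Hypothesis c0 : 0 < c.

Let phi' (x : measurableTypeR R) : measurableTypeR R := c * x + b.

Let mphi : measurable_fun setT phi'.
Proof.
apply: measurable_funD => //; apply: measurable_funM => //.
Qed.

Let cn : {nonneg R} := NngNum (ltW c0).

Let nu : {measure set (measurableTypeR R) -> \bar R} :=
  mscale cn (measure_function_pushforward__canonical__measure_function_Measure leb mphi).

(** Lebesgue measure is determined by its values on half-open intervals, so it equals c times its
    image under the affine map. *)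
Let nuE X : measurable X -> leb X = nu X.
Proof.
apply: lebesgue_measure_unique => _ [[x y] _ <-] /=.
rewrite /nu /mscale /= /pushforward.
have -> : phi' @^-1` `]x, y]%classic = `](x - b) / c, (y - b) / c]%classic.
  apply/seteqP; split => u /=; rewrite !in_itv/= /phi' ltr_pdivrMr// ler_pdivlMr//.
    by rewrite ltrBlDr lerBrDr ![u * c]mulrC.
  by rewrite ltrBlDr lerBrDr ![u * c]mulrC.
rewrite !lebesgue_measure_itv/= !lte_fin ltr_pM2r ?invr_gt0// ltrD2r.
case: ifP => _; last by rewrite mule0.
by rewrite -!EFinB -EFinM -mulrBl mulrC divfK ?gt_eqF//; congr EFin; ring.
Qed.

Lemma ge0_leb_affine (f : R -> \bar R) : measurable_fun [set: measurableTypeR R] f ->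
  (forall x, 0 <= f x)%E ->
  (\int[leb]_x f x = c%:E * \int[leb]_x f (c * x + b)%R)%E.
Proof.
move=> mf f0; rewrite (@eq_measure_integral _ _ _ _ nu); last by move=> X mX _; exact: nuE.
rewrite ge0_integral_mscale//; congr (_ * _)%E.
by rewrite ge0_integral_pushforward.
Qed.

Lemma leb_affine (f : R -> R) : L1 leb f ->
  L1 leb (fun x => f (c * x + b)) /\
  \int[leb]_x f (c * x + b) = c^-1 * \int[leb]_x f x.
Proof.
move=> Lf; have mf := L1_measurable Lf.
have mfc : measurable_fun setT (fun x : R => f (c * x + b)).
  exact: (@measurableT_comp _ _ _ _ _ _ f _ phi').
have Lfc : L1 leb (fun x => f (c * x + b)).
  apply/integrableP; split; first exact/measurable_EFinP.
  have /integrableP[_] := Lf.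
  rewrite (ge0_leb_affine (f := fun x => `|(EFin \o f) x|%E))//; last first.
    by apply: measurableT_comp => //; exact/measurable_EFinP.
  have : (0 <= \int[leb]_x `|(EFin \o (fun x => f (c * x + b)%R)) x|)%E by exact: integral_ge0.
  case: (\int[_]_x _)%E => //; first by move=> r _ _; rewrite ltry.
  by move=> _; rewrite gt0_muley ?lte_fin.
split=> //; apply: (mulfI (lt0r_neq0 c0)); rewrite mulrA mulfV ?gt_eqF// mul1r.
rewrite -rintZ//; rewrite /Rintegral; congr fine.
rewrite [in RHS]integralE (ge0_leb_affine (f := (EFin \o f)^\+%E))//; last first.
  by apply: measurable_funepos; exact/measurable_EFinP.
rewrite (ge0_leb_affine (f := (EFin \o f)^\-%E))//; last first.
  by apply: measurable_funeneg; exact/measurable_EFinP.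
rewrite -muleBr//; last first.
  apply: fin_num_adde_defr; have := integrable_pos_fin_num measurableT Lfc.
  by congr (_ \is a fin_num); apply: eq_integral => x _; rewrite !funeposE.
under eq_integral do rewrite EFinM.
rewrite integralZl//; congr (_ * _)%E; rewrite integralE; congr (_ - _)%E.
  by apply: eq_integral => x _; rewrite !funeposE.
by apply: eq_integral => x _; rewrite !funenegE.
Qed.

End affine.

Lemma cos_lip (a b : R) : `|cos a - cos b| <= `|a - b|.
Proof.
wlog ab : a b / b <= a.
  move=> h; case: (leP b a) => [ba|/ltW ab]; first exact: h.
  by rewrite distrC (distrC a); exact: h.
have -> : a = b + (a - b) by rewrite addrC subrK.
rewrite [X in _ <= X](_ : _ = 1 * (a - b)); last by rewrite addrAC subrr add0r mul1r ger0_norm ?subr_ge0.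
apply: (@mvt_norm _ cos (fun x => - sin x)); first by rewrite subr_ge0.
by move=> u _; rewrite normrN ler_norml sin_geN1 sin_le1.
Qed.

End lebesgue_line.

Section osc_integral.
Context {R : realType} {d : nat}.
Variable A : 'M[int]_d.
Hypothesis symA : A^T = A.
Hypothesis detA : \det A != 0.
Hypothesis d4 : (4 <= d)%N.
Local Notation E := 'rV[R]_d.
Local Notation V := 'rV[int]_d.
Local Notation leb := (@lebesgue_measure R).
Local Notation lt := (@lebesgue_tuple R d).
Local Notation cnt := (@counting V R).
Local Notation row := (@row_of_tuple R d).

Let d0 : (0 < d)%N. Proof. exact: leq_trans d4. Qed.

Definition Ic (w : E -> R) (m th lam : R) : R :=
  \int[lt]_x phi A w lam m th (row x).

Lemma qform_bound (y : E) : `|qform A y| <= d%:R * CA A * S y.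
Proof.
rewrite /qform normrM gtr0_norm ?invr_gt0//.
apply: (@le_trans _ _ (`|dotv (mxact A y) y|)); first by rewrite ler_piMl// invf_le1 ?ler1n.
apply: (le_trans (ler_norm_sum _ _ _)).
rewrite -mulrA mulr_natl -[X in _ *+ X]card_ord -sumr_const; apply: ler_sum => i _.
rewrite normrM; apply: (@le_trans _ _ (CA A * enorm y * enorm y)).
  by apply: ler_pM => //; [exact: mxact_enorm|exact: coord_le_enorm].
by rewrite -mulrA -expr2 enorm_sqr ler_wpM2l ?CA_ge0// /S lerDr.
Qed.

Section bounds.
Variables (M : nat) (N : R) (w : E -> R).
Hypothesis N0 : 0 <= N.
Hypothesis hw : wt (2 * d) (2 * d) N w.

Lemma wt_dom y : `|w y| <= N * (S y)^-1 ^+ d.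
Proof.
apply: (le_trans (wt_bound _ hw d0)); rewrite ler_wpM2l// SinvX_le//.
by rewrite leq_pmull.
Qed.

Lemma wt_cont : continuous w. Proof. by case: hw. Qed.

Lemma phi_dom lam m th y : `|phi A w lam m th y| <= N * (S y)^-1 ^+ d.
Proof. exact: le_trans (phi_le _ _ _ _ _ _) (wt_dom y). Qed.

Lemma phi_ct lam m th : continuous (phi A w lam m th).
Proof. exact: phi_continuous wt_cont. Qed.

Lemma L1_phi lam m th : L1 lt (fun x => phi A w lam m th (row x)).
Proof. exact: (L1_row (@phi_ct lam m th) (phi_dom lam m th)). Qed.

Definition phil (m : R) (xi : E) (th lam : R) (y : E) : R :=
  w y * cos (2 * pi * lam * (qform A y - m) + dotv xi y + th).

Lemma phil_ct m xi th lam : continuous (phil m xi th lam).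
Proof.
apply: ctM; first exact: wt_cont.
apply: (@ct_comp _ _ (@cos R)); first exact: continuous_cos.
apply: ctD; last exact: ctC.
apply: ctD; last exact: dotvl_continuous.
apply: ctM; first exact: ctC.
by apply: ctB; [exact: qform_continuous|exact: ctC].
Qed.

Lemma phil_dom m xi th lam y : `|phil m xi th lam y| <= N * (S y)^-1 ^+ d.
Proof. by apply: le_trans (wt_dom y); rewrite normrM ler_piMr// norm_cos. Qed.

Definition Icl (m : R) (xi : E) (th lam : R) : R :=
  \int[lt]_x phil m xi th lam (row x).

Lemma Icl0 m th lam : Icl m 0 th lam = Ic w m th lam.
Proof. by apply: eq_rint => x; rewrite /phil /phi dotv0l addr0. Qed.

Lemma theta_phil L lam m xi th : 0 < L ->
  theta_lin A w L (lam / L ^+ 2) (L ^+ 2 * m) (L^-1 *: xi) th =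
  \int[cnt]_k phil m xi th lam (0 + L^-1 *: toR k).
Proof.
move=> L0; apply: eq_rint => k; rewrite /phil add0r; congr (_ * cos (_ + _ + _)).
  by rewrite qformZ; field; rewrite gt_eqF.
by rewrite dotvZl dotvZr.
Qed.

(** With al = lam/L^2, t = L^2 m and linear phase xi/L, the normalized theta sum is a Riemann sum of
    mesh 1/L for the oscillatory integral. *)
Lemma Icl_cvg lam m xi th :
  (n.+1%:R^-1 ^+ d * theta_lin A w n.+1%:R (lam / n.+1%:R ^+ 2) (n.+1%:R ^+ 2 * m) (n.+1%:R^-1 *: xi) th)
    @[n --> \oo] --> Icl m xi th lam.
Proof.
have := riemann_cvg (@phil_ct m xi th lam) (phil_dom m xi th lam) 0 (s := fun n => n.+1%:R^-1).
move=> /(_ _ cvg_harmonic) h.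
under eq_fun do rewrite theta_phil//.
by apply: h => n; rewrite invr_gt0 ltr0n/= invf_le1 ?ler1n.
Qed.

Definition cI : R := cweyl (d := d) A * (50 * CT) ^+ d.

Lemma cweyl_ge0 : 0 <= cweyl (d := d) A :> R.
Proof. by rewrite !mulr_ge0 ?exprn_ge0 ?(le_trans ler01 (cW_ge1 _ _)) ?(le_trans ler01 (cS_ge1 _)). Qed.

Lemma cI_ge0 : 0 <= cI.
Proof. by rewrite mulr_ge0 ?cweyl_ge0// exprn_ge0// mulr_ge0// CT_ge0. Qed.

Lemma sq_limit (u : nat -> R) (l c : R) : u @ \oo --> l -> (\forall n \near \oo, u n ^+ 2 <= c) ->
  l ^+ 2 <= c.
Proof.
move=> ul uc; have u2 : (fun n => u n ^+ 2) @ \oo --> l ^+ 2.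
  by rewrite expr2; under eq_fun do rewrite expr2; exact: cvgM.
by rewrite -(cvg_lim _ u2)//; apply: limr_le => //; apply/cvg_ex; exists (l ^+ 2).
Qed.

Lemma Ic_sqr_aux (z c b l : R) : z != 0 ->
  z^-1 ^+ d ^+ 2 * (c * z ^+ d * (b * z ^+ d * l)) = c * b * l.
Proof.
by move=> z0; rewrite exprVn; have := expf_neq0 d z0; move: (z ^+ d) => a a0; field.
Qed.

(** The Weyl bound at al = lam/L^2, approximated by 0/1. The spacing sum is at most 50 [CT] L, or 6
    [CT] L/|lam|, and L cancels against the normalization before the limit is taken. *)
Lemma Icl_sqr lam m xi th : Icl m xi th lam ^+ 2 <= cI * N ^+ 2 /\
  (lam != 0 -> Icl m xi th lam ^+ 2 <= cI * N ^+ 2 * `|lam|^-1 ^+ d).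
Proof.
(* From L >= 2 |lam| on, |lam|/L^2 <= 1/(2L), so that 0/1 is an admissible approximation. *)
pose n0 := Num.truncn (2 * `|lam|).
have nn n : (n0 <= n)%N -> 2 * `|lam| <= n.+1%:R.
  move=> h; apply: ltW; apply: lt_le_trans (truncnS_gt _) _.
  by rewrite ler_nat ltnS.
have cond n : (n0 <= n)%N -> `|1%:R * (lam / n.+1%:R ^+ 2) - 0%:~R| <= 1 / (2 * n.+1%:R).
  move=> /nn h; rewrite (_ : 1%:R * _ - 0%:~R = lam / n.+1%:R ^+ 2); last by rewrite subr0 mul1r.
  rewrite normf_div [`|_ ^+ 2|]ger0_norm ?exprn_ge0//.
  rewrite ler_pdivrMr ?exprn_gt0// mul1r expr2 invfM mulrA mulfVK ?pnatr_eq0//; lra.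
have n1 n : 1 <= n.+1%:R :> R by rewrite ler1n.
have n3 n : 1%:R <= 3 * n.+1%:R :> R by have := n1 n; lra.
split=> [|lam0].
  apply: (sq_limit (@Icl_cvg lam m xi th)); exists n0 => // n /= h.
  have hT := @Tsum_q _ _ _ 1 0 (n1 n) isT (n3 n) isT (cond n h).
  rewrite divr1 in hT.
  have := weyl_lin symA detA d0 (n.+1%:R ^+ 2 * m) (n.+1%:R^-1 *: xi) th N0 hw (n1 n) hT.
  move=> h1; rewrite exprMn; apply: (le_trans (ler_wpM2l _ h1)).
    by rewrite !exprn_ge0.
  rewrite exprMn -!exprM /cI exprVn le_eqVlt; apply/orP; left; apply/eqP.
  by rewrite [(d * 2)%N]mulnC mul2n -addnn exprD; field; rewrite expf_neq0.
apply: (sq_limit (@Icl_cvg lam m xi th)); exists n0 => // n /= h.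
have ne : `|1%:R * (lam / n.+1%:R ^+ 2) - 0%:~R| != 0 :> R.
  by rewrite mul1r subr0 normr_eq0 mulf_neq0// invr_neq0// expf_neq0.
have hT := @Tsum_beta _ _ _ 1 0 (n1 n) isT (n3 n) isT (cond n h) ne.
have := weyl_lin symA detA d0 (n.+1%:R ^+ 2 * m) (n.+1%:R^-1 *: xi) th N0 hw (n1 n) hT.
move=> h1; rewrite exprMn; apply: (le_trans (ler_wpM2l _ h1)).
  by rewrite !exprn_ge0.
have l0 : `|lam| != 0 by rewrite normr_eq0.
rewrite (_ : 1%:R * _ - 0%:~R = lam / n.+1%:R ^+ 2); last by rewrite subr0 mul1r.
rewrite normf_div [`|_ ^+ 2|]ger0_norm ?exprn_ge0//.
have -> : 6 * CT / (n.+1%:R * (`|lam| / n.+1%:R ^+ 2)) = 6 * CT * n.+1%:R * `|lam|^-1 :> R.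
  have : n.+1%:R != 0 :> R by rewrite pnatr_eq0.
  by move: (n.+1%:R : R) => z z0; field; rewrite l0 z0.
apply: (@le_trans _ _ (cweyl A * N ^+ 2 * (6 * CT) ^+ d * `|lam|^-1 ^+ d)).
  have : n.+1%:R != 0 :> R by rewrite pnatr_eq0.
  move: (n.+1%:R : R) (`|lam|^-1) (6 * CT) => z l b z0.
  by rewrite (exprMn d (b * z)) (exprMn d b) Ic_sqr_aux.
have hh : (6 * CT) ^+ d <= (50 * CT) ^+ d :> R.
  apply: lerXn2r; rewrite ?nnegrE ?mulr_ge0 ?CT_ge0//.
  by rewrite ler_wpM2r ?CT_ge0// ler_nat.
have hq := ler_wpM2l (mulr_ge0 cweyl_ge0 (sqr_ge0 N)) hh.
apply: ler_wpM2r; first by rewrite exprn_ge0 ?invr_ge0.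
by apply: (le_trans hq); rewrite /cI mulrAC.
Qed.

Lemma sq_le_sqrt (x a b : R) : 0 <= a -> 0 <= b -> x ^+ 2 <= a * b ^+ 2 -> `|x| <= Num.sqrt a * b.
Proof.
move=> a0 b0 h; rewrite -(@ler_pXn2r _ 2) ?nnegrE ?mulr_ge0 ?sqrtr_ge0//.
by rewrite real_normK ?num_real// exprMn sqr_sqrtr.
Qed.

(** The use of d >= 4: the decay |lam|^(-d/2) is at least |lam|^(-2), hence integrable. *)
Lemma inv_le_rho (u : R) : 1 <= u -> u^-1 ^+ d <= (2 * rho u) ^+ 2.
Proof.
move=> u1; have u0 : 0 < u by exact: lt_le_trans u1.
apply: (@le_trans _ _ (u^-1 ^+ 4)).
  by apply: ler_wiXn2l; rewrite ?invr_ge0 ?(ltW u0)// invf_le1.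
rewrite (exprM _ 2 2); apply: lerXn2r; rewrite ?nnegrE ?exprn_ge0 ?invr_ge0 ?(ltW u0)//.
  by rewrite mulr_ge0// rho_ge0.
rewrite /rho ler_pdivlMr; last by have := sqr_ge0 u; lra.
by rewrite exprVn mulrDr mulVf ?expf_neq0 ?gt_eqF// mulr1 -lerBrDr -[leRHS]/(1 + 1 - 1) addrK invf_le1 ?exprn_gt0// exprn_ege1.
Qed.

Lemma rho_norm (u : R) : rho `|u| = rho u.
Proof. by rewrite /rho real_normK ?num_real. Qed.

(** Written with [rho] at scale X, so that integrating over |lam| >= X costs X times X^(-d/2). *)
Lemma Icl_tail (X lam m : R) xi (th : R) : 0 < X -> X <= `|lam| ->
  `|Icl m xi th lam| <= Num.sqrt cI * N * Num.sqrt (X^-1 ^+ d) * (2 * rho (lam / X)).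
Proof.
move=> X0 Xl; have l0 : 0 < `|lam| := lt_le_trans X0 Xl.
have [_ h] := Icl_sqr lam m xi th; have {}h := h _; rewrite -normr_gt0 in h; have {}h := h l0.
have u1 : 1 <= `|lam| / X by rewrite ler_pdivlMr// mul1r.
have e : `|lam|^-1 ^+ d = X^-1 ^+ d * (`|lam| / X)^-1 ^+ d.
  by rewrite -exprMn; congr (_ ^+ _); field; rewrite !gt_eqF.
rewrite [X in _ <= X * _]mulrAC -sqrtrM ?cI_ge0// -mulrA.
apply: sq_le_sqrt; first by rewrite mulr_ge0 ?cI_ge0// exprn_ge0// invr_ge0 ltW.
  by rewrite !mulr_ge0 ?rho_ge0.
apply: (le_trans h); rewrite e [X in _ <= _ * X]exprMn.
have := inv_le_rho u1.
have <- : rho (`|lam| / X) = rho (lam / X).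
  by rewrite -(rho_norm (lam / X)) normrM [`|X^-1|]gtr0_norm ?invr_gt0.
move=> h2; have X1 : 0 <= cI * N ^+ 2 * X^-1 ^+ d.
  by apply: (mulr_ge0 (mulr_ge0 cI_ge0 (sqr_ge0 _))); rewrite exprn_ge0// invr_ge0 ltW.
have -> : cI * X^-1 ^+ d * (N ^+ 2 * (2 * rho (`|lam| / X)) ^+ 2) =
  cI * N ^+ 2 * X^-1 ^+ d * (2 * rho (`|lam| / X)) ^+ 2.
  by move: cI (X^-1 ^+ d) => a b; ring.
by rewrite mulrA ler_wpM2l.
Qed.

Lemma Ic_tail (X lam m th : R) : 0 < X -> X <= `|lam| ->
  `|Ic w m th lam| <= Num.sqrt cI * N * Num.sqrt (X^-1 ^+ d) * (2 * rho (lam / X)).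
Proof. by rewrite -Icl0; exact: Icl_tail. Qed.

Lemma Icl_rho (lam m : R) xi (th : R) : `|Icl m xi th lam| <= Num.sqrt cI * N * (2 * rho lam).
Proof.
have [l1|l1] := lerP 1 `|lam|.
  by have := Icl_tail m xi th ltr01 l1; rewrite /= invr1 expr1n sqrtr1 !mulr1.
have [h _] := Icl_sqr lam m xi th; rewrite -mulrA.
apply: sq_le_sqrt; rewrite ?cI_ge0 ?mulr_ge0 ?rho_ge0//.
apply: (le_trans h); rewrite exprMn [leRHS]mulrA; apply: ler_peMr; first by apply: mulr_ge0; [exact: cI_ge0|exact: sqr_ge0].
apply: exprn_ege1; rewrite /rho ler_pdivlMr; last by have := sqr_ge0 lam; lra.
by rewrite mul1r -real_normK ?num_real//; have := normr_ge0 lam; nra.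
Qed.

Lemma Ic_rho (lam m th : R) : `|Ic w m th lam| <= Num.sqrt cI * N * (2 * rho lam).
Proof. by rewrite -Icl0; exact: Icl_rho. Qed.

(** Lipschitz in [lam]: the cosine is, and the factor F - m is absorbed by one power of [S]. *)
Lemma Ic_continuous (m th : R) : continuous (Ic w m th).
Proof.
pose F (y : E) := N * (2 * pi * (d%:R * CA A + `|m|)) * (S y)^-1 ^+ d.
pose G (y : E) := (S y)^-1 ^+ d.
have LG : L1 lt (fun x => G (row x)).
  apply: (@L1_row _ _ G _ 1).
    by apply: ctX; apply: ctV => [x|]; [rewrite gt_eqF ?S_gt0|exact: S_continuous].
  by move=> y; rewrite mul1r ger0_norm ?exprn_ge0 ?Sinv_ge0.
pose K := 2 * pi * N * (d%:R * CA A + `|m|).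
have K0 : 0 <= K by rewrite !mulr_ge0 ?pi_ge0// addr_ge0// mulr_ge0 ?CA_ge0.
have lip lam mu : `|Ic w m th lam - Ic w m th mu| <= K * `|lam - mu| * \int[lt]_x G (row x).
  rewrite -rintB; [|exact: L1_phi|exact: L1_phi]; rewrite -rintZ//.
  apply: rint_norm.
  - by apply: L1_measurable; apply: L1B; exact: L1_phi.
  - exact: L1Z.
  - move=> x; set y := row x; rewrite /phi -mulrBr normrM.
    have hF : `|qform A y - m| <= (d%:R * CA A + `|m|) * S y.
      apply: (le_trans (ler_normB _ _)); rewrite mulrDl lerD ?qform_bound//.
      by rewrite ler_peMr// S_ge1.
    have hc := cos_lip (2 * pi * lam * (qform A y - m) + th) (2 * pi * mu * (qform A y - m) + th).
    have wS : `|w y| <= N * (S y)^-1 ^+ d.+1.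
      by apply: (le_trans (wt_bound _ hw d0)); rewrite ler_wpM2l// SinvX_le// mul2n -addnn -addn1 leq_add.
    have e : 2 * pi * lam * (qform A y - m) + th - (2 * pi * mu * (qform A y - m) + th) =
      2 * pi * (lam - mu) * (qform A y - m) by ring.
    rewrite e !normrM [`|2|]ger0_norm// [`|pi|]ger0_norm ?pi_ge0// in hc.
    have pl : 0 <= 2 * pi * `|lam - mu| by rewrite !mulr_ge0 ?pi_ge0.
    have hc2 := le_trans hc (ler_wpM2l pl hF).
    apply: (le_trans (ler_pM _ _ wS hc2)) => //.
    rewrite le_eqVlt; apply/orP; left; apply/eqP; rewrite /G /K exprS.
    by move: ((S y)^-1 ^+ d) (S_gt0 y) => g Sy; field; rewrite gt_eqF.
have I0 : 0 <= \int[lt]_x G (row x) by apply: rint_ge0 => x; rewrite exprn_ge0 ?Sinv_ge0.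
move=> lam; apply/cvgrPdist_le => e e0.
pose K' := K * \int[lt]_x G (row x) + 1.
have K'0 : 0 < K' by rewrite ltr_wpDl// mulr_ge0.
near=> mu; apply: (le_trans (lip lam mu)).
have : `|lam - mu| <= e / K' by near: mu; apply: cvgr_dist_le; rewrite ?divr_gt0.
rewrite ler_pdivlMr// => h; apply: le_trans h; rewrite mulrAC mulrC ler_wpM2l// /K' lerDl//.
Unshelve. all: by end_near.
Qed.

End bounds.
End osc_integral.

(** * Gauss sums and the singular series *)

Section gauss.
Context {R : realType} {d : nat}.
Variable A : 'M[int]_d.
Hypothesis detA : \det A != 0.
Local Notation V := 'rV[int]_d.

Definition ph (q : nat) (x : int) : R := 2 * pi * (x%:~R / q%:R).

Lemma phD (q : nat) (x y : int) : ph q (x + y) = ph q x + ph q y.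
Proof. by rewrite /ph intrD [X in _ * X]mulrDl mulrDr. Qed.

Lemma ph_mul (q : nat) (k : int) : (0 < q)%N -> ph q (q%:Z * k) = 2 * pi * k%:~R.
Proof. by move=> q0; rewrite /ph intrM [X in _ * X]mulrAC -[q%:Z%:~R]/(q%:R) mulfV ?mul1r// pnatr_eq0 -lt0n. Qed.

Lemma cos_ph_mod (q : nat) (x k : int) th : (0 < q)%N ->
  cos (ph q (x + q%:Z * k) + th) = cos (ph q x + th).
Proof. by move=> q0; rewrite phD ph_mul// addrAC cosD2piz. Qed.

Lemma sin_ph_mod (q : nat) (x k : int) th : (0 < q)%N ->
  sin (ph q (x + q%:Z * k) + th) = sin (ph q x + th).
Proof. by move=> q0; rewrite phD ph_mul// addrAC sinD2piz. Qed.

Lemma cos_ph_neq1 (q : nat) (x : int) : (0 < q)%N -> ~~ (q%:Z %| x)%Z -> cos (ph q x) != 1.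
Proof.
move=> q0 qx; apply/eqP => c1.
pose y : R := x%:~R / q%:R; pose n := Num.floor (y + 1 / 2).
have s0 : sn2 y = 0 by rewrite /sn2 -/(ph q x) c1; ring.
have := floor_itv (y + 1 / 2); rewrite -/n rmorphD/= => /andP[n1 n2].
have yn : `|y - n%:~R| <= 1 / 2 by rewrite ler_norml; apply/andP; split; lra.
have := sn2_ge yn; rewrite sn2_int s0 => h.
have /eqP : (y - n%:~R) ^+ 2 = 0 by apply/eqP; rewrite eq_le h sqr_ge0.
rewrite sqrf_eq0 subr_eq0 /y => /eqP /(congr1 ( *%R^~ q%:R)).
rewrite divfK ?pnatr_eq0 -?lt0n// -[q%:R]/(q%:Z%:~R) -rmorphM/= => /intr_inj xE.
by move: qx; rewrite xE dvdz_mull.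
Qed.

Lemma dotZDr (k x y : V) : dotZ k (x + y) = dotZ k x + dotZ k y.
Proof. by rewrite /dotZ -big_split/=; apply: eq_bigr => i _; rewrite mxE mulrDr. Qed.

Lemma dotZZr (k x : V) (c : int) : dotZ k (c *: x) = c * dotZ k x.
Proof. by rewrite /dotZ mulr_sumr; apply: eq_bigr => i _; rewrite mxE mulrCA. Qed.

Lemma dotZ_delta (k : V) i : dotZ k (delta_mx 0 i) = k 0 i.
Proof.
rewrite /dotZ (bigD1 i)//= big1 ?addr0 => [|j ji]; rewrite mxE ?eqxx ?mulr1//=.
by rewrite (negbTE ji) mulr0.
Qed.

Section modulus.
Variable n : nat.
Local Notation q := n.+1.
Local Notation T := {ffun 'I_d -> 'I_q}.

Lemma resvD (b h : T) : exists k : V, resv (b + h) = resv b + resv h + q%:Z *: k.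
Proof.
exists (\row_i - ((b i + h i) %/ q)%N%:Z); apply/rowP => i; rewrite !mxE ffunE /=.
have := divn_eq (b i + h i) q; move: ((b i + h i) %/ q)%N => z e.
by have := congr1 Posz e; rewrite !PoszD PoszM => ->; ring.
Qed.

Definition unitf (i : 'I_d) : T := [ffun j => inord (j == i)%N].

Lemma resv_unitf i : (0 < n)%N -> resv (unitf i) = delta_mx 0 i :> V.
Proof.
move=> n0; apply/rowP => j; rewrite !mxE ffunE inordK; last by case: (j == i).
by rewrite eqxx; case: (j == i).
Qed.

(** Translation by [e] rotates the vector of the cosine and sine sums by the angle [ph q c], and a
    rotation other than the identity fixes only 0. *)
Lemma char_sum0 (xi : T -> int) (e : T) (c : int) th :
  (forall b, exists k, xi (b + e) = xi b + c + q%:Z * k) -> ~~ (q%:Z %| c)%Z ->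
  \sum_b cos (ph q (xi b) + th) = 0.
Proof.
move=> hx qc; set X := \sum_b _; pose Y := \sum_b sin (ph q (xi b) + th).
have cE : X = \sum_b (cos (ph q (xi b) + th) * cos (ph q c) - sin (ph q (xi b) + th) * sin (ph q c)).
  rewrite /X (reindex_inj (addIr e)); apply: eq_bigr => b _.
  by have [k ->] := hx b; rewrite cos_ph_mod// phD (addrAC (ph q (xi b))); exact: cosD.
have sE : Y = \sum_b (sin (ph q (xi b) + th) * cos (ph q c) + cos (ph q (xi b) + th) * sin (ph q c)).
  rewrite /Y (reindex_inj (addIr e)); apply: eq_bigr => b _.
  by have [k ->] := hx b; rewrite sin_ph_mod// phD (addrAC (ph q (xi b))); rewrite [LHS]sinD.
rewrite sumrB -!mulr_suml -/X -/Y in cE; rewrite big_split/= -!mulr_suml -/X -/Y in sE.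
have := cos_ph_neq1 (ltn0Sn n) qc; have := cos2Dsin2 (ph q c).
move: (cos _) (sin _) cE sE => C S' h1 h2 h3 h4.
have h5 : (1 - C) * X = - (S' * Y) by rewrite mulrBl mul1r {1}h1; ring.
have h6 : (1 - C) * Y = S' * X by rewrite mulrBl mul1r {1}h2; ring.
have h7 : ((1 - C) ^+ 2 + S' ^+ 2) * X = 0.
  rewrite mulrDl expr2 -mulrA h5.
  by rewrite mulrN mulrCA h6 expr2 mulrA; ring.
have h8 : (1 - C) ^+ 2 + S' ^+ 2 = 2 * (1 - C).
  by rewrite (_ : S' ^+ 2 = 1 - C ^+ 2); [ring|rewrite -h3; ring].
by move/eqP: h7; rewrite h8 mulf_eq0 mulf_eq0 pnatr_eq0/= subr_eq0 eq_sym (negbTE h4)/= => /eqP.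
Qed.

Definition good (h : T) := [forall i, q%:Z %| actZ A (resv h) 0%R i]%Z.

(** Multiplying A h = 0 by the adjugate gives det A times h_i = 0 modulo q, which has at most |det
    A| solutions in each coordinate. *)
Lemma kernel_card : (#|[set h : T | good h]%SET| <= `|\det A| ^ d)%N.
Proof.
pose D := `|\det A|%N; have D0 : (0 < D)%N by rewrite absz_gt0.
pose Z : {set 'I_q} := [set x : 'I_q | (q %| D * x)%N]%SET.
have ZD : (#|Z| <= D)%N.
  pose f (x : 'I_q) : 'I_D := Ordinal (ltn_pmod (D * x %/ q) D0).
  rewrite -[X in (_ <= X)%N]card_ord -[#|'I_D|]cardsT.
  rewrite -(card_in_imset (f := f)) ?subset_leq_card ?subsetT// => x y.
  rewrite !inE => qx qy /(congr1 val) /=.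
  have lt (z : 'I_q) : (D * z %/ q < D)%N by rewrite ltn_divLR// ltn_pmul2l.
  rewrite !modn_small// => e; apply/val_inj/eqP => /=.
  by rewrite -(eqn_pmul2l D0) -(divnK qx) -(divnK qy) e.
have lx (x y e : nat) : (x <= y)%N -> (x ^ e <= y ^ e)%N by case: e => // e; rewrite leq_exp2r.
apply: (@leq_trans (#|Z| ^ d)); last exact: lx.
rewrite -[X in (_ <= _ ^ X)%N]card_ord -card_ffun_on; apply: subset_leq_card.
apply/fintype.subsetP => h; rewrite inE => /forallP gh; apply/ffun_onP => i; rewrite inE.
have e : resv h *m A^T *m \adj A^T = \det A *: resv h :> V.
  by rewrite -mulmxA mul_mx_adj det_tr mul_mx_scalar.
have : (q%:Z %| \det A * (h i)%:Z)%Z.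
  have -> : \det A * (h i)%:Z = (\det A *: resv h : V) ord0 i by rewrite !mxE.
  rewrite -e mxE; apply: rpred_sum => j _; rewrite dvdz_mulr//.
by rewrite dvdzE abszM.
Qed.

(** Weyl differencing on (Z/q)^d. For a shift h the sum over b is a complete character sum, which
    vanishes unless A h = 0 modulo q. *)
Lemma gauss_bound (a : nat) (t : int) th : coprime a q -> A^T = A ->
  (forall i, (2 %| A i i)%Z) ->
  (\sum_(b : T) cos (ph q (a%:Z * (qZ A (resv b) - t)) + th)) ^+ 2 <= (`|\det A| ^ d)%:R * q%:R ^+ d.
Proof.
move=> aq symA evenA; pose xi (b : T) := ph q (a%:Z * (qZ A (resv b) - t)) + th.
pose C := \sum_(b : T) cos (xi b); pose S' := \sum_(b : T) sin (xi b).
(* For q = 1 there is no residue vector with an entry 1 to translate by; the sum has a single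
   term. *)
have [n0|n0] := posnP n.
  have q1 (b : T) : b = 0 by apply/ffunP => i; apply/val_inj; rewrite ffunE/=; case: (b i) => /=; rewrite {1}n0; case.
  rewrite (bigD1 (0 : T))//= big1 ?addr0; last by move=> b; rewrite [b]q1 eqxx.
  rewrite -real_normK ?num_real//; apply: (@le_trans _ _ 1).
    by apply: exprn_ile1 => //; exact: norm_cos.
  rewrite mulr_ege1//; first by rewrite ler1n expn_gt0 absz_gt0 detA.
  by rewrite exprn_ege1// ler1n.
have inner h : ~~ good h ->
    \sum_(b : T) cos (ph q (a%:Z * (dotZ (actZ A (resv h)) (resv b))) + ph q (a%:Z * qZ A (resv h))) = 0.
  rewrite negb_forall => /existsP[i gi].
  apply: (@char_sum0 _ (unitf i) (a%:Z * actZ A (resv h) 0 i)).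
    move=> b; have [k ->] := resvD b (unitf i); rewrite resv_unitf//.
    exists (a%:Z * dotZ (actZ A (resv h)) k).
    by rewrite !dotZDr dotZZr dotZ_delta; ring.
  rewrite Gauss_dvdzr//; rewrite coprimezE /= coprime_sym//.
have E1 : C ^+ 2 + S' ^+ 2 = \sum_(h : T) \sum_(b : T)
    cos (ph q (a%:Z * (dotZ (actZ A (resv h)) (resv b))) + ph q (a%:Z * qZ A (resv h))).
  transitivity (\sum_(b : T) \sum_(b' : T) cos (xi b' - xi b)).
    rewrite !expr2 {1}/C {1}/S' !mulr_suml -big_split/=; apply: eq_bigr => b _.
    rewrite /C /S' !mulr_sumr -big_split/=; apply: eq_bigr => b' _.
    by rewrite cosB; ring.
  rewrite exchange_big/= [RHS]exchange_big/= exchange_big/=; apply: eq_bigr => b _.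
  rewrite (reindex_inj (addrI b)); apply: eq_bigr => h _.
  have [k ek] := resvD b h; have [z ez] := @qZ_mod R d A symA evenA q%:Z (resv b + resv h) k.
  rewrite /xi ek ez (@qZD R)//.
  have -> : a%:Z * (qZ A (resv b) + dotZ (actZ A (resv h)) (resv b) + qZ A (resv h) + q%:Z * z - t) =
    a%:Z * (dotZ (actZ A (resv h)) (resv b)) + a%:Z * qZ A (resv h) + a%:Z * (qZ A (resv b) - t) + q%:Z * (a%:Z * z) by ring.
  by rewrite -(addrA (ph q _)) cos_ph_mod// !phD; congr cos; ring.
have card : (#|T| = q ^ d)%N by rewrite card_ffun !card_ord.
apply: (@le_trans _ _ (C ^+ 2 + S' ^+ 2)); first by rewrite lerDl sqr_ge0.
rewrite E1; apply: (@le_trans _ _ (\sum_(h : T | good h) q%:R ^+ d)).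
  rewrite (bigID good)/= [X in _ + X]big1 ?addr0; last by move=> h /inner.
  apply: ler_sum => h _; rewrite -natrX -card -sum1_card natr_sum; apply: ler_sum => b _.
  exact: cos_le1.
rewrite sumr_const -[leLHS]mulr_natl; apply: ler_wpM2r; first exact: exprn_ge0.
rewrite ler_nat; apply: leq_trans kernel_card; apply/eq_leq/eq_card => h.
by rewrite inE.
Qed.

End modulus.
End gauss.

Lemma ltn_logn p q : (0 < q)%N -> (logn p q < q)%N.
Proof.
move=> q0; have [pp|/negbTE pn] := boolP (prime p); last by rewrite lognE pn.
apply: (@leq_trans (p ^ logn p q)); first exact: ltn_expl (prime_gt1 pp).
exact: dvdn_leq q0 (pfactor_dvdnn p q).
Qed.

Lemma cvg_prodR {R : realType} (I : Type) (r : seq I) (P : pred I) (u : I -> nat -> R) (l : I -> R) :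
  (forall i, P i -> u i @ \oo --> l i) ->
  (fun k => \prod_(i <- r | P i) u i k) @ \oo --> \prod_(i <- r | P i) l i.
Proof.
move=> h; elim: r => [|i r IH].
  by under eq_fun do rewrite big_nil; rewrite big_nil; exact: cvg_cst.
under eq_fun do rewrite big_cons; rewrite big_cons; case: ifP => // Pi.
by apply: cvgM => //; exact: h.
Qed.

(** * Euler products of multiplicative functions of size q^(-3/2) *)

Section euler.
Context {R : realType}.

(** q^(-3/2), the size of the terms q^(1 - d/2) of the singular series when d = 5. *)
Definition usq (q : nat) : R := (q%:R * Num.sqrt q%:R)^-1.

Lemma usq_ge0 q : 0 <= usq q.
Proof. by rewrite invr_ge0 mulr_ge0 ?sqrtr_ge0. Qed.

Lemma usq_tel q : (1 < q)%N -> usq q <= 2 * ((Num.sqrt q.-1%:R)^-1 - (Num.sqrt q%:R)^-1).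
Proof.
case: q => [//|[//|q _]] /=; rewrite /usq.
have a0 : 0 < Num.sqrt q.+1%:R :> R by rewrite sqrtr_gt0.
have b0 : 0 < Num.sqrt q.+2%:R :> R by rewrite sqrtr_gt0.
have a2 : Num.sqrt q.+1%:R ^+ 2 = q.+1%:R :> R by rewrite sqr_sqrtr.
have b2 : Num.sqrt q.+2%:R ^+ 2 = q.+2%:R :> R by rewrite sqr_sqrtr.
have ab : Num.sqrt q.+1%:R <= Num.sqrt q.+2%:R :> R by rewrite ler_wsqrtr// ler_nat.
rewrite -{1}b2; have e : Num.sqrt q.+2%:R ^+ 2 = Num.sqrt q.+1%:R ^+ 2 + 1 :> R.
  by rewrite a2 b2 -[in LHS]addn1 natrD.
move: (Num.sqrt q.+1%:R) (Num.sqrt q.+2%:R) a0 b0 ab e => a b a0 b0 ab e.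
have -> : a^-1 - b^-1 = (b - a) / (a * b) by field; rewrite !gt_eqF.
have -> : b - a = (b + a)^-1.
  have ba : b + a != 0 by rewrite gt_eqF// addr_gt0.
  by apply: (mulIf ba); rewrite mulVf//; lra.
have -> : 2 * ((b + a)^-1 / (a * b)) = (((b + a) / 2) * (a * b))^-1.
  by field; rewrite !gt_eqF//= addr_gt0.
rewrite lef_pV2 ?posrE ?mulr_gt0 ?exprn_gt0 ?addr_gt0//.
have : (b + a) / 2 * a <= b * b by nra.
by move=> /(ler_wpM2r (ltW b0)); rewrite expr2 -!mulrA.
Qed.

Lemma usq_sum (X Y : nat) : (0 < X)%N -> \sum_(X.+1 <= q < Y) usq q <= 2 / Num.sqrt X%:R.
Proof.
move=> X0; have h : forall Y, \sum_(X.+1 <= q < X.+1 + Y) usq q <=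
    2 * ((Num.sqrt X%:R)^-1 - (Num.sqrt (X + Y)%:R)^-1).
  elim=> [|Y' IH]; first by rewrite !addn0 big_geq// subrr mulr0.
  rewrite addnS big_nat_recr ?leq_addr//=.
  have u := @usq_tel (X.+1 + Y')%N _; have {}u := u (leq_trans X0 (leq_addr _ _)).
  by apply: (le_trans (lerD IH u)); rewrite addSn /= addnS; lra.
have [XY|YX] := leqP X.+1 Y; last by rewrite big_geq 1?ltnW// divr_ge0 ?sqrtr_ge0.
rewrite -(subnKC XY); apply: (le_trans (h _)).
by rewrite ler_wpM2l// gerBl invr_ge0 sqrtr_ge0.
Qed.

Lemma sum_uniq_le (s : seq nat) (X Y : nat) (F : nat -> R) : uniq s -> (forall q, 0 <= F q) ->
  (forall q, q \in s -> (X < q < Y)%N) -> \sum_(q <- s) F q <= \sum_(X.+1 <= q < Y) F q.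
Proof.
move=> us F0 sXY.
have <- : \sum_(X.+1 <= q < Y | q \in s) F q = \sum_(q <- s) F q.
  rewrite -big_filter; apply: perm_big; apply: uniq_perm => //; first by rewrite filter_uniq// iota_uniq.
  by move=> q; rewrite mem_filter mem_index_iota; case: (boolP (q \in s)) => //= /sXY ->.
rewrite [leRHS](bigID (mem s))/= lerDl; exact: sumr_ge0.
Qed.

(** The integers met on expanding the Euler product over p <= n, each factor cut at exponents below
    k. By unique factorization none is repeated. *)
Fixpoint smooth_list (n k : nat) : seq nat :=
  if n is n'.+1 then
    if prime n then [seq (n ^ l * q)%N | l <- iota 0 k, q <- smooth_list n' k]
    else smooth_list n' k
  else [:: 1%N].

Lemma smooth_list_prop n k q : q \in smooth_list n k ->
  (0 < q)%N /\ (forall p, prime p -> (p %| q)%N -> (p <= n)%N).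
Proof.
elim: n q => [|n IH] q /=.
  by rewrite inE => /eqP ->; split=> // p pp; rewrite dvdn1 => /eqP p1; rewrite p1 in pp.
case: ifP => pn; last by move=> /IH[q0 h]; split=> // p pp /(h _ pp) /leqW.
case/allpairsP => -[l q'] /= [_ /IH[q0 h] ->]; split; first by rewrite muln_gt0 expn_gt0.
move=> p pp; rewrite Euclid_dvdM// => /orP[|/(h _ pp)/leqW//].
by rewrite Euclid_dvdX// => /andP[]; rewrite dvdn_prime2// => /eqP -> _.
Qed.

Lemma smooth_coprime n k q l : prime n.+1 -> q \in smooth_list n k -> coprime (n.+1 ^ l) q.
Proof.
move=> pn /smooth_list_prop[q0 h]; apply: coprimeXl; rewrite prime_coprime//.
by apply/negP => /(h _ pn); rewrite ltnn.
Qed.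

Lemma smooth_uniq n k : uniq (smooth_list n k).
Proof.
elim: n => [//|n IH] /=; case: ifP => // pn.
apply: allpairs_uniq => //; first exact: iota_uniq.
move=> [l q] [l' q'] /allpairsP[[l1 q1] [_ h1 e1]] /allpairsP[[l2 q2] [_ h2 e2]] /= e.
case: e1 h1 => <- <- /= h1; case: e2 h2 => <- <- /= h2.
have lq k' q'' : q'' \in smooth_list n k -> logn n.+1 (n.+1 ^ k' * q'') = k'.
  move=> hq; have [q0 _] := smooth_list_prop hq.
  rewrite lognM ?expn_gt0// lognX logn_prime// eqxx muln1.
  by rewrite logn_coprime ?addn0// -[n.+1]expn1; exact: smooth_coprime hq.
have ll : l = l' by rewrite -(lq l q h1) e lq.
by move: e; rewrite ll => /eqP; rewrite eqn_pmul2l ?expn_gt0// => /eqP ->.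
Qed.

Lemma smooth_mem n k q : (0 < q)%N -> (forall p, prime p -> (p %| q)%N -> (p <= n)%N) ->
  (forall p, (logn p q < k)%N) -> q \in smooth_list n k.
Proof.
elim: n q => [|n IH] q q0 hp hl /=.
  rewrite inE; apply/eqP; case: q q0 hp hl => [//|[//|q]] _ hp _.
  by have := hp _ (pdiv_prime (isT : 1 < q.+2)%N) (pdiv_dvd _); rewrite leqn0 => /eqP h; have := pdiv_gt0 q.+2; rewrite h.
case: ifP => pn; last first.
  apply: IH => // p pp pq; have := hp p pp pq; rewrite leq_eqVlt => /orP[/eqP pe|//].
  by rewrite -pe pp in pn.
have pd := pfactor_dvdnn n.+1 q.
have qe : q = (n.+1 ^ logn n.+1 q * (q %/ n.+1 ^ logn n.+1 q))%N by rewrite mulnC divnK.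
set q' := (q %/ _)%N in qe.
have q'0 : (0 < q')%N by rewrite divn_gt0 ?expn_gt0// dvdn_leq.
apply/allpairsP; exists (logn n.+1 q, q'); split => //=.
  by rewrite mem_iota /= add0n.
apply: IH => //.
  move=> p pp pq'; have := hp p pp; rewrite qe dvdn_mull// => /(_ isT).
  rewrite leq_eqVlt => /orP[/eqP pe|//].
  have : (n.+1 %| q')%N by rewrite -pe.
  move=> /dvdnP[r q'r]; have := congr1 (logn n.+1) qe.
  have r0 : (0 < r)%N by move: q'0; rewrite q'r muln_gt0 => /andP[].
  rewrite q'r !lognM ?expn_gt0 ?muln_gt0 ?r0// lognX (logn_prime n.+1 pn) eqxx muln1 => /eqP.
  by rewrite -[X in X == _]addn0 eqn_add2l addn1.
move=> p; apply: leq_ltn_trans (hl p); rewrite [in X in (_ <= X)%N]qe lognM ?expn_gt0//.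
exact: leq_addl.
Qed.

Variables (f : nat -> R) (C : R).
Hypothesis f1 : f 1%N = 1.
Hypothesis fM : forall a b, (0 < a)%N -> (0 < b)%N -> coprime a b -> f (a * b)%N = f a * f b.
Hypothesis C0 : 0 <= C.
Hypothesis fC : forall q, (0 < q)%N -> `|f q| <= C * usq q.

Lemma smooth_prod n k :
  \prod_(p < n.+1 | prime p) \sum_(l < k) f (p ^ l)%N = \sum_(q <- smooth_list n k) f q.
Proof.
elim: n => [|n IH]; first by rewrite big_mkcond/= big_ord_recl big_ord0 /= big_seq1 f1 mulr1.
rewrite big_mkcond big_ord_recr -big_mkcond/= IH; case: ifP => pn; last by rewrite mulr1.
rewrite big_allpairs_dep/= mulrC mulr_suml -(big_mkord xpredT (fun l => f (n.+1 ^ l)%N * _)) /index_iota subn0.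
rewrite big_seq [RHS]big_seq; apply: eq_bigr => l _; rewrite mulr_sumr.
rewrite big_seq [RHS]big_seq; apply: eq_bigr => q hq.
by rewrite fM ?expn_gt0//; [case: (smooth_list_prop hq)|exact: smooth_coprime hq].
Qed.

Lemma fsum_tail (s : seq nat) (X : nat) : (0 < X)%N -> uniq s ->
  (forall q, q \in s -> (X < q)%N) -> `|\sum_(q <- s) f q| <= C * (2 / Num.sqrt X%:R).
Proof.
move=> X0 us hs; apply: (le_trans (ler_norm_sum _ _ _)).
pose Y := (\max_(q <- s) q).+1.
apply: (@le_trans _ _ (\sum_(q <- s) C * usq q)).
  rewrite !big_seq; apply: ler_sum => q qs; apply: fC; exact: leq_ltn_trans (hs q qs).
rewrite -mulr_sumr ler_wpM2l//; apply: le_trans (usq_sum Y X0).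
apply: sum_uniq_le => // [q|q qs]; first exact: usq_ge0.
by rewrite hs//= /Y ltnS; apply: leq_bigmax_seq.
Qed.

(** The list contains every q <= X, since the primes of q are at most q and their exponents less
    than q. The other members exceed X and form part of the tail. *)
Lemma smooth_close n k X : (0 < X)%N -> (X <= n)%N -> (X <= k)%N ->
  `|\prod_(p < n.+1 | prime p) \sum_(l < k) f (p ^ l)%N - \sum_(1 <= q < X.+1) f q| <=
  C * (2 / Num.sqrt X%:R).
Proof.
move=> X0 Xn Xk; rewrite smooth_prod (bigID (fun q => (q <= X)%N))/=.
have -> : \sum_(q <- smooth_list n k | (q <= X)%N) f q = \sum_(1 <= q < X.+1) f q.
  rewrite -big_filter; apply: perm_big; apply: uniq_perm.
  - by rewrite filter_uniq// smooth_uniq.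
  - exact: iota_uniq.
  - move=> q; rewrite mem_filter mem_index_iota ltnS andbC; case: (leqP q X) => qX; rewrite ?andbF//= !andbT.
    apply/idP/idP => [/smooth_list_prop[]//|q0]; apply: smooth_mem => // [p pp pq|p].
      exact: leq_trans (leq_trans (dvdn_leq q0 pq) qX) Xn.
    by apply: leq_trans (leq_trans qX Xk); exact: ltn_logn.
rewrite addrAC subrr add0r -big_filter; apply: fsum_tail => //.
  by rewrite filter_uniq// smooth_uniq.
by move=> q; rewrite mem_filter -ltnNge => /andP[].
Qed.

Lemma cvg_euler_factor p : prime p -> cvgn (series (fun l => f (p ^ l)%N)).
Proof.
move=> pp; apply: normed_cvg.
apply: (@series_le_cvg _ _ (geometric C (2^-1))) => [n|n|n|].
- by rewrite normr_ge0.
- by rewrite /geometric/= mulr_ge0 ?exprn_ge0.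
- rewrite /geometric/=; apply: (le_trans (fC _)); first by rewrite expn_gt0 prime_gt0.
  rewrite ler_wpM2l// /usq exprVn lef_pV2 ?posrE ?exprn_gt0//; last first.
    have pn0 : 0 < (p ^ n)%:R :> R by rewrite ltr0n expn_gt0 prime_gt0.
    by rewrite mulr_gt0 ?sqrtr_gt0.
  rewrite -natrX; apply: (@le_trans _ _ (p ^ n)%:R).
    by rewrite ler_nat; case: (n) => // n'; rewrite leq_exp2r// prime_gt1.
  have p1 : 1 <= (p ^ n)%:R :> R by rewrite ler1n expn_gt0 prime_gt0.
  by rewrite ler_peMr ?(le_trans ler01 p1)// -[leLHS]sqrtr1 ler_wsqrtr.
- by apply: is_cvg_geometric_series; rewrite ger0_norm ?invf_lt1 ?ltr1n.
Qed.

Lemma cvg_tail_bound : (fun n : nat => C * (2 / Num.sqrt n%:R)) @ \oo --> 0.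
Proof.
apply/cvgrPdist_le => e e0; near=> n; rewrite sub0r normrN ger0_norm; last first.
  by rewrite mulr_ge0 ?divr_ge0 ?sqrtr_ge0.
have n0 : 0 < n%:R :> R by rewrite ltr0n; near: n; exact: nbhs_infty_gt.
rewrite mulrA ler_pdivrMr ?sqrtr_gt0//.
have h : (C * 2 / e) ^+ 2 <= n%:R by near: n; exact: nbhs_infty_ger.
have C2 : 0 <= C * 2 / e by rewrite divr_ge0 ?mulr_ge0// ltW.
have := ler_wsqrtr h; rewrite sqrtr_sqr ger0_norm//.
by rewrite ler_pdivrMr// [e * _]mulrC.
Unshelve. all: by end_near.
Qed.

(** [smooth_close] is uniform in the exponent cut-off k. Letting k grow compares the product over p
    <= n with the partial sum up to any X <= n; both then have the same limit. *)
Lemma euler_product : exists l : R,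
  [/\ forall X, (0 < X)%N -> `|l - \sum_(1 <= q < X.+1) f q| <= C * (2 / Num.sqrt X%:R),
      forall p, prime p -> cvgn (series (fun l => f (p ^ l)%N)) &
      (fun n => \prod_(p < n.+1 | prime p) limn (series (fun l => f (p ^ l)%N))) @ \oo --> l].
Proof.
pose s X := \sum_(1 <= q < X.+1) f q; pose P n := \prod_(p < n.+1 | prime p) limn (series (fun l => f (p ^ l)%N)).
have Ps n X : (0 < X)%N -> (X <= n)%N -> `|P n - s X| <= C * (2 / Num.sqrt X%:R).
  move=> X0 Xn; pose u k := \prod_(p < n.+1 | prime p) \sum_(l < k) f (p ^ l)%N - s X.
  have cu : u @ \oo --> P n - s X.
    apply: cvgB; last exact: cvg_cst.
    have cl p : prime p -> (fun k => \sum_(l < k) f (p ^ l)%N) @ \oo --> limn (series (fun l => f (p ^ l)%N)).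
      move=> pp; have := cvg_euler_factor pp; rewrite /series /=.
      by under eq_fun do rewrite big_mkord.
    by apply: cvg_prodR => p /cl.
  have nu : (fun k => `|u k|) @ \oo --> `|P n - s X| by exact: cvg_norm.
  rewrite -(cvg_lim _ nu)//; apply: limr_le; first by apply/cvg_ex; exists `|P n - s X|.
  by exists X => // k /= Xk; exact: smooth_close.
have ss X Y : (0 < X)%N -> (X <= Y)%N -> `|s Y - s X| <= C * (2 / Num.sqrt X%:R).
  move=> X0 XY; rewrite /s (@big_cat_nat _ _ _ X.+1 1 Y.+1)//= addrAC subrr add0r.
  apply: fsum_tail => //; first exact: iota_uniq.
  by move=> q; rewrite mem_index_iota => /andP[].
have cs : cvgn s.
  have sE : s = series (fun q => f q.+1).
    by apply/funext => X; rewrite /s /series/= big_add1.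
  rewrite sE; apply: normed_cvg; apply: (@series_le_cvg _ _ (fun q => C * usq q.+1)) => [n|n|n|].
  - by rewrite normr_ge0.
  - by rewrite mulr_ge0 ?usq_ge0.
  - exact: fC.
  - apply: nondecreasing_is_cvgn.
      by apply: nondecreasing_series => n _ _; rewrite mulr_ge0 ?usq_ge0.
    exists (C * (usq 1 + 2)) => _ [n _ <-]; rewrite /series/= -mulr_sumr ler_wpM2l//.
    case: n => [|n]; first by rewrite big_geq// addr_ge0 ?usq_ge0.
    rewrite big_nat_recl// lerD2l; have := @usq_sum 1 n.+2 isT.
    by rewrite sqrtr1 divr1 big_add1 big_add1.
exists (limn s); split.
- move=> X X0; have nu : (fun Y => `|s Y - s X|) @ \oo --> `|limn s - s X|.
    by apply: cvg_norm; apply: cvgB => //; exact: cvg_cst.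
  rewrite -(cvg_lim _ nu)//; apply: limr_le; first by apply/cvg_ex; exists `|limn s - s X|.
  by exists X => // Y /= XY; exact: ss.
- exact: cvg_euler_factor.
- have z : (fun n => P n - s n) @ \oo --> 0.
    apply: norm_cvg0; apply: (squeeze_cvgr _ (@cvg_cst _ _ _ _ _) cvg_tail_bound).
    near=> n; rewrite normr_ge0 Ps//; near: n; exact: nbhs_infty_gt.
  have -> : (fun n => \prod_(p < n.+1 | prime p) limn (series (fun l => f (p ^ l)%N))) =
    (fun n => P n - s n + s n) by apply/funext => n; rewrite subrK.
  by rewrite -[limn s]add0r; apply: cvgD.
Unshelve. all: by end_near.
Qed.

End euler.

(** * The complete sums S_q and the singular series *)

Section complete_sums.
Context {R : realType} {d : nat}.
Variable A : 'M[int]_d.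
Hypothesis symA : A^T = A.
Hypothesis evenA : forall i, (2 %| A i i)%Z.
Hypothesis detA : \det A != 0.
Local Notation V := 'rV[int]_d.

Definition SR (q : nat) (t : int) : R :=
  \sum_(a < q | coprime a q) \sum_(b : {ffun 'I_d -> 'I_q})
    cos (ph q (a%:Z * (qZ A (resv b) - t))).

Definition SI (q : nat) (t : int) : R :=
  \sum_(a < q | coprime a q) \sum_(b : {ffun 'I_d -> 'I_q})
    sin (ph q (a%:Z * (qZ A (resv b) - t))).

(** The substitution a -> - a permutes the units and conjugates the summands, so the complete sum is
    real. *)
Lemma SI0 q t : (0 < q)%N -> SI q t = 0.
Proof.
case: q => // n _.
have h (a : 'I_n.+1) : exists k : int, (- a : 'I_n.+1)%:Z = - a%:Z + n.+1%:Z * k.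
  exists (1 - (((n.+1 - a) %/ n.+1)%N)%:Z) => /=.
  have := congr1 Posz (divn_eq (n.+1 - a) n.+1); rewrite PoszD PoszM -subzn; last exact: ltnW (ltn_ord a).
  move: (_ %/ _)%N (_ %% _)%N => D r e.
  have -> : r%:Z = n.+1%:Z - a%:Z - D%:Z * n.+1%:Z by rewrite e; ring.
  by ring.
have : SI n.+1 t = - SI n.+1 t; last lra.
rewrite {1}/SI (reindex_inj (@oppr_inj _)) /SI -sumrN.
have cp (a : 'I_n.+1) : coprime (- a : 'I_n.+1) n.+1 = coprime a n.+1.
  have cs (x q : nat) : (x <= q)%N -> coprime (q - x) q = coprime x q.
    by move=> xq; rewrite /coprime -{2}(subnK xq) gcdnDl gcdnC -{2}(subnKC xq) gcdnDl.
  by rewrite /= coprime_modl cs// ltnW.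
under eq_bigl do rewrite cp.
apply: eq_bigr => a _; rewrite -sumrN; apply: eq_bigr => b _.
have [k ->] := h a.
have -> : (- a%:Z + n.+1%:Z * k) * (qZ A (resv b) - t) =
  - (a%:Z * (qZ A (resv b) - t)) + n.+1%:Z * (k * (qZ A (resv b) - t)) by ring.
rewrite -[ph _ _]addr0 sin_ph_mod// addr0 -sinN; congr sin.
by rewrite /ph rmorphN/= mulNr mulrN.
Qed.

Lemma sum_Complex (I : Type) (r : seq I) (P : pred I) (f g : I -> R) :
  \sum_(i <- r | P i) Complex (f i) (g i) =
  Complex (\sum_(i <- r | P i) f i) (\sum_(i <- r | P i) g i) :> R[i].
Proof. by elim/big_rec3 : _ => // i x y z _ ->. Qed.

Lemma gauss_sumE q t : (0 < q)%N -> gauss_sum R q 0 A t = real_complex R (SR q t).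
Proof.
move=> q0; rewrite -[RHS]/(Complex _ 0) -(SI0 t q0) -sum_Complex.
apply: eq_bigr => a _; rewrite -sum_Complex; apply: eq_bigr => b _.
have -> : residue_vec R b = toR (resv b).
  by apply/rowP => i; rewrite !mxE.
rewrite (_ : dotv _ _ = 0); last by rewrite /dotv big1// => i _; rewrite !mxE mul0r.
rewrite addr0 qformZE// /eq_char.
have -> : a%:R * ((qZ A (resv b))%:~R - t%:~R) = (a%:Z * (qZ A (resv b) - t))%:~R :> R.
  by rewrite intrM intrB.
by rewrite /ph !mulrA.
Qed.

Definition Cdet : R := Num.sqrt (`|\det A| ^ d)%:R.

Lemma SR_bound q t : (0 < q)%N -> `|SR q t| <= q%:R * (Cdet * Num.sqrt (q%:R ^+ d)).
Proof.
case: q => // n _; apply: (le_trans (ler_norm_sum _ _ _)).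
apply: (@le_trans _ _ (\sum_(a < n.+1) (Cdet * Num.sqrt (n.+1%:R ^+ d)))); last first.
  by rewrite sumr_const card_ord -[leLHS]mulr_natl.
rewrite [leLHS]big_mkcond; apply: ler_sum => a _; case: ifP => [ca|_]; last first.
  by rewrite mulr_ge0 ?sqrtr_ge0.
rewrite -sqrtrM// -sqrtr_sqr ler_wsqrtr//.
by under eq_bigr do rewrite -[ph _ _]addr0; exact: gauss_bound.
Qed.

Lemma SR1 t : SR 1 t = 1.
Proof.
have q1 (b : {ffun 'I_d -> 'I_1}) : b = [ffun=> ord0] by apply/ffunP => i; rewrite ffunE [b i]ord1.
rewrite /SR (big_pred1 ord0) => [|a]; last by rewrite /= coprimen1 [a]ord1 eqxx.
rewrite (bigD1 [ffun=> ord0])//= big1 => [|b]; last by rewrite [b]q1 eqxx.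
by rewrite mul0r /ph mul0r mulr0 cos0 addr0.
Qed.

Section multiplicative.
Variables (q1 q2 : nat) (t : int).
Hypothesis q10 : (0 < q1)%N.
Hypothesis q20 : (0 < q2)%N.
Hypothesis cop : coprime q1 q2.
Let q := (q1 * q2)%N.
Let q0 : (0 < q)%N. Proof. by rewrite muln_gt0 q10. Qed.

(** Chosen so that fa/q = p.1/q1 + p.2/q2 modulo 1. The phase then splits and the residue vector
    only needs to be reduced modulo q1 and q2. *)
Let fa (p : 'I_q1 * 'I_q2) : 'I_q := Ordinal (ltn_pmod (p.1 * q2 + p.2 * q1) q0).

Let fa_inj : injective fa.
Proof.
move=> [x y] [x' y'] /(congr1 val) /= e.
have m1 : (x * q2 = x' * q2 %[mod q1])%N.
  have := congr1 (modn^~ q1) e; rewrite !(modn_dvdm _ (dvdn_mulr q2 (dvdnn q1))).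
  by rewrite -modnDmr modnMl addn0 -[in RHS]modnDmr modnMl addn0.
have m2 : (y * q1 = y' * q1 %[mod q2])%N.
  have := congr1 (modn^~ q2) e; rewrite !(modn_dvdm _ (dvdn_mull q1 (dvdnn q2))).
  by rewrite -modnDml modnMl add0n -[in RHS]modnDml modnMl add0n.
have c (p p' : nat) (u v : nat) : coprime p p' -> (u < p)%N -> (v < p)%N ->
    (u * p' = v * p' %[mod p])%N -> u = v.
  move=> cp up vp /eqP; wlog uv : u v up vp / (u <= v)%N.
    by move=> h; case: (leqP u v) => [|/ltnW] uv H; [exact: h|apply/esym/h; rewrite // eq_sym].
  rewrite eq_sym eqn_mod_dvd ?leq_mul2r ?uv ?orbT// -mulnBl Gauss_dvdl// => dv.
  apply/eqP; rewrite eqn_leq uv/= -subn_eq0; apply: contraTT dv => h.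
  by rewrite gtnNdvd// ?lt0n// (leq_ltn_trans (leq_subr _ _)).
congr (_, _); apply/val_inj => /=.
  exact: c cop (ltn_ord x) (ltn_ord x') m1.
by apply: c (ltn_ord y) (ltn_ord y') m2; rewrite coprime_sym.
Qed.

Let fa_bij : bijective fa.
Proof. by apply: inj_card_bij fa_inj _; rewrite card_prod !card_ord. Qed.

Let fa_cop p : coprime (fa p) q = coprime p.1 q1 && coprime p.2 q2.
Proof.
rewrite /= coprime_modl coprimeMr; congr (_ && _).
  by rewrite -coprime_modl -modnDmr modnMl addn0 coprime_modl coprimeMl [coprime q2 _]coprime_sym cop andbT.
by rewrite -coprime_modl -modnDml modnMl add0n coprime_modl coprimeMl cop andbT.
Qed.

Let fb (b : {ffun 'I_d -> 'I_q}) : {ffun 'I_d -> 'I_q1} * {ffun 'I_d -> 'I_q2} :=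
  ([ffun i => Ordinal (ltn_pmod (b i) q10)], [ffun i => Ordinal (ltn_pmod (b i) q20)]).

Let fb_inj : injective fb.
Proof.
move=> b b' [/ffunP e1 /ffunP e2]; apply/ffunP => i; apply/val_inj => /=.
have := congr1 val (e1 i); have := congr1 val (e2 i); rewrite !ffunE /= => h2 h1.
have : (b i == b' i %[mod q]) by rewrite chinese_remainder// h1 h2 !eqxx.
by rewrite !modn_small// => /eqP.
Qed.

Let fb_bij : bijective fb.
Proof.
apply: inj_card_bij fb_inj _; rewrite card_prod !card_ffun !card_ord expnMn leqnn//.
Qed.

Let ph_split (p : 'I_q1 * 'I_q2) (b : {ffun 'I_d -> 'I_q}) : exists k : int,
  ph q ((fa p : nat)%:Z * (qZ A (resv b) - t)) =
  ph q1 (p.1%:Z * (qZ A (resv (fb b).1) - t)) + ph q2 (p.2%:Z * (qZ A (resv (fb b).2) - t)) + 2 * pi * k%:~R :> R.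
Proof.
have res (q' : nat) (q'0 : (0 < q')%N) : exists n : int,
    qZ A (resv b) - t = qZ A (resv [ffun i => Ordinal (ltn_pmod (b i) q'0)]) - t + q'%:Z * n.
  pose k : V := \row_i ((b i %/ q')%N)%:Z.
  have e : resv b = resv [ffun i => Ordinal (ltn_pmod (b i) q'0)] + q'%:Z *: k :> V.
    apply/rowP => i; rewrite !mxE ffunE /=.
    by have := congr1 Posz (divn_eq (b i) q'); rewrite PoszD PoszM => ->; ring.
  have [n en] := @qZ_mod R d A symA evenA q'%:Z (resv [ffun i => Ordinal (ltn_pmod (b i) q'0)]) k.
  by exists n; rewrite e en addrAC.
have [n1 e1] := res _ q10; have [n2 e2] := res _ q20.
have := congr1 Posz (divn_eq (p.1 * q2 + p.2 * q1) q); rewrite !PoszD !PoszM.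
rewrite -[((_ %% _)%N)%:Z]/((fa p : nat)%:Z); move: ((_ %/ _)%N) => k0 ek.
have -> : (fa p : nat)%:Z = p.1%:Z * q2%:Z + p.2%:Z * q1%:Z - k0%:Z * (q1%:Z * q2%:Z) by rewrite ek; ring.
move: e1 e2; rewrite -/(fb b).1 -/(fb b).2; set X := qZ A (resv b) - t.
set X1 := _ - t; set X2 := qZ A (resv [ffun i => Ordinal (ltn_pmod (b i) q20)]) - t => e1 e2.
exists (p.1%:Z * n1 + p.2%:Z * n2 - k0%:Z * X).
have -> : X1 = X - q1%:Z * n1 by rewrite e1; ring.
have -> : X2 = X - q2%:Z * n2 by rewrite e2; ring.
clearbody X X1 X2.
rewrite /ph /q !(intrM, intrD, mulrNz) natrM -![(Posz _)%:~R]/(_%:R).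
by field; rewrite !pnatr_eq0 -!lt0n q10 q20.
Qed.

(** After the Chinese remainder theorem this is the addition formula of the cosine; the product of
    the sine sums is 0 by [SI0]. *)
Lemma SR_mul : SR q t = SR q1 t * SR q2 t.
Proof.
transitivity (SR q1 t * SR q2 t - SI q1 t * SI q2 t); last by rewrite !SI0// mul0r subr0.
rewrite /SR (reindex fa) /=; last exact: onW_bij fa_bij.
under eq_bigl do rewrite fa_cop.
rewrite -(pair_big (fun a : 'I_q1 => coprime a q1) (fun a : 'I_q2 => coprime a q2)
  (fun a1 a2 => \sum_(b : {ffun 'I_d -> 'I_q}) cos (ph q ((fa (a1, a2) : nat)%:Z * (qZ A (resv b) - t)))))/=.
rewrite /SI !big_distrlr/= -sumrB; apply: eq_bigr => a1 _; rewrite -sumrB; apply: eq_bigr => a2 _.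
rewrite !big_distrlr/= -sumrB; under [RHS]eq_bigr do rewrite -sumrB.
rewrite pair_big/= (reindex fb)/=; last exact: onW_bij fb_bij.
apply: eq_bigr => b _; have [k ->] := ph_split (a1, a2) b.
by rewrite cosD2piz cosD.
Qed.

End multiplicative.

Definition fser (t : int) (q : nat) : R := q%:R^-1 ^+ d * SR q t.

Lemma fser_bound t q : (0 < q)%N -> `|fser t q| <= Cdet * (q%:R * Num.sqrt (q%:R^-1 ^+ d)).
Proof.
move=> q0; have qp : 0 < q%:R :> R by rewrite ltr0n.
rewrite normrM ger0_norm ?exprn_ge0 ?invr_ge0//.
apply: (le_trans (ler_wpM2l _ (SR_bound t q0))); first by rewrite exprn_ge0 ?invr_ge0.
have e : q%:R^-1 ^+ d * Num.sqrt (q%:R ^+ d) = Num.sqrt (q%:R^-1 ^+ d) :> R.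
  have {1}-> : q%:R^-1 ^+ d = Num.sqrt (q%:R^-1 ^+ d) ^+ 2 :> R.
    by rewrite sqr_sqrtr// exprn_ge0 ?invr_ge0.
  rewrite expr2 -mulrA -sqrtrM ?exprn_ge0 ?invr_ge0// -exprMn mulVf ?gt_eqF// expr1n sqrtr1 mulr1//.
by rewrite -e le_eqVlt; apply/orP; left; apply/eqP; ring.
Qed.

Hypothesis d5 : (5 <= d)%N.

Lemma sqrt_usq (q : nat) : (0 < q)%N ->
  q%:R * Num.sqrt (q%:R^-1 ^+ d) = Num.sqrt (q%:R^-1 ^+ (d - 5)) * usq q :> R.
Proof.
move=> q0; have qp : 0 < q%:R :> R by rewrite ltr0n.
rewrite -{1}(subnK d5) exprD sqrtrM ?exprn_ge0 ?invr_ge0// (exprD _ 4 1) sqrtrM ?exprn_ge0 ?invr_ge0//.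
rewrite (exprM _ 2 2) sqrtr_sqr ger0_norm ?exprn_ge0 ?invr_ge0// expr1 sqrtrV// /usq.
have : Num.sqrt q%:R != 0 :> R by rewrite gt_eqF// sqrtr_gt0.
by move: (Num.sqrt _) => z; move: (Num.sqrt _) => y y0; field; rewrite y0 gt_eqF.
Qed.

(** The surplus decay q^(-(d-5)/2) over q^(-3/2) is frozen at X. Summing [usq] then yields
    X^(-(d-4)/2), the rate that the truncation of the series needs. *)
Lemma fser_tail t q X : (0 < X)%N -> (X <= q)%N ->
  `|fser t q| <= Cdet * Num.sqrt (X%:R^-1 ^+ (d - 5)) * usq q.
Proof.
move=> X0 Xq; have q0 : (0 < q)%N by exact: leq_trans Xq.
apply: (le_trans (fser_bound t q0)); rewrite sqrt_usq// -mulrA ler_wpM2l ?sqrtr_ge0//.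
rewrite ler_wpM2r ?usq_ge0// ler_wsqrtr// lerXn2r ?nnegrE ?invr_ge0//.
by rewrite lef_pV2 ?posrE ?ltr0n// ler_nat.
Qed.

Lemma fser_usq t q : (0 < q)%N -> `|fser t q| <= Cdet * usq q.
Proof.
by move=> q0; have := @fser_tail t q 1 isT q0; rewrite invr1 expr1n sqrtr1 mulr1.
Qed.

Lemma fser1 t : fser t 1 = 1.
Proof. by rewrite /fser invr1 expr1n mul1r SR1. Qed.

Lemma fser_mul t a b : (0 < a)%N -> (0 < b)%N -> coprime a b ->
  fser t (a * b) = fser t a * fser t b.
Proof.
by move=> a0 b0 ab; rewrite /fser SR_mul// natrM invfM exprMn; ring.
Qed.

Lemma real_complex_cvg (u : nat -> R) (l : R) : u @ \oo --> l ->
  (fun n => real_complex R (u n) : R[i]^o) @ \oo --> (real_complex R l : R[i]^o).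
Proof.
move=> ul; apply/cvgrPdist_lt => e e0.
have e1 : 0 < complex.Re e by move: e0; rewrite ltcE => /andP[].
have ee : e = real_complex R (complex.Re e).
  by move: e0; rewrite ltcE/= => /andP[/eqP h _]; case: e h {e1} => x y /= ->.
have /cvgrPdist_lt/(_ _ e1) := ul; apply: filterS => n h.
rewrite ee -rmorphB /=.
have -> : `|real_complex R (l - u n)| = real_complex R `|l - u n|.
  by rewrite normc_def/= expr0n addr0 sqrtr_sqr.
by rewrite ltcR.
Qed.

Lemma real_complex_lim (u : nat -> R) : cvgn u ->
  limn (fun n => real_complex R (u n) : R[i]^o) = real_complex R (limn u).
Proof. by move=> cu; apply: cvg_lim => //; exact: real_complex_cvg. Qed.

(** The first estimate, at X = 1, gives the bound uniform in [t]; the second, sharper one is for the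
    circle method. *)
Lemma sing_series_real t : exists sg : R,
  [/\ sing_series_cvg R A t, sing_series R A t = real_complex R sg,
      forall X, (0 < X)%N -> `|sg - \sum_(1 <= q < X.+1) fser t q| <= Cdet * (2 / Num.sqrt X%:R)
    & forall X, (0 < X)%N -> `|sg - \sum_(1 <= q < X.+1) fser t q| <=
        Cdet * Num.sqrt (X%:R^-1 ^+ (d - 5)) * (2 / Num.sqrt X%:R)].
Proof.
have C0 : 0 <= Cdet by exact: sqrtr_ge0.
have [l [h1 h2 h3]] := euler_product (fser1 t) (fser_mul t) C0 (fser_usq t).
have tE p : prime p -> series (sigma_p_terms R A t p) =
    (fun n => real_complex R (series (fun l => fser t (p ^ l)) n)).
  move=> pp; apply/funext => n; rewrite /series/= rmorph_sum; apply: eq_bigr => k _.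
  rewrite /sigma_p_terms gauss_sumE ?expn_gt0 ?prime_gt0// /fser rmorphM/=; congr (_ * _).
  by rewrite exprVn -natrX -expnM mulnC fmorphV/= rmorph_nat.
have sE p : prime p -> sigma_p R A t p = real_complex R (limn (series (fun l => fser t (p ^ l)))).
  by move=> pp; rewrite /sigma_p tE// real_complex_lim//; exact: h2.
have pE : sigma_prod R A t = (fun n => real_complex R (\prod_(p < n.+1 | prime p) limn (series (fun l => fser t (p ^ l))))).
  by apply/funext => n; rewrite /sigma_prod rmorph_prod/=; apply: eq_bigr => p pp; exact: sE.
exists l; split => //.
- split=> [p pp|].
    by rewrite tE//; apply/cvg_ex; eexists; apply: real_complex_cvg; exact: h2.
  by rewrite pE; apply/cvg_ex; eexists; exact: real_complex_cvg h3.
- by rewrite /sing_series pE real_complex_lim; [congr (real_complex R _); exact: cvg_lim|apply/cvg_ex; exists l].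
- move=> X X0; set B := Cdet * _ * _; set s := fun X => \sum_(1 <= q < X.+1) fser t q.
  have hY Y : (X <= Y)%N -> `|l - s X| - B <= Cdet * (2 / Num.sqrt Y%:R).
    move=> XY; have := h1 Y (leq_trans X0 XY); rewrite -/(s Y).
    have : `|s Y - s X| <= B.
      rewrite /s (@big_cat_nat _ _ _ X.+1 1 Y.+1)//= addrAC subrr add0r.
      apply: (le_trans (ler_norm_sum _ _ _)); rewrite /B.
      apply: (@le_trans _ _ (\sum_(X.+1 <= q < Y.+1) Cdet * Num.sqrt (X%:R^-1 ^+ (d - 5)) * usq q)).
        rewrite !big_nat; apply: ler_sum => q /andP[Xq _]; exact: fser_tail (ltnW Xq).
      by rewrite -mulr_sumr ler_wpM2l ?usq_sum// mulr_ge0 ?sqrtr_ge0.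
    have := ler_distD (s Y) l (s X); lra.
  have := @cvg_tail_bound R Cdet C0 => ct.
  rewrite -subr_le0 -[leRHS](cvg_lim _ ct)//; apply: limr_ge; first by apply/cvg_ex; exists 0.
  by exists X => // Y /= XY; exact: hY.
Qed.

End complete_sums.

(** * Major and minor arcs *)

Section arcs.
Context {R : realType} {d : nat}.
Variable A : 'M[int]_d.
Hypothesis symA : A^T = A.
Hypothesis evenA : forall i, (2 %| A i i)%Z.
Hypothesis detA : \det A != 0.
Hypothesis d5 : (5 <= d)%N.
Local Notation E := 'rV[R]_d.
Local Notation V := 'rV[int]_d.
Local Notation leb := (@lebesgue_measure R).
Local Notation lt := (@lebesgue_tuple R d).
Local Notation cnt := (@counting V R).

Let d0 : (0 < d)%N. Proof. exact: leq_trans d5. Qed.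
Let d4 : (4 <= d)%N. Proof. exact: leq_trans d5. Qed.

Definition gph (q a : nat) (t : int) (b : {ffun 'I_d -> 'I_q}) : R :=
  ph q (a%:Z * (qZ A (resv b) - t)).

Section theta_major.
Variables (N : R) (w : E -> R) (L m : R) (t : int).
Hypothesis N0 : 0 <= N.
Hypothesis hw : wt (2 * d) (2 * d) N w.
Hypothesis L1' : 1 <= L.
Hypothesis Lm : L ^+ 2 * m = t%:~R.

(** The a/q part of the phase is constant on residue classes modulo q. On each class the rest is
    [phi] sampled on a grid of mesh q/L, by L^2 m = t. *)
Lemma theta_split (q a : nat) (be : R) : (0 < q)%N ->
  theta A w L (a%:R / q%:R + be) t%:~R 0 =
  \sum_(b : {ffun 'I_d -> 'I_q}) \int[cnt]_k
    phi A w (be * L ^+ 2) m (gph a t b) (L^-1 *: toR (resv b) + (q%:R / L) *: toR k).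
Proof.
move=> q0; have L0 : 0 < L by exact: lt_le_trans L1'.
have dd : (d <= 2 * d)%N by rewrite leq_pmull.
have Lw : L1 cnt (fun k : V => w (L^-1 *: toR k)).
  by have := wt_lat_L1 d0 0 N0 hw dd L1'; under eq_fun do rewrite add0r.
rewrite /theta (lat_residue q0); last exact: L1_mulcos.
apply: eq_bigr => b _; apply: eq_rint => k; rewrite /phi.
have yE : L^-1 *: toR (resv b + q%:Z *: k) = L^-1 *: toR (resv b) + (q%:R / L) *: toR k :> E.
  by rewrite toRD toRZ scalerDr scalerA [q%:R / L]mulrC.
rewrite yE; congr (_ * _); set z := resv b + q%:Z *: k.
rewrite -yE -/z qformZ qformZE//.
have [n en] := @qZ_mod R d A symA evenA q%:Z (resv b) k.
have -> : 2 * pi * (be * L ^+ 2) * (L^-1 ^+ 2 * (qZ A z)%:~R - m) = 2 * pi * be * ((qZ A z)%:~R - t%:~R).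
  by rewrite -Lm; field; rewrite gt_eqF.
rewrite -[RHS](@cosD2piz _ _ (a%:Z * n)); congr cos.
have qn : q%:R != 0 :> R by rewrite pnatr_eq0 -lt0n.
have zE : qZ A (resv b) = qZ A z - q%:Z * n by rewrite /z en addrK.
rewrite /gph /ph zE !(intrM, intrD, mulrNz) -![(Posz _)%:~R]/(_%:R).
by field.
Qed.

(** [sum_vs_integral] on each residue class with mesh s = q/L; the q^d classes multiply the error
    s^(-d) of one of them to L^d. *)
Lemma theta_major K C : 0 <= C ->
  (forall lam m th i y h, 0 <= h -> K.+1%:R * h <= 1 ->
   `|iter K.+1 (Dv i h) (phi A w lam m th) y| <= C * N * ((1 + `|lam|) * h) ^+ K.+1 * (S y)^-1 ^+ d) ->
  forall (q a : nat) (be : R), (0 < q)%N -> q%:R <= L ->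
  `|theta A w L (a%:R / q%:R + be) t%:~R 0 -
    (L / q%:R) ^+ d * \sum_(b : {ffun 'I_d -> 'I_q}) Ic A w m (gph a t b) (be * L ^+ 2)| <=
  d%:R * 12 ^+ d * C * N * L ^+ d * ((1 + `|be * L ^+ 2|) * (q%:R / L)) ^+ K.+1.
Proof.
move=> C0 hC q a be q0 qL; have L0 : 0 < L by exact: lt_le_trans L1'.
have qp : 0 < q%:R :> R by rewrite ltr0n.
rewrite theta_split// mulr_sumr -sumrB; set lam := be * L ^+ 2; set s := q%:R / L.
have s01 : 0 < s <= 1 by rewrite divr_gt0//= ler_pdivrMr// mul1r.
have s0 : 0 < s by case/andP: s01.
have sL : L / q%:R = s^-1 by rewrite invf_div.
rewrite sL; pose D := C * N * (1 + `|lam|) ^+ K.+1.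
have D0 : 0 <= D by rewrite !mulr_ge0// exprn_ge0// addr_ge0.
have one (b : {ffun 'I_d -> 'I_q}) : `|\int[cnt]_k phi A w lam m (gph a t b) (L^-1 *: toR (resv b) + s *: toR k) -
    s^-1 ^+ d * Ic A w m (gph a t b) lam| <= s^-1 ^+ d * (d%:R * 12 ^+ d * D * s ^+ K.+1).
  have fD i y h : 0 <= h -> K.+1%:R * h <= 1 ->
    `|iter K.+1 (Dv i h) (phi A w lam m (gph a t b)) y| <= D * h ^+ K.+1 * (S y)^-1 ^+ d.
    by move=> h0 h1; apply: (le_trans (hC _ _ _ _ _ _ h0 h1)); rewrite exprMn /D mulrA.
  have h := @sum_vs_integral R d _ (@phi_ct R d A N w hw lam m (gph a t b)) N (@phi_dom R d A d4 N w N0 hw lam m (gph a t b)) K D D0 fD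
    (L^-1 *: toR (resv b)) s s01.
  rewrite -(@ler_pM2l _ (s ^+ d)) ?exprn_gt0// mulrA -exprMn mulfV ?gt_eqF// expr1n mul1r.
  apply: le_trans h; rewrite -[X in X * `|_|](ger0_norm (exprn_ge0 d (ltW s0))) -normrM mulrBr mulrA -exprMn.
  by rewrite mulfV ?gt_eqF// expr1n mul1r.
apply: (le_trans (ler_norm_sum _ _ _)).
apply: (@le_trans _ _ (\sum_(b : {ffun 'I_d -> 'I_q}) s^-1 ^+ d * (d%:R * 12 ^+ d * D * s ^+ K.+1))).
  by apply: ler_sum => b _; exact: one.
rewrite sumr_const card_ffun !card_ord -[leLHS]mulr_natl natrX /D [in leRHS]exprMn.
have sq : q%:R * s^-1 = L by rewrite /s invf_div mulrCA mulfV ?gt_eqF// mulr1.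
clearbody s.
have -> : q%:R ^+ d * (s^-1 ^+ d * (d%:R * 12 ^+ d * (C * N * (1 + `|lam|) ^+ K.+1) * s ^+ K.+1)) =
  (q%:R * s^-1) ^+ d * (d%:R * 12 ^+ d * (C * N * (1 + `|lam|) ^+ K.+1) * s ^+ K.+1).
  by rewrite (exprMn d q%:R) mulrA.
rewrite sq le_eqVlt; apply/orP; left; apply/eqP.
by ring.
Qed.

End theta_major.

Section dissection.
Variables (L P : R).
Hypothesis L1' : 1 <= L.
Hypothesis P1 : 1 <= P.
Hypothesis PL : P <= L.

Let L0 : 0 < L. Proof. exact: lt_le_trans L1'. Qed.
Let P0 : 0 < P. Proof. exact: lt_le_trans P1. Qed.

(** The complement of these arcs, for q <= L/P, is where |q al - a| >= 1/(3LP); the factor 3 leaves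
    room for the arcs to be disjoint and to fit into one period. *)
Definition arcrad (q : nat) : R := (3 * q%:R * L * P)^-1.

Definition on_arc (al : R) (q a : nat) := `|al - a%:R / q%:R| < arcrad q.

Lemma arcrad_gt0 q : (0 < q)%N -> 0 < arcrad q.
Proof. by move=> q0; rewrite invr_gt0 !mulr_gt0// ltr0n. Qed.

(** Distinct fractions are at least 1/(q q') apart, while the two radii add up to (q + q')/(3 q q' L
    P), which is smaller. *)
Lemma arc_disjoint al q a q' a' : (0 < q)%N -> (0 < q')%N -> q%:R <= L / P -> q'%:R <= L / P ->
  coprime a q -> coprime a' q' -> on_arc al q a -> on_arc al q' a' -> q = q' /\ a = a'.
Proof.
move=> q0 q'0 qQ q'Q cq cq' h h'.
have qp : 0 < q%:R :> R by rewrite ltr0n.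
have q'p : 0 < q'%:R :> R by rewrite ltr0n.
have d1 : `|a%:R / q%:R - a'%:R / q'%:R| < arcrad q + arcrad q' :> R.
  apply: le_lt_trans (ltrD h h'); rewrite [`|al - a%:R / _|]distrC.
  exact: ler_distD.
have e1 : (a%:R / q%:R - a'%:R / q'%:R) * (q%:R * q'%:R) = (a%:Z * q'%:Z - a'%:Z * q%:Z)%:~R :> R.
  by rewrite intrB !intrM -![(Posz _)%:~R]/(_%:R); field; rewrite !gt_eqF.
have qq : 0 < q%:R * q'%:R :> R by rewrite mulr_gt0.
have d2 : `|(a%:Z * q'%:Z - a'%:Z * q%:Z)%:~R| < 1 :> R.
  rewrite -e1 normrM [`|_ * _|]gtr0_norm//; have := d1; rewrite -(ltr_pM2r qq).
  move/lt_le_trans; apply; rewrite /arcrad.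
  have -> : ((3 * q%:R * L * P)^-1 + (3 * q'%:R * L * P)^-1) * (q%:R * q'%:R) =
    (q%:R + q'%:R) / (3 * L * P) :> R by field; rewrite !gt_eqF.
  rewrite ler_pdivrMr ?mulr_gt0// mul1r.
  have LP : L / P <= L by rewrite ler_pdivrMr// ler_peMr// ltW.
  by have : L <= L * P; [rewrite ler_peMr// ltW|lra].
have e2 : a%:Z * q'%:Z = a'%:Z * q%:Z.
  apply/eqP; rewrite -subr_eq0 -absz_eq0 -leqn0 -ltnS -(@ltr_nat R).
  by rewrite -[_%:R]/((`|_|%N)%:Z%:~R) abszE intr_norm.
have {}e2 : (a * q' = a' * q)%N by apply/eqP; move/eqP: e2; rewrite -!PoszM.
have qE : q = q'.
  apply/eqP; rewrite eqn_dvd; apply/andP; split.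
    by rewrite -(@Gauss_dvdr q a) 1?coprime_sym// e2 dvdn_mull.
  by rewrite -(@Gauss_dvdr q' a') 1?coprime_sym// -e2 dvdn_mull.
split=> //; apply/eqP; rewrite -(@eqn_pmul2r q')//; apply/eqP.
by rewrite e2 qE.
Qed.

Variables (N : R) (w : E -> R) (t th : R).
Hypothesis N0 : 0 <= N.
Hypothesis hw : wt (2 * d) (2 * d) N w.

(** In the Dirichlet approximation either q > L/P, and [Tsum_q] gives 50 [CT] P; or al lies off the
    arc of a/q, and [Tsum_beta] gives 18 [CT] P. The Weyl bound turns P into P^(d/2). *)
Lemma theta_minor al : - (3 * L * P)^-1 <= al <= 1 - (3 * L * P)^-1 ->
  (forall q a : nat, (0 < q)%N -> q%:R <= L / P -> (a < q)%N -> coprime a q -> ~ on_arc al q a) ->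
  theta A w L al t th ^+ 2 <= cweyl (d := d) A * N ^+ 2 * L ^+ d * (50 * CT * P) ^+ d.
Proof.
move=> /andP[al0 al1] noarc; have [q [a [q0 q3 aq qa]]] := dirichlet al L1'.
have qp : 0 < q%:R :> R by rewrite ltr0n.
have cw : 0 <= cweyl A * N ^+ 2 * L ^+ d :> R.
  by apply: mulr_ge0; [apply: mulr_ge0; [exact: cweyl_ge0|exact: sqr_ge0]|rewrite exprn_ge0// ltW].
have fin B : 0 <= B -> B <= 50 * CT * P -> Tsum_le L al B ->
    theta A w L al t th ^+ 2 <= cweyl (d := d) A * N ^+ 2 * L ^+ d * (50 * CT * P) ^+ d.
  move=> B0 BP hB; apply: (le_trans (weyl symA detA d0 t th N0 hw L1' hB)).
  by rewrite ler_wpM2l// lerXn2r ?nnegrE// (le_trans B0).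
have [qQ|Qq] := leP q%:R (L / P); last first.
  apply: (fin (50 * CT * (L / q%:R))); last exact: Tsum_q L1' q0 q3 aq qa.
    by rewrite !mulr_ge0 ?CT_ge0 ?invr_ge0// ltW.
  rewrite ler_wpM2l ?mulr_ge0 ?CT_ge0//.
  by move: Qq; rewrite ltr_pdivrMr// => /ltW h; rewrite ler_pdivrMr// mulrC.
have far : arcrad q <= `|al - a%:~R / q%:R|.
  rewrite leNgt; apply/negP => near; have := near; rewrite ltr_norml => /andP[n1 n2].
  have rq : arcrad q * q%:R = (3 * L * P)^-1 by rewrite /arcrad; field; rewrite !gt_eqF.
  set ta := (3 * L * P)^-1 in rq al0 al1.
  have ta0 : 0 < ta by rewrite invr_gt0 !mulr_gt0.
  have ta1 : 3 * ta * q%:R <= 1.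
    rewrite /ta; have -> : 3 * (3 * L * P)^-1 * q%:R = q%:R / (L * P) by field; rewrite !gt_eqF.
    rewrite ler_pdivrMr ?mulr_gt0// mul1r; apply: (le_trans qQ); rewrite ler_pdivrMr//.
    by rewrite -mulrA ler_peMr ?mulr_ege1// ltW.
  have q1 : 1 <= q%:R :> R by rewrite ler1n.
  have a1 : a%:~R - ta < al * q%:R by have h := n1; rewrite -(ltr_pM2r qp) mulrBl divfK ?gt_eqF// mulNr rq in h; lra.
  have a2 : al * q%:R < a%:~R + ta by have h := n2; rewrite -(ltr_pM2r qp) mulrBl divfK ?gt_eqF// rq in h; lra.
  (* The range of al forces 0 <= a < q, so that a/q is one of the centres covered by [noarc]. *)
  have a_ge0 : 0 <= a.
    rewrite leNgt; apply/negP => aN; have : a%:~R <= -1 :> R by rewrite -[-1]/((-1)%:~R) ler_int -ltzD1 addNr.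
    nra.
  have a_ltq : a < q%:Z.
    rewrite ltNge; apply/negP => aN; have : q%:R <= a%:~R :> R by rewrite -[q%:R]/(q%:Z%:~R) ler_int.
    nra.
  case: a a_ge0 a_ltq aq near {qa n1 n2 a1 a2} => // a _ aq' cop near.
  by apply: (noarc q a q0 qQ _ _ near).
have qa2 : (3 * L * P)^-1 <= `|q%:R * al - a%:~R|.
  have -> : q%:R * al - a%:~R = (al - a%:~R / q%:R) * q%:R by field; rewrite gt_eqF.
  rewrite normrM [`|q%:R|]gtr0_norm//; have := ler_wpM2r (ltW qp) far.
  by rewrite /arcrad (_ : _^-1 * _ = (3 * L * P)^-1)//; field; rewrite !gt_eqF.
have x0 : 0 < `|q%:R * al - a%:~R| by apply: lt_le_trans qa2; rewrite invr_gt0 !mulr_gt0.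
apply: (fin (6 * CT / (L * `|q%:R * al - a%:~R|))); last first.
- by apply: (Tsum_beta L1' q0 q3 aq qa); rewrite gt_eqF.
- rewrite ler_pdivrMr ?mulr_gt0//; move: qa2; rewrite -div1r ler_pdivrMr ?mulr_gt0//.
  by have := @CT_ge0 R; nra.
- by rewrite divr_ge0 ?mulr_ge0 ?CT_ge0// ltW.
Qed.

End dissection.
End arcs.

Section line_tools.
Context {R : realType}.
Local Notation leb := (@lebesgue_measure R).

Lemma ftc_ind (f F : R -> R) (a b : R) : a < b -> continuous f ->
  (forall x : R, is_derive x (1 : R) F (f x)) ->
  \int[leb]_x (\1_`[a, b] x * f x) = F b - F a.
Proof.
move=> ab cf dF; have dvF x : derivable F x 1 by have [] := dF x.
have cF : continuous F by move=> x; apply/differentiable_continuous/derivable1_diffP.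
have := @continuous_FTC2 _ f F a b ab (continuous_subspaceT cf) _ _.
move=> /(_ _ _)/(congr1 fine) /= <-.
- rewrite /Rintegral; congr fine; rewrite [RHS]integral_mkcond; apply: eq_integral => x _.
  by rewrite patchE indicE; case: ifP => xJ; rewrite ?mul1r ?mul0r.
- split=> [x _||]; [exact: dvF|exact: cvg_at_right_filter (cF a)|exact: cvg_at_left_filter (cF b)].
- by move=> x _; rewrite derive1E; apply: derive_val.
Qed.

Definition arci (r x : R) : R := (`|x| < r)%R%:R.

Lemma arciE r : arci r = \1_(`]-r, r[).
Proof. by apply/funext => x; rewrite indicE /arci mem_setE in_itv/= ltr_norml. Qed.

Lemma measurable_arci r : measurable_fun setT (arci r).
Proof. by rewrite arciE; exact: measurable_indic. Qed.

Lemma arci_ge0 r x : 0 <= arci r x. Proof. by rewrite /arci. Qed.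
Lemma arci_le1 r x : arci r x <= 1. Proof. by rewrite /arci; case: (_ < _). Qed.

Lemma L1_indic (a b : R) : L1 leb (\1_`[a, b]).
Proof.
apply/integrableP; split; first exact/measurable_EFinP/measurable_indic.
rewrite [X in (X < _)%E](_ : _ = \int[leb]_x (\1_`[a, b] x)%:E)%E; last first.
  by apply: eq_integral => x _ /=; rewrite ger0_norm// indicE.
rewrite integral_indic//; rewrite (_ : _ `&` _ = `[a, b]%classic); last by rewrite setIT.
rewrite -[X in (X < _)%E]/(leb `[a, b]%classic) lebesgue_measure_itv/=; case: ifP => _; rewrite ?ltry// -EFinB ltry.
Qed.

Lemma L1_arci (f : R -> R) r c : L1 leb f -> L1 leb (fun x => arci r (x + c) * f x).
Proof.
move=> Lf; apply: (L1_dom _ (L1_norm Lf)).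
  apply: measurable_funM; last exact: L1_measurable Lf.
  apply: (measurableT_comp (measurable_arci r)); exact: measurable_funD.
by move=> x; rewrite normrM ler_piMl// ger0_norm ?arci_ge0 ?arci_le1.
Qed.

Lemma int_cos_period (a : R) (n : int) :
  \int[leb]_x (\1_`[a, a + 1] x * cos (2 * pi * x * n%:~R)) = (n == 0)%:R.
Proof.
have [->|n0] := eqVneq n 0.
  have -> : (fun x => \1_`[a, a + 1] x * cos (2 * pi * x * 0%:~R)) = (fun x => \1_`[a, a + 1] x * (cst 1 x)).
    by apply/funext => x; rewrite mulr0z mulr0 cos0.
  by rewrite (@ftc_ind (cst 1) id) //; [rewrite /= addrAC subrr add0r|rewrite ltrDl|exact: cst_continuous].
have nR : n%:~R != 0 :> R by rewrite intr_eq0.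
have p0 : pi != 0 :> R by rewrite gt_eqF// pi_gt0.
pose F (x : R) := (2 * pi * n%:~R)^-1 * sin (2 * pi * n%:~R * x + 0).
have hd (x : R) : is_derive x (1 : R) F (cos (2 * pi * x * n%:~R)).
  have h := @is_derive_affine R sin (cos (2 * pi * n%:~R * x + 0)) (2 * pi * n%:~R) 0 x.
  have {}h := h (is_derive_sin _).
  have h2 := @is_deriveZ _ _ _ (fun v => sin (2 * pi * n%:~R * v + 0)) (2 * pi * n%:~R)^-1 x 1 _ h.
  apply: is_derive_fun h2 => //; rewrite /GRing.scale/= addr0 mulrA mulVf ?mulf_neq0// mul1r.
  by congr cos; ring.
rewrite (ftc_ind _ _ hd).
- rewrite /F (_ : 2 * pi * n%:~R * (a + 1) + 0 = 2 * pi * n%:~R * a + 0 + 2 * pi * n%:~R); last by ring.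
  by rewrite sinD2piz subrr.
- by rewrite ltrDl.
- move=> x; apply: (@continuous_comp _ _ _ (fun x => 2 * pi * x * n%:~R)); last exact: continuous_cos.
  by apply: cvgM; [apply: cvgM; [exact: cvg_cst|exact: cvg_id]|exact: cvg_cst].
Qed.

End line_tools.

Section lat_product.
Context {R : realType} {d : nat} d1 (T : measurableType d1).
Local Notation V := 'rV[int]_d.

Lemma measurable_lat_prod d' (U : measurableType d') (f : T * V -> U) :
  (forall k, measurable_fun setT (fun x => f (x, k))) -> measurable_fun setT f.
Proof.
move=> mf _ Y mY; rewrite setTI.
have -> : f @^-1` Y = \bigcup_j (if unpickle j is Some k then
    ((fun x => f (x, k)) @^-1` Y) `*` [set k] else set0).
  apply/seteqP; split => [[x k] Yx|[x k] [j _]].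
    by exists (pickle k) => //; rewrite pickleK.
  by case: (unpickle j) => // k' [/= h ->].
apply: bigcup_measurable => j _; case: (unpickle j) => // k.
by apply: measurableX => //; rewrite -[X in measurable X]setTI; exact: mf.
Qed.

End lat_product.

Lemma subn45 (d : nat) : (5 <= d)%N -> (d - 4 = d - 5 + 1)%N.
Proof. lia. Qed.

Lemma muln2_sub (d : nat) : (5 <= d)%N -> (2 * (d - 2) = d + (d - 4))%N.
Proof. lia. Qed.

(** * Assembly of the circle method *)

Section circle.
Context {R : realType} {d : nat}.
Variable A : 'M[int]_d.
Hypothesis symA : A^T = A.
Hypothesis evenA : forall i, (2 %| A i i)%Z.
Hypothesis detA : \det A != 0.
Hypothesis d5 : (5 <= d)%N.
Local Notation E := 'rV[R]_d.
Local Notation V := 'rV[int]_d.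
Local Notation leb := (@lebesgue_measure R).
Local Notation cnt := (@counting V R).

Let d0 : (0 < d)%N. Proof. exact: leq_trans d5. Qed.
Let d4 : (4 <= d)%N. Proof. exact: leq_trans d5. Qed.

Variables (N : R) (w : E -> R) (L P m : R) (t : int) (K : nat) (C : R).
Hypothesis N0 : 0 <= N.
Hypothesis hw : wt (2 * d) (2 * d) N w.
Hypothesis L1' : 1 <= L.
Hypothesis P1 : 1 <= P.
Hypothesis PL : P <= L.
Hypothesis Lm : L ^+ 2 * m = t%:~R.
Hypothesis C0 : 0 <= C.
Hypothesis hC : forall lam m th i y h, 0 <= h -> K.+1%:R * h <= 1 ->
   `|iter K.+1 (Dv i h) (phi A w lam m th) y| <= C * N * ((1 + `|lam|) * h) ^+ K.+1 * (S y)^-1 ^+ d.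

Let L0 : 0 < L. Proof. exact: lt_le_trans L1'. Qed.
Let P0 : 0 < P. Proof. exact: lt_le_trans P1. Qed.

(** The radius of the arc about 0. Starting the period at - tau keeps every arc inside it, with none
    wrapping around. *)
Let tau : R := (3 * L * P)^-1.
Let chi : R -> R := \1_`[- tau, - tau + 1].
Let Th (al : R) : R := theta A w L al t%:~R 0.

Definition lat_sum : R := \int[cnt]_k (w (L^-1 *: toR k) * (qZ A k == t)%:R).

Let Lw : L1 cnt (fun k : V => w (L^-1 *: toR k)).
Proof.
have dd : (d <= 2 * d)%N by rewrite leq_pmull.
by have := wt_lat_L1 d0 0 N0 hw dd L1'; under eq_fun do rewrite add0r.
Qed.

(** Orthogonality of the characters over one period selects F(k) = t. *)
Lemma lat_sum_int : L1 leb (fun al => chi al * Th al) /\ lat_sum = \int[leb]_al (chi al * Th al).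
Proof.
pose f (p : R * V) : R := chi p.1 * (w (L^-1 *: toR p.2) * cos (2 * pi * p.1 * (qZ A p.2 - t)%:~R)).
have mf : measurable_fun setT f.
  apply: measurable_lat_prod => k; rewrite /f /=; apply: measurable_funM; first exact: measurable_indic.
  apply: measurable_funM; first exact: measurable_cst.
  apply: continuous_measurable_fun => x.
  apply: (@continuous_comp _ _ _ (fun x => 2 * pi * x * _)); last exact: continuous_cos.
  by apply: cvgM; [apply: cvgM; [exact: cvg_cst|exact: cvg_id]|exact: cvg_cst].
have dom x k : `|f (x, k)| <= chi x * `|w (L^-1 *: toR k)|.
  rewrite /f /= normrM [`|chi x|]ger0_norm ?ler_wpM2l// ?indicE//.
  by rewrite normrM ler_piMr// norm_cos.
have Lc : L1 leb chi by exact: L1_indic.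
have e1 x : \int[cnt]_k f (x, k) = chi x * Th x.
  rewrite /f/= rintZ; last exact: L1_mulcos.
  congr (_ * _); apply: eq_rint => k; congr (_ * cos _).
  by rewrite addr0 qformZE// intrB.
have := @fub_L1 _ _ (measurableTypeR R) V R leb (@lat_count R d) f chi _ mf Lc (L1_norm Lw) dom.
have := @fubini_dom _ _ (measurableTypeR R) V R leb (@lat_count R d) f chi _ mf Lc (L1_norm Lw) dom.
under eq_rint do rewrite e1.
move=> fu Lf; split; first by move: Lf; under eq_fun do rewrite e1.
rewrite [RHS]fu; apply: eq_rint => k; rewrite /f/=.
have Lcc : L1 leb (fun x => chi x * cos (2 * pi * x * (qZ A k - t)%:~R)).
  apply: (L1_dom _ Lc) => [|x].
    apply: measurable_funM; first exact: measurable_indic.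
    apply: continuous_measurable_fun => x.
    apply: (@continuous_comp _ _ _ (fun x => 2 * pi * x * _)); last exact: continuous_cos.
    by apply: cvgM; [apply: cvgM; [exact: cvg_cst|exact: cvg_id]|exact: cvg_cst].
  by rewrite normrM ger0_norm ?indicE// ler_piMr// norm_cos.
under eq_rint do rewrite mulrCA.
by rewrite rintZ// int_cos_period subr_eq0.
Qed.

Definition term (q a : nat) (be : R) : R :=
  (L / q%:R) ^+ d * \sum_(b : {ffun 'I_d -> 'I_q}) Ic A w m (gph A a t b) (be * L ^+ 2).

(** The arcs being disjoint, at most one summand is nonzero at a given al; off the arcs [model] is
    0. *)
Definition model (al : R) : R :=
  \sum_(1 <= q < (Num.truncn (L / P)).+1) \sum_(a < q | coprime a q)
    arci (arcrad L P q) (al + - (a%:R / q%:R)) * term q a (al + - (a%:R / q%:R)).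

(** [E1] is the error of [theta_major], as (1 + |be| L^2) q/L <= 2/P on an arc; [E2] is the bound
    off the arcs. *)
Let E1 : R := d%:R * 12 ^+ d * C * N * L ^+ d * (2 / P) ^+ K.+1.
Let E2 : R := Num.sqrt (cweyl (d := d) A * N ^+ 2 * L ^+ d * (50 * CT * P) ^+ d).

Lemma le_truncn q : (q < (Num.truncn (L / P)).+1)%N -> q%:R <= L / P.
Proof.
rewrite ltnS => h; apply: (@le_trans _ _ (Num.truncn (L / P))%:R); first by rewrite ler_nat.
by rewrite truncn_le divr_ge0// ltW.
Qed.

Lemma truncn_ge q : q%:R <= L / P -> (q < (Num.truncn (L / P)).+1)%N.
Proof. by move=> h; rewrite ltnS truncn_ge_nat ?divr_ge0// ltW. Qed.

Lemma Ic_scaled th : L1 leb (fun be => Ic A w m th (be * L ^+ 2)) /\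
  \int[leb]_be Ic A w m th (be * L ^+ 2) = L^-1 ^+ 2 * \int[leb]_lam Ic A w m th lam.
Proof.
have LI : L1 leb (Ic A w m th).
  apply: (L1_dom _ (L1Z (Num.sqrt (cI (d := d) A) * N) (L1Z 2 L1_rho))) => [|x].
    by apply: continuous_measurable_fun; exact: (@Ic_continuous R d A d4 N w N0 hw m).
  exact: (@Ic_rho R d A symA detA d4 N w N0 hw x m th).
have [h1 h2] := leb_affine 0 (exprn_gt0 2 L0) LI.
split; first by move: h1; under eq_fun do rewrite addr0 mulrC.
by rewrite exprVn -h2; apply: eq_rint => x; rewrite addr0 mulrC.
Qed.

Lemma L1_term q a : L1 leb (term q a).
Proof. by apply: L1Z; apply: L1_sum => b; have [] := Ic_scaled (gph A a t b). Qed.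

Lemma L1_arc_term q a c r : L1 leb (fun al => arci r (al + c) * term q a (al + c)).
Proof.
have [h _] := leb_affine c ltr01 (L1_term q a).
by apply: L1_arci; move: h; under eq_fun do rewrite mul1r.
Qed.

Lemma arc_sub q a al : (0 < q)%N -> q%:R <= L / P -> (a < q)%N -> coprime a q ->
  on_arc L P al q a -> - tau <= al <= - tau + 1.
Proof.
move=> q0 qQ aq cop; rewrite /on_arc /arcrad ltr_norml => /andP[h1 h2].
have qp : 0 < q%:R :> R by rewrite ltr0n.
have q1 : 1 <= q%:R :> R by rewrite ler1n.
have rE : (3 * q%:R * L * P)^-1 = tau / q%:R by rewrite /tau; field; rewrite !gt_eqF.
rewrite rE in h1 h2.
have tau0 : 0 < tau by rewrite invr_gt0 !mulr_gt0.
have tq : tau / q%:R <= tau by rewrite ler_pdivrMr// ler_peMr// ltW.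
have a0 : 0 <= a%:R / q%:R :> R by rewrite divr_ge0.
have tq3 : 3 * tau * q%:R <= 1.
  rewrite /tau; have -> : 3 * (3 * L * P)^-1 * q%:R = q%:R / (L * P) by field; rewrite !gt_eqF.
  rewrite ler_pdivrMr ?mulr_gt0// mul1r; apply: (le_trans qQ); rewrite ler_pdivrMr//.
  by rewrite -mulrA ler_peMr ?mulr_ege1// ltW.
have tq4 : 3 * tau <= q%:R^-1 by rewrite -[leRHS]mul1r ler_pdivlMr.
have a1 : a%:R / q%:R <= 1 - q%:R^-1 :> R.
  rewrite ler_pdivrMr// mulrBl mul1r mulVf ?gt_eqF// lerBrDr natr1 ler_nat.
  by [].
apply/andP; split; lra.
Qed.

Lemma model_close al : - tau <= al <= - tau + 1 -> `|Th al - model al| <= E1 + E2.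
Proof.
move=> alJ; have E10 : 0 <= E1.
  by rewrite /E1 !mulr_ge0// exprn_ge0 ?divr_ge0 ?ltW.
have E20 : 0 <= E2 by exact: sqrtr_ge0.
have [[q [a [q0 qQ aq cop arc]]]|no] := pselect (exists q a : nat,
    [/\ (0 < q)%N, q%:R <= L / P, (a < q)%N, coprime a q & on_arc L P al q a]).
  have mE : model al = term q a (al + - (a%:R / q%:R)).
    rewrite /model (bigD1_seq q)/= ?iota_uniq ?mem_index_iota ?q0 ?truncn_ge//.
    rewrite [X in _ + X]big1_seq ?addr0 => [|q' /andP[q'q]].
      rewrite (bigD1 (Ordinal aq))//= big1 ?addr0 => [|a' /andP[ca' a'a]].
        by move: arc; rewrite /arci /on_arc => ->; rewrite mul1r.
      rewrite /arci; case: ltP => arc'; last by rewrite mul0r.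
      have [_ e] := arc_disjoint L1' P1 q0 q0 qQ qQ ca' cop arc' arc.
      by move: a'a; rewrite -val_eqE /= e eqxx.
    rewrite mem_index_iota => /andP[q'0 q'Q]; apply: big1 => a' ca'.
    rewrite /arci; case: ltP => arc'; last by rewrite mul0r.
    have [e _] := arc_disjoint L1' P1 q'0 q0 (le_truncn q'Q) qQ ca' cop arc' arc.
    by rewrite e eqxx in q'q.
  rewrite mE; set be := al + - (a%:R / q%:R).
  have qp : 0 < q%:R :> R by rewrite ltr0n.
  have qL : q%:R <= L by apply: (le_trans qQ); rewrite ler_pdivrMr// ler_peMr// ltW.
  have := theta_major symA evenA d5 N0 hw L1' Lm C0 hC a be q0 qL.
  rewrite (_ : a%:R / q%:R + be = al); last by rewrite /be addrC subrK.
  move=> h; apply: (le_trans h); apply: (@le_trans _ _ E1); last by rewrite lerDl.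
  rewrite /E1 ler_wpM2l//; first by rewrite !mulr_ge0// exprn_ge0// ltW.
  apply: lerXn2r; rewrite ?nnegrE; [by rewrite mulr_ge0 ?addr_ge0 ?divr_ge0 ?(ltW L0)|by rewrite divr_ge0 ?(ltW P0)|].
  rewrite mulrDl mul1r; have x1 : q%:R / L <= P^-1.
    by rewrite ler_pdivrMr// mulrC.
  have x2 : `|be * L ^+ 2| * (q%:R / L) <= P^-1.
    rewrite normrM [`|L ^+ 2|]ger0_norm ?exprn_ge0 ?(ltW L0)//.
    have -> : `|be| * L ^+ 2 * (q%:R / L) = `|be| * (L * q%:R) by field; rewrite gt_eqF.
    have := arc; rewrite /on_arc -/be => /ltW hb.
    apply: (le_trans (ler_wpM2r _ hb)); first by rewrite mulr_ge0// ltW.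
    rewrite /arcrad (_ : _^-1 * _ = P^-1 / 3); last by field; rewrite !gt_eqF.
    by rewrite ler_pdivrMr// ler_peMr ?invr_ge0 ?(ltW P0)// ler1n.
  lra.
have -> : model al = 0.
  rewrite /model big1_seq// => q; rewrite mem_index_iota => /andP[_ /andP[q0 qQ]].
  apply: big1 => a ca; rewrite /arci; case: ltP => arc; last by rewrite mul0r.
  by exfalso; apply: no; exists q, a; split => //; exact: le_truncn.
rewrite subr0; apply: (@le_trans _ _ E2); last by rewrite lerDr.
rewrite -sqrtr_sqr ler_wsqrtr//.
apply: (theta_minor symA detA d5 L1' P1 t%:~R 0 N0 hw); first by move: alJ; rewrite [- _ + 1]addrC.
by move=> q a q0 qQ aq cop arc; apply: no; exists q, a.
Qed.

Lemma L1_model : L1 leb model.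
Proof. by apply: L1_sum => q; apply: L1_sum => a; exact: L1_arc_term. Qed.

Lemma chi_model al : chi al * model al = model al.
Proof.
rewrite /chi indicE mem_setE in_itv/=; have [h|h] := boolP (- tau <= al <= - tau + 1); rewrite ?mul1r ?mul0r//.
rewrite /model big1_seq// => q; rewrite mem_index_iota => /andP[_ /andP[q0 qQ]].
apply: big1 => a ca; rewrite /arci; case: ltP => arc; last by rewrite mul0r.
by move: h; rewrite (arc_sub q0 (le_truncn qQ) (ltn_ord a) ca arc).
Qed.

Lemma int_chi : \int[leb]_x chi x = 1.
Proof.
have := @ftc_ind R (cst 1) id (- tau) (- tau + 1) _ (@cst_continuous _ _ _) _.
rewrite ltrDl ltr01 => /(_ isT) h; rewrite -[RHS](_ : - tau + 1 - - tau = 1); last by ring.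
by rewrite -h; apply: eq_rint => x; rewrite mulr1.
Qed.

Lemma lat_sum_model : `|lat_sum - \int[leb]_al model al| <= E1 + E2.
Proof.
have [Lt ->] := lat_sum_int; rewrite -rintB//; last exact: L1_model.
rewrite -[leRHS]mulr1 -int_chi -rintZ; last exact: L1_indic.
apply: rint_norm; first by apply: (@L1_measurable _ _ _ leb); apply: L1B; [exact: Lt|exact: L1_model].
  by apply: L1Z; exact: L1_indic.
move=> al; rewrite -{1}chi_model -mulrBr /chi indicE mem_setE in_itv/=.
have [h|h] := boolP (- tau <= al <= - tau + 1); rewrite ?mul1r ?mul0r ?mulr0 ?mulr1 ?normr0//.
exact: model_close.
Qed.

Let I0 (r : R) : R := \int[leb]_be (arci r be * Ic A w m 0 (be * L ^+ 2)).

Lemma Ic_rot th lam : Ic A w m th lam = cos th * Ic A w m 0 lam - sin th * Ic A w m (- (pi / 2)) lam.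
Proof.
have Lp := @L1_phi R d A d4 N w N0 hw.
rewrite /Ic -!rintZ; [|exact: Lp|exact: Lp].
rewrite -rintB; [|exact/L1Z/Lp|exact/L1Z/Lp].
apply: eq_rint => x; rewrite /phi addr0 cosBpihalf cosD; ring.
Qed.

(** [Ic_rot] takes the phase [gph] out of the integral. Summed over a and b, the cosines give [SR]
    and the sines vanish by [SI0]. *)
Lemma model_int : \int[leb]_al model al =
  \sum_(1 <= q < (Num.truncn (L / P)).+1) L ^+ d * fser A t q * I0 (arcrad L P q).
Proof.
rewrite /model rint_sum => [|q]; last by apply: L1_sum => a; exact: L1_arc_term.
rewrite big_seq [RHS]big_seq; apply: eq_bigr => q; rewrite mem_index_iota => /andP[q0 _].
rewrite rint_sum => [|a]; last exact: L1_arc_term.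
pose I1 := \int[leb]_be (arci (arcrad L P q) be * Ic A w m (- (pi / 2)) (be * L ^+ 2)).
have LI th : L1 leb (fun be => arci (arcrad L P q) be * Ic A w m th (be * L ^+ 2)).
  have [h _] := Ic_scaled th; have := L1_arci (arcrad L P q) 0 h.
  by under eq_fun do rewrite addr0.
have one (a : 'I_q) : \int[leb]_al (arci (arcrad L P q) (al + - (a%:R / q%:R)) * term q a (al + - (a%:R / q%:R))) =
   (L / q%:R) ^+ d * ((\sum_(b : {ffun 'I_d -> 'I_q}) cos (gph A a t b)) * I0 (arcrad L P q) -
    (\sum_(b : {ffun 'I_d -> 'I_q}) sin (gph A a t b)) * I1).
  have L1t : L1 leb (fun be => arci (arcrad L P q) be * term q a be).
    have := L1_arci (arcrad L P q) 0 (L1_term q a); by under eq_fun do rewrite addr0.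
  have [_ h] := leb_affine (- (a%:R / q%:R)) ltr01 L1t.
  rewrite invr1 mul1r in h; under eq_rint do rewrite -[X in X + _]mul1r.
  rewrite h {h}; under eq_rint do rewrite /term mulrCA.
  rewrite rintZ; last first.
    under eq_fun do rewrite mulr_sumr; apply: L1_sum => b; exact: LI.
  congr (_ * _); under eq_rint do rewrite mulr_sumr.
  rewrite rint_sum => [|b]; last exact: LI.
  rewrite !mulr_suml -sumrB; apply: eq_bigr => b _.
  rewrite -!rintZ ?LI// -rintB; [|exact/L1Z/LI|exact/L1Z/LI].
  by apply: eq_rint => be; rewrite Ic_rot; ring.
under eq_bigr do rewrite one.
rewrite -mulr_sumr sumrB -!mulr_suml.
rewrite -/(SI A q t) (SI0 A t q0) mul0r subr0 -/(SR A q t) /fser exprMn.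
by rewrite !mulrA.
Qed.

Definition Jc : R := \int[leb]_lam Ic A w m 0 lam.
Definition CI : R := Num.sqrt (cI (d := d) A).
Definition Crho : R := \int[leb]_x @rho R x.

Lemma Crho_ge0 : 0 <= Crho. Proof. by apply: rint_ge0 => x; exact: rho_ge0. Qed.

Lemma Jc_bound : `|Jc| <= 2 * CI * N * Crho.
Proof.
apply: (@le_trans _ _ (\int[leb]_x (CI * N * (2 * rho x)))).
  apply: rint_norm => [|| x]; last exact: (@Ic_rho R d A symA detA d4 N w N0 hw x m 0).
    by apply: continuous_measurable_fun; exact: (@Ic_continuous R d A d4 N w N0 hw m).
  exact/L1Z/L1Z/L1_rho.
rewrite rintZ; last exact/L1Z/L1_rho.
by rewrite rintZ; [rewrite /Crho le_eqVlt; apply/orP; left; apply/eqP; ring|exact: L1_rho].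
Qed.

(** The cut at |be| = r is a cut at |lam| = L^2 r, where [Ic_tail] applies. *)
Lemma I0_tail r : 0 < r ->
  `|I0 r - L^-1 ^+ 2 * Jc| <= 2 * CI * N * Crho * (r * Num.sqrt ((L ^+ 2 * r)^-1 ^+ d)).
Proof.
move=> r0; have [LI EI] := Ic_scaled 0; rewrite -EI.
have LA : L1 leb (fun be => arci r be * Ic A w m 0 (be * L ^+ 2)).
  have := L1_arci r 0 LI; by under eq_fun do rewrite addr0.
rewrite distrC -rintB//; set X := L ^+ 2 * r.
have X0 : 0 < X by rewrite mulr_gt0 ?exprn_gt0.
have r10 : 0 < r^-1 by rewrite invr_gt0.
have [Lr Er] := leb_affine 0 r10 (@L1_rho R); rewrite invrK in Er.
set B := CI * N * Num.sqrt (X^-1 ^+ d).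
apply: (@le_trans _ _ (\int[leb]_x (B * (2 * rho (r^-1 * x + 0))))).
  apply: rint_norm => [||x].
  - by apply: (@L1_measurable _ _ _ leb); exact: L1B.
  - exact/L1Z/L1Z.
  - have B0 : 0 <= B * (2 * rho (r^-1 * x + 0)) by rewrite !mulr_ge0 ?sqrtr_ge0// rho_ge0.
    rewrite /arci; case: ltP => h; first by rewrite mul1r subrr normr0.
    rewrite mul0r subr0 /B.
    have := @Ic_tail R d A symA detA d4 N w N0 hw X (x * L ^+ 2) m 0 X0.
    rewrite (_ : x * L ^+ 2 / X = r^-1 * x + 0); last by rewrite /X; field; rewrite !gt_eqF.
    apply; rewrite normrM [`|L ^+ 2|]ger0_norm ?exprn_ge0 ?(ltW L0)// /X mulrC.
    by rewrite ler_wpM2r// exprn_ge0// ltW.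
rewrite rintZ; last exact/L1Z.
rewrite rintZ// Er /B -/Crho le_eqVlt; apply/orP; left; apply/eqP.
by ring.
Qed.


Variable sg : R.
Hypothesis hsg : forall X, (0 < X)%N -> `|sg - \sum_(1 <= q < X.+1) fser A t q| <=
        Cdet A * Num.sqrt (X%:R^-1 ^+ (d - 5)) * (2 / Num.sqrt X%:R).
Hypothesis LPK : L ^+ d <= P ^+ (2 * K.+1).

Let Q : R := L / P.
Let Q1 : 1 <= Q. Proof. by rewrite ler_pdivlMr// mul1r. Qed.
Let Qn := Num.truncn Q.
Let Qn0 : (0 < Qn)%N. Proof. by rewrite truncn_gt0. Qed.
Let QnQ : Qn%:R <= Q. Proof. by rewrite truncn_le (le_trans _ Q1). Qed.
Let QnQ2 : Q <= 2 * Qn%:R.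
Proof.
have : Q < Qn.+1%:R by exact: truncnS_gt.
have : 1 <= Qn%:R :> R by rewrite ler1n.
by rewrite -natr1; lra.
Qed.
Let G : R := Num.sqrt (Q^-1 ^+ (d - 4)).

(** For a given q the cost is q^(1-d/2) (Q/q)^(1-d/2) = Q^(1-d/2) up to constants: the powers of q
    cancel. The sum over at most Q values of q is Q^(2-d/2) = [G]. *)
Lemma completed_sum :
  `|\sum_(1 <= q < Qn.+1) L ^+ d * fser A t q * (I0 (arcrad L P q) - L^-1 ^+ 2 * Jc)| <=
  L ^+ d * L^-1 ^+ 2 * (2 * CI * N * Crho) * Cdet A * Num.sqrt (3 ^+ d) * G.
Proof.
have Q0 : 0 < Q by exact: lt_le_trans Q1.
set B := 2 * CI * N * Crho.
have B0 : 0 <= B by rewrite !mulr_ge0 ?sqrtr_ge0// Crho_ge0.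
apply: (le_trans (ler_norm_sum _ _ _)).
pose c := L ^+ d * L^-1 ^+ 2 * B * Cdet A * Num.sqrt (3 ^+ d) * (Q * Num.sqrt (Q^-1 ^+ d)).
apply: (@le_trans _ _ (\sum_(1 <= q < Qn.+1) c)).
  rewrite big_seq [leRHS]big_seq; apply: ler_sum => q; rewrite mem_index_iota => /andP[q0 _].
  have qp : 0 < q%:R :> R by rewrite ltr0n.
  rewrite normrM normrM [`|L ^+ d|]ger0_norm ?exprn_ge0 ?(ltW L0)//.
  have h1 := fser_bound (R := R) symA evenA detA t q0; have h2 := I0_tail (arcrad_gt0 L1' P1 q0).
  have Ld : 0 <= L ^+ d by rewrite exprn_ge0// ltW.
  rewrite -mulrA; apply: (le_trans (ler_wpM2l Ld (ler_pM (normr_ge0 _) (normr_ge0 _) h1 h2))).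
  have rE : L ^+ 2 * arcrad L P q = Q / (3 * q%:R) by rewrite /arcrad /Q; field; rewrite !gt_eqF.
  rewrite rE; have rE2 : arcrad L P q = L^-1 ^+ 2 * (Q / (3 * q%:R)).
    by rewrite -rE mulrA -exprMn mulVf ?gt_eqF// expr1n mul1r.
  rewrite rE2.
  have sE : Num.sqrt (q%:R^-1 ^+ d) * Num.sqrt ((Q / (3 * q%:R))^-1 ^+ d) = Num.sqrt (3 ^+ d) * Num.sqrt (Q^-1 ^+ d) :> R.
    rewrite -sqrtrM ?exprn_ge0 ?invr_ge0 ?(ltW qp)// -exprMn.
    have -> : q%:R^-1 * (Q / (3 * q%:R))^-1 = 3 * Q^-1 :> R by field; rewrite !gt_eqF.
    by rewrite exprMn sqrtrM ?exprn_ge0.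
  have -> : L ^+ d * (Cdet A * (q%:R * Num.sqrt (q%:R^-1 ^+ d)) * (B * (L^-1 ^+ 2 * (Q / (3 * q%:R)) * Num.sqrt ((Q / (3 * q%:R))^-1 ^+ d)))) =
    L ^+ d * Cdet A * B * L^-1 ^+ 2 * (Q / 3) * (Num.sqrt (q%:R^-1 ^+ d) * Num.sqrt ((Q / (3 * q%:R))^-1 ^+ d)).
    clearbody B; move: (Num.sqrt (q%:R^-1 ^+ d)) (Num.sqrt ((Q / (3 * q%:R))^-1 ^+ d)) (Cdet A) (L ^+ d) => a b c' e.
    by field; rewrite !gt_eqF.
  rewrite sE /c; set x := Num.sqrt (3 ^+ d); set y := Num.sqrt (Q^-1 ^+ d).
  have -> : L ^+ d * Cdet A * B * L^-1 ^+ 2 * (Q / 3) * (x * y) = (L ^+ d * L^-1 ^+ 2 * B * Cdet A * x * (Q * y)) / 3 by ring.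
  have x0 : 0 <= x := sqrtr_ge0 _; have y0 : 0 <= y := sqrtr_ge0 _.
  have Y0 : 0 <= L ^+ d * L^-1 ^+ 2 * B * Cdet A * x * (Q * y).
    have Li : 0 <= L^-1 by rewrite invr_ge0 ltW.
    by do ?[exact: B0|exact: x0|exact: y0|exact: (ltW Q0)|exact: Ld|exact: Li|apply: sqrtr_ge0|apply: mulr_ge0|apply: exprn_ge0].
  by rewrite ler_pdivrMr// ler_peMr ?ler1n.
have Li : 0 <= L^-1 by rewrite invr_ge0 ltW.
have c0 : 0 <= c.
  by do ?[exact: B0|exact: (ltW Q0)|exact: (ltW L0)|exact: Li|apply: sqrtr_ge0|apply: mulr_ge0|apply: exprn_ge0].
rewrite sumr_const_nat subn1/= -[leLHS]mulr_natl; apply: (le_trans (ler_wpM2r c0 QnQ)).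
rewrite le_eqVlt; apply/orP; left; apply/eqP; rewrite /c /G.
have d4' : d = (d - 4 + 4)%N by rewrite subnK.
rewrite [in Num.sqrt (Q^-1 ^+ d)]d4' exprD sqrtrM ?exprn_ge0 ?invr_ge0 ?(ltW Q0)//.
rewrite (exprM _ 2 2) sqrtr_sqr ger0_norm ?exprn_ge0 ?invr_ge0 ?(ltW Q0)//.
by move: (Num.sqrt (Q^-1 ^+ (d - 4))) (Num.sqrt (3 ^+ d)) (Cdet A) (L ^+ d) => u v x y; field; rewrite !gt_eqF.
Qed.

Lemma circle_tail : `|sg - \sum_(1 <= q < Qn.+1) fser A t q| <= 2 * Cdet A * Num.sqrt (2 ^+ (d - 4)) * G.
Proof.
have Q0 : 0 < Q by exact: lt_le_trans Q1.
apply: (le_trans (hsg Qn0)); have n0 : 0 < Qn%:R :> R by rewrite ltr0n.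
have -> : Cdet A * Num.sqrt (Qn%:R^-1 ^+ (d - 5)) * (2 / Num.sqrt Qn%:R) =
   2 * Cdet A * Num.sqrt (Qn%:R^-1 ^+ (d - 4)) :> R.
  rewrite -sqrtrV ?(ltW n0)//.
  rewrite (subn45 d5) exprD expr1 sqrtrM ?exprn_ge0 ?invr_ge0 ?(ltW n0)//; ring.
rewrite -[leRHS]mulrA; apply: ler_wpM2l; first by rewrite mulr_ge0 ?sqrtr_ge0.
rewrite /G -sqrtrM ?exprn_ge0// -exprMn ler_wsqrtr// lerXn2r ?nnegrE ?mulr_ge0 ?invr_ge0 ?(ltW n0) ?(ltW Q0)//.
by rewrite ler_pdivlMr// mulrC ler_pdivrMr.
Qed.

Let Tg : R := Num.sqrt ((L * P) ^+ d).

Definition cmain : R := d%:R * 12 ^+ d * C * 2 ^+ K.+1 + Num.sqrt (cI (d := d) A) +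
  (2 * CI * Crho) * Cdet A * Num.sqrt (3 ^+ d) + (2 * CI * Crho) * (2 * Cdet A * Num.sqrt (2 ^+ (d - 4))).

(** Four errors, one for each summand of [cmain]: on the arcs, off the arcs, completing the
    integrals, and completing the series. *)
Lemma circle_method : `|lat_sum - Jc * sg * L ^+ (d - 2)| <= cmain * N * Tg.
Proof.
have Q0 : 0 < Q by exact: lt_le_trans Q1.
have T0 : 0 <= Tg by exact: sqrtr_ge0.
have LE : L ^+ d * L^-1 ^+ 2 = L ^+ (d - 2).
  have d2 : d = (d - 2 + 2)%N by rewrite subnK// (leq_trans _ d5).
  by rewrite {1}d2 exprD exprVn mulfK// expf_neq0// gt_eqF.
(* L^(d-2) (P/L)^((d-4)/2) = L^(d/2) P^((d-4)/2). *)
have GT : L ^+ (d - 2) * G <= Tg.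
  rewrite /G /Tg -[X in X * _](ger0_norm (exprn_ge0 _ (ltW L0))) -sqrtr_sqr -sqrtrM ?sqr_ge0//.
  rewrite ler_wsqrtr// -exprM mulnC.
  have -> : Q^-1 = P / L by rewrite invf_div.
  have -> : L ^+ (2 * (d - 2)) * (P / L) ^+ (d - 4) = L ^+ d * P ^+ (d - 4).
    rewrite (muln2_sub d5) exprD exprMn exprVn.
    have := expf_neq0 (d - 4) (lt0r_neq0 L0); move: (L ^+ (d - 4)) (L ^+ d) (P ^+ (d - 4)) => x y z x0.
    by field.
  rewrite exprMn ler_wpM2l ?exprn_ge0 ?(ltW L0)//.
  by rewrite ler_weXn2l ?leq_subr.
(* By [LPK], P^(K+1) >= L^(d/2), so the error on the arcs is already O(L^(d/2)). *)
have E1T : E1 <= d%:R * 12 ^+ d * C * 2 ^+ K.+1 * N * Tg.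
  have h : L ^+ d * P^-1 ^+ K.+1 <= Tg.
    apply: (@le_trans _ _ (Num.sqrt (L ^+ d))).
      rewrite exprVn ler_pdivrMr ?exprn_gt0//.
      rewrite -{1}(sqr_sqrtr (exprn_ge0 d (ltW L0))) expr2 ler_wpM2l ?sqrtr_ge0//.
      rewrite -[leRHS]ger0_norm ?exprn_ge0 ?(ltW P0)// -sqrtr_sqr ler_wsqrtr// -exprM mulnC.
      exact: LPK.
    rewrite ler_wsqrtr// exprMn ler_peMr ?exprn_ge0 ?(ltW L0)//.
    exact: exprn_ege1.
  have c0 : 0 <= d%:R * 12 ^+ d * C * 2 ^+ K.+1 * N by rewrite !mulr_ge0// exprn_ge0.
  apply: le_trans (ler_wpM2l c0 h); rewrite /E1 exprMn le_eqVlt; apply/orP; left; apply/eqP.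
  by move: (P^-1 ^+ K.+1) (2 ^+ K.+1) (12 ^+ d) (L ^+ d) => a b c e; ring.
have E2T : E2 <= Num.sqrt (cI (d := d) A) * N * Tg.
  have cI0 : 0 <= cI (d := d) A :> R by exact: cI_ge0.
  rewrite /E2 /Tg -[N in leRHS]ger0_norm// -sqrtr_sqr -(sqrtrM _ cI0) -(sqrtrM _ (mulr_ge0 cI0 (sqr_ge0 _))).
  rewrite ler_wsqrtr// /cI (exprMn d (50 * CT)) (exprMn d L).
  move: (cweyl A) (N ^+ 2) ((50 * CT) ^+ d) (L ^+ d) (P ^+ d) => a b c e f.
  by rewrite le_eqVlt; apply/orP; left; apply/eqP; ring.
have J0 := Jc_bound; have cs := completed_sum; have ct := circle_tail.
have lm := lat_sum_model; rewrite model_int -/Q -/Qn in lm.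
set Sg := \sum_(1 <= q < Qn.+1) fser A t q in ct.
have cS : \sum_(1 <= q < Qn.+1) L ^+ d * fser A t q * (I0 (arcrad L P q) - L^-1 ^+ 2 * Jc) =
  \sum_(1 <= q < Qn.+1) L ^+ d * fser A t q * I0 (arcrad L P q) - L ^+ (d - 2) * Jc * Sg.
  rewrite -LE /Sg mulr_sumr -sumrB; apply: eq_bigr => q _.
  by move: (L ^+ d) => x; ring.
rewrite cS {cS} in cs; set Z := \sum_(1 <= q < Qn.+1) _ in cs lm.
have -> : lat_sum - Jc * sg * L ^+ (d - 2) =
  (lat_sum - Z) + (Z - L ^+ (d - 2) * Jc * Sg) - L ^+ (d - 2) * Jc * (sg - Sg) by ring.
apply: (le_trans (ler_normB _ _)); have B0 : 0 <= 2 * CI * Crho by rewrite !mulr_ge0 ?sqrtr_ge0// Crho_ge0.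
have dist (a b c e u v : R) : (a + b + c + e) * u * v = a * u * v + b * u * v + c * u * v + e * u * v by ring.
rewrite /cmain dist; apply: lerD.
  apply: (le_trans (ler_normD _ _)); apply: lerD.
    by apply: (le_trans lm); apply: lerD.
  apply: (le_trans cs); rewrite LE.
  have c0 : 0 <= 2 * CI * Crho * Cdet A * Num.sqrt (3 ^+ d) * N by rewrite !mulr_ge0 ?exprn_ge0 ?sqrtr_ge0// Crho_ge0.
  apply: le_trans (ler_wpM2l c0 GT); rewrite le_eqVlt; apply/orP; left; apply/eqP.
  by move: (Num.sqrt (3 ^+ d)) (Cdet A) G (L ^+ _) CI Crho => a b c e f g; ring.
rewrite normrM normrM [`|L ^+ _|]ger0_norm ?exprn_ge0 ?(ltW L0)//.
have Ld : 0 <= L ^+ (d - 2) by rewrite exprn_ge0// ltW.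
apply: (le_trans (ler_pM _ (normr_ge0 _) (ler_wpM2l Ld J0) ct)); first by rewrite mulr_ge0.
have c0 : 0 <= 2 * CI * Crho * (2 * Cdet A * Num.sqrt (2 ^+ (d - 4))) * N.
  by rewrite !mulr_ge0 ?exprn_ge0 ?sqrtr_ge0// Crho_ge0.
apply: le_trans (ler_wpM2l c0 GT); rewrite le_eqVlt; apply/orP; left; apply/eqP.
by move: (Num.sqrt (2 ^+ _)) (Cdet A) G (L ^+ _) CI Crho => a b c e f g; ring.
Qed.

End circle.

(** * Integration by parts and the Poisson kernel *)

Section ibp.
Context {R : realType} {d : nat}.
Local Notation E := 'rV[R]_d.
Local Notation V := 'rV[int]_d.
Local Notation lt := (@lebesgue_tuple R d).
Local Notation row := (@row_of_tuple R d).
Local Notation cnt := (@counting V R).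

Lemma ct_rV (T : topologicalType) (h : T -> E) :
  (forall j, continuous (fun t => h t 0 j)) -> continuous h.
Proof.
move=> ch t; apply/cvg_ballP => e e0.
have : \forall u \near t, forall j, ball (h t 0 j) e (h u 0 j).
  by apply: filter_forall => j; apply: (ch j t); exact: nbhsx_ballx.
by apply: filterS => u hu; split=> // i j; rewrite (ord1 i); exact: hu.
Qed.

Lemma ct_coord (j : 'I_d) : continuous (fun y : E => y 0 j).
Proof. exact: coord_continuous. Qed.

Lemma ct_shift (v : E) : continuous (fun y : E => y + v).
Proof.
apply: ct_rV => j; rewrite (_ : (fun y : E => (y + v) 0 j) = (fun y => y 0 j + v 0 j)).
  by apply: ctD; [exact: ct_coord|exact: ctC].
by apply/funext => y; rewrite mxE.
Qed.

Lemma invn1 : (forall n, 0 < (n.+1%:R^-1 : R) <= 1) /\ (fun n => n.+1%:R^-1 : R) @ \oo --> 0.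
Proof.
split=> [n|]; last exact: cvg_harmonic.
by rewrite invr_gt0 ltr0n invf_le1 ?ler1n.
Qed.

Lemma shift_dom (f : E -> R) (C : R) (v : E) : 0 <= C -> (forall y, `|f y| <= C * (S y)^-1 ^+ d) ->
  forall y, `|f (y + v)| <= C * (2 * S v) ^+ d * (S y)^-1 ^+ d.
Proof.
move=> C0 fC y; apply: (le_trans (fC _)); rewrite -mulrA -exprMn ler_wpM2l//.
apply: lerXn2r; rewrite ?nnegrE ?Sinv_ge0 ?mulr_ge0 ?Sinv_ge0//; first by rewrite ltW// S_gt0.
exact: Sinv_shift.
Qed.

(** Both sides are limits of the same Riemann sums, on a grid with offset [v]. *)
Lemma rint_shift (f : E -> R) (C : R) (v : E) : 0 <= C -> continuous f ->
  (forall y, `|f y| <= C * (S y)^-1 ^+ d) ->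
  \int[lt]_x f (row x + v) = \int[lt]_x f (row x).
Proof.
move=> C0 cf fC; have [s01 s0] := invn1.
have cfv : continuous (fun y : E => f (y + v)).
  move=> y; apply: (@continuous_comp _ _ _ (fun y : E => y + v) f); last exact: cf.
  exact: ct_shift.
have h1 := riemann_cvg cf fC v s01 s0.
have h2 := riemann_cvg cfv (shift_dom v C0 fC) 0 s01 s0.
have e : (fun n : nat => n.+1%:R^-1 ^+ d * \int[cnt]_k f (0 + n.+1%:R^-1 *: toR k + v)) =
  (fun n : nat => n.+1%:R^-1 ^+ d * \int[cnt]_k f (v + n.+1%:R^-1 *: toR k)).
  by apply/funext => n; congr (_ * _); apply: eq_rint => k; rewrite add0r addrC.
by rewrite e in h2; exact: (cvg_unique _ h2 h1).
Qed.

(** The difference quotients of f integrate to 0 by translation invariance and converge to g under a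
    common majorant. *)
Lemma ibp (i : 'I_d) (f g : E -> R) (C : R) : 0 <= C -> continuous f -> continuous g ->
  (forall y, is_derive y (unitv i) f (g y)) ->
  (forall y, `|f y| <= C * (S y)^-1 ^+ d) -> (forall y, `|g y| <= C * (S y)^-1 ^+ d) ->
  \int[lt]_x g (row x) = 0.
Proof.
move=> C0 cf cg fg fC gC; have [s01 s0] := invn1.
pose q (n : nat) (y : E) := (f (y + n.+1%:R^-1 *: unitv i) - f y) * n.+1%:R.
have Lf : L1 lt (fun x => f (row x)) := L1_row cf fC.
have cfv (v : E) : continuous (fun y : E => f (y + v)).
  move=> y; apply: (@continuous_comp _ _ _ (fun y : E => y + v) f); last exact: cf.
  exact: ct_shift.
have Lfv v : L1 lt (fun x => f (row x + v)) := L1_row (cfv v) (shift_dom v C0 fC).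
have q0 n : \int[lt]_x q n (row x) = 0.
  rewrite /q; under eq_rint do rewrite mulrC.
  by rewrite rintZ ?rintB ?L1B// (rint_shift _ C0)// subrr mulr0.
have su (t : R) : 0 <= t <= 1 -> S (t *: unitv i : E) <= 2.
  move=> /andP[t0 t1]; rewrite /S dotv_unitv (_ : 2 = 1 + 1)// lerD2l.
  by rewrite -[leRHS](expr1n _ 2) lerXn2r ?nnegrE.
have gb (y : E) (t : R) : 0 <= t <= 1 -> `|g (y + t *: unitv i)| <= C * 4 ^+ d * (S y)^-1 ^+ d.
  move=> t01; apply: (le_trans (shift_dom (t *: unitv i) C0 gC y)).
  rewrite -!mulrA ler_wpM2l// ler_wpM2r ?exprn_ge0 ?Sinv_ge0//.
  apply: lerXn2r; rewrite ?nnegrE ?mulr_ge0 ?(ltW (S_gt0 _))//.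
  by have := su t t01; lra.
have qb n y : `|q n y| <= C * 4 ^+ d * (S y)^-1 ^+ d.
  have h1 : 0 <= (n.+1%:R^-1 : R) by rewrite invr_ge0.
  have h2 : (n.+1%:R^-1 : R) <= 1 by rewrite invf_le1 ?ler1n.
  have := @mvt_norm R (fun u => f (y + u *: unitv i)) (fun u => g (y + u *: unitv i)) 0 n.+1%:R^-1
     (C * 4 ^+ d * (S y)^-1 ^+ d) h1 _ _.
  rewrite add0r scale0r addr0 => h; rewrite /q normrM [`|n.+1%:R|]ger0_norm// -ler_pdivlMr//.
  apply: h => [u|u /andP[u0 u1]]; first exact: is_derive_line (fg _).
  by apply: gb; rewrite u0 (le_trans u1).
have cq y : (fun n => q n y) @ \oo --> g y.
  have [dy dE] := fg y; rewrite -dE /derive.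
  have := dy; rewrite /derivable => /cvg_lim => _.
  have hc : (fun h : R => h^-1 *: (f (h *: unitv i + y) - f y)) @ 0^' --> 'D_(unitv i) f y by exact: dy.
  have sn : (fun n => n.+1%:R^-1 : R) @ \oo --> (0 : R)^'.
    move=> B; rewrite /dnbhs /within/= => hB.
    have hB' : \forall n \near \oo, (n.+1%:R^-1 != 0 :> R -> B n.+1%:R^-1) := s0 _ hB.
    by apply: filterS hB' => n; apply; rewrite invr_eq0 pnatr_eq0.
  have := cvg_comp _ _ sn hc; apply: cvg_trans; apply: near_eq_cvg; near=> n.
  by rewrite /q /comp invrK (addrC y) /GRing.scale/= mulrC.
have mq n : measurable_fun setT (fun x => q n (row x)).
  by apply: (@L1_measurable _ _ _ lt); rewrite /q; under eq_fun do rewrite mulrC; apply: L1Z; exact: L1B.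
have LS : L1 lt (fun x => C * 4 ^+ d * (S (row x))^-1 ^+ d).
  apply: L1Z; apply: (@L1_row R d (fun y => (S y)^-1 ^+ d) _ 1).
    by apply: ctX; apply: ctV => [x|]; [rewrite gt_eqF ?S_gt0|exact: S_continuous].
  by move=> y; rewrite mul1r ger0_norm ?exprn_ge0 ?Sinv_ge0.
have [_ lim] := @rint_cvg _ _ R lt (fun n x => q n (row x)) (fun x => g (row x))
  (fun x => C * 4 ^+ d * (S (row x))^-1 ^+ d) mq (measurable_row cg)
  (aeW _ (fun x => cq (row x))) LS (fun n x => qb n (row x)).
have := lim; under eq_fun do rewrite q0.
by move=> h; exact: (cvg_unique _ h (cvg_cst _)).
Unshelve. all: by end_near.
Qed.

Lemma ct_perm (s : {perm 'I_d}) : continuous (fun y : E => col_perm s y).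
Proof.
apply: ct_rV => j; rewrite (_ : (fun y : E => col_perm s y 0 j) = (fun y => y 0 (s j))).
  exact: ct_coord.
by apply/funext => z; rewrite mxE.
Qed.

Lemma S_perm (s : {perm 'I_d}) (y : E) : S (col_perm s y) = S y :> R.
Proof.
rewrite /S /dotv; congr (_ + _); rewrite [RHS](reindex_inj (@perm_inj _ s)).
by apply: eq_bigr => i _; rewrite !mxE.
Qed.

Lemma rint_perm (s : {perm 'I_d}) (f : E -> R) (C : R) : continuous f ->
  (forall y, `|f y| <= C * (S y)^-1 ^+ d) ->
  \int[lt]_x f (col_perm s (row x)) = \int[lt]_x f (row x).
Proof.
move=> cf fC; have [s01 s0] := invn1.
have cfp : continuous (fun y => f (col_perm s y)).
  move=> y; apply: (@continuous_comp _ _ _ (fun y : E => col_perm s y) f); last exact: cf.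
  exact: ct_perm.
have fCp y : `|f (col_perm s y)| <= C * (S y)^-1 ^+ d by rewrite -(S_perm s y).
have h1 := riemann_cvg cf fC 0 s01 s0; have h2 := riemann_cvg cfp fCp 0 s01 s0.
have ij : injective (fun k : V => col_perm s k).
  by move=> k l /rowP kl; apply/rowP => j; have := kl ((s^-1)%g j); rewrite !mxE permKV.
have e : (fun n : nat => n.+1%:R^-1 ^+ d * \int[cnt]_k f (col_perm s (0 + n.+1%:R^-1 *: toR k))) =
  (fun n : nat => n.+1%:R^-1 ^+ d * \int[cnt]_k f (0 + n.+1%:R^-1 *: toR k)).
  apply/funext => n; congr (_ * _).
  rewrite [RHS](lat_rint_inj ij) => [|k h]; last first.
    by exfalso; apply: (h (col_perm s^-1%g k)); apply/rowP => j; rewrite !mxE permK.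
  by apply: eq_rint => k; congr f; apply/rowP => j; rewrite !mxE.
by rewrite e in h2; exact: (cvg_unique _ h2 h1).
Qed.

End ibp.

Section coordinate_fubini.
Context {R : realType} {n : nat}.
Local Notation E := 'rV[R]_n.+1.
Local Notation leb := (@lebesgue_measure R).
Local Notation lt := (@lebesgue_tuple R n).
Local Notation row := (@row_of_tuple R n).
Variable i : 'I_n.+1.

Definition insc (u : R) (x : 'rV[R]_n) : E := @insert_coord R n.+1 i u x.

Lemma insc_i u x : insc u x 0 i = u.
Proof. by rewrite mxE unlift_none. Qed.

Lemma insc_lift u x k : insc u x 0 (lift i k) = x 0 k.
Proof. by rewrite mxE liftK. Qed.

Lemma insc_unit u x : insc u x = insc 0 x + u *: unitv i.
Proof.
apply/rowP => j; rewrite !mxE eqxx /=; case: unliftP => [k ->|->] /=.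
  by rewrite eq_sym (negbTE (neq_lift i k)) mulr0 addr0.
by rewrite eqxx mulr1 add0r.
Qed.

Lemma row_tcons_perm u (t : n.-tuple R) :
  insc u (row t) = col_perm (lift_perm i ord0 1%g) (row_of_tuple (tcons (u, t))).
Proof.
apply/rowP => j; rewrite !mxE; case: unliftP => [k ->|->] /=.
  by rewrite lift_perm_lift perm1 (tnth_nth 0) /= mxE (tnth_nth 0).
by rewrite lift_perm_id (tnth_nth 0).
Qed.

Lemma insc_S u (x : 'rV[R]_n) : (S (insc u x))^-1 ^+ n.+1 <= rho u * \prod_j rho (x 0 j).
Proof.
apply: (le_trans (prod_S _)); rewrite (bigD1_ord i)//= insc_i le_eqVlt; apply/orP; left; apply/eqP.
by congr (_ * _); apply: eq_bigr => k _; rewrite insc_lift.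
Qed.

Variables (f : E -> R) (C : R).
Hypothesis C0 : 0 <= C.
Hypothesis cf : continuous f.
Hypothesis fC : forall y, `|f y| <= C * (S y)^-1 ^+ n.+1.

Lemma insc_dom u t : `|f (insc u (row t))| <= C * rho u * \prod_j rho ((row t) 0 j).
Proof. by apply: (le_trans (fC _)); rewrite -mulrA ler_wpM2l// insc_S. Qed.

Lemma insc_measurable :
  measurable_fun setT (fun p : measurableTypeR R * n.-tuple R => f (insc p.1 (row p.2))).
Proof.
have h : measurable_fun setT (fun z : n.+1.-tuple R => f (col_perm (lift_perm i ord0 1%g) (row_of_tuple z))).
  apply: (@measurable_row R n.+1 (fun y => f (col_perm _ y))) => y.
  by apply: (@continuous_comp _ _ _ (fun y : E => col_perm (lift_perm i ord0 1%g) y)); [exact: ct_perm|exact: cf].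
have := measurableT_comp h (@measurable_tcons R n); apply: eq_measurable_fun => -[u t] _ /=.
by rewrite row_tcons_perm.
Qed.

Let Lr : L1 leb (fun u => C * @rho R u). Proof. exact/L1Z/L1_rho. Qed.
Let Lx : L1 lt (fun t => \prod_j rho ((row t) 0 j)). Proof. exact: L1_prod_rho. Qed.

(** [lebesgue_tuple] splits off the first coordinate only; a permutation brings the coordinate [i]
    there. *)
Lemma fub_coord : \int[@lebesgue_tuple R n.+1]_x f (row_of_tuple x) =
  \int[lt]_t \int[leb]_u f (insc u (row t)).
Proof.
have fp y : `|f (col_perm (lift_perm i ord0 1%g) y)| <= C * (S y)^-1 ^+ n.+1.
  by rewrite -(S_perm (lift_perm i ord0 1%g) y).
rewrite -(rint_perm (lift_perm i ord0 1%g) cf fC).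
have mz : measurable_fun setT (fun z : n.+1.-tuple R => f (col_perm (lift_perm i ord0 1%g) (row_of_tuple z))).
  apply: (@measurable_row R n.+1 (fun y => f (col_perm _ y))) => y.
  by apply: (@continuous_comp _ _ _ (fun y : E => col_perm (lift_perm i ord0 1%g) y)); [exact: ct_perm|exact: cf].
have dz u t : `|f (col_perm (lift_perm i ord0 1%g) (row_of_tuple (tcons (u, t))))| <= C * rho u * \prod_j rho ((row t) 0 j).
  by rewrite -row_tcons_perm; exact: insc_dom.
have [_ ->] := lt_cons_rint mz Lr Lx dz.
under eq_rint do under eq_rint do rewrite -row_tcons_perm.
exact: (@fubini_dom _ _ _ _ R leb lt _ _ _ insc_measurable Lr Lx insc_dom).
Qed.

Lemma L1_insc t : L1 leb (fun u => f (insc u (row t))).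
Proof. exact: (@fub_sec2 _ _ _ _ R leb _ _ _ insc_measurable Lr insc_dom). Qed.

End coordinate_fubini.

Section smooth_class.
Context {R : realType} {d : nat}.
Local Notation E := 'rV[R]_d.
Implicit Types (f p : E -> R) (g q : 'I_d -> E -> R).

Definition C1 (M : nat) (N : R) f g :=
  [/\ continuous f, forall i, continuous (g i),
      forall i y, is_derive y (unitv i) f (g i y),
      forall y, `|f y| <= N * (S y)^-1 ^+ M &
      forall i y, `|g i y| <= N * (S y)^-1 ^+ M].

Lemma C1_mul M M' N B f g p q : 0 <= N -> 0 <= B -> C1 M N f g -> C1 M' B p q ->
  C1 (M + M') (2 * (N * B)) (fun y => f y * p y) (fun i y => g i y * p y + f y * q i y).
Proof.
move=> N0 B0 [cf cg fg fN gN] [cp cq pq pB qB]; split.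
- exact: ctM.
- by move=> i; apply: ctD; apply: ctM.
- move=> i y; have := @is_deriveM _ _ f p y (unitv i) _ _ (fg i y) (pq i y).
  move=> h; apply: (@is_derive_eq _ _ _ (f * p) y (unitv i) _ _ h).
  by rewrite /GRing.scale/= addrC; congr (_ + _); rewrite mulrC.
- move=> y; rewrite normrM exprD; apply: (le_trans (ler_pM _ _ (fN y) (pB y))) => //.
  by rewrite mulrACA ler_wpM2r ?mulr_ge0 ?exprn_ge0 ?Sinv_ge0// mulr_natl mulr2n lerDl mulr_ge0.
- move=> i y; apply: (le_trans (ler_normD _ _)); rewrite !normrM exprD.
  apply: (le_trans (lerD (ler_pM _ _ (gN i y) (pB y)) (ler_pM _ _ (fN y) (qB i y)))) => //.
  by rewrite le_eqVlt; apply/orP; left; apply/eqP; ring.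
Qed.

Lemma C1_le M M' N N' f g : (M' <= M)%N -> N <= N' -> 0 <= N -> C1 M N f g -> C1 M' N' f g.
Proof.
move=> MM NN N0 [cf cg fg fN gN]; split => // [y|i y].
  apply: (le_trans (fN y)); apply: ler_pM => //; first by rewrite exprn_ge0 ?Sinv_ge0.
  exact: SinvX_le.
apply: (le_trans (gN i y)); apply: ler_pM => //; first by rewrite exprn_ge0 ?Sinv_ge0.
exact: SinvX_le.
Qed.

Lemma derive_line0 f y i (df : R) :
  is_derive (0 : R) (1 : R) (fun u : R => f (y + u *: unitv i)) df -> is_derive y (unitv i) f df.
Proof.
move=> [d1 e1].
have E0 : (fun t : R => t^-1 *: (((fun u : R => f (y + u *: unitv i)) \o shift (0 : R)) (t *: (1 : R)) - f (y + (0 : R) *: unitv i))) =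
  (fun t : R => t^-1 *: ((f \o shift y) (t *: unitv i) - f y)).
  apply/funext => t /=; congr (_ *: (f _ - f _)); last by rewrite scale0r addr0.
  by rewrite addr0 /GRing.scale/= mulr1 addrC.
split; first by rewrite /derivable -E0.
by rewrite /derive -E0.
Qed.

Lemma line_derive (h : R -> R) (l : E -> R) (c dh : R) y i :
  (forall u, l (y + u *: unitv i) = l y + u * c) -> is_derive (l y) (1 : R) h dh ->
  is_derive y (unitv i) (fun y => h (l y)) (c * dh).
Proof.
move=> hl hd; apply: derive_line0.
have h1 : is_derive (0 : R) (1 : R) (fun u : R => h (c * u + l y)) (c * dh).
  by apply: is_derive_affine; rewrite mulr0 add0r.
by apply: is_derive_fun h1 => // u /=; rewrite hl addrC mulrC.
Qed.

Lemma C1_lin (h h' : R -> R) (l : E -> R) (c : 'I_d -> R) (B D : R) : 0 <= B -> 1 <= D ->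
  continuous l -> (forall i y u, l (y + u *: unitv i) = l y + u * c i) -> (forall i, `|c i| <= D) ->
  continuous h' -> (forall u : R, is_derive u (1 : R) h (h' u)) ->
  (forall u, `|h u| <= B) -> (forall u, `|h' u| <= B) ->
  C1 0 (D * B) (fun y => h (l y)) (fun i y => c i * h' (l y)).
Proof.
move=> B0 D1 cl hl cD ch' hd hB h'B.
have ch : continuous h.
  by move=> u; apply/differentiable_continuous/derivable1_diffP; have [] := hd u.
have D0 : 0 <= D by exact: le_trans D1.
split.
- exact: ct_comp.
- by move=> i; apply: ctM; [exact: ctC|exact: ct_comp].
- by move=> i y; apply: line_derive.
- move=> y; rewrite expr0 mulr1; apply: (le_trans (hB _)); exact: ler_peMl.
- by move=> i y; rewrite expr0 mulr1 normrM ler_pM.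
Qed.

Lemma S_line (y : E) i u : S (y + u *: unitv i) = 1 * u ^+ 2 + 2 * y 0 i * u + S y.
Proof.
rewrite /S !dotvDl !dotvDr !dotvZl !dotvZr (dotvC (unitv i) y) !dotv_unit.
by rewrite (_ : unitv i 0 i = 1 :> R); [ring|rewrite mxE !eqxx].
Qed.

Lemma C1_Sinv M : C1 M (1 + 2 * M%:R) (fun y : E => (S y)^-1 ^+ M)
   (fun i y => - (2 * M%:R * y 0 i * (S y)^-1 ^+ M.+1)).
Proof.
have cSi : continuous (fun y : E => (S y)^-1).
  by apply: ctV => [y|]; [rewrite gt_eqF ?S_gt0|exact: S_continuous].
split.
- exact: ctX.
- move=> i; apply: (@ct_comp _ _ -%R); first exact: opp_continuous.
  apply: ctM; last exact: ctX.
  by apply: ctM; [exact: ctC|exact: ct_coord].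
- move=> i y; apply: derive_line0.
  pose Q (u : R) := 1 * u ^+ 2 + 2 * y 0 i * u + S y.
  have Q0 : Q 0 = S y by rewrite /Q; ring.
  have dQ : is_derive (0 : R) (1 : R) Q (2 * y 0 i).
    by apply: is_derive_fun (is_derive_quadratic 1 (2 * y 0 i) (S y) 0) => //; ring.
  have nQ : Q 0 != 0 by rewrite Q0 gt_eqF ?S_gt0.
  have dV := is_deriveV nQ dQ.
  have dX := @is_deriveX _ _ _ M _ _ _ dV.
  apply: is_derive_fun dX => [u|].
    by rewrite S_line -/(Q u) !fctE.
  rewrite Q0 /GRing.scale/=; have := S_gt0 y => /lt0r_neq0.
  move: (S y) => z z0; case: (M) => [|k]; first by field.
  by rewrite -pred_Sn [(z^-1) ^+ k.+2]exprS [z^-1 ^+ k.+1]exprS; move: (z^-1 ^+ k) => a; field.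
- move=> y; rewrite ger0_norm ?exprn_ge0 ?Sinv_ge0// ler_peMl ?exprn_ge0 ?Sinv_ge0//.
  by rewrite lerDl mulr_ge0.
- move=> i y; rewrite normrN !normrM [`|2|]ger0_norm// [`|M%:R|]ger0_norm//.
  rewrite [`|_ ^+ M.+1|]ger0_norm ?exprn_ge0 ?Sinv_ge0// exprS.
  have h : `|y 0 i| * (S y)^-1 <= 1 by rewrite ler_pdivrMr ?S_gt0// mul1r coord_le_S.
  have M0 : 0 <= 2 * M%:R :> R by rewrite mulr_ge0.
  have g0 : 0 <= (S y)^-1 ^+ M by rewrite exprn_ge0 ?Sinv_ge0.
  have := ler_wpM2r g0 (ler_wpM2l M0 h); rewrite mulr1 !mulrA => h2.
  by apply: (le_trans h2); rewrite ler_wpM2r// lerDr.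
Qed.

End smooth_class.

Section cauchy_kernel.
Context {R : realType}.
Local Notation leb := (@lebesgue_measure R).

(** The Poisson kernel of total mass 1, Fourier transform of exp(- eta |lam|). *)
Definition pk (eta s : R) : R := 2 * eta / (eta ^+ 2 + (2 * pi * s) ^+ 2).
(* The summand [0] gives the argument the affine shape of [is_derive_affine]. *)
Definition psi (eta s : R) : R := pi^-1 * atan (2 * pi / eta * s + 0).

Lemma pk_den (eta s : R) : 0 < eta -> 0 < eta ^+ 2 + (2 * pi * s) ^+ 2.
Proof. by move=> e0; rewrite ltr_wpDr ?sqr_ge0// exprn_gt0. Qed.

Lemma psi_derive (eta s : R) : 0 < eta -> is_derive s (1 : R) (psi eta) (pk eta s).
Proof.
move=> e0; have h := @is_derive_affine R atan _ (2 * pi / eta) 0 s (is_derive1_atan _).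
have h2 := @is_deriveZ _ _ _ _ pi^-1 s 1 _ h.
apply: is_derive_fun h2 => //; rewrite /GRing.scale/= addr0 /pk.
have p0 : pi != 0 :> R by rewrite gt_eqF ?pi_gt0.
have := pk_den s e0; move=> /lt0r_neq0 dn; have e1 := lt0r_neq0 e0.
have -> : 1 + (2 * pi / eta * s) ^+ 2 = (eta ^+ 2 + (2 * pi * s) ^+ 2) / eta ^+ 2 by field.
move: (eta ^+ 2 + _) dn => D dn; move: (@pi R) p0 => p p0.
by field; rewrite dn e1 p0.
Qed.

Lemma pk_ge0 (eta s : R) : 0 < eta -> 0 <= pk eta s.
Proof. by move=> e0; rewrite divr_ge0 ?mulr_ge0 ?ltW// pk_den. Qed.

Lemma pk_le (eta s : R) : 0 < eta -> pk eta s <= 2 / eta.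
Proof.
move=> e0; rewrite ler_pdivrMr ?pk_den//.
have -> : 2 / eta * (eta ^+ 2 + (2 * pi * s) ^+ 2) = 2 * eta + 2 / eta * (2 * pi * s) ^+ 2 by field; rewrite gt_eqF.
by rewrite lerDl mulr_ge0 ?sqr_ge0// divr_ge0// ltW.
Qed.

Lemma pk_continuous (eta : R) : 0 < eta -> continuous (pk eta).
Proof.
move=> e0; apply: ctM; first exact: ctC.
apply: ctV => [s|]; first by rewrite gt_eqF ?pk_den.
apply: ctD; first exact: ctC.
by apply: ctX; apply: ctM; [exact: ctC|move=> x; exact: cvg_id].
Qed.

Lemma psi_continuous (eta : R) : 0 < eta -> continuous (psi eta).
Proof.
by move=> e0 s; apply/differentiable_continuous/derivable1_diffP; have [] := psi_derive s e0.
Qed.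

Lemma psi_bound (eta s : R) : `|psi eta s| <= 1 / 2.
Proof.
have p0 := pi_gt0 R; rewrite normrM [`|pi^-1|]gtr0_norm ?invr_gt0//.
have h : `|atan (2 * pi / eta * s + 0)| <= pi / 2.
  by rewrite ler_norml; apply/andP; split; apply: ltW; [exact: atan_gtNpi2|exact: atan_ltpi2].
by rewrite ler_pdivrMl//; apply: (le_trans h); rewrite div1r.
Qed.

Lemma psi_lim (s : R) : (fun n => psi n.+1%:R^-1 s) @ \oo --> Num.sg s / 2.
Proof.
have p0 := pi_gt0 R.
wlog s0 : s / 0 < s.
  move=> h; have [s0|s0|->] := ltgtP s 0; first 1 last.
  - exact: h.
  - rewrite sgr0 mul0r; under eq_fun do rewrite /psi mulr0 addr0 atan0 mulr0.
    exact: cvg_cst.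
  have := h (- s); rewrite oppr_gt0 => /(_ s0) /cvgN; rewrite sgrN mulNr opprK.
  move=> h2; rewrite (_ : (fun n => _) = - (fun n => psi n.+1%:R^-1 (- s)))//.
  by apply/funext => n; rewrite !fctE /psi mulrN !addr0 atanN mulrN opprK.
rewrite gtr0_sg// (_ : 1 / 2 = pi^-1 * (pi / 2)); last by move: (@pi R) p0 => p p0; field; rewrite gt_eqF.
apply: cvgM; first exact: cvg_cst.
apply: (@cvg_comp _ _ _ (fun n : nat => 2 * pi / n.+1%:R^-1 * s + 0) atan _ +oo); last exact: cvgy_atan.
apply/cvgryPge => c; exists (Num.truncn (`|c| / (2 * pi * s))) => // n /= hn.
have ps : 0 < 2 * pi * s by rewrite !mulr_gt0.
apply: (le_trans (ler_norm c)); rewrite addr0 invrK mulrAC -ler_pdivrMl// mulrC.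
by apply/ltW/(lt_le_trans (truncnS_gt _)); rewrite ler_nat ltnS.
Qed.

Lemma expR_rho (x : R) : expR (- `|x|) <= 4 * rho x.
Proof.
have h1 : 1 + `|x| / 2 <= expR (`|x| / 2) by exact: expR_ge1Dx.
have x0 := normr_ge0 x.
have h2 : (1 + x ^+ 2) / 4 <= expR `|x|.
  have -> : expR `|x| = expR (`|x| / 2) ^+ 2 by rewrite expr2 -expRD; congr expR; lra.
  have : (1 + `|x| / 2) ^+ 2 <= expR (`|x| / 2) ^+ 2 by rewrite lerXn2r ?nnegrE ?expR_ge0// addr_ge0 ?divr_ge0.
  by rewrite -(real_normK (num_real x)); move: (expR _) => z; nra.
rewrite expRN -[4 * _]invrK lef_pV2 ?posrE ?expR_gt0 ?invr_gt0 ?mulr_gt0 ?rho_gt0//.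
by rewrite invfM /rho invrK mulrC.
Qed.

Definition dmp (eta c lam : R) : R := expR (- (eta * `|lam|)) * cos (c * lam).

(** An explicit antiderivative [G] on [0, n] and on [-n, 0], with k = - eta and k = eta; its values
    at the far ends tend to 0. *)
Lemma fourier_exp (eta c : R) : 0 < eta ->
  L1 leb (dmp eta c) /\ \int[leb]_lam dmp eta c lam = 2 * eta / (eta ^+ 2 + c ^+ 2).
Proof.
move=> e0; have den : eta ^+ 2 + c ^+ 2 != 0 by rewrite gt_eqF// ltr_wpDr ?sqr_ge0 ?exprn_gt0.
have [Lr _] := leb_affine 0 e0 (@L1_rho R).
have cE (k : R) : continuous (fun u : R => expR (k * u) * cos (c * u)).
  apply: ctM; apply: ct_comp; first exact: continuous_expR.
  - by apply: ctM; [exact: ctC|move=> x; exact: cvg_id].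
  - exact: continuous_cos.
  - by apply: ctM; [exact: ctC|move=> x; exact: cvg_id].
have mD : measurable_fun setT (dmp eta c).
  apply: continuous_measurable_fun; apply: ctM; apply: ct_comp; first exact: continuous_expR.
  - apply: (@ct_comp _ _ -%R); first exact: opp_continuous.
    by apply: ctM; [exact: ctC|move=> x; exact: norm_continuous].
  - exact: continuous_cos.
  - by apply: ctM; [exact: ctC|move=> x; exact: cvg_id].
have dom lam : `|dmp eta c lam| <= 4 * rho (eta * lam + 0).
  rewrite /dmp normrM [`|expR _|]ger0_norm ?expR_ge0//; apply: (@le_trans _ _ (expR (- (eta * `|lam|)))).
    by rewrite ler_piMr ?expR_ge0 ?norm_cos.
  by have := expR_rho (eta * lam); rewrite addr0 normrM (gtr0_norm e0).
have LD : L1 leb (dmp eta c) by apply: (L1_dom _ (L1Z 4 Lr)).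
split=> //.
pose m (n : nat) (u : R) : R := \1_`[0, n.+1%:R] u + \1_`[- n.+1%:R, 0] u.
pose G (k u : R) : R := (eta ^+ 2 + c ^+ 2)^-1 * (expR (k * u + 0) * (c * sin (c * u + 0) + k * cos (c * u + 0))).
have dG (k : R) : k ^+ 2 = eta ^+ 2 -> forall u : R, is_derive u (1 : R) (G k) (expR (k * u) * cos (c * u)).
  move=> k2 u.
  have d1 := @is_derive_affine R expR _ k 0 u (is_derive_expR _).
  have d2 := @is_derive_affine R sin _ c 0 u (is_derive_sin _).
  have d3 := @is_derive_affine R cos _ c 0 u (is_derive_cos _).
  have d4 := is_deriveD (is_deriveZ c d2) (is_deriveZ k d3).
  have d5 := is_deriveZ (eta ^+ 2 + c ^+ 2)^-1 (is_deriveM d1 d4).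
  apply: is_derive_fun d5 => [v|]; first by [].
  rewrite !fctE /GRing.scale_fun -![_ *: _]/(_ * _) !addr0 -k2; rewrite -k2 in den.
  by move: (expR _) (sin _) (cos _) => a b e; field.
have Lm (a b : R) : L1 leb (fun u => \1_`[a, b] u * dmp eta c u).
  apply: (L1_dom _ (L1_norm LD)) => [|u]; last first.
    by rewrite normrM ler_piMl// indicE; case: (_ \in _); rewrite ?normr0 ?normr1.
  by apply: measurable_funM => //; exact: measurable_indic.
have mE n : \int[leb]_u (m n u * dmp eta c u) = 2 * eta / (eta ^+ 2 + c ^+ 2) + (G (- eta) n.+1%:R - G eta (- n.+1%:R)).
  have n0 : 0 < n.+1%:R :> R by [].
  rewrite /m; under eq_rint do rewrite mulrDl.
  rewrite rintD; [|exact: Lm|exact: Lm].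
  have -> : \int[leb]_u (\1_`[0, n.+1%:R] u * dmp eta c u) = \int[leb]_u (\1_`[0, n.+1%:R] u * (expR (- eta * u) * cos (c * u))).
    apply: eq_rint => u; rewrite indicE mem_setE in_itv/= /dmp.
    by have [/andP[u0 _]|] := boolP (0 <= u <= _); rewrite ?mul0r// ger0_norm// mulNr.
  have -> : \int[leb]_u (\1_`[- n.+1%:R, 0] u * dmp eta c u) = \int[leb]_u (\1_`[- n.+1%:R, 0] u * (expR (eta * u) * cos (c * u))).
    apply: eq_rint => u; rewrite indicE mem_setE in_itv/= /dmp.
    by have [/andP[_ u0]|] := boolP (_ <= u <= 0); rewrite ?mul0r// ler0_norm// mulrN opprK.
  have dN := dG (- eta) (sqrrN _); have dP := dG eta erefl.
  rewrite (ftc_ind n0 (cE _) dN) (ftc_ind _ (cE _) dP) ?oppr_lt0//.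
  rewrite /G !mulr0 !addr0 expR0 sin0 cos0; field; exact: den.
have cm : (fun n => \int[leb]_u (m n u * dmp eta c u)) @ \oo --> \int[leb]_u dmp eta c u.
  have mm n : measurable_fun setT (fun u => m n u * dmp eta c u).
    by apply: measurable_funM => //; apply: measurable_funD; exact: measurable_indic.
  (* The origin lies in both intervals and is counted twice, so the limit holds only off it. *)
  have ae0 : \forall u \ae leb, (fun n => m n u * dmp eta c u) @ \oo --> dmp eta c u.
    exists [set 0]; split; [exact: measurable_set1|exact: lebesgue_measure_set1|].
    move=> u /= nu; apply: contrapT => u0; apply: nu.
    apply: cvg_near_cst; exists (Num.truncn `|u|) => // n /= hn.
    have hu : `|u| <= n.+1%:R by apply/ltW/(lt_le_trans (truncnS_gt _)); rewrite ler_nat ltnS.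
    move: hu; rewrite ler_norml => /andP[h1 h2].
    rewrite /m !indicE !mem_setE !in_itv/= h1 h2 andbT.
    by have [u1|u1|u1] := ltgtP u 0; rewrite ?add0r ?addr0 ?mul1r//; case: u0.
  have mb n u : `|m n u * dmp eta c u| <= 2 * `|dmp eta c u|.
    rewrite normrM ler_wpM2r//; apply: (le_trans (ler_normD _ _)).
    by rewrite (_ : 2 = 1 + 1)//; apply: lerD; rewrite indicE; case: (_ \in _); rewrite ?normr0 ?normr1.
  have [_ h] := @rint_cvg _ _ R leb _ _ _ mm mD ae0 (L1Z 2 (L1_norm LD)) mb.
  exact: h.
have z : (fun n => G (- eta) n.+1%:R - G eta (- n.+1%:R)) @ \oo --> 0.
  pose B := `|(eta ^+ 2 + c ^+ 2)^-1| * (8 / eta ^+ 2 * (`|c| + eta)).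
  apply: norm_cvg0; have hB : (fun n : nat => B * n.+1%:R^-1) @ \oo --> 0.
    by rewrite -(mulr0 B); apply: cvgM; [exact: cvg_cst|exact: cvg_harmonic].
  apply: (squeeze_cvgr _ (@cvg_cst _ _ _ _ _) hB); near=> n; rewrite normr_ge0/=.
  have n1 : 1 <= n.+1%:R :> R by rewrite ler1n.
  have eb : expR (- (eta * n.+1%:R)) <= 4 / eta ^+ 2 * n.+1%:R^-1.
    have := expR_rho (eta * n.+1%:R); rewrite ger0_norm ?mulr_ge0 ?(ltW e0)// => /le_trans; apply.
    rewrite -mulrA ler_wpM2l// /rho -invfM lef_pV2 ?posrE ?mulr_gt0 ?exprn_gt0 ?ltr_wpDr ?sqr_ge0//.
    have : 0 < eta ^+ 2 by rewrite exprn_gt0.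
    by rewrite exprMn; nra.
  have tb (k u : R) : `|k| = eta -> `|c * sin (c * u + 0) + k * cos (c * u + 0)| <= `|c| + eta.
    move=> <-; apply: (le_trans (ler_normD _ _)); apply: lerD; rewrite normrM ler_piMr// ?norm_cos//.
    by rewrite ler_norml sin_geN1 sin_le1.
  rewrite /G -mulrBr normrM /B -mulrA ler_wpM2l//; apply: (le_trans (ler_normB _ _)).
  rewrite !normrM !addr0 [- eta * n.+1%:R]mulNr [eta * - _]mulrN ![`|expR _|]ger0_norm ?expR_ge0//.
  have := tb (- eta) n.+1%:R; have := tb eta (- n.+1%:R); rewrite normrN !addr0 (gtr0_norm e0).
  move=> /(_ erefl) t1 /(_ erefl) t2.
  have ce0 : 0 <= `|c| + eta by rewrite addr_ge0// ltW.
  have := ler_pM (expR_ge0 _) (normr_ge0 _) eb t1; have := ler_pM (expR_ge0 _) (normr_ge0 _) eb t2.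
  move=> u1 u2; apply: (le_trans (lerD u1 u2)).
  by rewrite le_eqVlt; apply/orP; left; apply/eqP; field; rewrite ?gt_eqF.
have cm2 : (fun n => \int[leb]_u (m n u * dmp eta c u)) @ \oo --> 2 * eta / (eta ^+ 2 + c ^+ 2).
  rewrite (_ : (fun n => _) = fun n => 2 * eta / (eta ^+ 2 + c ^+ 2) + (G (- eta) n.+1%:R - G eta (- n.+1%:R))).
    by rewrite -[X in _ --> X]addr0; apply: cvgD => //; exact: cvg_cst.
  exact/funext/mE.
exact: (cvg_unique _ cm cm2).
Unshelve. all: by end_near.
Qed.

End cauchy_kernel.

(** * Damped oscillatory integrals and thin strips *)

Section regularization.
Context {R : realType} {d : nat}.
Variable A : 'M[int]_d.
Hypothesis symA : A^T = A.
Hypothesis detA : \det A != 0.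
Hypothesis d4 : (4 <= d)%N.
Local Notation E := 'rV[R]_d.
Local Notation leb := (@lebesgue_measure R).
Local Notation lt := (@lebesgue_tuple R d).
Local Notation row := (@row_of_tuple R d).

Lemma measurable_damp (eta : R) d' (T : measurableType d') (u : T -> R) : measurable_fun setT u ->
  measurable_fun setT (fun p => expR (- (eta * `|u p|))).
Proof.
move=> mu; apply: (measurableT_comp (f := expR)); first exact: measurable_expR.
by apply: measurableT_comp => //; apply: measurable_funM => //; apply: measurableT_comp.
Qed.

Lemma measurable_cosT d' (T : measurableType d') (u : T -> R) : measurable_fun setT u ->
  measurable_fun setT (fun p => cos (u p)).
Proof.
by move=> mu; apply: (measurableT_comp (f := cos)) => //; exact: continuous_measurable_fun (@continuous_cos R).
Qed.

(** The damping makes the double integral over [lam] and y absolutely convergent, so that [lam] can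
    be integrated first. *)
Lemma Ic_regularized (C : R) (f : E -> R) (m eta : R) : continuous f ->
  (forall y, `|f y| <= C * (S y)^-1 ^+ d) -> 0 < eta ->
  \int[leb]_lam (expR (- (eta * `|lam|)) * Ic A f m 0 lam) =
  \int[lt]_x (f (row x) * pk eta (qform A (row x) - m)).
Proof.
move=> cf fC e0; pose H (p : R * d.-tuple R) : R := expR (- (eta * `|p.1|)) * phi A f p.1 m 0 (row p.2).
have mw : measurable_fun setT (fun x => f (row x)) := measurable_row cf.
have mF : measurable_fun setT (fun x => qform A (row x)) := measurable_row (qform_continuous (A := A)).
have mf : measurable_fun setT H.
  rewrite /H /phi; apply: measurable_funM; first exact: measurable_damp.
  apply: measurable_funM; first exact: measurableT_comp mw _.
  apply: measurable_cosT; apply: measurable_funD => //; apply: measurable_funM; first exact: measurable_funM.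
  by apply: measurable_funB => //; exact: measurableT_comp mF _.
have [Le _] := fourier_exp 0 e0.
have Le' : L1 leb (fun u => expR (- (eta * `|u|))).
  by move: Le; rewrite /dmp; under eq_fun do rewrite mul0r cos0 mulr1.
have Lw : L1 lt (fun x => `|f (row x)|) by exact/L1_norm/(L1_row cf fC).
have dom u x : `|H (u, x)| <= expR (- (eta * `|u|)) * `|f (row x)|.
  by rewrite /H/= normrM [`|expR _|]ger0_norm ?expR_ge0// ler_wpM2l ?expR_ge0// phi_le.
have := @fubini_dom _ _ (measurableTypeR R) _ R leb lt H _ _ mf Le' Lw dom.
have Lp lam : L1 lt (fun x => phi A f lam m 0 (row x)).
  apply: (L1_row (@phi_continuous R d A f lam m 0 cf) (C := C)) => y.
  exact: le_trans (phi_le _ _ _ _ _ _) (fC y).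
under eq_rint do rewrite /H /= rintZ ?Lp//.
move=> ->; apply: eq_rint => x; have [Ld Ed] := fourier_exp (2 * pi * (qform A (row x) - m)) e0.
rewrite /pk -Ed -rintZ//; apply: eq_rint => u; rewrite /H /phi /dmp /= addr0.
by rewrite mulrCA; congr (_ * (_ * cos _)); ring.
Qed.

Lemma chi_fourier (k l : R) : 0 < k ->
  L1 leb (fun u => k / 2 * dmp k l u) /\ \int[leb]_u (k / 2 * dmp k l u) = rho (l / k).
Proof.
move=> k0; have [L e] := fourier_exp l k0; split; first exact: L1Z.
rewrite rintZ// e /rho; have kn := lt0r_neq0 k0.
have n1 : k ^+ 2 + l ^+ 2 != 0 by rewrite gt_eqF// ltr_wpDr ?sqr_ge0 ?exprn_gt0.
have -> : 1 + (l / k) ^+ 2 = (k ^+ 2 + l ^+ 2) / k ^+ 2 by field.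
by move: (k ^+ 2 + _) n1 => D n1; field; do ?[apply/andP; split].
Qed.

Lemma rho_ct : continuous (@rho R).
Proof. exact: continuous_oneDsqrV. Qed.

Section weight.
Variables (N : R) (w : E -> R) (m : R).
Hypothesis N0 : 0 <= N.
Hypothesis hw : wt (2 * d) (2 * d) N w.

Let B : R := Num.sqrt (cI A) * N.

(** The damping factor is at most 1, so a majorant of [Ic] bounds the mollified integrals uniformly
    in [eta]. *)
Lemma Ic_norm_damped (f : E -> R) (g : R -> R) (eta : R) : continuous f ->
  (forall y, `|f y| <= N * (S y)^-1 ^+ d) -> L1 leb g -> (forall lam, `|Ic A f m 0 lam| <= g lam) ->
  0 < eta -> `|\int[lt]_x (f (row x) * pk eta (qform A (row x) - m))| <= \int[leb]_lam g lam.
Proof.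
move=> cf fN Lg hg e0; rewrite -(Ic_regularized m cf fN e0).
have g0 lam : 0 <= g lam by apply: le_trans (hg lam).
have mI : measurable_fun setT (fun lam : R => expR (- (eta * `|lam|)) * Ic A f m 0 lam).
  apply: measurable_funM; first exact: measurable_damp.
  have mf : measurable_fun setT (fun p : R * d.-tuple R => rho p.1 * phi A f p.1 m 0 (row p.2)).
    apply: measurable_funM; first by apply: measurableT_comp => //; exact: continuous_measurable_fun rho_ct.
    apply: measurable_funM; first exact: (measurableT_comp (measurable_row cf)).
    apply: measurable_cosT; apply: measurable_funD => //; apply: measurable_funM; first exact: measurable_funM.
    by apply: measurable_funB => //; apply: (measurableT_comp (measurable_row (qform_continuous (A := A)))).
  have Lw : L1 lt (fun x => `|f (row x)|) by exact/L1_norm/(L1_row cf fN).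
  have dom u x : `|rho u * phi A f u m 0 (row x)| <= rho u * `|f (row x)|.
    by rewrite normrM (ger0_norm (rho_ge0 _)) ler_wpM2l ?rho_ge0 ?phi_le.
  have L := @fub_L1 _ _ (measurableTypeR R) _ R leb lt _ _ _ mf (@L1_rho R) Lw dom.
  (* With the factor [rho u] the integrand is dominated, and Fubini applies. *)
  rewrite (_ : Ic A f m 0 = fun u => (1 + u ^+ 2) * \int[lt]_x (rho u * phi A f u m 0 (row x))).
    apply: measurable_funM; last exact: (L1_measurable L).
    by apply: measurable_funD => //; exact: measurable_funX.
  apply/funext => u; rewrite rintZ.
    by rewrite mulrA divff ?mul1r// gt_eqF// ltr_wpDr ?sqr_ge0.
  apply: (L1_row (@phi_continuous R d A f u m 0 cf) (C := N)) => y.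
  exact: le_trans (phi_le _ _ _ _ _ _) (fN y).
apply: rint_norm => // lam; apply: le_trans (hg lam).
by rewrite normrM ler_piMl// ger0_norm ?expR_ge0// -expR0 ler_expR oppr_le0 mulr_ge0// (ltW e0).
Qed.

Lemma pk_bound (eta : R) : 0 < eta ->
  `|\int[lt]_x (w (row x) * pk eta (qform A (row x) - m))| <= B * (2 * \int[leb]_u rho u).
Proof.
move=> e0; have LI : L1 leb (fun u => B * (2 * rho u)) by exact/L1Z/L1Z/L1_rho.
have := Ic_norm_damped (wt_cont hw) (wt_dom d4 N0 hw) LI (fun u => @Ic_rho R d A symA detA d4 N w N0 hw u m 0) e0.
by rewrite !rintZ//; [exact: L1_rho|exact/L1Z/L1_rho].
Qed.

Lemma Jc_limit : (fun n => \int[lt]_x (w (row x) * pk n.+1%:R^-1 (qform A (row x) - m))) @ \oo -->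
  Jc A w m.
Proof.
have ctI := @Ic_continuous R d A d4 N w N0 hw m 0.
have mI : measurable_fun setT (Ic A w m 0) by exact: continuous_measurable_fun.
have LI : L1 leb (fun u => B * (2 * rho u)) by exact/L1Z/L1Z/L1_rho.
pose e (n : nat) (u : R) := expR (- (n.+1%:R^-1 * `|u|)).
have me n : measurable_fun setT (fun u => e n u * Ic A w m 0 u).
  by apply: measurable_funM => //; exact: measurable_damp.
have lim u : (fun n => e n u * Ic A w m 0 u) @ \oo --> Ic A w m 0 u.
  rewrite -[X in _ --> X]mul1r; apply: cvgM; last exact: cvg_cst.
  rewrite -expR0; apply: (@cvg_comp _ _ _ (fun n : nat => - (n.+1%:R^-1 * `|u|)) expR); last exact: continuous_expR.
  rewrite -oppr0; apply: cvgN; rewrite -[X in _ --> X](mul0r `|u|).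
  by apply: cvgM; [exact: cvg_harmonic|exact: cvg_cst].
have dom n u : `|e n u * Ic A w m 0 u| <= B * (2 * rho u).
  apply: le_trans (@Ic_rho R d A symA detA d4 N w N0 hw u m 0).
  rewrite normrM ler_piMl// ger0_norm ?expR_ge0// -expR0 ler_expR oppr_le0.
  by rewrite mulr_ge0 ?invr_ge0.
have [_ h] := @rint_cvg _ _ R leb _ _ _ me mI (aeW leb lim) LI dom.
by move: h; under eq_fun do rewrite (Ic_regularized m (wt_cont hw) (wt_dom d4 N0 hw))//.
Qed.

Variable xi : E.

(** k^2/(k^2 + l^2) with l = xi . y: a smooth weight of the strip |l| < k, equal to 1 on the
    hyperplane l = 0. *)
Definition chi (k : R) (y : E) : R := rho (dotv xi y / k).

Lemma chi_ct k : continuous (chi k).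
Proof. by apply: ct_comp; [exact: rho_ct|apply: ctM; [exact: dotvl_continuous|exact: ctC]]. Qed.

Lemma chi_dom k y : `|w y * chi k y| <= N * (S y)^-1 ^+ d.
Proof.
apply: le_trans (wt_dom d4 N0 hw y); rewrite normrM ler_piMr//.
by rewrite ger0_norm ?rho_le1 ?rho_ge0.
Qed.

(* [chi k] is the superposition of the phases [cos (u (xi . y))] with weights
   [(k / 2) exp (- k |u|)], and [Icl_rho] is uniform in the linear phase. *)
Lemma Ic_chi_rho (k lam : R) : 0 < k -> `|Ic A (fun y => w y * chi k y) m 0 lam| <= B * (2 * rho lam).
Proof.
move=> k0.
pose H (p : R * d.-tuple R) : R := k / 2 * dmp k (dotv xi (row p.2)) p.1 * phi A w lam m 0 (row p.2).
have cp := @phi_continuous R d A w lam m 0 (wt_cont hw).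
have mx : measurable_fun setT (fun x => dotv xi (row x)) := measurable_row (@dotvl_continuous R d xi).
have mf : measurable_fun setT H.
  apply: measurable_funM; last exact: (measurableT_comp (measurable_row cp)).
  apply: measurable_funM => //; apply: measurable_funM; first exact: measurable_damp.
  by apply: measurable_cosT; apply: measurable_funM => //; exact: (measurableT_comp mx).
have [Lk Ek] := chi_fourier 0 k0.
have Lw : L1 lt (fun x => `|w (row x)|) by exact/L1_norm/(L1_row (wt_cont hw) (wt_dom d4 N0 hw)).
have dE u : dmp k 0 u = expR (- (k * `|u|)) by rewrite /dmp mul0r cos0 mulr1.
have d0 u : 0 <= k / 2 * dmp k 0 u by rewrite dE mulr_ge0 ?expR_ge0 ?divr_ge0 ?ltW.
have dom u x : `|H (u, x)| <= k / 2 * dmp k 0 u * `|w (row x)|.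
  rewrite /H/= normrM; apply: ler_pM => //; last exact: phi_le.
  rewrite dE /dmp !normrM [`|k|]gtr0_norm// [`|2^-1|]gtr0_norm// ler_wpM2l ?divr_ge0 ?(ltW k0)//.
  by rewrite [`|expR _|]ger0_norm ?expR_ge0// ler_piMr ?expR_ge0 ?norm_cos.
have F := @fubini_dom _ _ (measurableTypeR R) _ R leb lt H _ _ mf Lk Lw dom.
have LH := @fub_L1 _ _ (measurableTypeR R) _ R leb lt H _ _ mf Lk Lw dom.
have -> : Ic A (fun y => w y * chi k y) m 0 lam = \int[lt]_x \int[leb]_u H (u, x).
  apply: eq_rint => x; have [Lx Ex] := chi_fourier (dotv xi (row x)) k0.
  under [in RHS]eq_rint do rewrite /H/= mulrC.
  by rewrite rintZ// Ex /phi /chi; ring.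
rewrite -F; have -> : B * (2 * rho lam) = \int[leb]_u (B * (2 * rho lam) * (k / 2 * dmp k 0 u)).
  by rewrite rintZ// Ek /rho mul0r expr0n addr0 invr1 mulr1.
apply: rint_norm => [||u]; [exact: (L1_measurable LH)|exact: L1Z|].
have LI th (z : E) : L1 lt (fun x => phil A w m z th lam (row x)).
  exact: (@L1_row _ _ _ (@phil_ct R d A N w hw m z th lam) N (phil_dom A d4 N0 hw m z th lam)).
have -> : \int[lt]_x H (u, x) =
   k / 2 * dmp k 0 u * (2^-1 * (Icl A w m (u *: xi) 0 lam + Icl A w m (- u *: xi) 0 lam)).
  rewrite /Icl -rintD//; rewrite -rintZ; last exact: L1D.
  rewrite -rintZ; last by apply/L1Z/L1D.
  apply: eq_rint => x; rewrite /H /phil /phi /= dE /dmp !dotvZl !addr0 mulNr [in RHS]cosD [cos (_ - _)]cosB.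
  by rewrite [dotv _ _ * u]mulrC; field.
rewrite normrM (ger0_norm (d0 u)) mulrC; apply: ler_wpM2r => //.
have h z := @Icl_rho R d A symA detA d4 N w N0 hw lam m z 0.
rewrite normrM [`|2^-1|]gtr0_norm// ler_pdivrMl//; apply: (le_trans (ler_normD _ _)).
by apply: (le_trans (lerD (h _) (h _))); rewrite /B; lra.
Qed.

End weight.
End regularization.

Section hyperplane_strip.
Context {R : realType} {n : nat}.
Local Notation E := 'rV[R]_n.+1.
Local Notation leb := (@lebesgue_measure R).
Local Notation lt := (@lebesgue_tuple R n).
Local Notation row := (@row_of_tuple R n).
Variables (xi : E) (i : 'I_n.+1).
Hypothesis xi0 : xi 0 i != 0.

(** Integrating first in the coordinate i, in which xi . y has slope xi_i <> 0, gives k/|xi_i| times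
    the integral of [rho]. *)
Lemma strip_bound : exists2 D : R, 0 <= D & forall (N k : R) (f : E -> R), 0 <= N -> continuous f ->
  (forall y, `|f y| <= N * (S y)^-1 ^+ n.+1) -> 0 < k ->
  `|\int[@lebesgue_tuple R n.+1]_x (f (row_of_tuple x) * chi xi k (row_of_tuple x))| <= N * D * k.
Proof.
have LP : L1 lt (fun t => \prod_j rho ((row t) 0 j)) := @L1_prod_rho R n.
pose I := \int[lt]_t \prod_j rho ((row t) 0 j).
exists (`|xi 0 i|^-1 * (\int[leb]_u rho u) * I).
  apply: mulr_ge0; last by apply: rint_ge0 => t; apply: prodr_ge0 => j _; exact: rho_ge0.
  by rewrite mulr_ge0 ?invr_ge0//; apply: rint_ge0 => u; exact: rho_ge0.
move=> N k f N0 cf fN k0.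
have cg : continuous (fun y => f y * chi xi k y) by apply: ctM => //; exact: chi_ct.
have gN y : `|f y * chi xi k y| <= N * (S y)^-1 ^+ n.+1.
  by apply: le_trans (fN y); rewrite normrM ler_piMr// ger0_norm ?rho_le1 ?rho_ge0.
rewrite (fub_coord i N0 cg gN).
pose G t : R := \prod_j rho ((row t) 0 j).
have G0 t : 0 <= G t by apply: prodr_ge0 => j _; exact: rho_ge0.
pose b t := dotv xi (insc i 0 (row t)) / k.
pose c := xi 0 i / k.
have lE u t : dotv xi (insc i u (row t)) / k = c * u + b t.
  by rewrite insc_unit dotvDr dotvZr dotv_unit /c /b; field; rewrite gt_eqF.
have rE u t : chi xi k (insc i u (row t)) = rho (`|c| * u + Num.sg c * b t).
  rewrite /chi lE; have [c0|c0|c0] := ltgtP c 0.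
  - by rewrite ltr0_norm// ltr0_sg// mulN1r mulNr -opprD /rho sqrrN.
  - by rewrite gtr0_norm// gtr0_sg// mul1r.
  - by have := mulf_neq0 xi0 (invr_neq0 (lt0r_neq0 k0)); rewrite -/c c0 eqxx.
have c0 : 0 < `|c| by rewrite normr_gt0 mulf_neq0// invr_neq0 ?gt_eqF.
have inner t : `|\int[leb]_u (f (insc i u (row t)) * chi xi k (insc i u (row t)))| <=
    N * (`|c|^-1 * \int[leb]_u rho u) * G t.
  have [L e] := leb_affine (Num.sg c * b t) c0 (@L1_rho R); rewrite -e.
  rewrite mulrAC -rintZ//; apply: rint_norm => [||u].
  - exact: (L1_measurable (L1_insc i N0 cg gN t)).
  - exact: L1Z.
  rewrite normrM rE (ger0_norm (rho_ge0 _)) ler_wpM2r ?rho_ge0//.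
  apply: (le_trans (fN _)); rewrite ler_wpM2l//; apply: (le_trans (insc_S i u (row t))).
  by rewrite ler_piMl ?rho_le1 ?G0.
have -> : N * (`|xi 0 i|^-1 * (\int[leb]_u rho u) * I) * k = \int[lt]_t (N * (`|c|^-1 * \int[leb]_u rho u) * G t).
  rewrite rintZ// /c normf_div (gtr0_norm k0) /I; have := xi0; rewrite -normr_eq0.
  move: (\int[lt]_t _) (\int[leb]_u _) `|xi 0 i| => a a' a'' h; field; rewrite h gt_eqF//.
apply: rint_norm => //; last exact: L1Z.
have LN : L1 leb (fun u => N * rho u) by exact/L1Z/L1_rho.
have := @fub_L12 _ _ (measurableTypeR R) _ R leb lt _ _ _ (insc_measurable i cg) LN LP.
move=> /(_ _) h; apply: (L1_measurable (h _)) => u t.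
exact: (insc_dom i N0 gN).
Qed.

End hyperplane_strip.

Section small_strip.
Context {R : realType} {n : nat}.
Local Notation d := n.+1.
Variable A : 'M[int]_d.
Hypothesis symA : A^T = A.
Hypothesis detA : \det A != 0.
Hypothesis d4 : (4 <= d)%N.
Local Notation E := 'rV[R]_d.
Local Notation leb := (@lebesgue_measure R).
Local Notation lt := (@lebesgue_tuple R d).
Local Notation row := (@row_of_tuple R d).
Variables (N : R) (w : E -> R) (m : R).
Hypothesis N0 : 0 <= N.
Hypothesis hw : wt (2 * d) (2 * d) N w.

(** [Ic] of the weight w [chi] has two majorants: a multiple of [rho], uniform in k, and a constant
    of the order of the width of the strip. The integral of their minimum tends to 0 by dominated
    convergence and does not involve [eta]. *)
Lemma chi_pk_small (xi : E) (i : 'I_d) : xi 0 i != 0 ->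
  exists2 e : nat -> R, e @ \oo --> 0 & forall k eta, 0 < eta ->
    `|\int[lt]_x (w (row x) * chi xi k.+1%:R^-1 (row x) * pk eta (qform A (row x) - m))| <= e k.
Proof.
move=> xi0; have [D D0 hD] := strip_bound xi0.
pose B : R := Num.sqrt (cI A) * N.
have B0 : 0 <= B by rewrite mulr_ge0 ?sqrtr_ge0.
pose a (k : nat) (lam : R) : R := Num.min (B * (2 * rho lam)) (N * D * k.+1%:R^-1).
have a0 k lam : 0 <= a k lam by rewrite le_min !mulr_ge0 ?rho_ge0 ?invr_ge0.
have ma k : measurable_fun setT (a k).
  apply: measurable_minr => //; apply: measurable_funM => //; apply: measurable_funM => //.
  exact: continuous_measurable_fun rho_ct.
have LI : L1 leb (fun u => B * (2 * rho u)) by exact/L1Z/L1Z/L1_rho.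
have dom k lam : `|a k lam| <= B * (2 * rho lam) by rewrite ger0_norm// ge_min lexx.
have La k : L1 leb (a k) by exact: (@L1_dom _ _ _ leb _ _ (ma k) LI (dom k)).
have lim lam : (fun k => a k lam) @ \oo --> (0 : R).
  have hB : (fun k : nat => N * D * k.+1%:R^-1) @ \oo --> (0 : R).
    by rewrite -(mulr0 (N * D)); apply: cvgM; [exact: cvg_cst|exact: cvg_harmonic].
  apply: (squeeze_cvgr _ (@cvg_cst _ _ _ _ _) hB); near=> k.
  by rewrite a0/= ge_min lexx orbT.
exists (fun k => \int[leb]_lam a k lam).
  have [_ h] := @rint_cvg _ _ R leb a (fun=> 0) _ ma (measurable_cst _) (aeW leb lim) LI dom.
  by rewrite [X in _ --> X](_ : _ = \int[leb]_x 0) // /Rintegral integral0.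
move=> k eta e0; have k0 : 0 < k.+1%:R^-1 :> R by rewrite invr_gt0.
apply: (@Ic_norm_damped R d A N m (fun y => w y * chi xi k.+1%:R^-1 y) (a k) eta) => //.
- by apply: ctM; [exact: wt_cont hw|exact: chi_ct].
- exact: (chi_dom d4 N0 hw).
move=> lam; rewrite le_min; apply/andP; split; first exact: (Ic_chi_rho symA detA d4 m N0 hw).
have -> : Ic A (fun y => w y * chi xi k.+1%:R^-1 y) m 0 lam =
  \int[lt]_x (phi A w lam m 0 (row x) * chi xi k.+1%:R^-1 (row x)).
  by apply: eq_rint => x; rewrite /phi mulrAC.
apply: hD => //; first exact: (@phi_continuous R d A w lam m 0 (wt_cont hw)).
exact: (phi_dom A d4 N0 hw).
Unshelve. all: by end_near.
Qed.

End small_strip.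

Section weight_power.
Context {R : realType} {d : nat}.
Local Notation E := 'rV[R]_d.

Lemma coord_line (i : 'I_d) (y : E) u : (y + u *: unitv i) 0 i = y 0 i + u * 1.
Proof. by rewrite !mxE !eqxx /=. Qed.

Lemma is_derive_coordX (i : 'I_d) p (y : E) :
  is_derive y (unitv i) (fun z : E => z 0 i ^+ p) (p%:R * y 0 i ^+ p.-1).
Proof.
have h := @is_deriveX _ _ (@id R) p (y 0 i) 1 1 (is_derive_id _ _).
have h' : is_derive (y 0 i) (1 : R) (fun x : R => x ^+ p) (p%:R * y 0 i ^+ p.-1).
  have -> : (fun x : R => x ^+ p) = id ^+ p by apply/funext => x; rewrite fctE.
  by apply: (@is_derive_eq _ _ _ _ _ _ _ _ h); exact: mulr1.
by have := line_derive (l := fun z : E => z 0 i) (@coord_line i y) h'; rewrite mul1r.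
Qed.

(* The functions [y_i^p S^-(M + p + q)], [p, q >= 0], span a space stable under [d/dy_i]. *)
Lemma Sinv_derivs (i : 'I_d) M K p q : exists N (g : nat -> E -> R),
  [/\ 0 <= N, g 0%N = (fun y => y 0 i ^+ p * (S y)^-1 ^+ (M + p + q)),
      forall k z, (k < K)%N -> is_derive z (unitv i) (g k) (g k.+1 z) &
      forall k z, (k <= K)%N -> `|g k z| <= N * (S z)^-1 ^+ M].
Proof.
have bnd p' q' (y : E) : `|y 0 i ^+ p' * (S y)^-1 ^+ (M + p' + q')| <= (S y)^-1 ^+ M.
  have S0 := Sinv_ge0 y; rewrite (_ : _ * _ = (S y)^-1 ^+ M * (S y)^-1 ^+ q' * (y 0 i * (S y)^-1) ^+ p'); last first.
    by rewrite !exprD exprMn; ring.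
  rewrite normrM [`|_ ^+ M * _|]ger0_norm ?mulr_ge0 ?exprn_ge0//.
  rewrite -[leRHS]mulr1; apply: ler_pM => //.
  - by rewrite mulr_ge0 ?exprn_ge0.
  - by rewrite ler_piMr ?exprn_ge0// exprn_ile1// Sinv_le1.
  rewrite normrX exprn_ile1// normrM (ger0_norm S0) ler_pdivrMr ?S_gt0// mul1r.
  exact: coord_le_S.
elim: K p q => [|K IH] p q.
  exists 1, (fun _ (y : E) => y 0 i ^+ p * (S y)^-1 ^+ (M + p + q)).
  by split=> // k z _; rewrite mul1r.
have [N1 [g1 [N10 g10 g1d g1b]]] := IH p.-1 q.+1.
have [N2 [g2 [N20 g20 g2d g2b]]] := IH p.+1 q.
pose m' := (M + p + q)%N; pose f (y : E) := y 0 i ^+ p * (S y)^-1 ^+ m'.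
pose g k (z : E) := if k is k'.+1 then p%:R * g1 k' z - 2 * m'%:R * g2 k' z else f z.
exists (1 + p%:R * N1 + 2 * m'%:R * N2), g; split => //.
- by rewrite !addr_ge0 ?mulr_ge0.
- move=> [|k] z kK /=.
    have [_ _ cd _ _] := C1_Sinv (R := R) (d := d) m'.
    have h := is_deriveM (is_derive_coordX i p z) (cd i z).
    apply: (@is_derive_eq _ _ _ _ _ _ _ _ h); rewrite /GRing.scale/= g10 g20.
    have -> : (M + p.+1 + q)%N = m'.+1 by rewrite addnS addSn.
    have -> : p%:R * (z 0 i ^+ p.-1 * (S z)^-1 ^+ (M + p.-1 + q.+1)) = p%:R * (z 0 i ^+ p.-1 * (S z)^-1 ^+ m').
      by rewrite /m'; case: (p) => [|p'] /=; [rewrite !mul0r|rewrite addnS -addSn -addnS].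
    rewrite (exprS (z 0 i)) (exprS (S z)^-1).
    by move: (z 0 i ^+ p) (z 0 i ^+ p.-1) ((S z)^-1 ^+ m') (S z)^-1 (z 0 i) => *; ring.
  apply: is_deriveB; first exact: is_deriveZ (g1d _ _ kK).
  exact: is_deriveZ (g2d _ _ kK).
- move=> [|k] z kK /=.
    apply: (le_trans (bnd p q z)); rewrite ler_peMl ?exprn_ge0 ?Sinv_ge0//.
    by rewrite -addrA lerDl addr_ge0 ?mulr_ge0.
  apply: (@le_trans _ _ ((p%:R * N1 + 2 * m'%:R * N2) * (S z)^-1 ^+ M)); last first.
    by rewrite ler_wpM2r ?exprn_ge0 ?Sinv_ge0// -addrA lerDr.
  rewrite [leRHS]mulrDl.
  apply: (le_trans (ler_normB _ _)); rewrite !normrM ![`|_%:R|]ger0_norm// -!mulrA.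
  by do ?[apply: lerD|apply: ler_wpM2l]; rewrite ?mulr_ge0 ?g1b ?g2b.
Qed.

(** The majorant of all weights is itself an admissible weight, so bounds for it give integrability
    on the quadric for every weight. *)
Lemma wt_Sinv K M : exists2 N : R, 0 <= N & wt K M N (fun y : E => (S y)^-1 ^+ M).
Proof.
have /choice[G hG] : forall i : 'I_d, exists p : R * (nat -> E -> R),
  [/\ 0 <= p.1, p.2 0%N = (fun y => (S y)^-1 ^+ M),
      forall k z, (k < K)%N -> is_derive z (unitv i) (p.2 k) (p.2 k.+1 z) &
      forall k z, (k <= K)%N -> `|p.2 k z| <= p.1 * (S z)^-1 ^+ M].
  move=> i; have [N [g [N0 g0 gd gb]]] := Sinv_derivs i M K 0 0.
  exists (N, g); split => //=; rewrite g0; apply/funext => y.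
  by rewrite expr0 mul1r !addn0.
have G0 i : 0 <= (G i).1 by case: (hG i).
exists (\sum_i (G i).1); first exact: sumr_ge0.
split.
  by apply: ctX; apply: ctV => [y|]; [rewrite gt_eqF ?S_gt0|exact: S_continuous].
exists (fun i => (G i).2); split => [i|i k z kK|i k z kK]; have [_ g0 gd gb] := hG i => //.
  exact: gd.
apply: (le_trans (gb _ _ kK)); rewrite ler_wpM2r ?exprn_ge0 ?Sinv_ge0//.
by rewrite (bigD1 i)//= lerDl sumr_ge0.
Qed.

End weight_power.

(** * The charts of the quadric *)

Section quadratic_roots.
Context {R : realType}.
Implicit Types (a b c u : R) (s : bool).

(** For q(u) = a u^2/2 + b u + c this is the square of the slope a u + b at a root. In [qdom] and
    [qroot] the sign of that slope, (-1)^s, selects the root; if a = 0 the only root has the sign of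
    b. *)
Definition qdisc a b c : R := b ^+ 2 - 2 * a * c.
Definition qdom a b c s : bool := (0 < qdisc a b c) && ((a != 0) || (0 < (-1) ^+ s * b)).
Definition qroot a b c s : R :=
  if a == 0 then - c / b else ((-1) ^+ s * Num.sqrt (qdisc a b c) - b) / a.

Lemma sgn_sqr s : (-1) ^+ s * (-1) ^+ s = 1 :> R.
Proof. by case: s; rewrite ?expr0 ?expr1; ring. Qed.

Lemma qdom_neq0 a b c s : qdom a b c s -> a = 0 -> b != 0.
Proof. by move=> /andP[_ /orP[/eqP//|h] _]; apply: contraTneq h => ->; rewrite mulr0 ltxx. Qed.

Lemma qroot_slope a b c s : qdom a b c s ->
  a * qroot a b c s + b = (-1) ^+ s * Num.sqrt (qdisc a b c).
Proof.
move=> h; rewrite /qroot; case: eqP => [a0|/eqP a0]; last by field.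
have := h; rewrite /qdom a0 eqxx/= => /andP[_ sb].
rewrite /qdisc mulr0 !mul0r subr0 add0r sqrtr_sqr.
have : `|b| = (-1) ^+ s * b by rewrite -(gtr0_norm sb) normrM normrX normrN1 expr1n mul1r.
by move=> ->; rewrite mulrA sgn_sqr mul1r.
Qed.

Lemma qroot_root a b c s : qdom a b c s ->
  2^-1 * a * qroot a b c s ^+ 2 + b * qroot a b c s + c = 0.
Proof.
move=> h; have e := qroot_slope h; have [a0|a0] := eqVneq a 0.
  have b0 := qdom_neq0 h a0; rewrite /qroot a0 eqxx; field; exact: b0.
have D0 : 0 <= qdisc a b c by case/andP: h => /ltW.
have e2 : (a * qroot a b c s + b) ^+ 2 = qdisc a b c.
  by rewrite e exprMn expr2 sgn_sqr mul1r sqr_sqrtr.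
have a2 : 2 * a != 0 by rewrite mulf_neq0.
apply: (mulfI a2); rewrite mulr0 /qdisc in e2 *; move: (qroot _ _ _ _) e2 => u e2.
have -> : 2 * a * (2^-1 * a * u ^+ 2 + b * u + c) = (a * u + b) ^+ 2 - (b ^+ 2 - 2 * a * c) by field.
by rewrite e2 subrr.
Qed.

Lemma qroot_uniq a b c s u : 2^-1 * a * u ^+ 2 + b * u + c = 0 ->
  0 < (-1) ^+ s * (a * u + b) -> qdom a b c s /\ u = qroot a b c s.
Proof.
move=> q0 sl; have e2 : (a * u + b) ^+ 2 = qdisc a b c.
  rewrite /qdisc; have -> : (a * u + b) ^+ 2 = 2 * a * (2^-1 * a * u ^+ 2 + b * u + c) + (b ^+ 2 - 2 * a * c) by field.
  by rewrite q0 mulr0 add0r.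
have n0 : a * u + b != 0 by apply: contraTneq sl => ->; rewrite mulr0 ltxx.
have D0 : 0 < qdisc a b c by rewrite -e2 exprn_even_gt0//= n0.
have e : a * u + b = (-1) ^+ s * Num.sqrt (qdisc a b c).
  rewrite -e2 sqrtr_sqr; have -> : `|a * u + b| = (-1) ^+ s * (a * u + b).
    by rewrite -(gtr0_norm sl) normrM normrX normrN1 expr1n mul1r.
  by rewrite mulrA sgn_sqr mul1r.
rewrite /qdom D0/= /qroot; case: eqVneq => [a0|a0]/=.
  rewrite a0 mul0r add0r in sl n0; split=> //.
  move: q0; rewrite a0 mulr0 mul0r add0r => /eqP; rewrite addr_eq0 => /eqP q0.
  by apply: (mulfI n0); rewrite q0; field.
split=> //; rewrite -e; field; exact: a0.
Qed.

End quadratic_roots.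

Section sign_integral.
Context {R : realType}.
Local Notation leb := (@lebesgue_measure R).
Variables (G G' : R -> R) (C : R).
Hypothesis C0 : 0 <= C.
Hypothesis cG' : continuous G'.
Hypothesis dG : forall u : R, is_derive u (1 : R) G (G' u).
Hypothesis Gb : forall u, `|G u| <= C * rho u.
Hypothesis G'b : forall u, `|G' u| <= C * rho u.

Definition step (r u : R) : R := (r <= u)%R%:R.

Lemma step_measurable r : measurable_fun setT (step r).
Proof.
rewrite (_ : step r = \1_[set` `[r, +oo[%R]); first exact: measurable_indic.
by apply/funext => u; rewrite /step indicE mem_setE in_itv/= andbT.
Qed.

Let mG' : measurable_fun setT G'. Proof. exact: continuous_measurable_fun. Qed.
Let LC : L1 leb (fun u => C * rho u). Proof. exact/L1Z/L1_rho. Qed.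
Let LG' : L1 leb G'. Proof. exact: (@L1_dom _ _ _ leb _ _ mG' LC G'b). Qed.

Let Lstep r : L1 leb (fun u => step r u * G' u).
Proof.
have ms : measurable_fun setT (fun u => step r u * G' u).
  by apply: measurable_funM => //; exact: step_measurable.
apply: (@L1_dom _ _ _ leb _ _ ms LC) => u.
rewrite normrM; apply: le_trans (G'b u); rewrite ler_piMl// /step.
by case: (r <= u)%R; rewrite ?normr0 ?normr1.
Qed.

Lemma rho_shift_le (r y : R) : rho (r + y) <= 2 * (1 + r ^+ 2) * rho y.
Proof. by have := rho_shift (r + y) (- r); rewrite sqrrN addrAC subrr add0r. Qed.

Lemma G_lim r : (fun n => G (r + n.+1%:R)) @ \oo --> 0 /\ (fun n => G (r - n.+1%:R)) @ \oo --> 0.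
Proof.
have h (e : R) : `|e| = 1 -> (fun n => G (r + e * n.+1%:R)) @ \oo --> 0.
  move=> e1; apply: norm_cvg0.
  pose K := C * (2 * (1 + r ^+ 2)).
  have hK : (fun n : nat => K * n.+1%:R^-1) @ \oo --> 0.
    by rewrite -(mulr0 K); apply: cvgM; [exact: cvg_cst|exact: cvg_harmonic].
  apply: (squeeze_cvgr _ (@cvg_cst _ _ _ _ _) hK); near=> n; rewrite normr_ge0/=.
  apply: (le_trans (Gb _)); rewrite /K -mulrA ler_wpM2l//; apply: (le_trans (rho_shift_le _ _)).
  have rr : 0 <= 2 * (1 + r ^+ 2) by rewrite mulr_ge0// addr_ge0 ?sqr_ge0.
  rewrite ler_wpM2l// /rho -(real_normK (num_real _)) normrM e1 mul1r ger0_norm//.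
  have n1 : 1 <= n.+1%:R :> R by rewrite ler1n.
  by rewrite lef_pV2 ?posrE ?ltr_wpDr ?sqr_ge0//; nra.
split; first by have := h 1; rewrite normr1 => /(_ erefl); under eq_fun do rewrite mul1r.
by have := h (-1); rewrite normrN1 => /(_ erefl); under eq_fun do rewrite mulN1r.
Unshelve. all: by end_near.
Qed.

Lemma int_window (f : R -> R) (x y : nat -> R) (l : R) : measurable_fun setT f ->
  (forall n, x n < y n) ->
  (forall u, \forall n \near \oo, \1_[set` `[x n, y n]%R] u * G' u = f u) ->
  (fun n => G (y n) - G (x n)) @ \oo --> l -> \int[leb]_u f u = l.
Proof.
move=> mf xy nf cl; pose F n u := \1_[set` `[x n, y n]%R] u * G' u.
have mF n : measurable_fun setT (F n).
  by apply: measurable_funM => //; exact: measurable_indic.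
have lim u : (fun n => F n u) @ \oo --> f u by apply: cvg_near_cst; exact: nf.
have dom n u : `|F n u| <= C * rho u.
  rewrite normrM; apply: le_trans (G'b u); rewrite ler_piMl// indicE.
  by case: (_ \in _); rewrite ?normr0 ?normr1.
have [_ h] := @rint_cvg _ _ R leb F f _ mF mf (aeW leb lim) LC dom.
have E n : \int[leb]_u F n u = G (y n) - G (x n) by apply: ftc_ind.
by apply: (cvg_unique _ h) => //; rewrite (_ : (fun n => _) = fun n => G (y n) - G (x n))//; exact/funext.
Qed.

Lemma int_step r : \int[leb]_u (step r u * G' u) = - G r.
Proof.
apply: (int_window (x := fun=> r) (y := fun n => r + n.+1%:R)).
- by apply: measurable_funM => //; exact: step_measurable.
- by move=> n; rewrite ltrDl.
- move=> u; exists (Num.truncn `|u - r|) => // n /= hn.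
  have hu : `|u - r| <= n.+1%:R by apply/ltW/(lt_le_trans (truncnS_gt _)); rewrite ler_nat ltnS.
  rewrite indicE mem_setE in_itv/= /step; congr (_ * _); case: (leP r u) => //= ru.
  by rewrite -lerBlDl (le_trans (ler_norm _)).
have [h _] := G_lim r; have := cvgB h (@cvg_cst _ (G r) nat \oo _).
by rewrite sub0r; exact.
Qed.

Lemma int_all : \int[leb]_u G' u = 0.
Proof.
apply: (int_window (x := fun n => 0 - n.+1%:R) (y := fun n => 0 + n.+1%:R)) => //.
- by move=> n; rewrite add0r add0r gtrN.
- move=> u; exists (Num.truncn `|u|) => // n /= hn.
  have hu : `|u| <= n.+1%:R by apply/ltW/(lt_le_trans (truncnS_gt _)); rewrite ler_nat ltnS.
  by rewrite indicE mem_setE in_itv/= !add0r -ler_norml hu mul1r.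
by have [h1 h2] := G_lim 0; have := cvgB h1 h2; rewrite subr0; exact.
Qed.

Lemma eq_rint_off (f g : R -> R) (r1 r2 : R) : L1 leb f -> L1 leb g ->
  (forall u, u != r1 -> u != r2 -> f u = g u) -> \int[leb]_u f u = \int[leb]_u g u.
Proof.
move=> Lf Lg fg; rewrite /Rintegral; congr fine; apply: ae_eq_integral => //.
- by apply/measurable_EFinP; exact: (L1_measurable Lf).
- by apply/measurable_EFinP; exact: (L1_measurable Lg).
exists ([set r1] `|` [set r2]); split.
- by apply: measurableU; exact: measurable_set1.
- by apply: countable_lebesgue_measure0; apply/finite_set_countable; rewrite finite_setU; split; exact: finite_set1.
move=> u /= h; apply: contrapT => /not_orP[/eqP h1 /eqP h2]; apply: h => _.
by rewrite fg.
Qed.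

Lemma sg_step (x : R) : Num.sg x = step 0 x - step 0 (- x).
Proof. by rewrite /step oppr_ge0; case: sgrP => h; rewrite ?(ltW h) ?(lt_geF h) ?lexx ?subrr ?subr0 ?sub0r. Qed.

Lemma sg_measurable : measurable_fun setT (@Num.sg R).
Proof.
rewrite (_ : @Num.sg R = fun x => step 0 x - step 0 (- x)); last by apply/funext/sg_step.
apply: measurable_funB; first exact: step_measurable.
by apply: (measurableT_comp (step_measurable 0)).
Qed.

Lemma L1_sg (q : R -> R) : measurable_fun setT q -> L1 leb (fun u => Num.sg (q u) * G' u).
Proof.
move=> mq; have ms : measurable_fun setT (fun u => Num.sg (q u) * G' u).
  by apply: measurable_funM => //; apply: (measurableT_comp sg_measurable).
apply: (@L1_dom _ _ _ leb _ _ ms LC) => u.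
rewrite normrM; apply: le_trans (G'b u); rewrite ler_piMl//.
by case: sgrP; rewrite ?normr0 ?normrN1 ?normr1.
Qed.

Lemma sg_subr (r u : R) : u != r -> Num.sg (u - r) = 2 * step r u - 1.
Proof.
rewrite /step => ur; case: (leP r u) => h.
  by rewrite gtr0_sg ?mulr1; [ring|rewrite subr_gt0 lt_neqAle eq_sym ur].
by rewrite ltr0_sg ?subr_lt0// mulr0 sub0r.
Qed.

Lemma stepM (r r' u : R) : r <= r' -> step r' u * step r u = step r' u.
Proof. by rewrite /step => rr; case: (leP r' u) => h; rewrite ?mul0r// (le_trans rr h) mulr1. Qed.

Lemma quad_measurable a b c : measurable_fun setT (fun u : R => 2^-1 * a * u ^+ 2 + b * u + c).
Proof.
apply: continuous_measurable_fun; have ci : continuous (@id R) by move=> x; exact: cvg_id.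
apply: ctD; last exact: ctC.
by apply: ctD; apply: ctM; [exact: ctC|exact: ctX|exact: ctC|].
Qed.

(** Integration by parts: at a simple root the sign of q jumps by 2 in the direction of the slope,
    and G vanishes at infinity. *)
Lemma sgn_quad a b c : \int[leb]_u (Num.sg (2^-1 * a * u ^+ 2 + b * u + c) * G' u) =
  - 2 * \sum_s (qdom a b c s)%:R * ((-1) ^+ s * G (qroot a b c s)).
Proof.
pose q u := 2^-1 * a * u ^+ 2 + b * u + c.
have mq : measurable_fun setT q := quad_measurable a b c.
have L2 k r1 r2 : L1 leb (fun u => k * (G' u + 2 * (step r1 u * G' u) - 2 * (step r2 u * G' u))).
  by apply: L1Z; apply: L1B; [apply: L1D => //|]; exact: L1Z.
have I2 k r1 r2 : \int[leb]_u (k * (G' u + 2 * (step r1 u * G' u) - 2 * (step r2 u * G' u))) =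
    k * (2 * (G r2 - G r1)).
  rewrite rintZ; last by apply: L1B; [apply: L1D => //|]; exact: L1Z.
  rewrite rintB; [|by apply: L1D => //; exact: L1Z|exact: L1Z].
  rewrite rintD//; last exact: L1Z.
  by rewrite !rintZ// !int_step int_all; ring.
rewrite big_bool/= expr1 expr0; have [a0|a0] := eqVneq a 0; last first.
  (* Without a root, or with a double one, q keeps the sign of a off the point - b/a, and the
     integral of G' is 0. *)
  have [D0|D0] := ltP 0 (qdisc a b c); last first.
    rewrite /qdom (le_gtF D0)/= !mul0r addr0 mulr0 -/(q _).
    transitivity (\int[leb]_u (Num.sg a * (G' u + 2 * (step 0 u * G' u) - 2 * (step 0 u * G' u)))); last first.
      by rewrite I2 subrr !mulr0.
    apply: (@eq_rint_off _ _ (- b / a) 0) => //; first exact: L1_sg.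
    move=> u nu _; rewrite addrK; congr (_ * _).
    have e : 2 * a * q u = (a * u + b) ^+ 2 - qdisc a b c by rewrite /q /qdisc; field.
    have n0 : a * u + b != 0.
      by apply: contra nu; rewrite addr_eq0 => /eqP h; apply/eqP; rewrite -h; field.
    have : 0 < 2 * a * q u by rewrite e ltr_wpDr ?oppr_ge0// exprn_even_gt0//= n0.
    by rewrite -mulrA pmulr_rgt0// => /gtr0_sg; rewrite sgrM; case: sgrP; case: sgrP => //; lra.
  have qd s : qdom a b c s by rewrite /qdom D0 a0.
  rewrite !qd !mul1r.
  pose r1 := qroot a b c true; pose r0 := qroot a b c false.
  have sD : 0 < Num.sqrt (qdisc a b c) by rewrite sqrtr_gt0.
  have e0 : a * r0 + b = Num.sqrt (qdisc a b c) by rewrite (qroot_slope (qd false)) expr0 mul1r.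
  have e1 : a * r1 + b = - Num.sqrt (qdisc a b c) by rewrite (qroot_slope (qd true)) expr1 mulN1r.
  have qE u : q u = 2^-1 * a * (u - r0) * (u - r1).
    have z0 : 2^-1 * a * r0 ^+ 2 + b * r0 + c = 0 := qroot_root (qd false).
    have b2 : b = - (2^-1 * a * (r0 + r1)) by move: e0 e1; lra.
    rewrite -[LHS]subr0 -[in X in _ - X]z0 /q b2; ring.
  have sE u : u != r0 -> u != r1 -> Num.sg (q u) = Num.sg a * ((2 * step r0 u - 1) * (2 * step r1 u - 1)).
    by move=> h0 h1; rewrite qE !sgrM -!sg_subr// [Num.sg 2^-1]gtr0_sg// mul1r mulrA.
  have [ap|an] : a > 0 \/ a < 0 by have [h|h|h] := ltgtP a 0; [right|left|rewrite h eqxx in a0].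
    have r10 : r1 <= r0 by rewrite -(ler_pM2l ap); lra.
    transitivity (\int[leb]_u (1 * (G' u + 2 * (step r0 u * G' u) - 2 * (step r1 u * G' u)))).
      apply: (@eq_rint_off _ _ r0 r1) => //; first exact: L1_sg.
      move=> u h0 h1; rewrite -/(q u) sE// gtr0_sg//; have := stepM u r10.
      by move: (step r0 u) (step r1 u) (G' u) => x y z e; ring: e.
    by rewrite I2; ring.
  have r01 : r0 <= r1 by rewrite -(ler_nM2l an); lra.
  transitivity (\int[leb]_u (- 1 * (G' u + 2 * (step r1 u * G' u) - 2 * (step r0 u * G' u)))).
    apply: (@eq_rint_off _ _ r0 r1) => //; first exact: L1_sg.
    move=> u h0 h1; rewrite -/(q u) sE// ltr0_sg//; have := stepM u r01.
    by move: (step r0 u) (step r1 u) (G' u) => x y z e; ring: e.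
  by rewrite I2; ring.
have [b0|b0] := eqVneq b 0.
  transitivity (\int[leb]_u (Num.sg c * (G' u + 2 * (step 0 u * G' u) - 2 * (step 0 u * G' u)))).
    by apply: eq_rint => u; rewrite addrK a0 b0 mulr0 !mul0r !add0r.
  have qd s : qdom a b c s = false by rewrite /qdom /qdisc a0 b0 expr0n/= mulr0 mul0r subr0 ltxx.
  by rewrite I2 !qd subrr !mul0r addr0 !mulr0.
pose r := - c / b.
transitivity (\int[leb]_u (Num.sg b * (2 * (step r u * G' u) - G' u))).
  apply: (@eq_rint_off _ _ r r) => //; first exact: L1_sg.
    by apply: L1Z; apply: L1B => //; exact: L1Z.
  move=> u h _; have -> : 2^-1 * a * u ^+ 2 + b * u + c = b * (u - r) by rewrite a0 /r; field.
  by rewrite sgrM sg_subr//; ring.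
rewrite rintZ; last by apply: L1B => //; exact: L1Z.
rewrite rintB//; last exact: L1Z.
rewrite rintZ// int_step int_all subr0 /qdom /qdisc /qroot a0 eqxx/= mulr0 mul0r subr0 exprn_even_gt0//= b0/=.
rewrite expr1 expr0 !mulN1r !mul1r oppr_gt0 -/r.
by have [h|h|h] := ltgtP b 0; [rewrite ltr0_sg//=; ring|rewrite gtr0_sg//=; ring|rewrite h eqxx in b0].
Qed.

End sign_integral.

Section fiber_integral.
Context {R : realType} {n : nat}.
Local Notation E := 'rV[R]_n.+1.
Local Notation leb := (@lebesgue_measure R).
Local Notation lt := (@lebesgue_tuple R n).
Local Notation row := (@row_of_tuple R n).
Variables (i : 'I_n.+1) (h : E -> R) (C : R).
Hypothesis C0 : 0 <= C.
Hypothesis ch : continuous h.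
Hypothesis hC : forall y, `|h y| <= C * (S y)^-1 ^+ n.+1.

Lemma fiber_measurable : measurable_fun setT (fun t => \int[leb]_u h (insc i u (row t))).
Proof.
have LN : L1 leb (fun u => C * rho u) by exact/L1Z/L1_rho.
have := @fub_L12 _ _ (measurableTypeR R) _ R leb lt _ _ _ (insc_measurable i ch) LN (@L1_prod_rho R n).
by move=> /(_ _) H; apply: (L1_measurable (H _)) => u t; exact: (insc_dom i C0 hC).
Qed.

Lemma fiber_bound t : `|\int[leb]_u h (insc i u (row t))| <=
  C * (\int[leb]_u rho u) * \prod_j rho ((row t) 0 j).
Proof.
have -> : C * (\int[leb]_u rho u) * \prod_j rho ((row t) 0 j) =
   \int[leb]_u (C * (\prod_j rho ((row t) 0 j)) * rho u).
  by rewrite rintZ; [rewrite mulrAC|exact: L1_rho].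
apply: rint_norm => [||u].
- exact: (L1_measurable (L1_insc i C0 ch hC t)).
- by apply: L1Z; exact: L1_rho.
- by rewrite mulrAC; exact: (insc_dom i C0 hC).
Qed.

End fiber_integral.

Section chart.
Context {R : realType} {n : nat}.
Local Notation d := n.+1.
Variable A : 'M[int]_d.
Hypothesis symA : A^T = A.
Local Notation E := 'rV[R]_d.
Local Notation leb := (@lebesgue_measure R).
Local Notation lt := (@lebesgue_tuple R d).
Local Notation ltn := (@lebesgue_tuple R n).
Local Notation row := (@row_of_tuple R d).
Local Notation rown := (@row_of_tuple R n).
Variables (m : R) (i : 'I_d).

Definition rowA : E := \row_j (A i j)%:~R.
Definition la : R := (A i i)%:~R.
Definition lb (x : 'rV[R]_n) : R := mxact A (insc i 0 x) 0 i.
Definition lc (x : 'rV[R]_n) : R := qform A (insc i 0 x) - m.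
Definition chart_disc x : R := qdisc la (lb x) (lc x).
Definition chart_dom s x : bool := qdom la (lb x) (lc x) s.
Definition chart_pt s (x : 'rV[R]_n) : E := insc i (qroot la (lb x) (lc x) s) x.

Lemma mxact_coord y : mxact A y 0 i = dotv rowA y.
Proof. by rewrite /mxact /dotv !mxE; apply: eq_bigr => j _; rewrite !mxE mulrC. Qed.

Lemma slope_insc u x : mxact A (insc i u x) 0 i = la * u + lb x.
Proof. by rewrite insc_unit /lb !mxact_coord dotvDr dotvZr dotv_unit mxE mulrC addrC. Qed.

Lemma qform_insc u x : qform A (insc i u x) - m = 2^-1 * la * u ^+ 2 + lb x * u + lc x.
Proof. by rewrite insc_unit qform_line// /lc /lb /la; ring. Qed.

Variable k : R.
Hypothesis k0 : 0 < k.

(** A smooth substitute for 1/l: l [hk] l = l^2/(k^2 + l^2). *)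
Definition hk (l : R) : R := l / (k ^+ 2 + l ^+ 2).
Definition hk' (l : R) : R := (k ^+ 2 - l ^+ 2) / (k ^+ 2 + l ^+ 2) ^+ 2.
(* On the quadric the slope [l = (A y)_i] is [+- sqrt (chart_disc x)]; the factor is
   [1 / |l|] damped by [l^2 / (k^2 + l^2)]. *)
Definition Tk (f : E -> R) (x : 'rV[R]_n) : R :=
  \sum_s (chart_dom s x)%:R * (f (chart_pt s x) * (Num.sqrt (chart_disc x) / (k ^+ 2 + chart_disc x))).

Let den (l : R) : 0 < k ^+ 2 + l ^+ 2.
Proof. by rewrite ltr_wpDr ?sqr_ge0// exprn_gt0. Qed.

Lemma hk_derive (u : R) : is_derive u (1 : R) hk (hk' u).
Proof.
pose Q v := 1 * v ^+ 2 + 0 * v + k ^+ 2.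
have QE v : Q v = k ^+ 2 + v ^+ 2 by rewrite /Q; ring.
have dq : is_derive u (1 : R) Q (2 * 1 * u + 0) by exact: is_derive_quadratic.
have nq : Q u != 0 by rewrite QE gt_eqF.
have h := is_deriveM (is_derive_id u (1 : R)) (is_deriveV nq dq).
apply: is_derive_fun h => [v|]; first by rewrite !fctE QE.
rewrite /GRing.scale/= /hk'; have := lt0r_neq0 (den u); rewrite QE.
have -> : k ^+ 2 - u ^+ 2 = k ^+ 2 + u ^+ 2 - 2 * u ^+ 2 by ring.
by move: (k ^+ 2 + _) => D D0; field.
Qed.

Lemma hk'_ct : continuous hk'.
Proof.
have ci : continuous (@id R) by move=> x; exact: cvg_id.
apply: ctM; first by apply: ctB; [exact: ctC|exact: ctX].
apply: ctV => [x|]; first by rewrite expf_neq0// gt_eqF.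
by apply: ctX; apply: ctD; [exact: ctC|exact: ctX].
Qed.

Let hB : R := k^-1 + k^-1 ^+ 2.
Let hB0 : 0 <= hB. Proof. by rewrite addr_ge0 ?exprn_ge0 ?invr_ge0 ?ltW. Qed.

Lemma hk_bound l : `|hk l| <= hB.
Proof.
have kp : 0 < k^-1 by rewrite invr_gt0.
apply: (@le_trans _ _ k^-1); last by rewrite lerDl exprn_ge0 ?ltW.
rewrite normrM normfV (gtr0_norm (den l)) ler_pdivrMr//.
rewrite -(ler_pM2l k0) mulrA divff ?gt_eqF// mul1r -(real_normK (num_real l)).
by move: `|l| => z; nra.
Qed.

Lemma hk'_bound l : `|hk' l| <= hB.
Proof.
apply: (@le_trans _ _ (k^-1 ^+ 2)); last by rewrite lerDr invr_ge0 ltW.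
rewrite normrM normfV [`|_ ^+ 2|]ger0_norm ?sqr_ge0// ler_pdivrMr ?exprn_gt0//.
apply: (@le_trans _ _ (k ^+ 2 + l ^+ 2)).
  by rewrite ler_norml; have := sqr_ge0 k; have := sqr_ge0 l; move: (k ^+ 2) (l ^+ 2) => a b; lra.
rewrite exprVn ler_pdivlMl ?exprn_gt0// expr2 ler_wpM2r ?(ltW (den l))//.
by rewrite lerDl sqr_ge0.
Qed.

Lemma hk_chi l : l * hk l = 1 - rho (l / k).
Proof.
rewrite /hk /rho; have kn := lt0r_neq0 k0; have := lt0r_neq0 (den l).
have -> : 1 + (l / k) ^+ 2 = (k ^+ 2 + l ^+ 2) / k ^+ 2 by field.
have -> : l * (l / (k ^+ 2 + l ^+ 2)) = (k ^+ 2 + l ^+ 2 - k ^+ 2) / (k ^+ 2 + l ^+ 2) by rewrite addrAC subrr add0r mulrA -expr2.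
by move: (k ^+ 2 + l ^+ 2) => D D0; field; rewrite D0 kn.
Qed.

Variables (M : nat) (N : R) (f : E -> R) (g : 'I_d -> E -> R).
Hypothesis N0 : 0 <= N.
Hypothesis dM : (d <= M)%N.
Hypothesis hf : C1 M N f g.

Let G (y : E) : R := f y * hk (mxact A y 0 i).
Let gG (j : 'I_d) (y : E) : R := g j y * hk (mxact A y 0 i) + f y * ((A i j)%:~R * hk' (mxact A y 0 i)).

Let slope_ct : continuous (fun y : E => mxact A y 0 i).
Proof. by rewrite (_ : (fun y => _) = dotv rowA); [exact: dotvl_continuous|exact/funext/mxact_coord]. Qed.

Lemma chart_C1 : exists2 K : R, 0 <= K & C1 M K G gG.
Proof.
pose D : R := 1 + \sum_j `|(A i j)%:~R : R|.
have D1 : 1 <= D by rewrite lerDl sumr_ge0.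
have h := @C1_lin R d hk hk' (fun y => mxact A y 0 i) (fun j => (A i j)%:~R) hB D hB0 D1 slope_ct.
have {}h := h _ _ hk'_ct hk_derive hk_bound hk'_bound.
exists (2 * (N * (D * hB))); first by rewrite !mulr_ge0// (le_trans ler01).
rewrite -(addn0 M); apply: C1_mul => //; first by rewrite mulr_ge0// (le_trans ler01).
apply: h => [j y u|j].
  by rewrite !mxact_coord dotvDr dotvZr dotv_unit mxE.
by rewrite /D (bigD1 j)//= addrCA lerDl addr_ge0// sumr_ge0.
Qed.

Lemma psi_line eta y : 0 < eta ->
  is_derive y (unitv i) (fun y => psi eta (qform A y - m)) (pk eta (qform A y - m) * mxact A y 0 i).
Proof.
move=> e0; apply: derive_line0.
pose Q (u : R) := 2^-1 * la * u ^+ 2 + mxact A y 0 i * u + (qform A y - m).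
have Q0 : Q 0 = qform A y - m by rewrite /Q; ring.
have dq : is_derive (0 : R) (1 : R) Q (mxact A y 0 i).
  by apply: is_derive_fun (is_derive_quadratic _ _ _ _) => //; ring.
have dp : is_derive (Q 0) (1 : R) (psi eta) (pk eta (qform A y - m)) by rewrite Q0; exact: psi_derive.
have h := @is_derive1_comp _ _ _ _ _ _ dp dq.
apply: is_derive_fun h => [u|//]; rewrite /= /Q qform_line// /la; congr psi; ring.
Qed.

(** The derivative of psi(F - m) f hk(l) in the coordinate i is pk(F - m) l f hk(l) plus psi(F - m)
    times the derivative of f hk(l), and l hk(l) = 1 - [chi]. *)
Lemma chart_ibp eta : 0 < eta ->
  \int[lt]_x (f (row x) * (1 - chi rowA k (row x)) * pk eta (qform A (row x) - m)) =
  - \int[lt]_x (psi eta (qform A (row x) - m) * gG i (row x)).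
Proof.
move=> e0; have [K K0 [cG cgG dG GK gK]] := chart_C1; have [cf cg _ fN _] := hf.
pose P1 (y : E) := f y * (1 - chi rowA k y) * pk eta (qform A y - m).
pose P2 (y : E) := psi eta (qform A y - m) * gG i y.
have cqm : continuous (fun y : E => qform A y - m).
  by apply: ctB; [exact: qform_continuous|exact: ctC].
have cp : continuous (fun y : E => psi eta (qform A y - m)) by apply: ct_comp => //; exact: psi_continuous.
have c1 : continuous P1.
  apply: ctM; last by apply: ct_comp => //; exact: pk_continuous.
  by apply: ctM => //; apply: ctB; [exact: ctC|exact: chi_ct].
have c2 : continuous P2 by exact: ctM.
have Sd (y : E) : (S y)^-1 ^+ M <= (S y)^-1 ^+ d by exact: SinvX_le.
pose C := 2 / eta * N + K.
have e2 : 0 <= 2 / eta by rewrite divr_ge0 ?ltW.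
have C0 : 0 <= C by apply: addr_ge0 => //; exact: mulr_ge0.
have half (x z : R) : `|x| <= 1 / 2 -> `|x * z| <= `|z|.
  by move=> hx; rewrite normrM ler_piMl//; lra.
have b1 y : `|P1 y| <= 2 / eta * N * (S y)^-1 ^+ d.
  rewrite normrM mulrC -mulrA; apply: ler_pM => //.
    by rewrite ger0_norm ?pk_ge0 ?pk_le.
  rewrite normrM; apply: le_trans (ler_wpM2l N0 (Sd y)); apply: le_trans (fN y).
  rewrite ler_piMr// ger0_norm ?subr_ge0 ?rho_le1//.
  by rewrite lerBlDr lerDl rho_ge0.
have b2 y : `|P2 y| <= K * (S y)^-1 ^+ d.
  apply: (le_trans (half _ _ (psi_bound _ _))); apply: (le_trans (gK i y)).
  by rewrite ler_wpM2l.
have L1' : L1 lt (fun x => P1 (row x)) by exact: (L1_row c1 b1).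
have L2' : L1 lt (fun x => P2 (row x)) by exact: (L1_row c2 b2).
apply/eqP; rewrite -addr_eq0 -rintD//; apply/eqP.
apply: (@ibp R d i (fun y => psi eta (qform A y - m) * G y) (fun y => P1 y + P2 y) C) => //.
- exact: ctM.
- exact: ctD.
- move=> y; have h := is_deriveM (psi_line y e0) (dG i y).
  apply: (@is_derive_eq _ _ _ _ _ _ _ _ h); rewrite /GRing.scale/= /P1 /P2 /chi -mxact_coord -hk_chi /G.
  by ring.
- move=> y; apply: (le_trans (half _ _ (psi_bound _ _))); apply: (le_trans (GK y)).
  by apply: ler_pM => //; rewrite ?exprn_ge0 ?Sinv_ge0// lerDr mulr_ge0.
- move=> y; apply: (le_trans (ler_normD _ _)); rewrite mulrDl; exact: lerD.
Qed.

(** [sgn_quad] on the line through x: at a root the slope l is (-1)^s sqrt([chart_disc]), and its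
    sign times hk(l) is the positive factor in [Tk]. *)
Lemma fiber_sgn x : forall t, x = rown t ->
  \int[leb]_u (Num.sg (qform A (insc i u x) - m) / 2 * gG i (insc i u x)) = - Tk f x.
Proof.
move=> t xt; have [K K0 [cG cgG dG GK gK]] := chart_C1.
pose p := \prod_j rho (x 0 j).
have p0 : 0 <= p by apply: prodr_ge0 => j _; exact: rho_ge0.
have Sd (y : E) : (S y)^-1 ^+ M <= (S y)^-1 ^+ d by exact: SinvX_le.
have Kd (h : E -> R) : (forall y, `|h y| <= K * (S y)^-1 ^+ M) -> forall u, `|h (insc i u x)| <= K * p * rho u.
  move=> hh u; rewrite xt /p xt mulrAC; apply: (insc_dom i K0) => y.
  by apply: (le_trans (hh y)); rewrite ler_wpM2l.
have ci : continuous (fun u : R => insc i u x).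
  apply: ct_rV => j; case: (unliftP i j) => [j' ->|->].
    by under eq_fun do rewrite insc_lift; exact: ctC.
  by under eq_fun do rewrite insc_i; move=> u; exact: cvg_id.
have cg : continuous (fun u : R => gG i (insc i u x)).
  by move=> u; apply: (@continuous_comp _ _ _ (fun u : R => insc i u x) (gG i)); [exact: ci|exact: cgG].
have dg u : is_derive u (1 : R) (fun u => G (insc i u x)) (gG i (insc i u x)).
  rewrite (_ : (fun u => _) = fun u => G (insc i 0 x + u *: unitv i)); last first.
    by apply/funext => v; rewrite insc_unit.
  by rewrite (insc_unit i u x); apply: is_derive_line; exact: dG.
have S := @sgn_quad R _ _ (K * p) (mulr_ge0 K0 p0) cg dg (Kd _ GK) (Kd _ (gK i)) la (lb x) (lc x).
under eq_rint do rewrite qform_insc mulrAC [_ * 2^-1]mulrC.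
rewrite rintZ; last first.
  exact: (@L1_sg R _ (K * p) cg (Kd _ (gK i)) _ (quad_measurable la (lb x) (lc x))).
rewrite S /Tk mulNr mulrN mulrA mulVf// mul1r; congr (- _).
apply: eq_bigr => s _; case hs : (chart_dom s x); rewrite /chart_dom in hs; rewrite hs; last by rewrite !mul0r.
rewrite !mul1r /G mulrCA; congr (_ * _); rewrite slope_insc qroot_slope// /hk.
rewrite exprMn sqr_sqrtr; last by case/andP: hs => /ltW.
by rewrite (expr2 ((-1) ^+ s)) sgn_sqr mul1r !mulrA sgn_sqr mul1r.
Qed.

Lemma chart_limit : L1 ltn (fun t => Tk f (rown t)) /\
  (fun j => \int[lt]_x (f (row x) * (1 - chi rowA k (row x)) * pk j.+1%:R^-1 (qform A (row x) - m))) @ \oo -->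
  \int[ltn]_t Tk f (rown t).
Proof.
have [K K0 [cG cgG dG GK gK]] := chart_C1.
pose h (j : nat) (y : E) := psi j.+1%:R^-1 (qform A y - m) * gG i y.
have j0 (j : nat) : 0 < j.+1%:R^-1 :> R by rewrite invr_gt0.
have ch j : continuous (h j).
  apply: ctM => //; apply: ct_comp; first exact: psi_continuous.
  by apply: ctB; [exact: qform_continuous|exact: ctC].
have hg j y : `|h j y| <= `|gG i y|.
  by rewrite normrM ler_piMl//; have := psi_bound j.+1%:R^-1 (qform A y - m); lra.
have gd y : `|gG i y| <= K * (S y)^-1 ^+ d.
  by apply: (le_trans (gK i y)); rewrite ler_wpM2l// SinvX_le.
have hd j y : `|h j y| <= K * (S y)^-1 ^+ d by exact: le_trans (hg j y) (gd y).
have LK : L1 leb (fun u => K * rho u) by exact/L1Z/L1_rho.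
pose a j t := \int[leb]_u h j (insc i u (rown t)).
have ma j : measurable_fun setT (a j) by exact: (fiber_measurable i K0 (ch j) (hd j)).
have lim t : (fun j => a j t) @ \oo --> - Tk f (rown t).
  rewrite -(fiber_sgn erefl).
  pose p := \prod_j rho ((rown t) 0 j).
  have ms (q : E -> R) : continuous q -> measurable_fun setT (fun u => q (insc i u (rown t))).
    move=> cq; apply: (measurableT_comp (insc_measurable i cq) (g := fun u => (u, t))).
    by apply: measurable_fun_pair.
  have Lp : L1 leb (fun u => K * p * rho u) by exact/L1Z/L1_rho.
  have dom j u : `|h j (insc i u (rown t))| <= K * p * rho u.
    by rewrite mulrAC; exact: (insc_dom i K0 (hd j)).
  have mlim : measurable_fun setT (fun u => Num.sg (qform A (insc i u (rown t)) - m) / 2 * gG i (insc i u (rown t))).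
    apply: measurable_funM; last exact: ms.
    apply: measurable_funM => //; apply: (measurableT_comp (@sg_measurable R)).
    by apply: (ms (fun y => qform A y - m)); apply: ctB; [exact: qform_continuous|exact: ctC].
  have ptw u : (fun j => h j (insc i u (rown t))) @ \oo --> Num.sg (qform A (insc i u (rown t)) - m) / 2 * gG i (insc i u (rown t)).
    by apply: cvgM; [exact: psi_lim|exact: cvg_cst].
  have [_ H] := @rint_cvg _ _ R leb (fun j u => h j (insc i u (rown t))) _ _ (fun j => ms _ (ch j)) mlim (aeW leb ptw) Lp dom.
  exact: H.
have mT : measurable_fun setT (fun t => - Tk f (rown t)).
  by apply: (measurable_fun_cvg ma) => t _; exact: lim.
have Lb : L1 ltn (fun t => K * (\int[leb]_u rho u) * \prod_j rho ((rown t) 0 j)).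
  exact/L1Z/L1_prod_rho.
have [LT cT] := @rint_cvg _ _ R ltn a _ _ ma mT (aeW ltn lim) Lb (fun j => fiber_bound i K0 (ch j) (hd j)).
have LT' : L1 ltn (fun t => Tk f (rown t)).
  by have := L1Z (-1) LT; under eq_fun do rewrite mulN1r opprK.
split=> //; have -> : \int[ltn]_t Tk f (rown t) = - (\int[ltn]_t - Tk f (rown t)).
  by rewrite -[RHS]mulN1r -rintZ//; apply: eq_rint => t; rewrite mulN1r opprK.
have := cvgN cT => /(_ _).
rewrite [X in _ -> X @ _ --> _](_ : _ = - (fun j => \int[ltn]_t a j t)); first by apply.
by apply/funext => j; rewrite (chart_ibp (j0 j)) (fub_coord i K0 (ch j) (hd j)).
Qed.

End chart.

Section monotone_limit.
Context d (T : measurableType d) (R : realType).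
Variable mu : {measure set T -> \bar R}.

Lemma L1_monotone_limit (f_ : nat -> T -> R) (f : T -> R) (B : R) :
  (forall n, L1 mu (f_ n)) -> (forall n x, 0 <= f_ n x) ->
  (forall n p x, (n <= p)%N -> f_ n x <= f_ p x) -> (forall x, f_ ^~ x @ \oo --> f x) ->
  (forall n, \int[mu]_x f_ n x <= B) -> L1 mu f.
Proof.
move=> Lf f0 nd lim hB.
have mf : measurable_fun setT f.
  by apply: (measurable_fun_cvg (fun n => L1_measurable (Lf n))) => x _; exact: lim.
have ff0 x : 0 <= f x.
  by rewrite -(cvg_lim _ (lim x))//; apply: limr_ge; [apply/cvg_ex; exists (f x); exact: lim|near=> n; exact: f0].
apply/integrableP; split; first exact/measurable_EFinP.
have -> : (\int[mu]_x `|(EFin \o f) x| = \int[mu]_x limn (fun n => (f_ n x)%:E))%E.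
  apply: eq_integral => x _; rewrite /= ger0_norm//; apply/esym/cvg_lim => //.
  by apply: cvg_EFin; [near=> n|exact: lim].
rewrite (monotone_convergence mu measurableT (g' := fun n x => (f_ n x)%:E)).
- apply: (@le_lt_trans _ _ B%:E); last exact: ltry.
  apply: lime_le.
    apply: ereal_nondecreasing_is_cvgn => n p np; apply: ge0_le_integral => //.
    + by move=> x _; rewrite lee_fin.
    + by apply/measurable_EFinP; exact: L1_measurable (Lf n).
    + by apply/measurable_EFinP; exact: L1_measurable (Lf p).
    + by move=> x _; rewrite lee_fin; exact: nd.
  by near=> n; rewrite -(L1_fineK (Lf n)) lee_fin.
- by move=> n; apply/measurable_EFinP; exact: L1_measurable (Lf n).
- by move=> n x _; rewrite lee_fin.
- by move=> x _ n p np; rewrite lee_fin; exact: nd.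
Unshelve. all: by end_near.
Qed.

Lemma measurable_level (f : T -> R) (c : R) : measurable_fun setT f -> measurable [set x | f x = c].
Proof.
move=> mf; have := mf measurableT _ (measurable_set1 c); rewrite setTI.
by congr measurable.
Qed.

(** The inverse, with value 0 at 0, is the pointwise limit of the continuous functions x/(x^2 +
    1/n). *)
Lemma measurable_funVr (f : T -> R) : measurable_fun setT f -> measurable_fun setT (fun x => (f x)^-1).
Proof.
move=> mf; apply: (measurableT_comp (f := fun y : R => y^-1)) => //.
have p (n : nat) (x : R) : 0 < x ^+ 2 + n.+1%:R^-1 by rewrite ltr_wpDl ?sqr_ge0.
apply: (measurable_fun_cvg (h := fun n (x : R) => x * (x ^+ 2 + n.+1%:R^-1)^-1)) => [n|x _].
  apply: continuous_measurable_fun; have ci : continuous (@id R) by move=> x; exact: cvg_id.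
  apply: ctM => //; apply: ctV => [x|]; first by rewrite gt_eqF.
  by apply: ctD; [exact: ctX|exact: ctC].
have [->|x0] := eqVneq x 0.
  by rewrite invr0; under eq_fun do rewrite mul0r; exact: cvg_cst.
have -> : x^-1 = x * (x ^+ 2 + 0)^-1 by rewrite addr0; field.
apply: cvgM; first exact: cvg_cst.
apply: cvgV; first by rewrite addr0 expf_neq0.
by apply: cvgD; [exact: cvg_cst|exact: cvg_harmonic].
Qed.

Lemma measurable_gt0 (f : T -> R) : measurable_fun setT f -> measurable_fun setT (fun x => (0 < f x)%R%:R : R).
Proof.
move=> mf; rewrite (_ : (fun x => _) = fun x => 1 - step 0 (- f x)).
  apply: measurable_funB => //; apply: (measurableT_comp (step_measurable 0)).
  exact: measurableT_comp.
by apply/funext => x; rewrite /step oppr_ge0 ltNge; case: (_ <= _); rewrite ?subrr ?subr0.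
Qed.

End monotone_limit.

(** * Removal of the damping, and null slices *)

Section chart_integral.
Context {R : realType} {n : nat}.
Local Notation d := n.+1.
Variable A : 'M[int]_d.
Hypothesis symA : A^T = A.
Hypothesis detA : \det A != 0.
Hypothesis d4 : (4 <= d)%N.
Local Notation E := 'rV[R]_d.
Local Notation leb := (@lebesgue_measure R).
Local Notation lt := (@lebesgue_tuple R d).
Local Notation ltn := (@lebesgue_tuple R n).
Local Notation row := (@row_of_tuple R d).
Local Notation rown := (@row_of_tuple R n).
Variables (m : R) (i : 'I_d).

Local Notation ldom := (chart_dom A m i).
Local Notation ldisc := (chart_disc A m i).
Local Notation gam := (chart_pt A m i).

Definition T0 (f : E -> R) (x : 'rV[R]_n) : R :=
  \sum_s (ldom s x)%:R * (f (gam s x) * (Num.sqrt (ldisc x))^-1).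

Lemma rowA_neq0 : exists j, rowA A i 0 j != 0 :> R.
Proof.
apply: contrapT => h; move: detA; rewrite (expand_det_row A i) big1 ?eqxx// => j _.
have [->|a0] := eqVneq (A i j) 0; first by rewrite mul0r.
by case: h; exists j; rewrite mxE intr_eq0.
Qed.

Let insc_fun_measurable (f : E -> R) (r : n.-tuple R -> R) : continuous f -> measurable_fun setT r ->
  measurable_fun setT (fun t => f (insc i (r t) (rown t))).
Proof.
move=> cf mr; apply: (measurableT_comp (insc_measurable i cf) (g := fun t => (r t, t))).
exact: measurable_fun_pair.
Qed.

Let lb_measurable : measurable_fun setT (fun t => lb A i (rown t)).
Proof. exact: (insc_fun_measurable (@mxact_continuous R d A i)). Qed.

Let lc_measurable : measurable_fun setT (fun t => lc A m i (rown t)).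
Proof. by apply: measurable_funB => //; apply: insc_fun_measurable => //; exact: qform_continuous. Qed.

Lemma ldisc_measurable : measurable_fun setT (fun t => ldisc (rown t)).
Proof. by apply: measurable_funB; [exact: measurable_funX|exact: measurable_funM]. Qed.

Lemma sqrt_ldisc_measurable : measurable_fun setT (fun t => Num.sqrt (ldisc (rown t))).
Proof.
apply: (measurableT_comp (f := @Num.sqrt R)); last exact: ldisc_measurable.
by apply: continuous_measurable_fun; exact: sqrt_continuous.
Qed.

Lemma ldom_measurable s : measurable_fun setT (fun t => (ldom s (rown t))%:R : R).
Proof.
rewrite (_ : (fun t => _) = fun t => (0 < ldisc (rown t))%R%:R *
    (if la A i != 0 :> R then 1 else (0 < (-1) ^+ s * lb A i (rown t))%R%:R)).
  apply: measurable_funM; first by apply: measurable_gt0; exact: ldisc_measurable.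
  by case: (la A i != 0) => //; apply: measurable_gt0; exact: measurable_funM.
apply/funext => t; rewrite /chart_dom /qdom -/(ldisc _); case: (0 < _); rewrite ?mul0r ?mul1r//=.
by case: (la A i == 0).
Qed.

Lemma gam_measurable s (f : E -> R) : continuous f -> measurable_fun setT (fun t => f (gam s (rown t))).
Proof.
move=> cf; apply: insc_fun_measurable => //; rewrite /qroot; case: (la A i == 0).
  by apply: measurable_funM; [exact: measurableT_comp|exact: measurable_funVr].
apply: measurable_funM => //; apply: measurable_funB => //; apply: measurable_funM => //.
exact: sqrt_ldisc_measurable.
Qed.

Lemma T0_measurable f : continuous f -> measurable_fun setT (fun t => T0 f (rown t)).
Proof.
move=> cf; apply: measurable_sum => s; apply: measurable_funM; first exact: ldom_measurable.
by apply: measurable_funM; [exact: gam_measurable|apply: measurable_funVr; exact: sqrt_ldisc_measurable].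
Qed.

Let f0 (y : E) : R := (S y)^-1 ^+ (2 * d).
Let f0_ge0 y : 0 <= f0 y. Proof. by rewrite exprn_ge0 ?Sinv_ge0. Qed.
Let C10 := C1_Sinv (R := R) (d := d) (2 * d).
Let dd : (d <= 2 * d)%N. Proof. by rewrite leq_pmull. Qed.
Let kp (j : nat) : 0 < j.+1%:R^-1 :> R. Proof. by rewrite invr_gt0. Qed.
Let N1_ge0 : 0 <= 1 + 2 * (2 * d)%:R :> R. Proof. by rewrite addr_ge0 ?mulr_ge0. Qed.

Lemma ldom_disc s x : ldom s x -> 0 < ldisc x.
Proof. by case/andP. Qed.

Let fac_ge0 (k D : R) : 0 < k -> 0 <= D -> 0 <= Num.sqrt D / (k ^+ 2 + D).
Proof. by move=> k0 h; rewrite divr_ge0 ?sqrtr_ge0// addr_ge0// exprn_ge0// ltW. Qed.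

Let fac_le (k D : R) : 0 < k -> 0 < D -> Num.sqrt D / (k ^+ 2 + D) <= (Num.sqrt D)^-1.
Proof.
move=> k0 h; have s0 : 0 < Num.sqrt D by rewrite sqrtr_gt0.
rewrite ler_pdivrMr ?ltr_wpDl ?exprn_ge0 ?(ltW k0)// ler_pdivlMl// -expr2 sqr_sqrtr ?(ltW h)//.
by rewrite lerDr exprn_ge0 ?ltW.
Qed.

Let fac_mono (k k' D : R) : 0 < k -> k <= k' -> 0 < D ->
  Num.sqrt D / (k' ^+ 2 + D) <= Num.sqrt D / (k ^+ 2 + D).
Proof.
move=> k0 kk h; have k'0 := lt_le_trans k0 kk.
rewrite ler_wpM2l ?sqrtr_ge0// lef_pV2 ?posrE ?ltr_wpDl ?exprn_ge0 ?(ltW k0) ?(ltW k'0)//.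
by rewrite lerD2r lerXn2r ?nnegrE ?(ltW k0) ?(ltW k'0).
Qed.

Let Tk_f0_ge0 (k : R) f x : 0 < k -> (forall y, 0 <= f y) -> 0 <= Tk A m i k f x.
Proof.
move=> k0 hf; apply: sumr_ge0 => s _; case h : (ldom s x); last by rewrite mul0r.
by rewrite mul1r mulr_ge0// fac_ge0// ltW// (ldom_disc h).
Qed.

Lemma Tk_lim f x : (fun j : nat => Tk A m i j.+1%:R^-1 f x) @ \oo --> T0 f x.
Proof.
rewrite /Tk /T0 big_bool; under eq_fun do rewrite big_bool.
suff H s : (fun j : nat => (ldom s x)%:R * (f (gam s x) * (Num.sqrt (ldisc x) / (j.+1%:R^-1 ^+ 2 + ldisc x)))) @ \oo -->
    (ldom s x)%:R * (f (gam s x) * (Num.sqrt (ldisc x))^-1) by apply: cvgD; exact: H.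
case h : (ldom s x); last first.
  by rewrite mul0r; under eq_fun do rewrite mul0r; exact: cvg_cst.
rewrite mul1r; under eq_fun do rewrite mul1r.
apply: cvgM; first exact: cvg_cst.
have D0 := ldom_disc h; have s0 : Num.sqrt (ldisc x) != 0 by rewrite gt_eqF ?sqrtr_gt0.
have -> : (Num.sqrt (ldisc x))^-1 = Num.sqrt (ldisc x) * (0 ^+ 2 + ldisc x)^-1.
  by rewrite expr0n add0r -[in X in _ = _ * X^-1](sqr_sqrtr (ltW D0)); field.
apply: cvgM; first exact: cvg_cst.
apply: cvgV; first by rewrite expr0n add0r gt_eqF.
apply: cvgD; last exact: cvg_cst.
by rewrite expr2; under eq_fun do rewrite expr2; apply: cvgM; exact: cvg_harmonic.
Qed.

(** For the positive weight [f0] the functions [Tk] increase to [T0] as the damping is removed. As 1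
    - [chi] <= 1, their integrals stay below the bound [pk_bound] for the whole mollified
    integral. *)
Lemma T0_f0_L1 : L1 ltn (fun t => T0 f0 (rown t)).
Proof.
have [N N0 hw] := @wt_Sinv R d (2 * d) (2 * d).
have cf0 : continuous f0 by case: hw.
have h j := chart_limit symA m i (kp j) N1_ge0 dd C10.
apply: (L1_monotone_limit (f_ := fun j t => Tk A m i j.+1%:R^-1 f0 (rown t))
  (B := Num.sqrt (cI A) * N * (2 * \int[leb]_u rho u))).
- by move=> j; have [] := h j.
- by move=> j t; exact: Tk_f0_ge0.
- move=> j p t jp; apply: ler_sum => s _; case hs : (ldom s _); rewrite ?mul0r// !mul1r.
  rewrite ler_wpM2l// fac_mono ?(ldom_disc hs)//.
  by rewrite lef_pV2 ?posrE// ler_nat.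
- by move=> t; exact: Tk_lim.
move=> j; have [_ cj] := h j; rewrite -(cvg_lim _ cj)//; apply: limr_le.
  by apply/cvg_ex; eexists; exact: cj.
near=> p; apply: le_trans (pk_bound symA detA d4 m N0 hw (kp p)); apply: le_trans (ler_norm _).
have [_ _ _ fb _] := C10.
have pb y : 0 <= pk p.+1%:R^-1 (qform A y - m) := pk_ge0 _ (kp p).
have ck : continuous (fun y : E => pk p.+1%:R^-1 (qform A y - m)).
  apply: ct_comp; first exact: pk_continuous.
  by apply: ctB; [exact: qform_continuous|exact: ctC].
have bd (q : E -> R) y : `|q y| <= 1 -> `|f0 y * q y * pk p.+1%:R^-1 (qform A y - m)| <= 2 / p.+1%:R^-1 * (S y)^-1 ^+ d.
  move=> q1; rewrite normrM mulrC; apply: ler_pM => //; first by rewrite ger0_norm// pk_le.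
  rewrite normrM (ger0_norm (f0_ge0 _)); apply: (@le_trans _ _ (f0 y)); first by rewrite ler_piMr.
  exact: SinvX_le.
apply: rint_le.
- apply: (@L1_row R d (fun y => f0 y * (1 - chi (rowA A i) j.+1%:R^-1 y) * pk p.+1%:R^-1 (qform A y - m)) _ (2 / p.+1%:R^-1)).
    by do 2 apply: ctM => //; apply: ctB; [exact: ctC|exact: chi_ct].
  move=> y; apply: (bd (fun y => 1 - chi (rowA A i) j.+1%:R^-1 y)).
  by rewrite ger0_norm ?subr_ge0 ?rho_le1// lerBlDr lerDl rho_ge0.
- apply: (@L1_row R d (fun y => f0 y * pk p.+1%:R^-1 (qform A y - m)) _ (2 / p.+1%:R^-1)); first exact: ctM.
  by move=> y; have := bd (fun=> 1) y; rewrite normr1 lexx mulr1; exact.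
move=> x; have c1 : 1 - chi (rowA A i) j.+1%:R^-1 (row x) <= 1 by rewrite lerBlDr lerDl rho_ge0.
apply: ler_wpM2r; first exact: pb.
by apply: ler_piMr => //; exact: f0_ge0.
Unshelve. all: by end_near.
Qed.

Lemma T0_cvg N f g : 0 <= N -> C1 (2 * d) N f g -> L1 ltn (fun t => T0 f (rown t)) /\
  (fun j : nat => \int[ltn]_t Tk A m i j.+1%:R^-1 f (rown t)) @ \oo --> \int[ltn]_t T0 f (rown t).
Proof.
move=> N0 hf; have [cf _ _ fb _] := hf.
have mT := T0_measurable cf.
have h j := chart_limit symA m i (kp j) N0 dd hf.
have mTk j : measurable_fun setT (fun t => Tk A m i j.+1%:R^-1 f (rown t)).
  by have [L _] := h j; exact: L1_measurable L.
apply: (@rint_cvg _ _ R ltn (fun j t => Tk A m i j.+1%:R^-1 f (rown t)) _ _ mTk mT _ (L1Z N T0_f0_L1)).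
  by apply: (aeW ltn) => t; exact: Tk_lim.
move=> j t; rewrite /T0 mulr_sumr; apply: (le_trans (ler_norm_sum _ _ _)); apply: ler_sum => s _.
case hs : (ldom s _); last by rewrite !mul0r normr0 mulr0.
have D0 := ldom_disc hs.
rewrite !mul1r normrM mulrA; apply: ler_pM => //.
by rewrite ger0_norm ?fac_le// fac_ge0// ltW.
Qed.

(** Splitting w = w (1 - [chi]) + w [chi] in the mollified integrals: the first part tends to the
    integral of [Tk], the second is at most [e j] whatever the mollification. Afterwards j tends to
    infinity. *)
Lemma Jc_T0 N w N' g : 0 <= N -> wt (2 * d) (2 * d) N w -> 0 <= N' -> C1 (2 * d) N' w g ->
  Jc A w m = \int[ltn]_t T0 w (rown t).
Proof.
move=> N0 hw N'0 hC; have [_ cT] := T0_cvg N'0 hC.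
have [i' xi0] := rowA_neq0; have [e e0 he] := chi_pk_small symA detA d4 m N0 hw xi0.
have Jl := @Jc_limit R d A symA detA d4 N w m N0 hw.
have [cf _ _ fb _] := hC.
have close j : `|Jc A w m - \int[ltn]_t Tk A m i j.+1%:R^-1 w (rown t)| <= e j.
  have [_ cj] := chart_limit symA m i (kp j) N'0 dd hC.
  have cd : (fun p => `|\int[lt]_x (w (row x) * pk p.+1%:R^-1 (qform A (row x) - m)) -
      \int[lt]_x (w (row x) * (1 - chi (rowA A i) j.+1%:R^-1 (row x)) * pk p.+1%:R^-1 (qform A (row x) - m))|) @ \oo -->
      `|Jc A w m - \int[ltn]_t Tk A m i j.+1%:R^-1 w (rown t)|.
    by apply: cvg_norm; apply: cvgB; [exact: Jl|exact: cj].
  rewrite -(cvg_lim _ cd)//; apply: limr_le; first by apply/cvg_ex; eexists; exact: cd.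
  near=> p.
  have ck : continuous (fun y : E => pk p.+1%:R^-1 (qform A y - m)).
    apply: ct_comp; first exact: pk_continuous.
    by apply: ctB; [exact: qform_continuous|exact: ctC].
  have bd (q : E -> R) y : `|q y| <= 1 -> `|w y * q y * pk p.+1%:R^-1 (qform A y - m)| <= 2 / p.+1%:R^-1 * N' * (S y)^-1 ^+ d.
    move=> q1; rewrite normrM mulrC -mulrA; apply: ler_pM => //; first by rewrite ger0_norm ?pk_ge0// pk_le.
    rewrite normrM; apply: (@le_trans _ _ `|w y|); first by rewrite ler_piMr.
    by apply: (le_trans (fb y)); rewrite ler_wpM2l// SinvX_le.
  rewrite -rintB.
  - apply: le_trans (he j _ (kp p)); rewrite le_eqVlt; apply/orP; left; apply/eqP; congr `|_|.
    by apply: eq_rint => x; ring.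
  - apply: (@L1_row R d (fun y => w y * pk p.+1%:R^-1 (qform A y - m)) _ (2 / p.+1%:R^-1 * N')); first exact: ctM.
    by move=> y; have := bd (fun=> 1) y; rewrite normr1 lexx mulr1; exact.
  - apply: (@L1_row R d (fun y => w y * (1 - chi (rowA A i) j.+1%:R^-1 y) * pk p.+1%:R^-1 (qform A y - m)) _ (2 / p.+1%:R^-1 * N')).
      by do 2 apply: ctM => //; apply: ctB; [exact: ctC|exact: chi_ct].
    move=> y; apply: (bd (fun y => 1 - chi (rowA A i) j.+1%:R^-1 y)).
    by rewrite ger0_norm ?subr_ge0 ?rho_le1// lerBlDr lerDl rho_ge0.
have cJ : (fun j : nat => \int[ltn]_t Tk A m i j.+1%:R^-1 w (rown t)) @ \oo --> Jc A w m.
  apply/cvgrPdist_le => eps eps0; move/cvgrPdist_le: e0 => /(_ eps eps0) e0.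
  near=> j; apply: le_trans (close j) _; apply: le_trans (ler_norm _) _.
  by rewrite -normrN -sub0r; near: j; exact: e0.
exact: (cvg_unique _ cJ cT).
Unshelve. all: by end_near.
Qed.

Lemma chi_C1 (xi : E) (k : R) : 0 < k -> exists2 K : R, 0 <= K & exists g, C1 0 K (chi xi k) g.
Proof.
move=> k0; pose h' (u : R) : R := - (2 * (u / k) * k^-1 * rho (u / k) ^+ 2).
have ki : 0 < k^-1 by rewrite invr_gt0.
have dh (u : R) : is_derive u (1 : R) (fun u => rho (u / k)) (h' u).
  pose Q (v : R) := (k^-1 ^+ 2) * v ^+ 2 + 0 * v + 1.
  have QE v : Q v = 1 + (v / k) ^+ 2 by rewrite /Q exprMn; ring.
  have nq : Q u != 0 by rewrite QE gt_eqF// ltr_wpDr ?sqr_ge0.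
  have h := is_deriveV nq (is_derive_quadratic (k^-1 ^+ 2) 0 1 u : is_derive u (1 : R) Q _).
  apply: is_derive_fun h => [v|]; first by rewrite QE.
  rewrite -![_ *: _]/(_ * _) QE /h' /rho -exprVn; move: (1 + _)^-1 => z; ring.
have ch : continuous h'.
  have ci : continuous (@id R) by move=> x; exact: cvg_id.
  have cq : continuous (fun u : R => u / k) by apply: ctM => //; exact: ctC.
  apply: (@ct_comp _ _ -%R); first exact: opp_continuous.
  apply: ctM; first by apply: ctM; [apply: ctM => //; exact: ctC|exact: ctC].
  by apply: ctX; apply: ct_comp => //; exact: rho_ct.
pose B : R := 1 + k^-1; pose D : R := 1 + \sum_j `|xi 0 j|.
have B0 : 0 <= B by rewrite addr_ge0 ?ltW.
have D1 : 1 <= D by rewrite lerDl sumr_ge0.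
exists (D * B); first by rewrite mulr_ge0// (le_trans ler01).
exists (fun j y => xi 0 j * h' (dotv xi y)).
apply: (@C1_lin R d (fun u => rho (u / k)) h' (dotv xi) (fun j => xi 0 j) B D B0 D1 (@dotvl_continuous R d xi)) => //.
- by move=> j y u; rewrite dotvDr dotvZr dotv_unit.
- by move=> j; rewrite /D (bigD1 j)//= addrCA lerDl addr_ge0// sumr_ge0.
- by move=> u; rewrite ger0_norm ?rho_ge0// (le_trans (rho_le1 _))// lerDl ltW.
move=> u; rewrite /h' normrN; apply: (@le_trans _ _ k^-1); last by rewrite lerDr.
set v := u / k; have r0 := rho_ge0 v; have r1 := rho_le1 v.
have v2 : 2 * `|v| * rho v <= 1.
  rewrite /rho ler_pdivrMr ?ltr_wpDr ?sqr_ge0// mul1r -(real_normK (num_real v)).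
  by have := sqr_ge0 (1 - `|v|); move: `|v| => z; nra.
rewrite 3!normrM (gtr0_norm ki) [`|2|]gtr0_norm// (ger0_norm (exprn_ge0 2 r0)).
have -> : 2 * `|v| * k^-1 * rho v ^+ 2 = k^-1 * ((2 * `|v| * rho v) * rho v) by ring.
by rewrite ler_piMr ?(ltW ki)//; apply: mulr_ile1 => //; rewrite !mulr_ge0.
Qed.

(** On the slice [chi] equals 1 for every k, so the integral of a positive density over it is at
    most that of [Tk] with weight [f0] [chi], hence at most [e k] for every k. *)
Lemma slice_null s (xi : E) (j' : 'I_d) : xi 0 j' != 0 ->
  measurable [set t : n.-tuple R | ldom s (rown t) /\ dotv xi (gam s (rown t)) = 0] /\
  ltn [set t : n.-tuple R | ldom s (rown t) /\ dotv xi (gam s (rown t)) = 0] = 0%E.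
Proof.
move=> xi0; set Z := [set t | _].
have mZ : measurable Z.
  rewrite (_ : Z = [set t | (ldom s (rown t))%:R = 1 :> R] `&` [set t | dotv xi (gam s (rown t)) = 0]).
    apply: measurableI; first exact: measurable_level (ldom_measurable s).
    by apply: measurable_level; apply: gam_measurable; exact: dotvl_continuous.
  apply/seteqP; split => t [h1 h2]; split => //=; first by rewrite h1.
  by move: h1 => /=; case: (ldom _ _) => // /eqP; rewrite eq_sym oner_eq0.
split=> //; have [N N0 hw] := @wt_Sinv R d (2 * d) (2 * d).
have [e e0 he] := chi_pk_small symA detA d4 m N0 hw xi0.
pose F t : R := (ldom s (rown t))%:R * (f0 (gam s (rown t)) * (Num.sqrt (ldisc (rown t)) / (1 ^+ 2 + ldisc (rown t)))).
pose h t : R := \1_Z t * F t.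
have F0 t : 0 <= F t.
  rewrite /F; case hs : (ldom _ _); last by rewrite mul0r.
  by rewrite mul1r mulr_ge0// fac_ge0// ltW// (ldom_disc hs).
have cf0 : continuous f0 by case: hw.
have mF : measurable_fun setT F.
  apply: measurable_funM; first exact: ldom_measurable.
  apply: measurable_funM; first exact: gam_measurable.
  apply: measurable_funM; first exact: sqrt_ldisc_measurable.
  by apply: measurable_funVr; apply: measurable_funD => //; exact: ldisc_measurable.
have mh : measurable_fun setT h by apply: measurable_funM => //; exact: measurable_indic.
have h0 t : 0 <= h t by rewrite mulr_ge0// indicE.
have FT t : F t <= T0 f0 (rown t).
  rewrite /T0 (bigD1 s)//= ler_wpDr ?sumr_ge0// => [s' _|].
    by rewrite !mulr_ge0 ?invr_ge0 ?sqrtr_ge0.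
  rewrite /F; case hs : (ldom _ _); last by rewrite !mul0r.
  by rewrite !mul1r ler_wpM2l// fac_le// (ldom_disc hs).
have Lh : L1 ltn h.
  apply: (@L1_dom _ _ _ ltn _ _ mh T0_f0_L1) => t; rewrite ger0_norm//.
  by apply: le_trans (FT t); rewrite ler_piMl// indicE; case: (_ \in _).
have hle k : \int[ltn]_t h t <= e k.
  have [K K0 [g hg]] := chi_C1 xi (kp k).
  have hC := C1_mul N1_ge0 K0 C10 hg.
  have K2 : 0 <= 2 * ((1 + 2 * (2 * d)%:R) * K) by rewrite !mulr_ge0.
  have d2 : (d <= 2 * d + 0)%N by rewrite addn0.
  have [L c] := chart_limit symA m i (@ltr01 R) K2 d2 hC.
  apply: (@le_trans _ _ (\int[ltn]_t Tk A m i 1 (fun y => f0 y * chi xi k.+1%:R^-1 y) (rown t))).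
    apply: rint_le => // t; rewrite /h indicE; case: (boolP (t \in Z)) => tZ; last first.
      rewrite mul0r; apply: Tk_f0_ge0 => // y; rewrite mulr_ge0 ?rho_ge0//.
    have [td tl] : Z t := set_mem tZ.
    rewrite mul1r /Tk (bigD1 s)//= ler_wpDr ?sumr_ge0// => [s' _|]; last first.
      by rewrite /F /chi tl mul0r /rho expr0n addr0 invr1 mulr1.
    case hs : (ldom s' _); last by rewrite mul0r.
    rewrite mul1r; apply: mulr_ge0; last by apply: fac_ge0 => //; exact: ltW (ldom_disc hs).
    by apply: mulr_ge0; [exact: f0_ge0|exact: rho_ge0].
  rewrite -(cvg_lim _ c)//; apply: limr_le; first by apply/cvg_ex; eexists; exact: c.
  near=> p; apply: le_trans (he k _ (kp p)); apply: le_trans (ler_norm _).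
  have ck : continuous (fun y : E => pk p.+1%:R^-1 (qform A y - m)).
    apply: ct_comp; first exact: pk_continuous.
    by apply: ctB; [exact: qform_continuous|exact: ctC].
  have pb y : 0 <= pk p.+1%:R^-1 (qform A y - m) := pk_ge0 _ (kp p).
  have bd (q : E -> R) y : `|q y| <= 1 -> `|f0 y * q y * pk p.+1%:R^-1 (qform A y - m)| <= 2 / p.+1%:R^-1 * (S y)^-1 ^+ d.
    move=> q1; rewrite normrM mulrC; apply: ler_pM => //; first by rewrite ger0_norm// pk_le.
    rewrite normrM (ger0_norm (f0_ge0 _)); apply: (@le_trans _ _ (f0 y)); first by rewrite ler_piMr.
    exact: SinvX_le.
  have cc : continuous (chi xi k.+1%:R^-1 : E -> R) by exact: chi_ct.
  have c1 (k' : R) (z : E) y : 0 <= 1 - chi z k' y <= 1.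
    by rewrite subr_ge0 rho_le1/= lerBlDr lerDl rho_ge0.
  have r01 y : 0 <= chi xi k.+1%:R^-1 y <= 1 by rewrite rho_ge0 rho_le1.
  apply: rint_le.
  - apply: (@L1_row R d (fun y => f0 y * chi xi k.+1%:R^-1 y * (1 - chi (rowA A i) 1 y) * pk p.+1%:R^-1 (qform A y - m)) _ (2 / p.+1%:R^-1)).
      apply: ctM => //; apply: ctM; first exact: ctM.
      by apply: ctB; [exact: ctC|exact: chi_ct].
    move=> y; have := bd (fun y => chi xi k.+1%:R^-1 y * (1 - chi (rowA A i) 1 y)) y; rewrite mulrA; apply.
    have /andP[a0 a1] := r01 y; have /andP[b0 b1] := c1 1 (rowA A i) y.
    by rewrite ger0_norm; [exact: mulr_ile1|exact: mulr_ge0].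
  - apply: (@L1_row R d (fun y => f0 y * chi xi k.+1%:R^-1 y * pk p.+1%:R^-1 (qform A y - m)) _ (2 / p.+1%:R^-1)).
      by do 2 apply: ctM => //.
    by move=> y; apply: (bd (chi xi k.+1%:R^-1)); have /andP[a0 a1] := r01 y; rewrite ger0_norm.
  move=> x; have /andP[b0 b1] := c1 1 (rowA A i) (row x); have /andP[a0 a1] := r01 (row x).
  apply: ler_wpM2r; first exact: pb.
  by apply: ler_piMr => //; apply: mulr_ge0 => //; exact: f0_ge0.
have Ih : \int[ltn]_t h t = 0.
  apply/eqP; rewrite eq_le (rint_ge0 _ h0) andbT -(cvg_lim _ e0)//.
  by apply: limr_ge; [apply/cvg_ex; exists 0|near=> k; exact: hle].
have : (\int[ltn]_(t in setT) `|(EFin \o h) t| = 0)%E.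
  transitivity (\int[ltn]_t (h t)%:E)%E; first by apply: eq_integral => t _; rewrite /= ger0_norm.
  by rewrite -(L1_fineK Lh) Ih.
have meh : measurable_fun setT (EFin \o h) by exact/measurable_EFinP.
move=> /(ae_eq_integral_abs ltn measurableT meh) [Y [mY Y0 sY]].
apply/eqP; rewrite eq_le measure_ge0 andbT -Y0; apply: le_measure; [exact: mem_set|exact: mem_set|].
move=> t tZ; apply: sY => /= /(_ Logic.I) [] /eqP; apply/negP.
rewrite /h indicE mem_set// mul1r /F; have [-> _] := tZ; rewrite mul1r.
have D0 := ldom_disc tZ.1; rewrite gt_eqF// mulr_gt0 ?exprn_gt0 ?Sinv_gt0// divr_gt0 ?sqrtr_gt0//.
by rewrite addr_gt0.
Unshelve. all: by end_near.
Qed.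

End chart_integral.

(** * The volume element of a chart *)

Lemma near_eq_diff {R : numFieldType} {V W : normedModType R} (f g : V -> W) (x : V) :
  differentiable f x -> (\forall y \near x, f y = g y) -> 'd g x = 'd f x :> (V -> W).
Proof.
move=> df fg; have cd : continuous ('d f x) by exact: diff_continuous.
apply: (@diff_unique _ _ _ g ('d f x) x cd).
have := diff_locally df => /eqaddoP h; apply/eqaddoP => e e0.
have gx : g x = f x by rewrite (nbhs_singleton fg).
have fg0 : \forall y \near (0 : V), f (y + x) = g (y + x).
  have cs : (fun y : V => y + x) @ (0 : V) --> x.
    by rewrite -[X in _ --> X]add0r; apply: cvgD; [exact: cvg_id|exact: cvg_cst].
  exact: cs _ fg.
apply: filterS2 (h e e0) fg0 => y h1 h2.
change (`|g (y + x) - (g x + 'd f x y)| <= e * `|y|); rewrite -h2 gx; exact: h1.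
Qed.

(** The matrix determinant lemma: one block matrix is factored into triangular ones in two ways. *)
Lemma det_one_plus_dyad {F : comNzRingType} {n : nat} (c : 'rV[F]_n) :
  \det (1%:M + c^T *m c) = 1 + (c *m c^T) 0 0.
Proof.
have e1 : \det (block_mx 1%:M (- c) c^T 1%:M) = \det (1%:M + c^T *m c).
  have -> : block_mx 1%:M (- c) c^T 1%:M =
      block_mx 1%:M 0 c^T 1%:M *m block_mx 1%:M (- c) 0 (1%:M + c^T *m c) :> 'M[F]_(1 + n).
    rewrite mulmx_block !mul1mx ?mulmx1 ?mul0mx ?mulmx0 ?addr0; congr block_mx.
    by rewrite mulmxN addrCA addNr addr0.
  by rewrite det_mulmx det_lblock det_ublock !det1 !mul1r.
have e2 : \det (block_mx 1%:M (- c) c^T 1%:M) = \det (1%:M + c *m c^T).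
  have -> : block_mx 1%:M (- c) c^T 1%:M =
      block_mx 1%:M (- c) 0 1%:M *m block_mx (1%:M + c *m c^T) 0 c^T 1%:M :> 'M[F]_(1 + n).
    rewrite mulmx_block !mul1mx ?mulmx1 ?mul0mx ?mulmx0 ?add0r; congr block_mx.
    by rewrite mulNmx addrK.
  by rewrite det_mulmx det_lblock det_ublock !det1 !mul1r mulr1.
by rewrite -e1 e2 det_mx11 !mxE eqxx mulr1n.
Qed.

Section graph.
Context {R : realType} {n : nat}.
Local Notation d := n.+1.
Variable A : 'M[int]_d.
Hypothesis symA : A^T = A.
Local Notation E := 'rV[R]_d.
Local Notation F := 'rV[R]_n.
Variables (m : R) (i : 'I_d) (s : bool).

Local Notation ldom := (chart_dom A m i s).
Local Notation ldisc := (chart_disc A m i).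
Local Notation gam := (chart_pt A m i s).

Definition lroot (x : F) : R := qroot (la A i) (lb A i x) (lc A m i x) s.

Lemma graph_partP u (x : F) : graph_part A m i s (insc i u x) <-> ldom x /\ u = lroot x.
Proof.
rewrite /graph_part /quadric /= slope_insc; split.
  move=> [/eqP q0 sl]; apply: qroot_uniq => //.
  by rewrite -(qform_insc symA m); apply/eqP; rewrite subr_eq0.
move=> [h ->]; have D0 : 0 < ldisc x by case/andP: h.
split; last by rewrite qroot_slope// mulrA sgn_sqr mul1r sqrtr_gt0.
by apply/eqP; rewrite -subr_eq0; apply/eqP; rewrite (qform_insc symA) qroot_root.
Qed.

Lemma graph_domP (x : F) : graph_dom A m i s x <-> ldom x.
Proof.
split=> [[u /graph_partP[]]//|h]; exists (lroot x).
exact/graph_partP.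
Qed.

Lemma graph_mapE (x : F) : ldom x -> graph_map A m i s x = gam x.
Proof.
move=> h; rewrite /graph_map (_ : xget _ _ = lroot x)//.
apply: xget_unique => [|u]; first exact/graph_partP.
by move=> /graph_partP[].
Qed.

Lemma gam_slope (x : F) : ldom x -> mxact A (gam x) 0 i = (-1) ^+ s * Num.sqrt (ldisc x).
Proof. by move=> h; rewrite slope_insc qroot_slope. Qed.

Definition embP : 'M[R]_(n, d) := \matrix_(k, j) (j == lift i k)%:R.

Lemma insc0E (x : F) : insc i 0 x = x *m embP.
Proof.
apply/rowP => j; rewrite [RHS]mxE; case: (unliftP i j) => [k ->|->].
  rewrite insc_lift (bigD1 k)//= big1 ?addr0 => [|k' kk'].
    by rewrite mxE eqxx mulr1.
  by rewrite mxE (inj_eq lift_inj) eq_sym (negbTE kk') mulr0.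
rewrite insc_i big1// => k _.
by rewrite mxE (negbTE (neq_lift i k)) mulr0.
Qed.

Lemma embP_ct : continuous (mulmxr embP : F -> E).
Proof.
apply: ct_rV => j; rewrite (_ : (fun t => _) = fun x : F => \sum_k x 0 k * embP k j).
  by apply: ct_sum => k; apply: ctM; [exact: ct_coord|exact: ctC].
by apply/funext => x; rewrite /= mxE.
Qed.

Lemma diff_embP (x : F) : differentiable (mulmxr embP : F -> E) x.
Proof. exact: linear_differentiable embP_ct. Qed.

Lemma diff_embPE (x : F) : 'd (mulmxr embP : F -> E) x = mulmxr embP :> (F -> E).
Proof. exact: (@diff_lin _ _ _ (mulmxr embP) x embP_ct). Qed.

Lemma diff_coordP (x : F) j : differentiable (fun y : F => (y *m embP) 0 j : R) x.
Proof.
by apply: (@differentiable_comp _ _ _ _ (mulmxr embP) (fun z : E => z 0 j)); [exact: diff_embP|exact: differentiable_coord].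
Qed.

Lemma diff_sumf (x : F) p (f : 'I_p -> F -> R) : (forall j, differentiable (f j) x) ->
  differentiable (fun y => \sum_j f j y) x.
Proof.
move=> h; rewrite (_ : (fun y => _) = \sum_j f j); first exact: differentiable_sum.
by apply/funext => y; rewrite fct_sumE.
Qed.

Lemma diff_mulf (x : F) (f g : F -> R) : differentiable f x -> differentiable g x ->
  differentiable (fun y => f y * g y) x.
Proof. exact: differentiableM. Qed.

Lemma diff_mx (x : F) k : differentiable (fun y : F => mxact A (insc i 0 y) 0 k : R) x.
Proof.
rewrite (_ : (fun y => _) = fun y : F => \sum_j (A k j)%:~R * (y *m embP) 0 j); last first.
  by apply/funext => y; rewrite mxactE insc0E.
apply: diff_sumf => j; apply: diff_mulf; first exact: differentiable_cst.
exact: diff_coordP.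
Qed.

Lemma diff_lc (x : F) : differentiable (lc A m i) x.
Proof.
rewrite (_ : lc A m i = fun y : F => 2^-1 * (\sum_j mxact A (insc i 0 y) 0 j * (y *m embP) 0 j) + (- m)); last first.
  by apply/funext => y; rewrite /lc /qform /dotv -insc0E.
apply: differentiableD; last exact: differentiable_cst.
apply: diff_mulf; first exact: differentiable_cst.
by apply: diff_sumf => j; apply: diff_mulf; [exact: diff_mx|exact: diff_coordP].
Qed.

Lemma diff_ldisc (x : F) : differentiable ldisc x.
Proof.
rewrite (_ : ldisc = fun y : F => lb A i y * lb A i y - 2 * la A i * lc A m i y).
  apply: differentiableB; first by apply: diff_mulf; exact: diff_mx.
  by apply: diff_mulf; [exact: differentiable_cst|exact: diff_lc].
by apply/funext => y; rewrite /chart_disc /qdisc expr2.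
Qed.

Lemma diff_lroot (x : F) : ldom x -> differentiable lroot x.
Proof.
move=> h; have D0 : 0 < ldisc x by case/andP: h.
have [a0|a0] := eqVneq (la A i : R) 0.
  rewrite (_ : lroot = fun y => - 1 * lc A m i y * (lb A i y)^-1); last first.
    by apply/funext => y; rewrite /lroot /qroot a0 eqxx mulN1r.
  apply: diff_mulf; first by apply: diff_mulf; [exact: differentiable_cst|exact: diff_lc].
  by apply: differentiableV; [exact: diff_mx|exact: qdom_neq0 h a0].
rewrite (_ : lroot = fun y => ((-1) ^+ s * (Num.sqrt \o ldisc) y - lb A i y) * (la A i)^-1); last first.
  by apply/funext => y; rewrite /lroot /qroot (negbTE a0).
apply: diff_mulf; last exact: differentiable_cst.
apply: differentiableB; last exact: diff_mx.
apply: diff_mulf; first exact: differentiable_cst.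
apply: differentiable_comp; first exact: diff_ldisc.
by apply/derivable1_diffP; have [] := is_derive1_sqrt D0.
Qed.

Lemma ldom_near (x : F) : ldom x -> \forall y \near x, ldom y.
Proof.
move=> h; have D0 : 0 < ldisc x by case/andP: h.
have cD : {for x, continuous ldisc} by exact/differentiable_continuous/diff_ldisc.
have nD : \forall y \near x, 0 < ldisc y by exact: (cvgr_gt _ cD).
have nb : \forall y \near x, (la A i != 0 :> R) || (0 < (-1) ^+ s * lb A i y).
  have [a0|a0] := eqVneq (la A i : R) 0; last by near=> y.
  have sb : 0 < (-1) ^+ s * lb A i x by move: h; rewrite /chart_dom /qdom a0 eqxx => /andP[].
  have cb : {for x, continuous (fun y => (-1) ^+ s * lb A i y)}.
    by apply/differentiable_continuous; apply: diff_mulf; [exact: differentiable_cst|exact: diff_mx].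
  by exact: (cvgr_gt _ cb).
near=> y; rewrite /chart_dom /qdom; apply/andP; split; near: y.
- exact: nD.
- exact: nb.
Unshelve. all: by end_near.
Qed.

(** Implicit differentiation of F = m along the chart; the equation holds in a neighbourhood of x
    because the domain is open. *)
Lemma lroot_derive (x : F) k : ldom x ->
  mxact A (gam x) 0 i * 'd lroot x (unitv k) + mxact A (gam x) 0 (lift i k) = 0.
Proof.
move=> h; pose e : F := unitv k.
have dr : is_derive x e lroot ('d lroot x e).
  have df := diff_lroot h.
  by apply: DeriveDef; [exact: diff_derivable|exact: deriveE].
have lineE (u : R) : insc i 0 (x + u *: e) = insc i 0 x + u *: unitv (lift i k).
  rewrite !insc0E mulmxDl -scalemxAl; congr (_ + _ *: _).
  apply/rowP => j; rewrite mxE (bigD1 k)//= big1 => [|k' kk'].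
    by rewrite !mxE !eqxx addr0 mul1r.
  by rewrite !mxE eqxx (negbTE kk') mul0r.
have db : is_derive x e (lb A i) (A i (lift i k))%:~R.
  have hl u : lb A i (x + u *: e) = lb A i x + u * (A i (lift i k))%:~R.
    by rewrite /lb lineE !mxact_coord dotvDr dotvZr dotv_unit mxE.
  have := line_derive (h := @id R) hl (is_derive_id _ _); rewrite mulr1; exact.
have dc : is_derive x e (lc A m i) (mxact A (insc i 0 x) 0 (lift i k)).
  apply: derive_line0; have dq := is_derive_quadratic ((A (lift i k) (lift i k))%:~R / 2)
    (mxact A (insc i 0 x) 0 (lift i k)) (lc A m i x) (0 : R).
  apply: is_derive_fun dq => [u|]; last by ring.
  by rewrite /lc lineE qform_line// addrA.
pose Q (y : F) := 2^-1 * la A i * lroot y ^+ 2 + lb A i y * lroot y + lc A m i y.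
have Q0 : \forall y \near x, cst 0 y = Q y.
  by near=> y; rewrite /Q /lroot qroot_root//; near: y; exact: ldom_near.
have dQ0 : is_derive x e Q 0 by apply: (near_eq_is_derive Q0); exact: is_derive_cst.
have dQ := is_deriveD (is_deriveD (is_deriveZ (2^-1 * la A i) (is_deriveX 2 dr)) (is_deriveM db dr)) dc.
have QE : Q = (2^-1 * la A i) \*: lroot ^+ 2 + lb A i * lroot + lc A m i by apply/funext => y; rewrite !fctE.
rewrite -QE in dQ; have [_ E1] := dQ0; have [_ E2] := dQ.
have : 'D_e Q x = 0 := E1; rewrite E2 -![_ *: _]/(_ * _) => {E1 E2 dQ dQ0}.
rewrite slope_insc (_ : mxact A (gam x) 0 (lift i k) = mxact A (insc i 0 x) 0 (lift i k) + lroot x * (A i (lift i k))%:~R); last first.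
  have sA : A (lift i k) i = A i (lift i k) by rewrite -[in LHS]symA mxE.
  by rewrite /chart_pt insc_unit mxactD [LHS]mxE mxactZ [X in _ + X]mxE mxact_unit sA.
rewrite -/e -/(lroot x) /= expr1 => E0; rewrite -[RHS]E0.
move: ('d lroot x e) (lroot x) => D r; by field.
Unshelve. all: by end_near.
Qed.

Lemma diff_gam (x : F) : ldom x ->
  differentiable gam x /\ (forall v, 'd gam x v = v *m embP + 'd lroot x v *: (unitv i : E)).
Proof.
move=> h; have dl := diff_lroot h; have dZ := differentiableZl (unitv i : E) dl.
have gE : gam = (mulmxr embP : F -> E) + (fun y => lroot y *: (unitv i : E)).
  by apply/funext => y; rewrite !fctE /chart_pt insc_unit insc0E.
split=> [|v]; first by rewrite gE; apply: differentiableD; [exact: diff_embP|].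
have e1 := diffD (diff_embP x) dZ; have e2 := diff_embPE x; have e3 := diffZl (unitv i : E) dl.
rewrite gE; apply: (etrans (congr1 (fun H => H v) e1)).
exact: (congr2 +%R (congr1 (fun H => H v) e2) (congr1 (fun H => H v) e3)).
Qed.

(** The Gram matrix is 1 + c^T c with c the gradient of the root. Since c_k is minus the quotient of
    the corresponding coordinate of A y by (A y)_i, its determinant is |A y|^2/(A y)_i^2. *)
Lemma vol_densityE (x : F) : ldom x ->
  vol_density (graph_map A m i s) x = enorm (mxact A (gam x)) / Num.sqrt (ldisc x).
Proof.
move=> h; have D0 : 0 < ldisc x by case/andP: h.
have s0 : 0 < Num.sqrt (ldisc x) by rewrite sqrtr_gt0.
have dl := diff_lroot h.
have [dg dgE] := diff_gam h.
have ng : \forall y \near x, gam y = graph_map A m i s y.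
  by near=> y; rewrite graph_mapE//; near: y; exact: ldom_near.
pose c : F := \row_k 'd lroot x (unitv k).
have JE : jacobian (graph_map A m i s) x = embP + c^T *m (unitv i : E).
  rewrite /jacobian (near_eq_diff dg ng); apply/matrixP => k j.
  rewrite [LHS]mxE dgE -[delta_mx 0 k]/(unitv k) !mxE big_ord1 !mxE; congr (_ + _).
  by rewrite (bigD1 k)//= big1 => [|k' kk']; rewrite !mxE !eqxx ?mul1r ?addr0// (negbTE kk') mul0r.
have PP : embP *m embP^T = 1%:M.
  apply/matrixP => k k'; rewrite !mxE (bigD1 (lift i k))//= big1 => [|j jk].
    by rewrite !mxE eqxx mul1r addr0 (inj_eq lift_inj).
  by rewrite !mxE (negbTE jk) mul0r.
have Pe : embP *m (unitv i : E)^T = 0.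
  apply/matrixP => k k'; rewrite !mxE big1// => j _; rewrite !mxE ord1 eqxx/=.
  by case: eqP => [->|]; rewrite ?mul0r// eq_sym (negbTE (neq_lift i k)) mulr0.
have ee : (unitv i : E) *m (unitv i)^T = 1%:M.
  apply/matrixP => k k'; rewrite !ord1 !mxE (bigD1 i)//= big1 => [|j ji].
    by rewrite !mxE !eqxx mulr1 addr0.
  by rewrite !mxE (negbTE ji) mul0r.
have G : jacobian (graph_map A m i s) x *m (jacobian (graph_map A m i s) x)^T = 1%:M + c^T *m c.
  rewrite JE linearD/= trmx_mul trmxK mulmxDl !mulmxDr PP mulmxA Pe mul0mx addr0; congr (_ + _).
  rewrite -(mulmxA c^T _ embP^T) -[(unitv i) *m embP^T]trmxK trmx_mul trmxK Pe trmx0 mulmx0 add0r.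
  by rewrite mulmxA -(mulmxA c^T) ee mulmx1.
rewrite /vol_density G det_one_plus_dyad.
have li := gam_slope h.
have l2 : mxact A (gam x) 0 i ^+ 2 = ldisc x by rewrite li exprMn expr2 sgn_sqr mul1r sqr_sqrtr ?ltW.
have l0 : mxact A (gam x) 0 i != 0 by rewrite -sqrf_eq0 l2 gt_eqF.
have ck k : c 0 k = - mxact A (gam x) 0 (lift i k) / mxact A (gam x) 0 i.
  have -> : c 0 k = 'd lroot x (unitv k) by rewrite mxE.
  have := lroot_derive k h; rewrite addrC => /eqP; rewrite addr_eq0 => /eqP ->.
  by rewrite opprK mulrAC mulfV// mul1r.
have -> : 1 + (c *m c^T) 0 0 = dotv (mxact A (gam x)) (mxact A (gam x)) / ldisc x.
  rewrite /dotv (bigD1_ord i)//= mulrDl -expr2 l2 divff ?gt_eqF//; congr (_ + _).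
  rewrite mxE mulr_suml; apply: eq_bigr => k _; rewrite [c^T _ _]mxE ck -l2 /=.
  by move: (mxact _ _ 0 i) l0 => z z0; field.
by rewrite sqrtrM ?dotv_ge0// sqrtrV ?ltW.
Unshelve. all: by end_near.
Qed.

End graph.

(** * The surface measure in terms of the charts *)

Section surface.
Context {R : realType} {n : nat}.
Local Notation d := n.+1.
Variable A : 'M[int]_d.
Hypothesis symA : A^T = A.
Hypothesis detA : \det A != 0.
Hypothesis d4 : (4 <= d)%N.
Local Notation E := 'rV[R]_d.
Local Notation ltn := (@lebesgue_tuple R n).
Local Notation rown := (@row_of_tuple R n).
Variables (m : R) (N : R) (w : E -> R).
Hypothesis N0 : 0 <= N.
Hypothesis cw : continuous w.
Hypothesis wb : forall y, `|w y| <= N * (S y)^-1 ^+ (2 * d).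

Definition chart_density (i : 'I_d) s (t : n.-tuple R) : R :=
  (chart_dom A m i s (rown t))%:R * (w (chart_pt A m i s (rown t)) * (Num.sqrt (chart_disc A m i (rown t)))^-1).

Lemma chart_density_L1 i s : L1 ltn (chart_density i s).
Proof.
have mg : measurable_fun setT (chart_density i s).
  apply: measurable_funM; first exact: ldom_measurable.
  by apply: measurable_funM; [exact: gam_measurable|apply: measurable_funVr; exact: sqrt_ldisc_measurable].
have L0 := L1Z N (T0_f0_L1 symA detA d4 m i).
apply: (@L1_dom _ _ _ ltn _ _ mg L0) => t; rewrite /T0 mulr_sumr (bigD1 s)//= ler_wpDr ?sumr_ge0// => [s' _|].
  by rewrite !mulr_ge0 ?invr_ge0 ?sqrtr_ge0// exprn_ge0// Sinv_ge0.
rewrite /chart_density normrM normr_nat mulrCA ler_wpM2l// normrM mulrA ler_pM ?wb//.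
by rewrite ger0_norm// invr_ge0 sqrtr_ge0.
Qed.

(** The vanishing of several coordinates becomes that of a sum of squares, so the piece is cut out
    by level sets of measurable functions. *)
Lemma piece_domE i s : piece_dom A m i s = [set t | (chart_dom A m i s (rown t))%:R = 1 :> R] `&`
  [set t | \sum_(j < d | (j < i)%N) mxact A (chart_pt A m i s (rown t)) 0 j ^+ 2 = 0].
Proof.
apply/seteqP; split => t.
  move=> [/(graph_domP symA m i s) h hj]; split => /=; first by rewrite h.
  by rewrite big1// => j ji; rewrite -(graph_mapE symA h) (hj j ji) expr0n.
move=> [/= h1 h2]; have h : chart_dom A m i s (rown t).
  by move: h1; case: (chart_dom _ _ _ _ _) => // /eqP; rewrite eq_sym oner_eq0.
split; first exact/(graph_domP symA m i s).
move=> j ji; rewrite (graph_mapE symA h); apply/eqP; rewrite -sqrf_eq0.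
have := psumr_eq0P (fun (j : 'I_d) _ => sqr_ge0 (mxact A (chart_pt A m i s (rown t)) 0 j)) h2.
by move=> /(_ j ji) ->.
Qed.

Lemma piece_measurable i s : measurable (piece_dom A m i s : set (n.-tuple R)).
Proof.
rewrite piece_domE; apply: measurableI; first exact: measurable_level (ldom_measurable _ _ _ _).
apply: measurable_level; apply: (gam_measurable A m i s (f := fun y => \sum_(j < d | (j < i)%N) mxact A y 0 j ^+ 2)).
rewrite (_ : (fun y : E => _) = fun y : E => \sum_(j < d) if (j < i)%N then mxact A y 0 j ^+ 2 else 0); last first.
  by apply/funext => y; rewrite big_mkcond.
apply: ct_sum => j; case: (j < i)%N; last exact: ctC.
by apply: ctX; exact: mxact_continuous.
Qed.

(** The factor |A y| of the volume element cancels the one in [sing_weight]. *)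
Lemma piece_integrandE i s (t : n.-tuple R) : piece_dom A m i s t ->
  piece_integrand A m i s (sing_weight A w) t = (chart_density i s t)%:E.
Proof.
move=> [/(graph_domP symA m i s) h _]; rewrite /piece_integrand /chart_density h mul1r.
congr EFin; rewrite (vol_densityE symA h) (graph_mapE symA h) /sing_weight.
have D0 := ldom_disc h; have l0 : enorm (mxact A (chart_pt A m i s (rown t))) != 0.
  rewrite sqrtr_eq0 -ltNge; apply: (@lt_le_trans _ _ (mxact A (chart_pt A m i s (rown t)) 0 i ^+ 2)).
    by rewrite gam_slope// exprMn expr2 sgn_sqr mul1r exprn_gt0// sqrtr_gt0.
  by rewrite /dotv (bigD1 i)//= -expr2 lerDl sumr_ge0// => j _; rewrite -expr2 sqr_ge0.
by rewrite mulrA mulfVK.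
Qed.

Lemma surface_integrableE : surface_integrable A m (sing_weight A w).
Proof.
move=> i s; have L : (ltn).-integrable (piece_dom A m i s) (EFin \o chart_density i s).
  exact: (integrableS measurableT (piece_measurable i s) (@subsetT _ _) (chart_density_L1 i s)).
have e : {in piece_dom A m i s, EFin \o chart_density i s =1 piece_integrand A m i s (sing_weight A w)}.
  by move=> t /set_mem h; rewrite (piece_integrandE h).
by apply: (@eq_integrable _ _ _ _ _ _ _ _ e) L; exact: piece_measurable.
Qed.

Lemma piece_integral0 s : (\int[ltn]_(t in piece_dom A m ord0 s)
  piece_integrand A m ord0 s (sing_weight A w) t = (\int[ltn]_t chart_density ord0 s t)%:E)%E.
Proof.
rewrite (L1_fineK (chart_density_L1 ord0 s)).
transitivity (\int[ltn]_(t in piece_dom A m ord0 s) (chart_density ord0 s t)%:E)%E.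
  by apply: eq_integral => t /set_mem h; rewrite (piece_integrandE h).
rewrite [LHS]integral_mkcond; apply: eq_integral => t _; rewrite patchE; case: ifPn => // tn.
rewrite /chart_density; case h : (chart_dom _ _ _ _ _); last by rewrite mul0r.
case/negP: tn; apply/mem_set; rewrite piece_domE; split => /=; first by rewrite h.
by rewrite big_pred0.
Qed.

(** On a piece with i > 0 the coordinate (A y)_0 vanishes, so the piece lies in a null slice of its
    chart; the charts of index 0 carry the whole measure. *)
Lemma piece_integralS (i : 'I_d) s : (0 < i)%N ->
  (\int[ltn]_(t in piece_dom A m i s) piece_integrand A m i s (sing_weight A w) t = 0)%E.
Proof.
move=> i0; have [j xi0] := rowA_neq0 (R := R) detA ord0.
have [mZ Z0] := slice_null symA detA d4 m i s xi0.
have null : ltn (piece_dom A m i s) = 0%E.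
  apply/eqP; rewrite eq_le measure_ge0 andbT -Z0; apply: le_measure; [exact: mem_set (piece_measurable i s)|exact: mem_set|].
  move=> t; rewrite piece_domE => -[/= h1 h2]; split.
    by move: h1; case: (chart_dom _ _ _ _ _) => // /eqP; rewrite eq_sym oner_eq0.
  apply/eqP; rewrite -mxact_coord -sqrf_eq0.
  have := psumr_eq0P (fun (j : 'I_d) _ => sqr_ge0 (mxact A (chart_pt A m i s (rown t)) 0 j)) h2.
  by move=> /(_ ord0 i0) ->.
have L := surface_integrableE i s.
exact: (null_set_integral (piece_measurable i s) (measurable_int _ L) null).
Qed.

Lemma surface_integralE :
  surface_integral A m (sing_weight A w) = (\int[ltn]_t T0 A m ord0 w (rown t))%:E.
Proof.
rewrite /surface_integral big_ord_recl [X in (_ + X)%E]big1 ?adde0 => [|i _]; last first.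
  by rewrite big1// => s _; exact: piece_integralS.
rewrite big_bool/= !piece_integral0 -EFinD -rintD; [|exact: chart_density_L1|exact: chart_density_L1].
by congr EFin; apply: eq_rint => t; rewrite /T0 big_bool.
Qed.

End surface.

Section surface_smooth.
Context {R : realType} {n : nat}.
Local Notation d := n.+1.
Variable A : 'M[int]_d.
Hypothesis symA : A^T = A.
Hypothesis detA : \det A != 0.
Hypothesis d4 : (4 <= d)%N.

Lemma sing_integralE (m N N' : R) (w : 'rV[R]_d -> R) g : 0 <= N -> wt (2 * d) (2 * d) N w ->
  0 <= N' -> C1 (2 * d) N' w g ->
  surface_integrable A m (sing_weight A w) /\ sing_integral A w m = Jc A w m.
Proof.
move=> N0 hw N'0 hC; have [cw _ _ wb _] := hC; split; first exact: (surface_integrableE symA detA d4 m N'0 cw wb).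
rewrite /sing_integral (surface_integralE symA detA d4 m N'0 cw wb) /=.
by rewrite (Jc_T0 symA detA d4 m ord0 N0 hw N'0 hC).
Qed.

End surface_smooth.

(** * The asymptotic formula *)

Section lattice_points.
Context {R : realType} {d : nat}.
Variable A : 'M[int]_d.
Hypothesis symA : A^T = A.
Hypothesis evenA : forall i, (2 %| A i i)%Z.
Local Notation E := 'rV[R]_d.
Local Notation V := 'rV[int]_d.
Local Notation cnt := (@counting V R).
Variables (L m : R) (t : int) (w : E -> R).
Hypothesis L0 : 0 < L.
Hypothesis Lm : L ^+ 2 * m = t%:~R.

Let e (k : V) : E := L^-1 *: toR k.
Let D : set V := [set k | qZ A k = t].
Let f (k : V) : R := w (e k) * (qZ A k == t)%:R.

Let e_inj : set_inj D e.
Proof.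
move=> k l _ _ /rowP h; apply/rowP => i; have := h i; rewrite !mxE.
by move/(mulfI (invr_neq0 (lt0r_neq0 L0)))/intr_inj.
Qed.

Let quadric_latticeE : quadric A m `&` lattice L = [set e k | k in D].
Proof.
have q k : qform A (e k) = m <-> qZ A k = t.
  rewrite /e qformZ qformZE//; split => [h|->].
    by apply: (@intr_inj R); rewrite -Lm -h mulrA -exprMn mulfV ?expr1n ?mul1r// gt_eqF.
  by rewrite -Lm mulrA -exprMn mulVf ?expr1n ?mul1r// gt_eqF.
apply/seteqP; split => [z [zq [k _ kz]]|z [k kD <-]].
  by exists k => //; apply/q; rewrite /e /toR kz.
by split; [exact/q|exists k].
Qed.

Hypothesis Lw : L1 cnt (fun k => w (L^-1 *: toR k)).

Let Lf : L1 cnt f.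
Proof.
apply: (L1_dom _ (L1_norm Lw)); first exact: measurable_lat.
by move=> k; rewrite normrM ler_piMr// normr_nat lern1 leq_b1.
Qed.

Let fD k : D k -> f k = w (e k).
Proof. by move=> h; rewrite /f (introT eqP h) mulr1. Qed.

Lemma lattice_summableE : lattice_summable A L w m.
Proof.
rewrite /lattice_summable /summable quadric_latticeE (@esum_image R _ _ D e _ e_inj).
move/lat_L1_summable: Lf; rewrite /summable; apply: le_lt_trans.
rewrite esum_mkcond [leRHS]esum_mkcond; apply: le_esum => k _; rewrite in_setT.
by case: ifPn => // /set_mem kD; rewrite /= fD.
Qed.

Lemma lattice_countE : lattice_count A L w m = lat_sum A w L t.
Proof.
rewrite /lattice_count quadric_latticeE /lat_sum -/(f _).
rewrite (@lat_sumE R d D f Lf) => [|k kD]; last first.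
  by rewrite /f; case: eqP => [/kD//|]; rewrite mulr0.
by rewrite !(@esum_image R _ _ D e _ e_inj); congr (fine _ - fine _); apply: eq_esum => k kD;
  rewrite ?funeposE ?funenegE /= fD.
Qed.

End lattice_points.

Section smoothness.
Context {R : realType} {d : nat}.
Local Notation E := 'rV[R]_d.

Lemma wt_mono K K' M M' (N N' : R) (w : E -> R) : 0 <= N -> (K' <= K)%N -> (M' <= M)%N -> N <= N' ->
  wt K M N w -> wt K' M' N' w.
Proof.
move=> N0 KK MM NN [cw [g [g0 gd gb]]]; split=> //; exists g; split=> // i k z kK.
  by apply: gd; exact: leq_trans KK.
apply: (le_trans (gb i k z (leq_trans kK KK))).
by apply: ler_pM => //; rewrite ?exprn_ge0 ?Sinv_ge0 ?SinvX_le.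
Qed.

Lemma Cspace_C1 K1 (K2 : R) M (w : E -> R) : (0 < d)%N -> Cspace K1 K2 w -> (0 < K1)%N -> (2 * M)%:R <= K2 ->
  C1 M (2 ^+ M * fine (wnorm K1 K2 w)) w (fun i => partial i w).
Proof.
move=> d0 hC K10 MK; have hw := Cspace_wt hC K10 MK; have [cw [g [g0 gd gb]]] := hw.
have pE i z : partial i w z = g i 1%N z.
  by have [_] := gd i 0%N z isT; rewrite g0.
split => // [i|i z|z|i z].
- case: hC => + _; case: K1 K10 {MK hw gd gb} => // K1 _ [_ /(_ i)[_]].
  by case: K1 => [|K1] [].
- by rewrite pE -[X in is_derive _ _ X](g0 i); exact: gd.
- exact: wt_bound hw d0.
- by rewrite pE; exact: gb.
Qed.

End smoothness.

Lemma normc_real {R : rcfType} (x : R) : ComplexField.Normc.normc (real_complex R x) = `|x|.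
Proof. by rewrite /= expr0n addr0 sqrtr_sqr. Qed.

Section main.
Context {R : realType} {n : nat}.
Local Notation d := n.+1.
Hypothesis d5 : (5 <= d)%N.

(** The Weyl bound takes 2 d derivatives; d^2 <= 4 eps (K + 1) is [LPK] for P = L^(2 eps/d). Of the
    decay K + 1 + d, K + 1 powers go to the differences of the phase and d to summability, and one
    power of [S] counts twice in [K2]. *)
Lemma counting_main (eps : R) (K K1 : nat) (K2 K3 : R) : 0 < eps <= 1 ->
  (2 * d <= K.+1)%N -> (d ^ 2)%:R <= 4 * eps * K.+1%:R -> (K.+1 <= K1)%N ->
  (2 * (K.+1 + d))%:R <= K2 -> counting_asymptotics d eps K1 K2 K3.
Proof.
move=> /andP[e0 e1] dK dKe KK1 MK2 A [symA evenA detA] m.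
have [C C0 hC] := phi_line (R := R) symA K.+1 d.
pose M := (K.+1 + d)%N.
have d0 : (0 : R) < d%:R by rewrite ltr0n.
exists (`|cmain A K C| * 2 ^+ M) => L t w L1' Lm hC1 hC3.
have L0 : 0 < L := lt_le_trans ltr01 L1'.
pose nu := fine (wnorm K1 K2 w); pose N := 2 ^+ M * nu.
have nu0 : 0 <= nu by apply: fine_ge0; exact: wnorm_ge0.
have nu3 : 0 <= fine (wnorm 0 K3 w) by apply: fine_ge0; exact: wnorm_ge0.
have N0 : 0 <= N by rewrite mulr_ge0 ?exprn_ge0.
have hwK : wt K.+1 M N w by exact: Cspace_wt.
have dM : (2 * d <= M)%N by rewrite (leq_trans dK) ?leq_addr.
have hw : wt (2 * d) (2 * d) N w by exact: wt_mono hwK.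
have hC1' : C1 (2 * d) N w (fun i => partial i w).
  apply: (C1_le dM (lexx N) N0); apply: Cspace_C1 => //.
  exact: leq_trans KK1.
have d4 : (4 <= d)%N by exact: leq_trans d5.
have [si SJ] := sing_integralE symA detA d4 m N0 hw N0 hC1'.
have [sg [scv ssE _ hsg]] := sing_series_real (R := R) symA evenA detA d5 t.
have Lw : L1 (@counting 'rV[int]_d R) (fun k => w (L^-1 *: toR k)).
  have dd : (d <= 2 * d)%N by rewrite leq_pmull.
  have := wt_lat_L1 (isT : (0 < d)%N) 0 N0 hw dd L1'; by under eq_fun do rewrite add0r.
have ls := lattice_summableE symA evenA L0 Lm Lw.
have lc := lattice_countE symA evenA L0 Lm Lw.
split=> //.
rewrite lc SJ ssE -!rmorphM -rmorphB normc_real.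
(* The exponent for which (L P)^(d/2) = L^(d/2 + eps). *)
pose del : R := 2 * eps / d%:R.
pose P := L `^ del.
have del0 : 0 <= del by rewrite divr_ge0 ?mulr_ge0// ltW.
have P1 : 1 <= P by rewrite /P -(powRr0 L) ler_powR.
have del1 : del <= 1.
  rewrite /del ler_pdivrMr// mul1r; apply: (@le_trans _ _ 2); first by lra.
  by rewrite ler_nat (leq_trans _ d5).
have PL : P <= L by rewrite -[leRHS]powRr1 ?(ltW L0)// ler_powR.
have LPK : L ^+ d <= P ^+ (2 * K.+1).
  rewrite -!powR_mulrn ?(ltW L0) ?powR_ge0// -powRrM ler_powR//.
  have -> : del * (2 * K.+1)%:R = 4 * eps * K.+1%:R / d%:R.
    by rewrite natrM /del; field; rewrite gt_eqF.
  by rewrite ler_pdivlMr// -natrM mulnn.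
have hC2 : forall lam m0 th i (y : 'rV[R]_d) h, 0 <= h -> K.+1%:R * h <= 1 ->
   `|iter K.+1 (Dv i h) (phi A w lam m0 th) y| <= C * N * ((1 + `|lam|) * h) ^+ K.+1 * (S y)^-1 ^+ d.
  by move=> lam m0 th i y h; exact: (hC N w N0 hwK).
have H := circle_method symA evenA detA d5 N0 hw L1' P1 PL Lm C0 hC2 hsg LPK.
apply: (le_trans H).
have -> : Num.sqrt ((L * P) ^+ d) = L `^ (d%:R / 2 + eps).
  have -> : (L * P) ^+ d = (L `^ (d%:R / 2 + eps)) ^+ 2.
    rewrite -!powR_mulrn ?powR_ge0 ?mulr_ge0 ?powR_ge0 ?(ltW L0)//.
    rewrite -[X in (X * P) `^ _]powRr1 ?(ltW L0)// /P -powRD; last by rewrite (gt_eqF L0) implybT.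
    rewrite -!powRrM; congr (_ `^ _); rewrite /del; field; rewrite gt_eqF//.
  by rewrite sqrtr_sqr ger0_norm ?powR_ge0.
rewrite /N; set q := L `^ _; have q0 : 0 <= q by exact: powR_ge0.
apply: (@le_trans _ _ (`|cmain A K C| * (2 ^+ M * nu) * q)).
  by rewrite !ler_wpM2r ?ler_norm// mulr_ge0 ?exprn_ge0.
rewrite mulrA [leLHS]mulrAC; apply: ler_wpM2l; first by rewrite !mulr_ge0 ?exprn_ge0.
by rewrite lerDl.
Qed.

Lemma sing_series_bounded (A : 'M[int]_d) : even_form A ->
  exists B : R, forall (L m : R) (t : int), 1 <= L -> L ^+ 2 * m = t%:~R ->
    sing_series_cvg R A t /\ ComplexField.Normc.normc (sing_series R A t) <= B.
Proof.
move=> [symA evenA detA]; exists (1 + Cdet A * 2) => L m t _ _.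
have [sg [scv ssE h _]] := sing_series_real (R := R) symA evenA detA d5 t.
split=> //; rewrite ssE normc_real.
(* The partial sum up to 1 is 1, and the tail after it is at most 2 [Cdet], for every t. *)
have := h 1%N isT; rewrite big_nat1 fser1 sqrtr1 divr1 => h1.
by rewrite -(subrK 1 sg) addrC; apply: (le_trans (ler_normD _ _)); rewrite normr1 lerD2l.
Qed.

End main.

Theorem theorem1p3 (R : realType) (d : nat) (d_ge5 : (5 <= d)%N) :
  [/\ forall eps : R, 0 < eps <= 1 ->
        exists (K1 : nat) (K2 K3 : R),
          [/\ (0 < K1)%N, 0 < K2, 0 < K3, K2 <= K3 &
              counting_asymptotics d eps K1 K2 K3],
      forall A : 'M[int]_d, even_form A ->
        exists B : R, forall (L m : R) (t : int),
          1 <= L -> L ^+ 2 * m = t%:~R ->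
          sing_series_cvg R A t /\
          ComplexField.Normc.normc (sing_series R A t) <= B &
      let K1 := (2 * d * (d ^ 2 + d - 1))%N in
      let K2 := (4 * (d + 1) ^ 2 + 3 * d + 1)%N in
      let K3 := (K1 + 3 * d + 4)%N in
      counting_asymptotics d (2^-1 : R) K1 K2%:R K3%:R].
Proof.
case: d d_ge5 => // n d5; split.
- move=> eps he; have e0 : 0 < eps by case/andP: he.
  (* Makes K + 1 larger than both 2 d and d^2/(4 eps). *)
  pose K := (2 * n.+1 + Num.truncn ((n.+1 ^ 2)%:R / (4 * eps)))%N.
  exists K.+1, (2 * (K.+1 + n.+1))%:R, (2 * (K.+1 + n.+1))%:R.
  split; rewrite ?ltr0n//; apply: (@counting_main R n d5 eps K) => //.
    by rewrite leqW// leq_addr.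
  rewrite mulrC -ler_pdivrMr ?mulr_gt0//; apply/ltW/(lt_le_trans (truncnS_gt _)).
  by rewrite ler_nat ltnS leq_addl.
- exact: sing_series_bounded.
have n4 : (4 <= n)%N by [].
(* With K + 1 = d^2 differences, d^2 <= 4 eps (K + 1) = 2 d^2, and the decay 2 (d^2 + d) is below 4
   (d + 1)^2 + 3 d + 1. *)
apply: (@counting_main R n d5 2^-1 (n.+1 ^ 2).-1).
- by rewrite invr_gt0 ltr0n/= invf_le1 ?ler1n.
- by rewrite prednK ?expn_gt0//; nia.
- by rewrite prednK ?expn_gt0// natrX; have : (0 : R) <= n.+1%:R ^+ 2 by []; lra.
- by rewrite prednK ?expn_gt0//; nia.
- by rewrite prednK ?expn_gt0// ler_nat; nia.
Qed.
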